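(* Let $\Theta\subset\mathbb{R}^d$ and let $\{f_\theta:\theta\in\Theta\}$ be a family of non-decreasing functions $f_\theta:\mathbb{N}_+\to(0,\infty)$ such that $\theta\mapsto f_\theta(k)$ is twice continuously differentiable for every $k$, with gradient $\dot f_\theta(k)$. Let $K\in\mathbb{N}_+$ be given and suppose $f_\theta(k)=f_\theta(\min(k,K))$ for all $k\in\mathbb{N}_+$ and $\theta\in\Theta$. Let the true parameter $\theta_0$ be interior to $\Theta$ and suppose that the matrix $A_K$ associated with $f=f_{\theta_0}$ satisfies $\Re\lambda_2(A_K)<\lambda_1(A_K)/2$. Let $V_0$ be the matrix $$V_0=\sum_{k=1}^\infty\frac{\dot f_{\theta_0}\dot f_{\theta_0}^T}{f_{\theta_0}^2}(k)\,p^{(0)}_{>k}-\Bigl(\sum_{k=1}^\infty\frac{\dot f_{\theta_0}}{f_{\theta_0}}(k)\,p^{(0)}_{>k}\Bigr)\Bigl(\sum_{k=1}^\infty\frac{\dot f_{\theta_0}^T}{f_{\theta_0}}(k)\,p^{(0)}_{>k}\Bigr),$$ assumed nonsingular, and let $V=MW_0M^T$, where $W_0$ is the covariance matrix of the centered normal limit distribution, under $\theta_0$, of $\sum_{k=1}^\infty F_{\theta_0}(k)\sqrt n(P_k(n)-p_k^{(0)})$, with $F_\theta(k)=\bigl(\sum_{j=1}^{k-1}\frac{\dot f_\theta}{f_\theta}(j),\dot f_\theta(k),f_\theta(k)\bigr)^T\in\mathbb{R}^{2d+1}$, and $$M=\Bigl(I_d,\ -\frac1{s_3}I_d,\ \frac1{s_3^2}s_2\Bigr)\in\mathbb{R}^{d\times(2d+1)},\quad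 s_2=\sum_{k=1}^\infty\dot f_{\theta_0}(k)p^{(0)}_k,\quad s_3=\sum_{k=1}^\infty f_{\theta_0}(k)p^{(0)}_k.$$ Then, under $\theta_0$, the pseudo maximum likelihood estimator $\tilde\theta_n$ satisfies $\sqrt n(\tilde\theta_n-\theta_0)\to N(0,V_0^{-1}VV_0^{-1})$ in distribution as $n\to\infty$, provided that $\tilde\theta_n$ is consistent at $\theta_0$.
   Context: Preferential attachment (PA) tree with PA function $f:\mathbb{N}_+\to(0,\infty)$: at time $1$ there is a single node $v_1$, of degree $1$ (a root with a loose edge). Given the tree at time $n$ with nodes $v_1,\dots,v_n$ of degrees $d_1(n),\dots,d_n(n)$, a new node $v_{n+1}$ of degree $1$ is attached by an edge to the node $v_i$ with conditional probability $f(d_i(n))/\sum_{j=1}^n f(d_j(n))$ given the past; the degree of the chosen node increases by $1$. ''Under $\theta_0$'' means the tree is generated with PA function $f_{\theta_0}$. $N_k(n)$ is the number of nodes of degree $k$ at time $n$, $P_k(n)=N_k(n)/n$, $P_{>k}(n)=\sum_{l>k}P_l(n)$, $S_h(n)=\sum_kh(k)N_k(n)$. The pseudo maximum likelihood estimator $\tilde\theta_n$ is a maximizer over $\Theta$ of $\tilde\iota_n(f_\theta)=\sum_{k}\log f_\theta(k)P_{>k}(n)-\log S_{f_\theta}(n)$, or a zero of $\dot{\tilde\iota}_n(f_\theta)=\sum_k\frac{\dot f_\theta}{f_\theta}(k)P_{>k}(n)-\frac{S_{\dot f_\theta}(n)}{S_{f_\theta}(n)}$. The limiting degree distribution for PA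 function $f$ is $p_k=\frac{\lambda^*}{\lambda^*+f(k)}\prod_{j=1}^{k-1}\frac{f(j)}{\lambda^*+f(j)}$, where $\lambda^*>0$ solves $\sum_{l=1}^\infty\prod_{k=1}^l\frac{f(k)}{\lambda^*+f(k)}=1$; $p^{(0)}_k$ is $p_k$ for $f=f_{\theta_0}$, $p^{(0)}_{>k}=\sum_{l>k}p^{(0)}_l$. $A_K$ is the $(K+1)\times(K+1)$ matrix whose nonzero entries are: $(A_K)_{1,j}=f(j)$ for $2\le j\le K+1$; $(A_K)_{i,i-1}=f(i-1)$ for $2\le i\le K+1$; $(A_K)_{i,i}=-f(i)$ for $2\le i\le K$ (and $(A_K)_{1,1}=(A_K)_{K+1,K+1}=0$). Its eigenvalues (with multiplicity) are ordered by real part, $\lambda_1>\Re\lambda_2\ge\Re\lambda_3\ge\cdots$, where $\lambda_1>0$ is real. *)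

(* Defs.v *)
From HB Require Import structures.
From mathcomp Require Import all_boot all_order all_algebra.
From mathcomp Require Import all_classical all_reals all_analysis.
From mathcomp.real_closed Require Import complex.

Set Implicit Arguments.
Unset Strict Implicit.
Unset Printing Implicit Defensive.

Import Order.TTheory GRing.Theory Num.Theory.
Import numFieldNormedType.Exports.

Local Open Scope classical_set_scope.
Local Open Scope ring_scope.

Notation "\sum_ ( m <= i <oo ) F" :=
  (\big[+%R/0%R]_(m <= i <oo) F%R) : ring_scope.

Definition borel_cV (R : realType) (m : nat) :=
  g_sigma_algebraType (@open 'cV[R]_m).

(* [normal_prob 0 s] is the uniform law on [0, 1] when s = 0, so the degenerate
   normal law has to be given separately. *)
Definition centered_normal (R : realType) (v : R) (A : set R) : \bar R :=
  if v == 0 then \d_(0 : R) A else normal_prob 0 (Num.sqrt v) A.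

Definition qform (R : realType) (m : nat) (S : 'M[R]_m) (u : 'cV[R]_m) : R :=
  (u^T *m S *m u) 0 0.

(* N(0, S), possibly singular: every linear form u^T x has law
   N(0, u^T S u). *)
Definition is_normal_law (R : realType) (m : nat) (S : 'M[R]_m)
    (mu : probability (borel_cV R m) R) : Prop :=
  [/\ S^T = S,
      forall u : 'cV[R]_m, 0 <= qform S u
    & forall (u : 'cV[R]_m) (A : set R), measurable A ->
        mu [set x : 'cV[R]_m | A ((u^T *m x) 0 0)] =
        centered_normal (qform S u) A].

Definition cvg_in_distribution (d : measure_display) (T : measurableType d)
    (R : realType) (P : probability T R) (m : nat) (X : nat -> T -> 'cV[R]_m)
    (mu : probability (borel_cV R m) R) : Prop :=
  forall g : 'cV[R]_m -> R, continuous g ->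
    (exists M : R, forall x, `|g x| <= M) ->
    (fun n => (\int[P]_w (g (X n w))%:E)%E) @ \oo -->
    (\int[mu]_x (g x)%:E)%E.

Definition asymptotically_normal (d : measure_display) (T : measurableType d)
    (R : realType) (P : probability T R) (m : nat) (X : nat -> T -> 'cV[R]_m)
    (S : 'M[R]_m) : Prop :=
  exists2 mu : probability (borel_cV R m) R,
    is_normal_law S mu & cvg_in_distribution P X mu.

Definition cvg_in_probability (d : measure_display) (T : measurableType d)
    (R : realType) (P : probability T R) (m : nat) (X : nat -> T -> 'cV[R]_m)
    (x : 'cV[R]_m) : Prop :=
  forall e : R, 0 < e ->
    (fun n => P [set w | e <= `|X n w - x|]) @ \oo --> 0%E.

(* A tree with n nodes is encoded by its attachment history [:: a_1; ...;
   a_(n-1)]: nodes are numbered from 0 and a_m < m is the node to which node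
   number m was attached. Position i of [degrees h] is the degree of node i. *)
Definition attach (ds : seq nat) (i : nat) : seq nat := rcons (incr_nth ds i) 1.

Definition degrees (h : seq nat) : seq nat := foldl attach [:: 1%N] h.

(* c m w is the node to which node number m is attached; c 0 is irrelevant. *)
Definition history (T : Type) (c : nat -> T -> nat) (n : nat) (w : T) :
  seq nat := [seq c m w | m <- iota 1 n.-1].

Definition is_PA_tree (d : measure_display) (T : measurableType d)
    (R : realType) (P : probability T R) (f : nat -> R)
    (c : nat -> {RV P >-> nat}) : Prop :=
  forall (n : nat) (h : seq nat) (i : nat),
    (0 < n)%N -> size h = n.-1 -> (i < n)%N ->
    P [set w | history c n w = h /\ c n w = i] =
    (P [set w | history c n w = h] *
     (f (nth 0%N (degrees h) i) /
      \sum_(j < n) f (nth 0%N (degrees h) j))%:E)%E.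

Definition degree_path (T : Type) (c : nat -> T -> nat) (w : T) (n : nat) :
  seq nat := degrees (history c n w).

(* D n below is the degree sequence at time n. *)
Definition deg_count (D : nat -> seq nat) (n k : nat) : nat := count_mem k (D n).

Definition deg_prop (R : realType) (D : nat -> seq nat) (n k : nat) : R :=
  (deg_count D n k)%:R / n%:R.

Definition deg_tail (R : realType) (D : nat -> seq nat) (n k : nat) : R :=
  \sum_(k.+1 <= l <oo) deg_prop R D n l.

Definition deg_sum (R : realType) (V : normedModType R) (h : nat -> V)
  (D : nat -> seq nat) (n : nat) : V := \sum_(1 <= k <oo) h k *+ deg_count D n k.

Definition pseudo_loglik (R : realType) (f : nat -> R) (D : nat -> seq nat)
    (n : nat) : R :=
  \sum_(1 <= k <oo) (ln (f k) * deg_tail R D n k) - ln (deg_sum f D n).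

Definition pseudo_score (R : realType) (d : nat) (f : nat -> R)
    (df : nat -> 'cV[R]_d) (D : nat -> seq nat) (n : nat) : 'cV[R]_d :=
  \sum_(1 <= k <oo) (deg_tail R D n k / f k *: df k) -
  (deg_sum f D n)^-1 *: deg_sum df D n.

Definition is_PMLE (R : realType) (d : nat) (Theta : set 'cV[R]_d)
    (f : 'cV[R]_d -> nat -> R) (df : 'cV[R]_d -> nat -> 'cV[R]_d)
    (D : nat -> seq nat) (n : nat) (t : 'cV[R]_d) : Prop :=
  Theta t /\
  ((forall s, Theta s -> pseudo_loglik (f s) D n <= pseudo_loglik (f t) D n) \/
   pseudo_score (f t) (df t) D n = 0).

Definition is_C2_with_gradient (R : realType) (d : nat) (U : set 'cV[R]_d)
    (g : 'cV[R]_d -> R) (dg : 'cV[R]_d -> 'cV[R]_d) : Prop :=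
  forall t, U t ->
    [/\ differentiable g t,
        forall v : 'cV[R]_d, 'D_v g t = ((dg t)^T *m v) 0 0,
        differentiable dg t
      & forall v : 'cV[R]_d, {for t, continuous (fun s => 'D_v dg s)}].

Definition is_malthusian (R : realType) (f : nat -> R) (lam : R) : Prop :=
  0 < lam /\
  (fun n => \sum_(1 <= l < n) \prod_(1 <= k < l.+1) (f k / (lam + f k)))
    @ \oo --> (1 : R).

Definition limit_deg (R : realType) (f : nat -> R) (lam : R) (k : nat) : R :=
  lam / (lam + f k) * \prod_(1 <= j < k) (f j / (lam + f j)).

Definition limit_tail (R : realType) (f : nat -> R) (lam : R) (k : nat) : R :=
  \sum_(k.+1 <= l <oo) limit_deg f lam l.

(* Indices start at 0: entry (i, j) is the entry (i + 1, j + 1) of A_K. *)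
Definition urn_matrix (R : realType) (f : nat -> R) (K : nat) : 'M[R]_K.+1 :=
  \matrix_(i < K.+1, j < K.+1)
    if (i : nat) == 0%N then (if (j : nat) == 0%N then 0 else f j.+1)
    else if (i : nat) == j.+1 then f j.+1
    else if (i == j) && (i < K)%N then - f i.+1
    else 0.

(* The list ev of complex eigenvalues, with algebraic multiplicity, ordered by
   nonincreasing real part. *)
Definition ordered_eigenvalues (R : realType) (m : nat) (A : 'M[R]_m)
    (ev : seq R[i]) : Prop :=
  char_poly (map_mx (real_complex R) A) = \prod_(z <- ev) ('X - z%:P) /\
  sorted (fun z w => complex.Re w <= complex.Re z) ev.

Definition F_stat (R : realType) (d : nat) (f : nat -> R)
    (df : nat -> 'cV[R]_d) (k : nat) : 'cV[R]_(d + d + 1) :=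
  col_mx (col_mx (\sum_(1 <= j < k) ((f j)^-1 *: df j)) (df k)) (f k)%:M.

Definition V0_matrix (R : realType) (d : nat) (f : nat -> R)
    (df : nat -> 'cV[R]_d) (lam : R) : 'M[R]_d :=
  let b := \sum_(1 <= k <oo) (limit_tail f lam k / f k *: df k) in
  \sum_(1 <= k <oo)
    (limit_tail f lam k / f k ^+ 2 *: (df k *m (df k)^T)) - b *m b^T.

Definition M_matrix (R : realType) (d : nat) (f : nat -> R)
    (df : nat -> 'cV[R]_d) (lam : R) : 'M[R]_(d, d + d + 1) :=
  let s2 : 'cV[R]_d := \sum_(1 <= k <oo) (limit_deg f lam k *: df k) in
  let s3 : R := \sum_(1 <= k <oo) (f k * limit_deg f lam k) in
  row_mx (row_mx 1%:M (- s3^-1 *: 1%:M)) (s3 ^- 2 *: s2).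

Definition F_fluctuation (R : realType) (d : nat) (f : nat -> R)
    (df : nat -> 'cV[R]_d) (lam : R) (D : nat -> seq nat) (n : nat) :
    'cV[R]_(d + d + 1) :=
  \sum_(1 <= k <oo)
    (Num.sqrt n%:R * (deg_prop R D n k - limit_deg f lam k) *: F_stat f df k).

(* Main.v *)
(** A node of degree d is a ball of type min(d, K + 1), so the degree counts form
a (K + 1)-colour urn X with mean matrix A. Centred at n times the vector p of
limiting proportions, Y = X - n p has conditional drift C Y / n with
C = (A - p phi^T) / lam up to the fluctuation of the total weight, and the
eigenvalues of C have real part < 1/2 by the spectral gap. A quadratic Lyapunov
form for C gives E|Y_n|^2 = O(n). If b_m is the backward solution of
b_m = b_(m+1) (1 + C / m) from b_n = a / sqrt n, then b_m Y_m is nearly a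
martingale, and telescoping E cos(th + b_m Y_m) against the Gaussian factor shows
that a Y_n / sqrt n is asymptotically N(0, a S a^T), where S solves the Sylvester
equation S = C S + S C^T + Gamma.

A normal law with a given positive semidefinite covariance is built one rank-one
summand at a time, and convergence of characteristic functions is turned into
convergence in distribution by approximating continuous functions on a box by
trigonometric polynomials. Beyond K the summand F(k) is
affine in k and the sum of the degrees is deterministic, so the fluctuation of the
statement is a linear image of Y_n / sqrt n up to O(1 / sqrt n).

The score times S_f is the double sum
sum_j z_j f_t(j) (sum_k a_k g_t(k) - g_t(j)), with g = df / f and with weights a, z
that are affine in X / n. At the limiting weights it vanishes at t0 and has
derivative - lam V0 there; varying the weights contributes lam M F. Hence
V0 sqrt n (est - t0) - M F tends to 0 in probability, and Slutsky applies. *)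
Require Import Defs.
From HB Require Import structures.
From mathcomp Require Import all_boot all_order all_algebra.
From mathcomp Require Import all_classical all_reals all_analysis.
From mathcomp.real_closed Require Import complex.
From mathcomp Require Import measurable_realfun.
From mathcomp Require Import ring lra zify.

Set Implicit Arguments.
Unset Strict Implicit.
Unset Printing Implicit Defensive.

Import Order.TTheory GRing.Theory Num.Theory.
Import numFieldNormedType.Exports.

Local Open Scope classical_set_scope.
Local Open Scope ring_scope.

(** * Quadratic forms and Lyapunov functions *)

(** The mean matrix of the urn is neither symmetric nor known to be diagonalisable, so eigenvector
    expansions are avoided: a spectral bound enters only through an annihilating product of factors
    C - z, which is converted into one quadratic form. The same form then serves as the norm for
    moments, for the growth of the rows b_m and for uniqueness in the Sylvester equation. The total
    weight phi x is random. In the second moment this is met by normalising q(Y) not by n but by u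
    x, with u the left Perron vector: numerator and denominator then both drift at rate 1 / (phi x).
    In the characteristic function, phi x is replaced by lam m at a cost quadratic in Y, which the
    second moment pays for. Working with cos (th + b Y) for all phases th carries the information of
    the complex characteristic function while staying real. Its expectation is a finite sum over
    attachment histories, so that no conditional expectation appears. Only consistency of the
    estimator is given; the rate sqrt n comes out of the linearised score equation, whose error is a
    small multiple of the unknown distance and can be absorbed. *)

Definition dotp (R : realType) N (h : 'rV[R]_N) (x : 'cV[R]_N) : R :=
  (h *m x) 0 0.

(** Given by a list of linear forms, the bilinear form is symmetric and nonnegative by construction,
    and sums of forms are concatenations of lists. *)
Definition qb (R : realType) N (hs : seq 'rV[R]_N) (x y : 'cV[R]_N) : R :=
  \sum_(h <- hs) dotp h x * dotp h y.

Section Forms.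
Variables (R : realType) (N : nat).
Implicit Types (h : 'rV[R]_N) (x y z : 'cV[R]_N) (hs : seq 'rV[R]_N).

Lemma dotpE h x : dotp h x = \sum_i h 0 i * x i 0.
Proof. by rewrite /dotp mxE. Qed.

Lemma dotpDr h x y : dotp h (x + y) = dotp h x + dotp h y.
Proof. by rewrite /dotp mulmxDr mxE. Qed.

Lemma dotpBr h x y : dotp h (x - y) = dotp h x - dotp h y.
Proof. by rewrite /dotp mulmxBr !mxE. Qed.

Lemma dotpZr h k x : dotp h (k *: x) = k * dotp h x.
Proof. by rewrite /dotp -scalemxAr mxE. Qed.

Lemma dotpDl h h' x : dotp (h + h') x = dotp h x + dotp h' x.
Proof. by rewrite /dotp mulmxDl mxE. Qed.

Lemma dotpBl h h' x : dotp (h - h') x = dotp h x - dotp h' x.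
Proof. by rewrite /dotp mulmxBl !mxE. Qed.

Lemma dotpZl k h x : dotp (k *: h) x = k * dotp h x.
Proof. by rewrite /dotp -scalemxAl mxE. Qed.

Lemma dotp_mulmx h (M : 'M[R]_N) x : dotp (h *m M) x = dotp h (M *m x).
Proof. by rewrite /dotp mulmxA. Qed.

Lemma dotp_delta x i : dotp (delta_mx 0 i) x = x i 0.
Proof. by rewrite /dotp -rowE mxE. Qed.

Lemma qbDl hs x y z : qb hs (x + y) z = qb hs x z + qb hs y z.
Proof.
by rewrite /qb -big_split/=; apply: eq_bigr => h _; rewrite dotpDr mulrDl.
Qed.

Lemma qbC hs x y : qb hs x y = qb hs y x.
Proof. by apply: eq_bigr => h _; rewrite mulrC. Qed.

Lemma qbDr hs x y z : qb hs z (x + y) = qb hs z x + qb hs z y.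
Proof. by rewrite qbC qbDl !(qbC _ z). Qed.

Lemma qbZl hs k x y : qb hs (k *: x) y = k * qb hs x y.
Proof.
by rewrite /qb big_distrr/=; apply: eq_bigr => h _; rewrite dotpZr mulrA.
Qed.

Lemma qbZr hs k x y : qb hs x (k *: y) = k * qb hs x y.
Proof. by rewrite qbC qbZl qbC. Qed.

Lemma qb_ge0 hs x : 0 <= qb hs x x.
Proof. by apply: sumr_ge0 => h _; rewrite -expr2 sqr_ge0. Qed.

Lemma qb_cat hs hs' x y : qb (hs ++ hs') x y = qb hs x y + qb hs' x y.
Proof. by rewrite /qb big_cat. Qed.

Lemma qb_scale s hs x y : qb [seq s *: h | h <- hs] x y = s ^+ 2 * qb hs x y.
Proof.
rewrite /qb big_map big_distrr/=; apply: eq_bigr => h _.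
by rewrite !dotpZl; ring.
Qed.

Lemma qb_sum hs (I : Type) (r : seq I) (F : I -> 'cV[R]_N) y :
  qb hs (\sum_(i <- r) F i) y = \sum_(i <- r) qb hs (F i) y.
Proof.
elim/big_rec2: _ => [|i a b _ <-]; last by rewrite qbDl.
by rewrite -[0 in LHS](scale0r (0 : 'cV[R]_N)) qbZl mul0r.
Qed.

Lemma qb_sqrD hs x y :
  qb hs (x + y) (x + y) = qb hs x x + 2 * qb hs x y + qb hs y y.
Proof. by rewrite !(qbDl, qbDr) (qbC _ y x); ring. Qed.

(* The discriminant of t |-> q (x + t y) is nonpositive. *)
Lemma qb_CS hs x y : (qb hs x y) ^+ 2 <= qb hs x x * qb hs y y.
Proof.
have P t : 0 <= qb hs x x + 2 * t * qb hs x y + t ^+ 2 * qb hs y y.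
  have := qb_ge0 hs (x + t *: y).
  by rewrite !(qbDl, qbDr, qbZl, qbZr) (qbC _ y x); nra.
have a0 := qb_ge0 hs x; have b0 := qb_ge0 hs y.
have [y0|y0] := eqVneq (qb hs y y) 0.
  have [->|xy0] := eqVneq (qb hs x y) 0; first by rewrite y0 mulr0 expr0n.
  (* With q(y) = 0 the polynomial is affine in t; at this t it would equal -1. *)
  have := P (- (qb hs x x + 1) / (2 * qb hs x y)); rewrite y0 mulr0 addr0.
  have -> : 2 * (- (qb hs x x + 1) / (2 * qb hs x y)) * qb hs x y =
    - (qb hs x x + 1) by field.
  by move=> ?; nra.
have yp : 0 < qb hs y y by rewrite lt_def y0.
have := P (- qb hs x y / qb hs y y).
set a := qb hs x x; set b := qb hs y y; set c := qb hs x y => H.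
have E : a + 2 * (- c / b) * c + (- c / b) ^+ 2 * b = (a * b - c ^+ 2) / b.
  by field.
by move: H; rewrite E pmulr_lge0 ?invr_gt0// subr_ge0.
Qed.

Lemma qb_abs_le hs x y : `|qb hs x y| <= Num.sqrt (qb hs x x) * Num.sqrt (qb hs y y).
Proof.
by rewrite -sqrtr_sqr -sqrtrM ?qb_ge0// ler_wsqrtr// qb_CS.
Qed.

End Forms.

Section Lyapunov.
Variables (R : realType) (N : nat) (C : 'M[R]_N.+1) (g : R).
Let Cc := map_mx (real_complex R) C.

Let Re_mul (a : 'rV[R[i]]_N.+1) : map_mx (@complex.Re R) (a *m Cc) = map_mx (@complex.Re R) a *m C.
Proof.
apply/rowP => j; rewrite !mxE raddf_sum; apply: eq_bigr => i _ /=.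
by rewrite !mxE; case: (a 0 i) => u v /=; rewrite mulr0 subr0.
Qed.

Let Im_mul (a : 'rV[R[i]]_N.+1) : map_mx (@complex.Im R) (a *m Cc) = map_mx (@complex.Im R) a *m C.
Proof.
apply/rowP => j; rewrite !mxE raddf_sum; apply: eq_bigr => i _ /=.
by rewrite !mxE; case: (a 0 i) => u v /=; rewrite mulr0 add0r.
Qed.

(* If a' = a (C - z), then |a x|^2 + w q' is a Lyapunov form for a as soon as q'
   is one for a' and the weight w is large. *)
Lemma lyapunov_row (zs : seq R[i]) (a : 'rV[R[i]]_N.+1) :
  a *m \prod_(z <- zs) (Cc - z%:M) = 0 ->
  (forall z, z \in zs -> complex.Re z < g) ->
  exists hs c, [/\ c < g,
    forall x, qb hs x (C *m x) <= c * qb hs x x &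
    forall x, dotp (map_mx (@complex.Re R) a) x ^+ 2 +
      dotp (map_mx (@complex.Im R) a) x ^+ 2 <= qb hs x x].
Proof.
elim: zs a => [|z zs IH] a.
  rewrite big_nil mulmx1 => -> _; exists [::], (g - 1); split.
  - lra.
  - by move=> x; rewrite /qb !big_nil mulr0.
  - move=> x; rewrite (_ : map_mx _ _ = 0); last by apply/rowP => i; rewrite !mxE.
    rewrite (_ : map_mx _ _ = 0); last by apply/rowP => i; rewrite !mxE.
    by rewrite /dotp mul0mx mxE /qb big_nil; lra.
rewrite big_cons mulmxA => /IH {}IH Hz.
have [|hs [c [cg H1 H2]]] := IH; first by move=> y yz; apply: Hz; rewrite inE yz orbT.
have zg : complex.Re z < g by apply: Hz; rewrite inE eqxx.
set ar := map_mx (@complex.Re R) a; set ai := map_mx (@complex.Im R) a.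
pose u := complex.Re z; pose v := complex.Im z.
have Er x : dotp ar (C *m x) = dotp (map_mx (@complex.Re R) (a *m (Cc - z%:M))) x
   + u * dotp ar x - v * dotp ai x.
  rewrite -dotp_mulmx -Re_mul -!dotpZl -dotpDl -dotpBl; congr dotp.
  apply/rowP => j; rewrite mulmxBr mul_mx_scalar !mxE raddfB/=.
  by rewrite /u /v; case: (z) => z1 z2; case: (a 0 j) => a1 a2 /=; ring.
have Ei x : dotp ai (C *m x) = dotp (map_mx (@complex.Im R) (a *m (Cc - z%:M))) x
   + u * dotp ai x + v * dotp ar x.
  rewrite -dotp_mulmx -Im_mul -!dotpZl -!dotpDl; congr dotp.
  apply/rowP => j; rewrite mulmxBr mul_mx_scalar !mxE raddfB/=.
  by rewrite /u /v; case: (z) => z1 z2; case: (a 0 j) => a1 a2 /=; ring.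
(* Half of the slack g - u pays for the cross term. The weight w is fixed by 2 d w (g - c) = 1,
   which turns e f <= d e^2 + (w (g - c) / 2) f^2 in [X1] into a perfect square; c' collects the
   resulting rates (c + g) / 2 and u + d, both below g. *)
pose d := (g - u) / 2; have d0 : 0 < d by rewrite /d /u; lra.
pose w := (2 * d * (g - c))^-1.
have w0 : 0 < w by rewrite invr_gt0 mulr_gt0 ?mulr_gt0//; lra.
pose c' := Num.max ((c + g) / 2) (u + d).
exists ([seq Num.sqrt w *: h | h <- hs] ++ [:: ar; ai]), c'.
have c1 : (c + g) / 2 <= c' by rewrite le_max lexx.
have c2 : u + d <= c' by rewrite le_max lexx orbT.
split.
- by rewrite gt_max; apply/andP; split; rewrite /d; rewrite -/u in zg; lra.
- move=> x; rewrite !qb_cat !qb_scale (sqr_sqrtr (ltW w0)).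
  rewrite /qb !big_cons !big_nil -!/(qb _ _ _) Er Ei !addr0.
  have := H2 x; have := H1 x; have := qb_ge0 hs x.
  set q := qb hs x x; set b := qb hs x _.
  set s := dotp ar x; set t := dotp ai x.
  set s' := dotp _ x; set t' := dotp _ x => q0 bq sq.
  have ws : d * 2 * (w * (g - c)) = 1.
    by rewrite /w; field; apply/andP; split; apply: lt0r_neq0; lra.
  have X1 : s * s' + t * t' <= d * (s ^+ 2 + t ^+ 2) + w * (g - c) / 2 * q.
    have Y e f : e * f <= d * e ^+ 2 + (w * (g - c) / 2) * f ^+ 2.
      have := sqr_ge0 (2 * d * e - f); set k := w * (g - c) in ws *.
      have k0 : 0 < k by rewrite mulr_gt0//; lra.
      have E : d * e ^+ 2 + k / 2 * f ^+ 2 - e * f = k / 2 * (2 * d * e - f) ^+ 2.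
        have -> : k / 2 * (2 * d * e - f) ^+ 2 = (d * 2 * k) * (d * e ^+ 2 - e * f) + k / 2 * f ^+ 2.
          by field.
        by rewrite ws; ring.
      by move=> H; rewrite -subr_ge0 E mulr_ge0//; lra.
    have k0 : 0 < w * (g - c) / 2 by rewrite divr_gt0 ?mulr_gt0//; lra.
    have := Y s s'; have := Y t t'; have := ler_wpM2l (ltW k0) sq; lra.
  have X2 : w * b <= w * (c * q) by rewrite (ler_wpM2l (ltW w0)).
  have X3 : 0 <= (c' - (c + g) / 2) * (w * q) by apply: mulr_ge0; [rewrite subr_ge0|apply: mulr_ge0; [exact: ltW|]].
  have X4 : 0 <= (c' - (u + d)) * (s ^+ 2 + t ^+ 2).
    by apply: mulr_ge0; [rewrite subr_ge0|rewrite addr_ge0 ?sqr_ge0].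
  (* The imaginary part v rotates (s, t) and drops out of the form. *)
  have -> : s * (s' + u * s - v * t) + t * (t' + u * t + v * s) = s * s' + t * t' + u * (s ^+ 2 + t ^+ 2) by ring.
  have -> : s * s + t * t = s ^+ 2 + t ^+ 2 by ring.
  move: X1 X2 X3 X4; set r := s ^+ 2 + t ^+ 2; lra.
- move=> x; rewrite qb_cat qb_scale (sqr_sqrtr (ltW w0)).
  rewrite /qb !big_cons !big_nil -!/(qb _ _ _).
  have := mulr_ge0 (ltW w0) (qb_ge0 hs x); rewrite !expr2; lra.
Qed.

(** An annihilating product is all that is used, so Jordan blocks and complex pairs are treated
    alike. The lists obtained from the unit rows are concatenated, which makes the form dominate
    every coordinate and hence positive definite. *)
Lemma lyapunov (zs : seq R[i]) :
  \prod_(z <- zs) (Cc - z%:M) = 0 ->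
  (forall z, z \in zs -> complex.Re z < g) ->
  exists hs c, [/\ c < g,
    forall x, qb hs x (C *m x) <= c * qb hs x x &
    forall (x : 'cV[R]_N.+1) i, x i 0 ^+ 2 <= qb hs x x].
Proof.
move=> P0 Hz.
have H (k : nat) : exists hs c, [/\ c < g,
    forall x, qb hs x (C *m x) <= c * qb hs x x &
    forall (x : 'cV[R]_N.+1) (i : 'I_N.+1), (i < k)%N -> x i 0 ^+ 2 <= qb hs x x].
  elim: k => [|k [hs [c [cg H1 H2]]]].
    exists [::], (g - 1); split => //; first by lra.
    by move=> x; rewrite /qb !big_nil mulr0.
  have [|hs' [c' [cg' H1' H2']]] := @lyapunov_row zs (delta_mx 0 (inord k)) _ Hz.
    by rewrite P0 mulmx0.
  exists (hs ++ hs'), (Num.max c c'); split.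
  - by rewrite gt_max cg.
  - move=> x; rewrite !qb_cat mulrDr.
    have := H1 x; have := H1' x.
    have : c <= Num.max c c' by rewrite le_max lexx.
    have : c' <= Num.max c c' by rewrite le_max lexx orbT.
    move=> /(ler_wpM2r (qb_ge0 hs' x)) A1 /(ler_wpM2r (qb_ge0 hs x)) A2; lra.
  - move=> x i; rewrite ltnS leq_eqVlt => /orP[/eqP ik|ik]; rewrite qb_cat; last first.
      by have := H2 x i ik; have := qb_ge0 hs' x; lra.
    have := H2' x; rewrite (_ : map_mx _ _ = delta_mx 0 i); last first.
      apply/rowP => j; rewrite !mxE/= -ik inord_val; case: eqP => //=.
    rewrite dotp_delta => A; have := qb_ge0 hs x; move: A.
    by set s := dotp _ _; have := sqr_ge0 s; lra.
have [hs [c [cg H1 H2]]] := H N.+1.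
by exists hs, c; split => // x i; exact: H2.
Qed.

End Lyapunov.

(** * The Sylvester equation and the urn matrix *)

Section Sylvester.
Variables (R : realType) (N : nat) (C : 'M[R]_N) (hs : seq 'rV[R]_N) (c : R).
Hypothesis c2 : c < 2^-1.
Hypothesis hsC : forall x, qb hs x (C *m x) <= c * qb hs x x.
Hypothesis hs_coord : forall (x : 'cV[R]_N) i, x i 0 ^+ 2 <= qb hs x x.

Let dotp_tr (h k : 'rV[R]_N) (S : 'M[R]_N) : dotp k (S *m h^T) = dotp h (S^T *m k^T).
Proof. by rewrite /dotp -[in LHS](trmxK (k *m _)) mxE !trmx_mul trmxK mulmxA. Qed.

(** The quantity n(S), the sum of the squares of k S h^T over all h, k in [hs], is invariant under
    transposition. Substituting S = C S + S C^T in one factor and applying the Lyapunov bound to S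
    and to S^T gives n(S) <= 2 c n(S) with 2 c < 1. *)
Lemma sylvester_inj (S : 'M[R]_N) : S = C *m S + S *m C^T -> S = 0.
Proof.
move=> SE.
pose n (S : 'M[R]_N) := \sum_(h <- hs) qb hs (S *m h^T) (S *m h^T).
have nT : n S^T = n S.
  rewrite /n /qb exchange_big/=; apply: eq_bigr => h _; apply: eq_bigr => k _.
  by rewrite !(dotp_tr k h) trmxK.
have leN S' : \sum_(h <- hs) qb hs (S' *m h^T) (C *m (S' *m h^T)) <= c * n S'.
  by rewrite /n big_distrr/=; apply: ler_sum => h _; exact: hsC.
have nE : n S = \sum_(h <- hs) qb hs (S *m h^T) (C *m (S *m h^T)) +
    \sum_(h <- hs) qb hs (S^T *m h^T) (C *m (S^T *m h^T)).
  rewrite [X in _ = _ + X](_ : _ = \sum_(h <- hs) qb hs (S *m h^T) (S *m C^T *m h^T)).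
    rewrite -big_split/=; apply: eq_bigr => h _; rewrite -qbDr mulmxA -mulmxDl.
    by congr (qb _ _ (_ *m _)).
  rewrite /qb exchange_big/=; apply: eq_bigr => h _; apply: eq_bigr => k _.
  by rewrite !(dotp_tr h k) trmx_mul trmxK mulmxA.
have n0 : n S = 0.
  have ge0 : 0 <= n S by apply: sumr_ge0 => h _; exact: qb_ge0.
  have : n S <= 2 * c * n S.
    by rewrite {1}nE; have := leN S; have := leN S^T; rewrite nT; lra.
  move=> le; apply/eqP; rewrite eq_le ge0 andbT.
  rewrite leNgt; apply/negP => n_gt0; move: c2; rewrite -subr_gt0 => c2'.
  by have := mulr_gt0 c2' n_gt0; lra.
have S0 h : h \in hs -> S *m h^T = 0.
  move=> hin; have : qb hs (S *m h^T) (S *m h^T) = 0.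
    move/eqP: n0; rewrite /n psumr_eq0; last by move=> *; exact: qb_ge0.
    by move/allP => /(_ _ hin)/eqP.
  move=> q0; apply/colP => i; rewrite !mxE; apply/eqP; rewrite -sqrf_eq0.
  have := hs_coord (S *m h^T) i; rewrite q0 mxE => le0.
  by rewrite eq_le le0 sqr_ge0.
apply/matrixP => i j; rewrite mxE; apply/eqP; rewrite -sqrf_eq0.
pose y := S^T *m (delta_mx 0 i : 'rV[R]_N)^T.
have := hs_coord y j; rewrite (_ : qb hs y y = 0).
  rewrite /y -trmx_mul -rowE !mxE => le0; by rewrite eq_le le0 sqr_ge0.
rewrite /qb big_seq big1// => h hin.
by rewrite /y -dotp_tr (S0 _ hin) /dotp mulmx0 mxE mul0r.
Qed.

(** On vectorised matrices the Sylvester operator is a square matrix, so injectivity gives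
    solvability. *)
Lemma sylvester (G : 'M[R]_N) : exists S, S = C *m S + S *m C^T + G.
Proof.
pose M := 1%:M - lin_mx (mulmx C) - lin_mx (mulmxr C^T).
have ME S : mxvec S *m M = mxvec (S - C *m S - S *m C^T).
  by rewrite /M !mulmxBr !mul_vec_lin mulmx1 !raddfB.
have Mu : M \in unitmx.
  rewrite -row_free_unit; apply: inj_row_free => v.
  rewrite -(vec_mxK v) ME => /eqP; rewrite mxvec_eq0 -addrA -opprD subr_eq0 => /eqP.
  by move=> /sylvester_inj ->; rewrite linear0.
exists (vec_mx (mxvec G *m invmx M)).
set S := vec_mx _.
have : mxvec S *m M = mxvec G by rewrite /S vec_mxK mulmxKV.
rewrite ME => /(can_inj mxvecK) <-; by rewrite [RHS]addrC -[X in X + _]addrA -opprD subrK.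
Qed.

End Sylvester.

(** The tail p_{>k} of the limiting degree distribution in product form; [limit_tailE] identifies
    the two. *)
Definition surv (R : realType) (f : nat -> R) (lam : R) (k : nat) : R :=
  \prod_(1 <= j < k.+1) (f j / (lam + f j)).

(* In the next definitions index i stands for nodes of degree i + 1 if i < K
   and of degree > K if i = K. *)
Definition urn_p (R : realType) (f : nat -> R) (lam : R) (K : nat) : 'cV[R]_K.+1 :=
  \col_i (if (i < K)%N then surv f lam i - surv f lam i.+1 else surv f lam K).

Definition urn_phi (R : realType) (f : nat -> R) (K : nat) : 'rV[R]_K.+1 :=
  \row_i f i.+1.

Definition urn_jump (R : realType) (K : nat) (j : 'I_K.+1) : 'cV[R]_K.+1 :=
  \col_i ((i == 0%N :> nat)%:R +
     (j < K)%N%:R * ((i == j.+1 :> nat)%:R - (i == j :> nat)%:R)).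

(** * The urn matrix: Perron vectors, deflation and spectrum *)

Section UrnMatrix.
Variables (R : realType) (f : nat -> R) (lam : R) (K : nat).
Hypothesis f0 : forall k, (0 < k)%N -> 0 < f k.
Hypothesis lam0 : 0 < lam.
Hypothesis K0 : (0 < K)%N.
Hypothesis fK : f K.+1 = f K.
Hypothesis mal : \sum_(1 <= l < K) surv f lam l + surv f lam K.-1 * f K / lam = 1.

Local Notation pi_ := (surv f lam).
Local Notation p := (urn_p f lam K).
Local Notation phi := (urn_phi f K).
Local Notation A := (urn_matrix f K).

Lemma surv0 : pi_ 0 = 1. Proof. by rewrite /surv big_nil. Qed.

Lemma survS k : pi_ k.+1 = pi_ k * (f k.+1 / (lam + f k.+1)).
Proof. by rewrite /surv big_nat_recr. Qed.

Let lf k : (0 < k)%N -> 0 < lam + f k.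
Proof. by move=> k0; rewrite addr_gt0 ?f0. Qed.

Lemma surv_gt0 k : 0 < pi_ k.
Proof.
by elim: k => [|k IH]; rewrite ?surv0// survS mulr_gt0// divr_gt0 ?f0 ?lf.
Qed.

Lemma surv_rec k : f k.+1 * (pi_ k - pi_ k.+1) = lam * pi_ k.+1.
Proof. by rewrite survS; field; rewrite gt_eqF ?lf. Qed.

Lemma limit_degE k : limit_deg f lam k.+1 = pi_ k - pi_ k.+1.
Proof.
rewrite /limit_deg survS -/(pi_ k); field; by rewrite gt_eqF ?lf.
Qed.

Lemma urn_p_gt0 i : 0 < p i 0.
Proof.
rewrite mxE; case: ifP => _; last exact: surv_gt0.
by rewrite -(pmulr_rgt0 _ (f0 (ltn0Sn i))) surv_rec mulr_gt0 ?surv_gt0.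
Qed.

Lemma urn_phi_gt0 i : 0 < phi 0 i. Proof. by rewrite mxE f0. Qed.

Lemma urn_phi_p i : phi 0 i * p i 0 =
  if (i < K)%N then lam * pi_ i.+1 else f K * pi_ K.
Proof.
rewrite !mxE; case: ifP => iK; first by rewrite surv_rec.
have -> : i = K :> nat by apply/eqP; rewrite eqn_leq -ltnS ltn_ord leqNgt iK.
by rewrite fK.
Qed.

(** The Malthusian equation in disguise: by [urn_phi_p] the sum is lam times the tails up to K plus
    f(K) times the last tail, and [mal] evaluates it. *)
Lemma urn_phi_sum : dotp phi p = lam.
Proof.
rewrite dotpE (eq_bigr (fun i : 'I_K.+1 => if (i < K)%N then lam * pi_ i.+1 else f K * pi_ K)); last first.
  by move=> i _; rewrite urn_phi_p.
rewrite -(big_mkord xpredT (fun i => if (i < K)%N then lam * pi_ i.+1 else f K * pi_ K)).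
rewrite big_nat_recr//= ltnn.
rewrite (eq_big_nat _ _ (F2 := fun i => lam * pi_ i.+1)); last first.
  by move=> i /andP[_ ->].
rewrite -big_distrr/= -[K]prednK//= big_nat_recr//= prednK//.
rewrite -(big_add1 _ _ 0 K xpredT pi_)/=.
have := surv_rec K.-1; rewrite prednK// => H.
move: mal; set s := \sum_(_ <= _ < _) _ => E.
have -> : s = 1 - pi_ K.-1 * f K / lam by rewrite -E; ring.
have -> : lam * (1 - pi_ K.-1 * f K / lam + pi_ K) + f K * pi_ K =
  lam - pi_ K.-1 * f K + lam * pi_ K + f K * pi_ K by field; rewrite gt_eqF.
by move: H; lra.
Qed.

Lemma urn_jump_sum j : \sum_i @urn_jump R K j i 0 = 1.
Proof.
under eq_bigr do rewrite mxE.
rewrite big_split/= -big_distrr/= sumrB.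
have S (k : 'I_K.+1) : \sum_(i < K.+1) (i == k :> nat)%:R = 1 :> R.
  rewrite (bigD1 k)//= eqxx big1 ?addr0// => i /negPf ik.
  by have -> : (i == k :> nat) = false by [].
rewrite (S ord0); have [jK|_] := boolP (j < K)%N; last by rewrite mul0r addr0.
by rewrite (S j) (S (Ordinal (jK : j.+1 < K.+1)%N)) subrr mulr0 addr0.
Qed.

Lemma urn_jump_dot (u : 'rV[R]_K.+1) (g : nat -> R) (j : 'I_K.+1) :
  (forall i, u 0 i = g i) ->
  dotp u (urn_jump R j) = g 0 + (j < K)%N%:R * (g j.+1 - g j).
Proof.
move=> ug; rewrite dotpE.
under eq_bigr do rewrite ug mxE mulrDr mulrCA mulrBr.
rewrite big_split/= -big_distrr/= sumrB.
have S (k : 'I_K.+1) : \sum_(i < K.+1) g i * (i == k :> nat)%:R = g k :> R.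
  rewrite (bigD1 k)//= eqxx mulr1 big1 ?addr0// => i /negPf ik.
  by have -> : (i == k :> nat) = false by []; rewrite mulr0.
rewrite (S ord0); have [jK|_] := boolP (j < K)%N; last by rewrite !mul0r.
by rewrite (S j) (S (Ordinal (jK : j.+1 < K.+1)%N)).
Qed.

(** Column j is the attachment weight of type j times the jump it causes. The zero at (0, 0) is a
    leaf promoted while a leaf is added; the zero at (K, K) is a node that stays in the last
    class. *)
Lemma urn_matrixE i j : A i j = phi 0 j * urn_jump R j i 0.
Proof.
rewrite !mxE; case: j => j jK; case: i => i iK; rewrite -val_eqE /=.
rewrite !ltnS in iK jK.
case: (eqVneq i 0%N) => [->|i0].
  case: j jK => [|j] jK /=; first by rewrite K0 mul1r sub0r subrr mulr0.
  by rewrite subrr mulr0 addr0 mulr1.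
rewrite /= add0r; case: (eqVneq i j.+1) => [E|ij].
  by rewrite E in iK *; rewrite iK gtn_eqF// subr0 !mulr1.
case: (eqVneq i j) => [<-|_] /=; last by rewrite subrr !mulr0.
by case: (ltnP i K) => iK' /=; rewrite ?mul0r ?mulr0// mul1r sub0r mulrN1.
Qed.

Lemma urn_colsum (h : 'I_K.+1 -> R) (g : nat -> R) i : (forall j, h j = g j) ->
  \sum_j h j * urn_jump R j i 0 =
  (i == 0%N :> nat)%:R * (\sum_j h j) + (0 < i)%N%:R * g i.-1 - (i < K)%N%:R * g i.
Proof.
move=> hg; under eq_bigr do rewrite mxE mulrDr mulrC.
rewrite big_split/= -big_distrr/= -addrA; congr (_ + _).
rewrite (eq_bigr (fun j : 'I_K.+1 => (i == j.+1 :> nat)%:R * g j - (i < K)%N%:R * ((i == j :> nat)%:R * g j))); last first.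
  move=> j _; rewrite hg; case: (eqVneq (i : nat) j) => [->|ij].
    by rewrite ltn_eqF// ?(mulr0n, mulr1n); ring.
  case: (eqVneq (i : nat) j.+1) => [ij1|ij1]; rewrite ?(mulr0n, mulr1n); last by ring.
  have -> : (j < K)%N by rewrite -ltnS -ij1.
  by rewrite ?mulr1n; ring.
rewrite sumrB -big_distrr/=; congr (_ - _ * _).
  case: i => -[|i] iK /=; first by rewrite mul0r big1// => j _; rewrite mul0r.
  rewrite (bigD1 (Ordinal (ltnW iK)))//= eqxx big1 ?addr0// => j /negPf.
  by rewrite -val_eqE/= eqSS eq_sym => ->; rewrite mul0r.
rewrite (bigD1 i)//= eqxx mul1r big1 ?addr0// => j /negPf ij.
by rewrite eq_sym -[_ == _ :> nat]/(j == i) ij mul0r.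
Qed.

(** Row i is a balance of flows: inflow from class i - 1 minus outflow of class i equals lam p_i,
    and the inflow of the first class is the total weight lam. *)
Lemma urn_Ap : A *m p = lam *: p.
Proof.
apply/colP => i; rewrite !mxE.
under eq_bigr do rewrite urn_matrixE mulrAC.
pose g k := if (k < K)%N then lam * pi_ k.+1 else f K * pi_ K.
rewrite (@urn_colsum _ g); last by move=> j; rewrite urn_phi_p.
rewrite -dotpE urn_phi_sum /g; case: i => -[|i] /= iK.
  by rewrite K0 mul0r surv0 mul1r mulr1n; ring.
rewrite ltnS in iK; rewrite iK mul0r add0r mul1r.
case: ifP => iK'; first by rewrite mulr1n; ring.
have -> : i.+1 = K by apply/eqP; rewrite eqn_leq iK leqNgt iK'.
by rewrite mul0r subr0.
Qed.

Let tail j : R := \sum_(j <= l < K) pi_ l + pi_ K.-1 * f K / lam.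
Let ug j : R := if (j < K)%N then tail j.+1 / pi_ j else f K / lam.

(** The reproductive value: entry j is the sum of [surv l] over l > j divided by [surv j], with the
    geometric tail from K on summed in closed form. It is the discounted expected number of further
    children of a node of type j; entry 0 is 1 by the Malthusian equation. *)
Definition urn_u : 'rV[R]_K.+1 :=
  \row_j (if (j < K)%N then (\sum_(j.+1 <= l < K) pi_ l + pi_ K.-1 * f K / lam) / pi_ j
          else f K / lam).

Lemma urn_u_gt0 i : 0 < urn_u 0 i.
Proof.
rewrite mxE; case: ifP => _; last by rewrite divr_gt0// f0.
rewrite divr_gt0 ?surv_gt0// ltr_wpDl ?divr_gt0 ?mulr_gt0 ?surv_gt0 ?f0//.
by apply: sumr_ge0 => l _; rewrite ltW// surv_gt0.
Qed.

(** Left eigenvector equation colour by colour. In this form it gives the increment of the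
    normaliser u x in the second moment estimate. *)
Lemma urn_u_jump j : phi 0 j * dotp urn_u (urn_jump R j) = lam * urn_u 0 j.
Proof.
rewrite (@urn_jump_dot _ ug); last by move=> i; rewrite mxE.
have u0 : ug 0 = 1.
  by rewrite /ug K0 /tail surv0 divr1.
rewrite u0 [in RHS]mxE -/(tail _) -/(ug j) [phi 0 j]mxE.
case: j => j /=; rewrite ltnS => jK; rewrite /ug.
case: (ltnP j K) => jK'; last first.
  have -> : j = K by apply/eqP; rewrite eqn_leq jK.
  by rewrite fK /= mul0r; field; rewrite gt_eqF.
have pj := lt0r_neq0 (surv_gt0 j); have pj1 := lt0r_neq0 (surv_gt0 j.+1).
have l0 := lt0r_neq0 lam0.
have E : lam * tail j.+1 = f j.+1 * (pi_ j + tail j.+2 * (pi_ j / pi_ j.+1) - tail j.+1) ->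
   f j.+1 * (1 + 1 * (tail j.+2 / pi_ j.+1 - tail j.+1 / pi_ j)) = lam * (tail j.+1 / pi_ j).
  move=> H; rewrite [in RHS]mulrA H; field; exact/andP.
have fe : pi_ j / pi_ j.+1 = (lam + f j.+1) / f j.+1.
  rewrite survS; field; rewrite ?gt_eqF ?lf ?f0 ?surv_gt0//.
have [j1K|j1K] := ltnP j.+1 K.
  apply: E; have -> : tail j.+1 = pi_ j.+1 + tail j.+2.
    by rewrite /tail big_ltn// addrA.
  move: (tail j.+2) => tl; rewrite mulrBr !mulrDr fe.
  have -> : f j.+1 * (tl * ((lam + f j.+1) / f j.+1)) = (lam + f j.+1) * tl.
    by field; rewrite gt_eqF// f0.
  by have := surv_rec j; lra.
have jE : K = j.+1 by apply/eqP; rewrite eqn_leq j1K jK'.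
rewrite /tail big_geq ?add0r; last by rewrite jE.
rewrite jE/=; field; by rewrite ?l0 ?pj.
Qed.

Lemma urn_uA : urn_u *m A = lam *: urn_u.
Proof.
apply/rowP => j; rewrite !mxE; under eq_bigr do rewrite urn_matrixE mulrCA.
by rewrite -big_distrr/= -dotpE urn_u_jump mxE.
Qed.

(** The rows after the first are a two-term recursion with nonzero leading coefficient, so an
    eigenvector for lam is determined by its first entry: the geometric multiplicity is one. *)
Lemma urn_ker (v : 'cV[R[i]]_K.+1) :
  map_mx (real_complex R) A *m v = (real_complex R lam) *: v ->
  v = map_mx (real_complex R) p *m (v 0 0 / real_complex R (p 0 0))%:M.
Proof.
move=> Av; set a := v 0 0 / _.
have p0 : real_complex R (p 0 0) != 0.
  by rewrite fmorph_eq0 gt_eqF ?urn_p_gt0.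
suff E k (kK : (k < K.+1)%N) : v (Ordinal kK) 0 = real_complex R (p (Ordinal kK) 0) * a.
  apply/colP => -[k kK]; rewrite E mul_mx_scalar !mxE mulrC; congr (_ * real_complex R _).
have row (w : 'cV[R[i]]_K.+1) k' (kK1 : (k'.+1 < K.+1)%N) (kK' : (k' < K.+1)%N) :
  map_mx (real_complex R) A *m w = (real_complex R lam) *: w ->
  (real_complex R (lam + (k'.+1 < K)%N%:R * f k'.+2)) * w (Ordinal kK1) 0 =
    real_complex R (f k'.+1) * w (Ordinal kK') 0.
  move=> /colP/(_ (Ordinal kK1)); rewrite !mxE => H.
  rewrite rmorphD mulrDl -H (bigD1 (Ordinal kK'))//= !mxE/= eqxx -addrA.
  rewrite [X in _ + X](_ : _ = 0) ?addr0//.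
  case: (ltnP k'.+1 K) => k1K; last first.
    rewrite mul0r rmorph0 mul0r addr0 big1// => j jk; rewrite !mxE/=.
    rewrite eqSS; have [kj|_] := eqVneq k' j.
      by case/eqP: jk; apply/val_inj.
    by rewrite ltnNge k1K andbF rmorph0 mul0r.
  rewrite (bigD1 (Ordinal kK1))/=; last by rewrite -val_eqE/= gtn_eqF.
  rewrite [X in _ + X + _]big1 ?addr0; last first.
    move=> j /andP[jk jk']; rewrite !mxE/= eqSS.
    have [kj|_] := eqVneq k' j; first by case/eqP: jk; apply/val_inj.
    by rewrite -val_eqE/= eq_sym [_ == _](negPf jk') /= rmorph0 mul0r.
  rewrite mul1r [X in X * _ + _](_ : _ = - real_complex R (f k'.+2)).
    by rewrite mulNr addNr.
  rewrite [LHS]mxE -[RHS]rmorphN; congr (real_complex R _).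
  by rewrite mxE/= k1K -val_eqE eqxx ltn_eqF.
elim: k kK => [|k IH] kK.
  rewrite (_ : Ordinal kK = 0); last exact/val_inj.
  by rewrite mulrC divfK.
have cne : real_complex R (lam + (k.+1 < K)%N%:R * f k.+2) != 0.
  by rewrite fmorph_eq0 gt_eqF// ltr_wpDr// mulr_ge0// ltW// f0.
apply: (mulfI cne); rewrite (row v k kK (ltnW kK) Av) IH; clearbody a; rewrite !mulrA; congr (_ * _).
have := row (map_mx (real_complex R) p) k kK (ltnW kK).
rewrite -map_mxM urn_Ap map_mxZ => /(_ erefl).
by rewrite [in LHS]mxE [in RHS]mxE => ->.
Qed.

Let Ac := map_mx (real_complex R) A.
Let A' := A - p *m phi.

(* Moduli of the coordinates of a left eigenvector y form a subsolution
   Re z |y| <= |y| A, because A is nonnegative off the diagonal; test against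
   the Perron vector p. *)
Lemma urn_perron (z : R[i]) : eigenvalue Ac z -> complex.Re z <= lam.
Proof.
move=> /eigenvalueP[y yA y0].
pose n (j : 'I_K.+1) := Normc.normc (y 0 j).
have n0 j : 0 <= n j by rewrite /n; case: (y 0 j) => a b /=; rewrite sqrtr_ge0.
have nM (a b : R[i]) : Normc.normc (a * b) = Normc.normc a * Normc.normc b.
  exact: Normc.normcM.
have nD (a b : R[i]) : Normc.normc (a + b) <= Normc.normc a + Normc.normc b.
  have := ler_normD a b; rewrite !normc_def -!rmorphD /= lecR.
  by case: a b => [? ?] [? ?].
have nR (a : R) : Normc.normc (real_complex R a) = `|a|.
  by rewrite /= expr0n/= addr0 sqrtr_sqr.
have nre (a : R[i]) : complex.Re a <= Normc.normc a.
  case: a => a b /=; apply: le_trans (ler_norm a) _.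
  by rewrite -sqrtr_sqr ler_wsqrtr// lerDl sqr_ge0.
have nS (I : finType) (Q : pred I) (F : I -> R[i]) :
    Normc.normc (\sum_(i | Q i) F i) <= \sum_(i | Q i) Normc.normc (F i).
  elim/big_ind2: _ => //; first by rewrite (nR 0) normr0.
  by move=> a b c d ab cd; apply: le_trans (nD _ _) _; exact: lerD.
have Aoff i j : i != j -> 0 <= A i j.
  move=> ij; rewrite mxE; case: ifP => _; first by case: ifP => // _; rewrite ltW// f0.
  by case: ifP => _; [rewrite ltW// f0|rewrite (negPf ij)].
have sub j : complex.Re z * n j <= \sum_i n i * A i j.
  have : (z - real_complex R (A j j)) * y 0 j = \sum_(i | i != j) y 0 i * Ac i j.
    rewrite mulrBl -[z * _]/(z * _).
    have -> : z * y 0 j = y 0 j * Ac j j + \sum_(i < K.+1 | i != j) y 0 i * Ac i j.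
      by have := congr1 (fun M : 'rV__ => M 0 j) yA; rewrite mxE [in RHS]mxE (bigD1 j) => // <-.
    by rewrite [Ac j j]mxE mulrC addrAC subrr add0r.
  move=> /(congr1 (@Normc.normc R)); rewrite nM => E.
  have := nre (z - real_complex R (A j j)); rewrite raddfB /= => L.
  have := nS _ (fun i => i != j) (fun i => y 0 i * Ac i j); rewrite -E => L2.
  have L3 : \sum_(i < K.+1 | i != j) Normc.normc (y 0 i * Ac i j) = \sum_(i < K.+1 | i != j) n i * A i j.
    by apply: eq_bigr => i ij; rewrite nM [Ac i j]mxE nR ger0_norm// Aoff.
  rewrite (bigD1 j)//= -L3; have := ler_wpM2r (n0 j) L; rewrite -/(n j) in L2.
  by move: L2; lra.
have S : complex.Re z * (\sum_j n j * p j 0) <= lam * \sum_j n j * p j 0.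
  have -> : lam * \sum_j n j * p j 0 = \sum_j (\sum_i n i * A i j) * p j 0.
    under [RHS]eq_bigr do rewrite big_distrl/=.
    rewrite exchange_big/= big_distrr/=; apply: eq_bigr => i _.
    have E := congr1 (fun M : 'cV__ => n i * M i 0) urn_Ap.
    rewrite mxE [X in _ = n i * X]mxE in E.
    under eq_bigr do rewrite -mulrA; rewrite -big_distrr/= E; ring.
  rewrite big_distrr/=; apply: ler_sum => j _; rewrite mulrA.
  by apply: ler_wpM2r => //; rewrite ltW// urn_p_gt0.
suff Sp : 0 < \sum_j n j * p j 0 by rewrite -(ler_pM2r Sp).
rewrite lt_def.
rewrite sumr_ge0 ?andbT; last by move=> j _; rewrite mulr_ge0// ltW// urn_p_gt0.
apply/eqP => /eqP; rewrite psumr_eq0; last first.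
  by move=> j _; rewrite mulr_ge0// ltW// urn_p_gt0.
move=> /allP H; case/eqP: y0; apply/rowP => j; rewrite mxE.
have := H j (mem_index_enum _); rewrite mulf_eq0 (gt_eqF (urn_p_gt0 _)) orbF => /eqP.
exact: Normc.eq0_normc.
Qed.

Lemma urn_drift_p : A' *m p = 0.
Proof.
rewrite mulmxBl urn_Ap -mulmxA.
have -> : phi *m p = lam%:M by rewrite [LHS]mx11_scalar -/(dotp _ _) urn_phi_sum.
by rewrite mul_mx_scalar subrr.
Qed.

(** Deflation: subtracting p phi moves the eigenvalue lam to 0. Let Q be the product of the factors
    A - z over [zs]. By Cayley-Hamilton A - lam kills Q, so by [urn_ker] the columns of Q are
    multiples of p. As (A' - z) p = - z p, replacing A by A' changes the product only by a matrix of
    the form p b, and A' p = 0 kills everything. *)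
Lemma urn_annih (zs : seq R[i]) :
  char_poly Ac = \prod_(z <- real_complex R lam :: zs) ('X - z%:P) ->
  \prod_(z <- 0 :: zs) (map_mx (real_complex R) A' - z%:M) = 0.
Proof.
move=> cp; have := Cayley_Hamilton Ac; rewrite cp rmorph_prod/=.
have hE z : horner_mx Ac ('X - z%:P) = Ac - z%:M.
  by rewrite rmorphB/= horner_mx_X horner_mx_C.
under eq_bigr do rewrite hE.
rewrite big_cons; set Q := \prod_(z <- zs) _ => AQ.
set A'c := map_mx _ A'; set pc := map_mx (real_complex R) p.
have A'p : A'c *m pc = 0 by rewrite -map_mxM urn_drift_p map_mx0.
have [b Qb] : exists b : 'rV_K.+1, \prod_(z <- zs) (A'c - z%:M) = Q + pc *m b.
  rewrite /Q; elim: (zs) => [|z zs' [b IH]].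
    by exists 0; rewrite !big_nil mulmx0 addr0.
  rewrite !big_cons IH; set Q' := \prod_(z <- zs') _.
  exists (- (map_mx (real_complex R) phi) *m Q' - z *: b).
  have -> : A'c - z%:M = Ac - z%:M - pc *m map_mx (real_complex R) phi.
    by rewrite /A'c map_mxB map_mxM addrAC.
  rewrite mulrDr -[X in _ + X = _]/((_ - _) *m _) [X in _ + X = _]mulmxA.
  rewrite [X in _ + X *m _ = _](_ : _ = - (z *: pc)); last first.
    rewrite -[X in X *m pc]addrAC mulmxBl mul_scalar_mx.
    by rewrite -map_mxM -map_mxB A'p sub0r.
  rewrite mulrBl -[X in _ - X + _]/((_ *m _) *m _) -mulmxA mulmxDr mulmxN.
  by rewrite -addrA; congr (_ + _); rewrite !mulNmx mulmxN -scalemxAl -scalemxAr.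
have [r Qr] : exists r : 'rV_K.+1, Q = pc *m r.
  exists (\row_j (Q 0 j / real_complex R (p 0 0))).
  apply/matrixP => i j.
  have /urn_ker : Ac *m col j Q = (real_complex R lam) *: col j Q.
    apply/eqP; rewrite -subr_eq0 -mul_scalar_mx -mulmxBl.
    have AQ' : (Ac - (real_complex R lam)%:M) *m Q = 0 by exact: AQ.
    by rewrite colE mulmxA AQ' mul0mx.
  move=> /colP/(_ i); rewrite mul_mx_scalar !mxE big_ord1 !mxE => ->.
  by rewrite mulrC.
rewrite big_cons Qb Qr raddf0 subr0 -mulmxDr -[LHS]/(_ *m _) mulmxA A'p.
by rewrite mul0mx.
Qed.

(** The value lam is in the list and no real part exceeds it. If it were not the head z0, the gap
    would force lam < Re z0 / 2 <= lam / 2. *)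
Lemma urn_eigen (ev : seq R[i]) : ordered_eigenvalues A ev ->
  complex.Re ev`_1 < complex.Re ev`_0 / 2 ->
  exists zs : seq R[i], ev = real_complex R lam :: zs /\
    (forall z : R[i], z \in zs -> complex.Re z < lam / 2).
Proof.
move=> [cp so] gap.
have evE z : z \in ev -> eigenvalue Ac z.
  by move=> zev; rewrite eigenvalue_root_char cp root_prod_XsubC.
have lamev : real_complex R lam \in ev.
  rewrite -root_prod_XsubC -cp -eigenvalue_root_char; apply/eigenvalueP.
  exists (map_mx (real_complex R) urn_u); first by rewrite -map_mxM urn_uA map_mxZ.
  apply/eqP => /rowP/(_ 0); rewrite !mxE => /eqP; rewrite fmorph_eq0.
  by have := urn_u_gt0 0; rewrite mxE => /gt_eqF ->.
case: ev cp so gap evE lamev => // z0 zs cp so /= gap evE lamev.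
have tr : transitive (fun z w : R[i] => complex.Re w <= complex.Re z).
  by move=> a b c ab bc; exact: le_trans bc ab.
have small z : z \in zs -> complex.Re z < complex.Re z0 / 2.
  case: zs so gap {cp evE lamev} => // z1 zs /= /andP[_ so] gap.
  rewrite inE => /orP[/eqP->//|zin]; apply: le_lt_trans gap.
  by have /(order_path_min tr)/allP/(_ _ zin) := so.
have z0lam := urn_perron (evE z0 (mem_head _ _)).
exists zs; move: lamev; rewrite inE => /orP[/eqP lamE|lamz].
  by rewrite lamE; split => // z /small; rewrite -lamE.
have := small _ lamz; rewrite /= => ?; exfalso; move: lam0; lra.
Qed.

End UrnMatrix.

(** * Real estimates *)

Section RealBounds.
Variable R : realType.
Implicit Types x y z : R.

Lemma derive_ge0 (f df : R -> R) : (forall x, is_derive x 1 f (df x)) ->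
  (forall x, 0 <= x -> 0 <= df x) -> f 0 = 0 -> forall x, 0 <= x -> 0 <= f x.
Proof.
move=> fdf df0 f0 x x0; have [|c c0x E] := @MVT_segment R f df 0 x x0 (fun y _ => fdf y).
  by apply: derivable_within_continuous => y _; exact: ex_derive.
move: E; rewrite f0 !subr0 => ->; rewrite mulr_ge0// df0//.
by move: c0x; rewrite in_itv => /andP[].
Qed.

Lemma sin_le x : 0 <= x -> 0 <= x - sin x.
Proof.
apply: (@derive_ge0 (fun x => x - sin x) (fun x => 1 - cos x)) => [y _|].
- by rewrite subr_ge0 cos_le1.
- by rewrite sin0 subr0.
Qed.

Lemma cos_ge_quad x : 0 <= x -> 0 <= x ^+ 2 / 2 - 1 + cos x.
Proof.
apply: (@derive_ge0 (fun x => x ^+ 2 / 2 - 1 + cos x) (fun x => x - sin x)) => [y|y|].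
- apply: is_derive_eq; rewrite /GRing.scale/=; lra.
- exact: sin_le.
- rewrite cos0; lra.
Qed.

Lemma cos_ge_lin x : 0 <= x -> 0 <= x - 1 + cos x.
Proof.
apply: (@derive_ge0 (fun x => x - 1 + cos x) (fun x => 1 - sin x)) => [y|y _|].
- apply: is_derive_eq; rewrite /GRing.scale/=; lra.
- by rewrite subr_ge0 sin_le1.
- rewrite cos0; lra.
Qed.

Lemma sin_ge_quad x : 0 <= x -> 0 <= x ^+ 2 / 2 - x + sin x.
Proof.
apply: (@derive_ge0 (fun x => x ^+ 2 / 2 - x + sin x) (fun x => x - 1 + cos x)) => [y|y|].
- apply: is_derive_eq; rewrite /GRing.scale/=; lra.
- exact: cos_ge_lin.
- rewrite sin0; lra.
Qed.

Lemma cos_le_cubic x : 0 <= x -> 0 <= x ^+ 3 / 6 - x ^+ 2 / 2 + 1 - cos x.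
Proof.
apply: (@derive_ge0 (fun x => x ^+ 3 / 6 - x ^+ 2 / 2 + 1 - cos x)
  (fun x => x ^+ 2 / 2 - x + sin x)) => [y|y|].
- apply: is_derive_eq; rewrite /GRing.scale/=; lra.
- exact: sin_ge_quad.
- rewrite cos0; lra.
Qed.

Lemma sin_ge_cubic x : 0 <= x -> 0 <= x ^+ 3 / 6 - x + sin x.
Proof.
apply: (@derive_ge0 (fun x => x ^+ 3 / 6 - x + sin x) (fun x => x ^+ 2 / 2 - 1 + cos x)) => [y|y|].
- apply: is_derive_eq; rewrite /GRing.scale/=; lra.
- exact: cos_ge_quad.
- rewrite sin0; lra.
Qed.

Lemma cos_taylor z x :
  `|cos (z + x) - (cos z - x * sin z - x ^+ 2 / 2 * cos z)| <= `|x| ^+ 3.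
Proof.
have C : `|cos x - 1 + x ^+ 2 / 2| <= `|x| ^+ 3 / 6.
  have -> : cos x = cos `|x| by case: (ger0P x) => // _; rewrite cosN.
  rewrite -real_normK ?num_real//.
  have := cos_ge_quad (normr_ge0 x); have := cos_le_cubic (normr_ge0 x).
  by rewrite ler_norml; lra.
have S : `|sin x - x| <= `|x| ^+ 3 / 6.
  have -> : `|sin x - x| = `|sin `|x| - `|x| |.
    case: (ger0P x) => // _; rewrite sinN -[in LHS]normrN; congr `|_|; ring.
  have := sin_le (normr_ge0 x); have := sin_ge_cubic (normr_ge0 x).
  by rewrite ler_norml; have := exprn_ge0 3 (normr_ge0 x); lra.
rewrite cosD.
have -> : cos z * cos x - sin z * sin x - (cos z - x * sin z - x ^+ 2 / 2 * cos z) =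
  cos z * (cos x - 1 + x ^+ 2 / 2) - sin z * (sin x - x) by ring.
apply: le_trans (ler_normB _ _) _; rewrite !normrM.
have := ler_wpM2r (normr_ge0 (cos x - 1 + x ^+ 2 / 2)) (cos_max z).
have := ler_wpM2r (normr_ge0 (sin x - x)) (sin_max z).
have := exprn_ge0 3 (normr_ge0 x); lra.
Qed.

Lemma cos_lip x y : `|cos x - cos y| <= `|x - y|.
Proof.
wlog: x y / x < y.
  move=> H; case: (ltgtP x y) => [|yx|->]; [exact: H| |by rewrite !subrr normr0].
  by rewrite distrC [leRHS]distrC; exact: H.
move=> xy; have [|c _ E] := @MVT R cos (fun z => - sin z) x y xy (fun z _ => is_derive_cos z).
  by apply: continuous_subspaceT; exact: continuous_cos.
by rewrite distrC E [leRHS]distrC normrM normrN ler_piMl// sin_max.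
Qed.

Lemma expR_taylor (B : R) : exists2 K, 0 <= K &
  forall x, `|x| <= B -> `|expR x - 1 - x| <= K * x ^+ 2.
Proof.
exists (4 * (expR B + 1 + `|B|) + 2) => [|x xB].
  by have := expR_gt0 B; have := normr_ge0 B; lra.
have B0 : 0 <= B by apply: le_trans xB.
rewrite (ger0_norm B0).
have eB := expR_gt0 B.
(* Near 0 the constant 2 suffices. Away from 0, x^2 >= 1/4, so four times a bound of the left-hand
   side is a valid constant. *)
have [x2|x2] := lerP `|x| 2^-1.
  have := expR_ge1Dx x => e1.
  have e2 : expR x <= 1 + x + 2 * x ^+ 2.
    have /andP[x2a x2b] : - 2^-1 <= x <= 2^-1 by rewrite -ler_norml.
    have e3 : 1 - x <= expR (- x) by exact: expR_ge1Dx.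
    have e4 : (1 - x) * expR x <= 1.
      have := ler_wpM2r (ltW (expR_gt0 x)) e3.
      by rewrite -expRD addNr expR0.
    have : (1 - x) * expR x <= (1 - x) * (1 + x + 2 * x ^+ 2).
      apply: le_trans e4 _; have := sqr_ge0 x; rewrite !expr2; nra.
    by rewrite ler_pM2l//; lra.
  rewrite ger0_norm; last by lra.
  by apply: (@le_trans _ _ (2 * x ^+ 2)); [lra|]; rewrite ler_wpM2r ?sqr_ge0//; lra.
have xsq : 4^-1 <= x ^+ 2.
  rewrite -real_normK ?num_real//.
  have := ltW x2; set t := `|x| => h; rewrite expr2; nra.
apply: le_trans (ler_normB _ _) _.
have h1 : `|expR x - 1| <= expR B + 1.
  apply: le_trans (ler_normB _ _) _; rewrite normr1 lerD2r ger0_norm ?expR_ge0//.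
  by rewrite ler_expR; move: xB; rewrite ler_norml => /andP[].
have : 4 * (expR B + 1 + B) * 4^-1 <= 4 * (expR B + 1 + B) * x ^+ 2.
  by rewrite ler_wpM2l//; lra.
have := sqr_ge0 x; rewrite mulrDl; lra.
Qed.

Lemma pos_bounds (I : finType) (g : I -> R) : (forall i, 0 < g i) ->
  exists2 e, 0 < e & forall i, e <= g i <= e^-1.
Proof.
move=> g0; pose s := 1 + \sum_i (g i + (g i)^-1).
have t0 i : 0 <= g i + (g i)^-1 by rewrite addr_ge0// ?invr_ge0 ltW.
have s0 : 0 < s by rewrite ltr_pwDl// sumr_ge0.
exists s^-1 => [|i]; first by rewrite invr_gt0.
have gs : g i + (g i)^-1 <= s.
  by rewrite /s (bigD1 i)//= addrCA lerDl addr_ge0// sumr_ge0.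
have gi : 0 < (g i)^-1 by rewrite invr_gt0.
apply/andP; split; last by rewrite invrK; have := g0 i; lra.
by rewrite -[leRHS]invrK lef_pV2 ?posrE//; have := g0 i; lra.
Qed.

(* 1 + s / m <= (1 - 1 / m) ^ (- s) *)
Lemma powR_step (s : R) (m : nat) : 0 <= s -> (1 < m)%N ->
  m%:R `^ (- s) * (1 + s / m%:R) <= m.-1%:R `^ (- s).
Proof.
move=> s0 m1; have mp : 0 < m%:R :> R by rewrite ltr0n ltnW.
have m1p : 0 < m.-1%:R :> R by rewrite ltr0n -ltnS prednK// ltnW.
have mE : m.-1%:R = m%:R * (1 - m%:R^-1) :> R.
  by rewrite mulrBr mulr1 divff ?gt_eqF// -subn1 natrB// ltnW.
have q0 : 0 < 1 - m%:R^-1 :> R by rewrite -(pmulr_rgt0 _ mp) -mE.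
rewrite mE powRM ?(ltW mp) ?(ltW q0)//; apply: ler_wpM2l; first exact: powR_ge0.
rewrite /powR gt_eqF//; apply: le_trans (expR_ge1Dx _) _.
rewrite ler_expR mulNr -mulrN ler_wpM2l//.
have : ln (1 + - m%:R^-1) <= - m%:R^-1 :> R.
  by apply: le_ln1Dx; rewrite ltrN2 invf_lt1// ltr1n.
by lra.
Qed.

(* Second-order expansion of 1 / (U + d) *)
Lemma quotient_step (Q D E n q U d B r : R) : 0 < E -> 1 <= n -> n <= E * U ->
  0 <= d <= D -> 0 <= q <= Q * n ^+ 2 -> `|2 * B + r| <= Q * n -> 0 <= r <= Q ->
  0 <= q + 2 * B + r ->
  (q + 2 * B + r) / (U + d) <= q / U - q / U * (d / U) + 2 * (B / U) +
    (Q * D ^+ 2 * E ^+ 3 + Q * E + Q * (D * E ^+ 2 + D ^+ 2 * E ^+ 3)) / n.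
Proof.
move=> E0 n1 nU /andP[d0 dD] /andP[q0 qQ] tQ /andP[r0 rQ] t0.
have n0 : 0 < n by lra.
have U0 : 0 < U by rewrite -(pmulr_rgt0 _ E0); lra.
have Une : U != 0 by rewrite gt_eqF.
have nne : n != 0 by rewrite gt_eqF.
have w0 : 0 < U^-1 by rewrite invr_gt0.
have v0 : 0 < n^-1 by rewrite invr_gt0.
have nv : n * n^-1 = 1 by rewrite divff.
have wv : U^-1 <= E * n^-1.
  by rewrite -(ler_pM2l U0) divff// mulrA -(ler_pM2r n0) mul1r -mulrA mulVf ?mulr1// mulrC.
have v1 : n^-1 <= 1 by rewrite invf_le1.
have D0 : 0 <= D by lra.
have Q0 : 0 <= Q by lra.
have inv : (U + d)^-1 <= U^-1 - d * U^-1 ^+ 2 + d ^+ 2 * U^-1 ^+ 3.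
  have Ud0 : 0 < U + d by lra.
  rewrite -(ler_pM2l Ud0) divff ?gt_eqF//.
  have -> : (U + d) * (U^-1 - d * U^-1 ^+ 2 + d ^+ 2 * U^-1 ^+ 3) = 1 + (d / U) ^+ 3.
    by field.
  by rewrite lerDl exprn_ge0// divr_ge0// ltW.
apply: le_trans (ler_wpM2l t0 inv) _.
move: wv w0 v0 v1 nv; move: U^-1 n^-1 => w v wv w0 v0 v1 nv.
have w0' := ltW w0; have v0' := ltW v0.
have wE2 : w ^+ 2 <= (E * v) ^+ 2 by rewrite lerXn2r ?nnegrE ?mulr_ge0// ltW.
have wE3 : w ^+ 3 <= (E * v) ^+ 3 by rewrite lerXn2r ?nnegrE ?mulr_ge0// ltW.
have d2 : d ^+ 2 <= D ^+ 2 by rewrite lerXn2r ?nnegrE.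
have d20 := sqr_ge0 d.
have w20 := sqr_ge0 w; have w30 : 0 <= w ^+ 3 by rewrite exprn_ge0// ltW.
have X1 : q * (d ^+ 2 * w ^+ 3) <= Q * n ^+ 2 * (D ^+ 2 * (E * v) ^+ 3).
  by apply: ler_pM => //; [rewrite mulr_ge0|apply: ler_pM].
have X2 : r * w <= Q * (E * v) by apply: ler_pM => //; exact: ltW.
have X3 : (2 * B + r) * (- (d * w ^+ 2) + d ^+ 2 * w ^+ 3) <=
    Q * n * (D * (E * v) ^+ 2 + D ^+ 2 * (E * v) ^+ 3).
  apply: le_trans (ler_norm _) _; rewrite normrM; apply: ler_pM => //.
  apply: le_trans (ler_normD _ _) _; rewrite normrN !ger0_norm ?mulr_ge0//.
  by apply: lerD; apply: ler_pM.
have E1 : Q * n ^+ 2 * (D ^+ 2 * (E * v) ^+ 3) = Q * D ^+ 2 * E ^+ 3 * v.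
  by rewrite -[RHS]mulr1 -[in RHS](expr1n _ 2) -nv; ring.
have E2 : Q * n * (D * (E * v) ^+ 2 + D ^+ 2 * (E * v) ^+ 3) =
    Q * (D * E ^+ 2 + D ^+ 2 * E ^+ 3 * v) * v.
  by rewrite -[RHS]mulr1 -[in RHS]nv; ring.
have E3 : D ^+ 2 * E ^+ 3 * v <= D ^+ 2 * E ^+ 3.
  by rewrite ler_piMr// mulr_ge0 ?sqr_ge0// exprn_ge0// ltW.
have E4 : Q * (D * E ^+ 2 + D ^+ 2 * E ^+ 3 * v) * v <= Q * (D * E ^+ 2 + D ^+ 2 * E ^+ 3) * v.
  by apply: ler_wpM2r; [exact: ltW|rewrite ler_wpM2l// lerD2l].
have -> : (q + 2 * B + r) * (w - d * w ^+ 2 + d ^+ 2 * w ^+ 3) =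
  q * w - q * w * (d * w) + 2 * (B * w) + q * (d ^+ 2 * w ^+ 3) + r * w +
  (2 * B + r) * (- (d * w ^+ 2) + d ^+ 2 * w ^+ 3) by ring.
rewrite E1 in X1; rewrite E2 in X3; lra.
Qed.

Lemma bounded_rec (x : nat -> R) (a b : R) : 0 < a -> a <= 1 ->
  (forall n, (0 < n)%N -> x n.+1 <= (1 - a / n%:R) * x n + b / n%:R) ->
  exists M, forall n, (0 < n)%N -> x n <= M.
Proof.
(* The number b / a is the fixed point of the recursion. *)
move=> a0 a1 H; exists (Num.max (x 1%N) (b / a)) => n; set M := Num.max _ _.
have Mb : b <= a * M.
  by rewrite mulrC -ler_pdivrMr// /M le_max lexx orbT.
elim: n => // -[_ _|n IH _]; first by rewrite /M le_max lexx.
apply: le_trans (H n.+1 isT) _.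
have v0 : 0 < n.+1%:R^-1 :> R by rewrite invr_gt0.
have v1 : n.+1%:R^-1 <= 1 :> R by rewrite invf_le1// ler1n.
move: (IH isT) v0 v1; move: (x n.+1) n.+1%:R^-1 => y v yM v0 v1.
have av : 0 <= 1 - a * v by have := ler_pM (ltW a0) (ltW v0) a1 v1; lra.
have := ler_wpM2l av yM; have := ler_wpM2r (ltW v0) Mb; lra.
Qed.

Lemma normr_le_sqr x y : 0 <= y -> (`|x| <= y) = (x ^+ 2 <= y ^+ 2).
Proof. by move=> y0; rewrite -[x ^+ 2]real_normK ?num_real// ler_sqr ?nnegrE. Qed.

Lemma cvg_le_dist0 (x v : nat -> R) (l : R) :
  (\forall n \near \oo, `|x n - l| <= v n) -> v @ \oo --> (0 : R) ->
  x @ \oo --> l.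
Proof.
move=> xv /cvgrPdist_le v0; apply/cvgrPdist_le => e e0.
apply: filterS2 xv (v0 e e0) => n h1 h2; rewrite distrC; apply: le_trans h1 _.
by apply: le_trans h2; rewrite sub0r normrN ler_norm.
Qed.

End RealBounds.

(** * Second moments of an urn *)

Definition coord_sum (R : realType) N (x : 'cV[R]_N) : R := \sum_i x i 0.

Definition chain_dom (R : realType) N (n : nat) (x : 'cV[R]_N) : Prop :=
  coord_sum x = n%:R /\ forall i, 0 <= x i 0.

(* One step from state x: type j is drawn with probability proportional to
   phi_j x_j and the state moves by dl j. *)
Definition chain_step (R : realType) N (phi : 'rV[R]_N) (dl : 'I_N -> 'cV[R]_N)
    (G : 'cV[R]_N -> R) (x : 'cV[R]_N) : R :=
  \sum_j phi 0 j * x j 0 / dotp phi x * G (x + dl j).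

Definition chain_mean (R : realType) N (phi : 'rV[R]_N) (dl : 'I_N -> 'cV[R]_N) :
    'M[R]_N :=
  \matrix_(i, j) (phi 0 j * dl j i 0).

(** Covariance of one jump in equilibrium: type j has limiting frequency phi_j p_j / lam, and the
    mean jump is then p. This is Gamma in the equation for S. *)
Definition chain_cov (R : realType) N (phi : 'rV[R]_N) (dl : 'I_N -> 'cV[R]_N)
    (lam : R) (p : 'cV[R]_N) : 'M[R]_N :=
  \sum_j (phi 0 j * p j 0 / lam) *: ((dl j - p) *m (dl j - p)^T).

(** Expectations enter the analysis of the urn only through these rules: monotone on states of the
    right total mass, linear, normalised, and Markov. No measurability is involved at this level. *)
Definition is_chain (R : realType) N (phi : 'rV[R]_N) (dl : 'I_N -> 'cV[R]_N)
    (EE : nat -> ('cV[R]_N -> R) -> R) : Prop :=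
  [/\ forall n G H, (0 < n)%N -> (forall x, chain_dom n x -> G x <= H x) ->
        EE n G <= EE n H,
      forall n a b G H,
        EE n (fun x => a * G x + b * H x) = a * EE n G + b * EE n H,
      forall n, (0 < n)%N -> EE n (fun=> 1) = 1 &
      forall n G, (0 < n)%N -> EE n.+1 G = EE n (chain_step phi dl G)].

Section ChainBounds.
Variables (R : realType) (N : nat) (phi : 'rV[R]_N) (dl : 'I_N -> 'cV[R]_N).
Variables (lam : R) (p : 'cV[R]_N) (hs : seq 'rV[R]_N).
Hypothesis phi_gt0 : forall i, 0 < phi 0 i.
Hypothesis dl_sum : forall j, coord_sum (dl j) = 1.
Hypothesis lam_gt0 : 0 < lam.
Hypothesis p_sum : coord_sum p = 1.
Hypothesis phi_p : dotp phi p = lam.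
Hypothesis mean_p : chain_mean phi dl *m p = lam *: p.
Hypothesis hs_coord : forall (x : 'cV[R]_N) i, x i 0 ^+ 2 <= qb hs x x.

Local Notation q x := (qb hs x x).
Local Notation nq x := (Num.sqrt (qb hs x x)).

(** The time is read off as the coordinate sum, so the centring is a function of the state alone. *)
Definition centred (x : 'cV[R]_N) := x - coord_sum x *: p.
Local Notation Y := centred.
(** The numerator of the conditional increment of Y: the drift is A' x / (phi x), and A' p = 0
    replaces x by Y. In the notation of the overview it is lam C. *)
Definition drift_mx := chain_mean phi dl - p *m phi.
Local Notation A' := drift_mx.

Lemma coord_sumD (x y : 'cV[R]_N) : coord_sum (x + y) = coord_sum x + coord_sum y.
Proof. by rewrite /coord_sum -big_split/=; apply: eq_bigr => i _; rewrite mxE. Qed.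

Lemma centredD_jump x j : Y (x + dl j) = Y x + (dl j - p).
Proof.
rewrite /centred coord_sumD dl_sum scalerDl scale1r opprD.
by rewrite addrACA.
Qed.

Lemma centredE n x : chain_dom n x -> x = Y x + n%:R *: p.
Proof. by move=> [xn _]; rewrite /centred xn subrK. Qed.

Lemma dotp_phi_centred n x : chain_dom n x ->
  dotp phi x = dotp phi (Y x) + n%:R * lam.
Proof. by move=> /centredE {1}->; rewrite dotpDr dotpZr phi_p. Qed.

Lemma sum_jump (w : 'cV[R]_N) :
  \sum_j (phi 0 j * w j 0) *: (dl j - p) = chain_mean phi dl *m w - (dotp phi w) *: p.
Proof.
apply/colP => i; rewrite summxE !mxE dotpE big_distrl/= -sumrB.
by apply: eq_bigr => j _; rewrite !mxE; ring.
Qed.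

Lemma drift_mxE w : A' *m w = chain_mean phi dl *m w - (dotp phi w) *: p.
Proof.
rewrite mulmxBl -mulmxA [phi *m w]mx11_scalar mul_mx_scalar.
by congr (_ - _ *: _); rewrite /dotp.
Qed.

Lemma drift_p : A' *m p = 0.
Proof. by rewrite drift_mxE mean_p phi_p subrr. Qed.

Lemma drift_centred n x : chain_dom n x -> A' *m x = A' *m Y x.
Proof.
by move=> /centredE {1}->; rewrite mulmxDr -scalemxAr drift_p scaler0 addr0.
Qed.

Lemma nq_ge0 x : 0 <= nq x. Proof. exact: sqrtr_ge0. Qed.

Lemma nq_sqr x : nq x ^+ 2 = q x. Proof. by rewrite sqr_sqrtr// qb_ge0. Qed.

Lemma coord_nq (x : 'cV[R]_N) i : `|x i 0| <= nq x.
Proof. by rewrite -sqrtr_sqr ler_wsqrtr. Qed.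

Lemma dotp_nq (h : 'rV[R]_N) : exists2 k, 0 <= k & forall x, `|dotp h x| <= k * nq x.
Proof.
exists (\sum_i `|h 0 i|) => [|x]; first exact: sumr_ge0.
rewrite dotpE big_distrl/=; apply: le_trans (ler_norm_sum _ _ _) _.
by apply: ler_sum => i _; rewrite normrM ler_wpM2l// coord_nq.
Qed.

Lemma mulmx_nq (M : 'M[R]_N) : exists2 k, 0 <= k & forall x, nq (M *m x) <= k * nq x.
Proof.
suff [k k0 H] : exists2 k, 0 <= k & forall x, q (M *m x) <= k * q x.
  exists (Num.sqrt k) => [|x]; first exact: sqrtr_ge0.
  by rewrite -sqrtrM// ler_wsqrtr.
(* Induction on the list of the left-hand form only; the right-hand side keeps the full norm, which
   dominates each linear form. *)
rewrite /qb; elim: {1}hs => [|h hs' [k k0 IH]].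
  by exists 0 => // x; rewrite big_nil mul0r.
have [kh kh0 H] := dotp_nq (h *m M).
exists (kh ^+ 2 + k) => [|x]; first by rewrite addr_ge0 ?sqr_ge0.
rewrite big_cons mulrDl lerD//.
rewrite -/(qb hs x x) -expr2 -dotp_mulmx -real_normK ?num_real// -nq_sqr -exprMn.
by rewrite lerXn2r// ?nnegrE// mulr_ge0// nq_ge0.
Qed.

(* All the constants of the estimates below are absorbed into a single one. *)
Lemma chain_consts : exists2 k, 1 <= k &
  [/\ forall n x, (0 < n)%N -> chain_dom n x -> nq (Y x) <= k * n%:R,
      forall j, nq (dl j - p) <= k,
      forall x, nq (A' *m x) <= k * nq x,
      forall x, `|dotp phi x| <= k * nq x &
      [/\ forall n x, (0 < n)%N -> chain_dom n x -> n%:R / k <= dotp phi x <= k * n%:R,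
      forall j, phi 0 j <= k,
      forall j, `|p j 0| <= k,
      lam^-1 <= k & lam <= k]].
Proof.
have [e e0 He] := pos_bounds phi_gt0.
have [k1 k10 H1] := mulmx_nq A'.
have [k2 k20 H2] := dotp_nq phi.
pose k3 := \sum_j nq (dl j - p).
pose k4 := \sum_j `|p j 0|.
have [k5 k50 H5] : exists2 k5, 0 <= k5 & forall n x, (0 < n)%N -> chain_dom n x ->
    nq (Y x) <= k5 * n%:R.
  suff [k k0 H] : exists2 k, 0 <= k & forall n x, (0 < n)%N -> chain_dom n x ->
      q (Y x) <= k * n%:R ^+ 2.
    exists (Num.sqrt k) => [|n x n0 xn]; first exact: sqrtr_ge0.
    rewrite -[n%:R]ger0_norm// -sqrtr_sqr -sqrtrM// ler_wsqrtr//; exact: H.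
  rewrite /qb; elim: {1}hs => [|h hs' [k k0 IH]].
    by exists 0 => // n x; rewrite big_nil mul0r.
  pose kh := \sum_i `|h 0 i| * (1 + `|p i 0|).
  have kh0 : 0 <= kh by apply: sumr_ge0 => i _; rewrite mulr_ge0// addr_ge0.
  exists (kh ^+ 2 + k) => [|n x n0 xn]; first by rewrite addr_ge0 ?sqr_ge0.
  rewrite big_cons mulrDl lerD//; last exact: IH.
  rewrite -expr2 -real_normK ?num_real// -exprMn lerXn2r ?nnegrE ?mulr_ge0//.
  rewrite dotpE /kh big_distrl/=; apply: le_trans (ler_norm_sum _ _ _) _.
  apply: ler_sum => i _; rewrite normrM -mulrA ler_wpM2l//.
  have [xs x0] := xn; rewrite !mxE xs; apply: le_trans (ler_normB _ _) _.
  rewrite mulrDl mul1r normrM normr_nat [n%:R * _]mulrC lerD// ger0_norm//.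
  by rewrite -xs /coord_sum (bigD1 i)//= lerDl sumr_ge0.
have k30 : 0 <= k3 by apply: sumr_ge0 => j _; exact: nq_ge0.
have k40 : 0 <= k4 by exact: sumr_ge0.
have k3E j : nq (dl j - p) <= k3.
  by rewrite /k3 (bigD1 j)//= lerDl; apply: sumr_ge0 => i _; exact: nq_ge0.
have k4E j : `|p j 0| <= k4 by rewrite /k4 (bigD1 j)//= lerDl; apply: sumr_ge0.
clearbody k3 k4.
have li0 : 0 < lam^-1 by rewrite invr_gt0.
have ei0 : 0 < e^-1 by rewrite invr_gt0.
have [li liE] : exists li, li = lam^-1 by exists lam^-1.
have [ei eiE] : exists ei, ei = e^-1 by exists e^-1.
rewrite -liE in li0 *; rewrite -eiE in ei0 He.
have l0 := lam_gt0.
pose k := 1 + k1 + k2 + k3 + k4 + k5 + li + lam + ei.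
exists k; first by rewrite /k; lra.
split.
- move=> n x n0 xn; apply: le_trans (H5 n x n0 xn) _; rewrite ler_wpM2r//.
  by rewrite /k; lra.
- move=> j; apply: (le_trans (k3E j)); rewrite /k; lra.
- move=> x; apply: le_trans (H1 x) _; rewrite ler_wpM2r ?nq_ge0//.
  by rewrite /k; lra.
- move=> x; apply: le_trans (H2 x) _; rewrite ler_wpM2r ?nq_ge0//.
  by rewrite /k; lra.
split.
- move=> n x n0 [xs x0].
  have nE : n%:R = \sum_i x i 0 by rewrite -xs.
  have kp : 0 < k by rewrite /k; lra.
  have ke : k^-1 <= e by rewrite -[e]invrK -eiE lef_pV2 ?posrE// /k; lra.
  rewrite nE dotpE; apply/andP; split.
    rewrite big_distrl/=; apply: ler_sum => i _; rewrite mulrC ler_wpM2r//.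
    by apply: le_trans ke _; have /andP[] := He i.
  rewrite big_distrr/=; apply: ler_sum => i _; rewrite ler_wpM2r//.
  have /andP[_ h] := He i; apply: le_trans h _; rewrite /k; lra.
- move=> j; have /andP[_ h] := He j; apply: le_trans h _; rewrite /k; lra.
- move=> j; apply: (le_trans (k4E j)); rewrite /k; lra.
- by rewrite /k; lra.
- by rewrite /k; lra.
Qed.

Variables (u : 'rV[R]_N) (c : R) (EE : nat -> ('cV[R]_N -> R) -> R).
Hypothesis u_gt0 : forall i, 0 < u 0 i.
Hypothesis u_jump : forall j, phi 0 j * dotp u (dl j) = lam * u 0 j.
Hypothesis c_lt : c < lam / 2.
Hypothesis hs_drift : forall x, qb hs x (A' *m x) <= c * q x.
Hypothesis EEP : is_chain phi dl EE.

Lemma EE_le n G H : (0 < n)%N -> (forall x, chain_dom n x -> G x <= H x) ->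
  EE n G <= EE n H.
Proof. by case: EEP => h _ _ _; exact: h. Qed.

Lemma EE_lin n a b G H :
  EE n (fun x => a * G x + b * H x) = a * EE n G + b * EE n H.
Proof. by case: EEP => _ h _ _; exact: h. Qed.

Lemma EEZ n a G : EE n (fun x => a * G x) = a * EE n G.
Proof.
have := EE_lin n a 0 G G; rewrite mul0r addr0 => <-; congr (EE n _).
by apply/funext => x; rewrite mul0r addr0.
Qed.

Lemma EED n G H : EE n (fun x => G x + H x) = EE n G + EE n H.
Proof.
have := EE_lin n 1 1 G H; rewrite !mul1r => <-; congr (EE n _).
by apply/funext => x; rewrite !mul1r.
Qed.

Lemma EEB n G H : EE n (fun x => G x - H x) = EE n G - EE n H.
Proof.
have := EE_lin n 1 (-1) G H; rewrite mul1r mulN1r => <-; congr (EE n _).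
by apply/funext => x; rewrite mul1r mulN1r.
Qed.

Lemma EE_cst n k : (0 < n)%N -> EE n (fun=> k) = k.
Proof.
move=> n0; have := EEZ n k (fun=> 1); case: EEP => _ _ -> // _.
by rewrite mulr1 => {2}<-; congr (EE n _); apply/funext => x; rewrite mulr1.
Qed.

Lemma EE_step n G : (0 < n)%N -> EE n.+1 G = EE n (chain_step phi dl G).
Proof. by case: EEP => _ _ _ h; exact: h. Qed.

Lemma EE_abs n G : (0 < n)%N -> `|EE n G| <= EE n (fun x => `|G x|).
Proof.
move=> n0; rewrite ler_norml; apply/andP; split; last first.
  by apply: EE_le => // x _; exact: ler_norm.
rewrite -mulN1r -EEZ; apply: EE_le => // x _.
by rewrite mulN1r lerNl -normrN ler_norm.
Qed.

Lemma EE_bnd n G k : (0 < n)%N -> (forall x, chain_dom n x -> G x <= k) -> EE n G <= k.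
Proof. by move=> n0 H; rewrite -[k](EE_cst k n0); exact: EE_le. Qed.

Lemma phi_dom_gt0 n x : (0 < n)%N -> chain_dom n x -> 0 < dotp phi x.
Proof.
move=> n0 xn; have [k k1 [_ _ _ _ [H _ _ _ _]]] := chain_consts.
have /andP[h _] := H n x n0 xn; apply: lt_le_trans h.
by rewrite divr_gt0 ?ltr0n//; lra.
Qed.

Lemma step_weights n x : (0 < n)%N -> chain_dom n x ->
  (forall j, 0 <= phi 0 j * x j 0 / dotp phi x) /\
  \sum_j phi 0 j * x j 0 / dotp phi x = 1.
Proof.
move=> n0 xn; have S0 := phi_dom_gt0 n0 xn; split.
  move=> j; rewrite divr_ge0 ?(ltW S0)// mulr_ge0//; first exact: ltW.
  by case: xn.
by rewrite -big_distrl/= -dotpE divff// gt_eqF.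
Qed.

(* The drift of q(Y) / (u x) is at most - (lam - 2 c) / (phi x) times itself,
   up to O(1/n). *)
Lemma second_moment : exists2 C0, 0 <= C0 &
  forall n, (0 < n)%N -> EE n (fun x => q (Y x)) <= C0 * n%:R.
Proof.
have [k k1 [H1 H2 H3 H4 [H5 H6 H7 H8 H9]]] := chain_consts.
have [e e0 He] := pos_bounds u_gt0.
have uU n x : (0 < n)%N -> chain_dom n x -> n%:R <= e^-1 * dotp u x <= e^-1 ^+ 2 * n%:R.
  move=> n0 [xs x0]; have nE : n%:R = \sum_i x i 0 by rewrite -xs.
  rewrite nE dotpE !big_distrr/=; apply/andP; split; apply: ler_sum => i _.
    by rewrite mulrA ler_peMl// mulrC ler_pdivlMr// mul1r; case/andP: (He i).
  rewrite mulrA ler_wpM2r// expr2 ler_wpM2l ?invr_ge0 ?(ltW e0)//; by case/andP: (He i).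
have ei0 : 0 < e^-1 by rewrite invr_gt0.
pose D := \sum_j dotp u (dl j).
have d0 j : 0 <= dotp u (dl j).
  by rewrite -(pmulr_rge0 _ (phi_gt0 j)) u_jump mulr_ge0// ltW.
have dD j : 0 <= dotp u (dl j) <= D.
  by rewrite d0 /D (bigD1 j)//= lerDl sumr_ge0.
pose Q := 3 * k ^+ 2.
pose b := Q * D ^+ 2 * e^-1 ^+ 3 + Q * e^-1 + Q * (D * e^-1 ^+ 2 + D ^+ 2 * e^-1 ^+ 3).
pose psi x := q (Y x) / dotp u x.
have kp : 0 < k by lra.
(* The minimum with 1 is the condition a <= 1 of [bounded_rec]; the k comes from phi x <= k n. *)
pose a := Num.min 1 ((lam - 2 * c) / k).
have a0 : 0 < a by rewrite lt_min ltr01 divr_gt0//; move: c_lt; lra.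
have a1 : a <= 1 by rewrite ge_min lexx.
have step n x : (0 < n)%N -> chain_dom n x ->
    chain_step phi dl psi x <= (1 - a / n%:R) * psi x + b / n%:R.
  move=> n0 xn; have S0 := phi_dom_gt0 n0 xn; have [w0 w1] := step_weights n0 xn.
  have n1 : 1 <= n%:R :> R by rewrite ler1n.
  have np : 0 < n%:R :> R by lra.
  have /andP[U1 U2] := uU n x n0 xn.
  have U0 : 0 < dotp u x by rewrite -(pmulr_rgt0 _ ei0); lra.
  set q0 := q (Y x); have q00 : 0 <= q0 by exact: qb_ge0.
  have q1 : q0 <= k ^+ 2 * n%:R ^+ 2.
    rewrite /q0 -nq_sqr -exprMn lerXn2r ?nnegrE ?nq_ge0//; last exact: H1.
    by rewrite mulr_ge0// ltW.
  have J j : psi (x + dl j) <= q0 / dotp u x - q0 / dotp u x * (dotp u (dl j) / dotp u x)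
      + 2 * (qb hs (Y x) (dl j - p) / dotp u x) + b / n%:R.
    rewrite /psi centredD_jump dotpDr.
    have -> : q (Y x + (dl j - p)) = q0 + 2 * qb hs (Y x) (dl j - p) + q (dl j - p).
      exact: qb_sqrD.
    have r1 : q (dl j - p) <= k ^+ 2.
      by rewrite -nq_sqr lerXn2r ?nnegrE ?nq_ge0// ltW.
    have k2 : 0 <= k ^+ 2 by exact: sqr_ge0.
    apply: quotient_step => //.
    - by rewrite q00 (le_trans q1)// ler_wpM2r ?sqr_ge0// /Q; lra.
    - have B : `|qb hs (Y x) (dl j - p)| <= k ^+ 2 * n%:R.
        apply: le_trans (qb_abs_le _ _ _) _; rewrite expr2 -mulrA [k * (k * _)]mulrC.
        by apply: ler_pM; rewrite ?nq_ge0//; exact: H1.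
      have := qb_ge0 hs (dl j - p); move: B; rewrite !ler_norml.
      set bb := qb _ _ _ => /andP[B1 B2] r0.
      have := ler_wpM2l k2 n1; rewrite mulr1 => kn.
      by apply/andP; split; rewrite /Q; lra.
    - by rewrite qb_ge0 (le_trans r1)// /Q; lra.
    - have := qb_ge0 hs (Y x + (dl j - p)).
      by rewrite qb_sqrD.
  rewrite /chain_step.
  have L : \sum_j phi 0 j * x j 0 / dotp phi x * psi (x + dl j) <=
      \sum_j phi 0 j * x j 0 / dotp phi x * (q0 / dotp u x - q0 / dotp u x * (dotp u (dl j) / dotp u x)
      + 2 * (qb hs (Y x) (dl j - p) / dotp u x) + b / n%:R).
    by apply: ler_sum => j _; exact: ler_wpM2l.
  apply: le_trans L _.
  (* Averaged over j, the jump of u x contributes - lam / (phi x) psi and the jump of q at most 2 c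
     / (phi x) psi. The random phi x factors out, so that only an upper bound of it is needed to get
     the rate a / n. *)
  have -> : \sum_j phi 0 j * x j 0 / dotp phi x * (q0 / dotp u x - q0 / dotp u x * (dotp u (dl j) / dotp u x)
      + 2 * (qb hs (Y x) (dl j - p) / dotp u x) + b / n%:R) =
     (q0 / dotp u x + b / n%:R) * (\sum_j phi 0 j * x j 0 / dotp phi x)
     - q0 / dotp u x / dotp u x / dotp phi x * (\sum_j x j 0 * (phi 0 j * dotp u (dl j)))
     + 2 / dotp u x / dotp phi x * (\sum_j qb hs ((phi 0 j * x j 0) *: (dl j - p)) (Y x)).
    rewrite !big_distrr/= -sumrB -big_split/=; apply: eq_bigr => j _.
    by rewrite qbZl (qbC _ _ (Y x)); ring.
  rewrite w1 -qb_sum sum_jump -drift_mxE (drift_centred xn) qbC.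
  under eq_bigr do rewrite u_jump mulrCA.
  rewrite -big_distrr/=.
  have -> : \sum_i x i 0 * u 0 i = dotp u x by rewrite dotpE; apply: eq_bigr => i _; rewrite mulrC.
  have B2 : qb hs (Y x) (A' *m Y x) <= c * q0 by exact: hs_drift.
  have cf0 : 0 <= 2 / dotp u x / dotp phi x by rewrite !divr_ge0 ?(ltW U0) ?(ltW S0).
  have := ler_wpM2l cf0 B2 => B3.
  have psi0 : 0 <= psi x by rewrite divr_ge0 ?(ltW U0).
  have aS : a / n%:R <= (lam - 2 * c) / dotp phi x.
    have /andP[_ Sk] := H5 n x n0 xn.
    rewrite ler_pdivrMr// mulrAC ler_pdivlMr//.
    have : a * k <= lam - 2 * c by rewrite -ler_pdivlMr// ge_min lexx orbT.
    move=> ak; have := ler_wpM2l (ltW a0) Sk; have := ler_wpM2r (ltW np) ak; lra.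
  have := ler_wpM2r psi0 aS => B4.
  have E1 : q0 / dotp u x / dotp u x / dotp phi x * (lam * dotp u x) = lam / dotp phi x * psi x.
    by rewrite /psi -/q0; field; rewrite !gt_eqF.
  have E2 : 2 / dotp u x / dotp phi x * (c * q0) = 2 * c / dotp phi x * psi x.
    by rewrite /psi -/q0; field; rewrite !gt_eqF.
  have E3 : q0 / dotp u x = psi x by [].
  rewrite E1 E3; rewrite E2 in B3.
  rewrite mulrBl in B4 *.
  move: B3 B4; set X := 2 / _ / _ * _; lra.
have [M HM] : exists M, forall n, (0 < n)%N -> EE n psi <= M.
  apply: (@bounded_rec _ (fun n => EE n psi) a b) => // n n0.
  rewrite EE_step// -[b / n%:R](@EE_cst n)// -EEZ -EED.
  by apply: EE_le => // x xn; exact: step.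
exists (`|M| * e^-1) => [|n n0]; first by rewrite mulr_ge0// ltW.
apply: (@le_trans _ _ (EE n (fun x => e^-1 * n%:R * psi x))).
  apply: EE_le => // x xn; have /andP[U1 U2] := uU n x n0 xn.
  have np : 0 < n%:R :> R by rewrite ltr0n.
  have U0 : 0 < dotp u x by rewrite -(pmulr_rgt0 _ ei0); lra.
  rewrite /psi mulrA ler_pdivlMr// mulrC ler_wpM2r ?qb_ge0//.
  by rewrite -(ler_pM2l ei0) mulrA -expr2.
rewrite EEZ mulrC; have en0 : 0 <= e^-1 * n%:R by rewrite mulr_ge0// ltW.
have := ler_wpM2r en0 (HM n n0).
have := ler_wpM2r en0 (ler_norm M); lra.
Qed.

End ChainBounds.

(** * Characteristic functions of an urn *)

Section ChainCf.
Variables (R : realType) (N : nat) (phi : 'rV[R]_N) (dl : 'I_N -> 'cV[R]_N).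
Variables (lam : R) (p : 'cV[R]_N) (hs : seq 'rV[R]_N).
Hypothesis phi_gt0 : forall i, 0 < phi 0 i.
Hypothesis dl_sum : forall j, coord_sum (dl j) = 1.
Hypothesis lam_gt0 : 0 < lam.
Hypothesis phi_p : dotp phi p = lam.
Hypothesis mean_p : chain_mean phi dl *m p = lam *: p.
Hypothesis hs_coord : forall (x : 'cV[R]_N) i, x i 0 ^+ 2 <= qb hs x x.
Variables (u : 'rV[R]_N) (c : R) (EE : nat -> ('cV[R]_N -> R) -> R).
Hypothesis u_gt0 : forall i, 0 < u 0 i.
Hypothesis u_jump : forall j, phi 0 j * dotp u (dl j) = lam * u 0 j.
Hypothesis c_lt : c < lam / 2.
Local Notation A' := (drift_mx phi dl p).
Hypothesis hs_drift : forall x, qb hs x (A' *m x) <= c * qb hs x x.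
Hypothesis EEP : is_chain phi dl EE.

Local Notation q x := (qb hs x x).
Local Notation nq x := (Num.sqrt (qb hs x x)).
Local Notation Y := (centred p).
Local Notation C := (lam^-1 *: A').
Local Notation G := (chain_cov phi dl lam p).

Definition rform (M : 'M[R]_N) (b : 'rV[R]_N) : R := dotp b (M *m b^T).

(** The norm of b dual to the Lyapunov norm is at most beta. *)
Definition dual_le (b : 'rV[R]_N) (beta : R) : Prop :=
  forall y, `|dotp b y| <= beta * nq y.

Lemma rform_cov (b : 'rV[R]_N) :
  rform G b = \sum_j phi 0 j * p j 0 / lam * dotp b (dl j - p) ^+ 2.
Proof.
rewrite /rform /chain_cov mulmx_suml /dotp mulmx_sumr summxE; apply: eq_bigr => j _.
rewrite -scalemxAl -scalemxAr mxE; congr (_ * _).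
rewrite -mulmxA -trmx_mul mulmxA mxE big_ord1 [X in _ * X]mxE expr2.
by [].
Qed.

(** The cosine is expanded around the argument already shifted by the linearised mean drift t = b C
    Y / m. The first-order term is then only the error of replacing phi x by lam m, of size beta
    |Y|^2 / m^2. The second-order term is [rform G b] up to the fluctuation of the type frequencies,
    of size beta^2 |Y| / m. The third order is beta^3. *)
Lemma cf_step : exists2 K, 0 <= K & forall m x b beta th,
  (0 < m)%N -> chain_dom m x -> 0 <= beta -> dual_le b beta ->
  `|chain_step phi dl (fun x => cos (th + dotp b (Y x))) x -
    (1 - rform G b / 2) * cos (th + dotp (b + m%:R^-1 *: (b *m C)) (Y x))| <=
  K * (beta * q (Y x) / m%:R ^+ 2 + beta ^+ 2 * nq (Y x) / m%:R + beta ^+ 3).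
Proof.
have [k k1 [H1 H2 H3 H4 [H5 H6 H7 H8 H9]]] := chain_consts dl p phi_gt0 lam_gt0 hs_coord.
have kp : 0 < k by lra.
have k0 := ltW kp.
exists (k ^+ 4 + (N%:R * (2 * k ^+ 7) + 2 * k ^+ 3 + k ^+ 5) + (k + k ^+ 3) ^+ 3).
  by rewrite !addr_ge0// ?exprn_ge0// ?addr_ge0// ?mulr_ge0// ?exprn_ge0.
move=> m x b beta th m0 xm beta0 bb.
have [w0 w1] := step_weights dl p phi_gt0 lam_gt0 hs_coord m0 xm.
have S0 := phi_dom_gt0 dl p phi_gt0 lam_gt0 hs_coord m0 xm.
set S := dotp phi x in w0 w1 S0 *.
have mp : 0 < m%:R :> R by rewrite ltr0n.
have [v vE] : exists v, v = m%:R^-1 :> R by exists m%:R^-1.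
have v0 : 0 < v by rewrite vE invr_gt0.
have mv : m%:R * v = 1 by rewrite vE divff// gt_eqF.
set n := nq (Y x).
have n0 : 0 <= n := nq_ge0 hs (Y x).
have nk : n * v <= k.
  by rewrite vE ler_pdivrMr//; exact: (H1 _ _ m0 xm).
have iS : S^-1 <= k * v.
  have /andP[h _] := H5 _ _ m0 xm.
  by rewrite -[k * v]invrK lef_pV2 ?posrE ?invr_gt0 ?mulr_gt0// invfM vE invrK mulrC.
have iS0 : 0 < S^-1 by rewrite invr_gt0.
have li0 : 0 < lam^-1 by rewrite invr_gt0.
pose h j := dotp b (dl j - p).
have hb j : `|h j| <= beta * k by apply: le_trans (bb _) _; rewrite ler_wpM2l.
pose t := v * dotp b (C *m Y x).
have At : `|dotp b (A' *m Y x)| <= beta * (k * n).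
  by apply: le_trans (bb _) _; rewrite ler_wpM2l.
have tE : t = v * (lam^-1 * dotp b (A' *m Y x)).
  by rewrite /t -scalemxAl dotpZr.
have tb : `|t| <= beta * k ^+ 2 * (n * v).
  rewrite tE !normrM (gtr0_norm v0) (gtr0_norm li0).
  have := ler_pM (ltW li0) (normr_ge0 _) H8 At => /(ler_wpM2l (ltW v0)); lra.
have tb' : `|t| <= beta * k ^+ 3.
  apply: le_trans tb _; have := ler_wpM2l (mulr_ge0 beta0 (sqr_ge0 k)) nk; lra.
pose w j := phi 0 j * x j 0 / S.
pose z := th + dotp (b + m%:R^-1 *: (b *m C)) (Y x).
have zE : z = th + dotp b (Y x) + t.
  by rewrite /z dotpDl dotpZl dotp_mulmx -vE /t; lra.
pose eps j := h j - t.
have ce j : cos (th + dotp b (Y (x + dl j))) = cos (z + eps j).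
  by rewrite (centredD_jump _ dl_sum) dotpDr zE /eps /h; congr cos; lra.
have epsb j : `|eps j| <= beta * (k + k ^+ 3).
  by apply: le_trans (ler_normB _ _) _; rewrite mulrDr lerD.
have Sw : \sum_j w j = 1 by [].
pose s1 := \sum_j w j * h j.
have s1E : s1 = S^-1 * dotp b (A' *m Y x).
  have -> : dotp b (A' *m Y x) = dotp b (\sum_j (phi 0 j * x j 0) *: (dl j - p)).
    by rewrite sum_jump -drift_mxE (drift_centred phi_p mean_p xm).
  rewrite /dotp mulmx_sumr summxE big_distrr/=; apply: eq_bigr => j _.
  by rewrite -/(dotp _ _) dotpZr /w /h; ring.
have s1b : `|s1| <= beta * k.
  apply: le_trans (ler_norm_sum _ _ _) _; rewrite -[leRHS]mul1r -[X in _ <= X * _]Sw big_distrl/=.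
  by apply: ler_sum => j _; rewrite normrM (ger0_norm (w0 j)) ler_wpM2l.
have SmE : S - m%:R * lam = dotp phi (Y x).
  by rewrite /S (dotp_phi_centred phi_p xm); lra.
have d1 : `|s1 - t| <= beta * k ^+ 4 * (n ^+ 2 * v ^+ 2).
  (* The exact difference of 1 / (phi x) and 1 / (lam m) brings out the factor phi Y, hence a second
     power of Y. *)
  have -> : s1 - t = - (dotp b (A' *m Y x) * (dotp phi (Y x)) * (S^-1 * (lam^-1 * v))).
    rewrite s1E tE -SmE -{1}[v]mulr1 vE; field.
    by rewrite !gt_eqF.
  rewrite normrN !normrM (gtr0_norm v0) (gtr0_norm li0) (gtr0_norm iS0).
  have X1 := ler_pM (normr_ge0 _) (normr_ge0 _) At (H4 (Y x)).
  have X2 : S^-1 * (lam^-1 * v) <= (k * v) * (k * v).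
    apply: ler_pM => //; [exact: ltW|exact: mulr_ge0 (ltW li0) (ltW v0)|].
    exact: ler_wpM2r (ltW v0) _ _ H8.
  have X3 : 0 <= S^-1 * (lam^-1 * v) := mulr_ge0 (ltW iS0) (mulr_ge0 (ltW li0) (ltW v0)).
  have := ler_pM (mulr_ge0 (normr_ge0 _) (normr_ge0 _)) X3 X1 X2.
  rewrite -/n; lra.
pose s2 := \sum_j w j * h j ^+ 2.
have gE := rform_cov b.
have d2 : `|s2 - rform G b| <= N%:R * (2 * k ^+ 7) * (beta ^+ 2 * (n * v)).
  rewrite gE /s2 -sumrB; apply: le_trans (ler_norm_sum _ _ _) _.
  have -> : N%:R * (2 * k ^+ 7) * (beta ^+ 2 * (n * v)) =
      \sum_(j < N) 2 * k ^+ 7 * (beta ^+ 2 * (n * v)).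
    by rewrite sumr_const card_ord -mulr_natl; ring.
  apply: ler_sum => j _; rewrite -mulrBl normrM.
  have E : w j - phi 0 j * p j 0 / lam =
      phi 0 j * (lam * (Y x) j 0 - p j 0 * dotp phi (Y x)) * (S^-1 * lam^-1).
    have [xs _] := xm; rewrite -SmE !mxE xs /w; field.
    by rewrite !gt_eqF.
  rewrite E.
  have Z1 := ler_pM (normr_ge0 _) (normr_ge0 _) (hb j) (hb j).
  have Z2 : `|lam * (Y x) j 0 - p j 0 * dotp phi (Y x)| <= 2 * (k ^+ 2 * n).
    apply: le_trans (ler_normB _ _) _; rewrite !normrM (gtr0_norm lam_gt0).
    have := ler_pM (ltW lam_gt0) (normr_ge0 _) H9 (coord_nq hs_coord (Y x) j).
    have := ler_pM (normr_ge0 _) (normr_ge0 _) (H7 j) (H4 (Y x)).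
    rewrite -/n; have : 0 <= k * n by rewrite mulr_ge0.
    move=> /(ler_wpM2r)/(_ _ _ k1); lra.
  have Z3 : S^-1 * lam^-1 <= k * v * k.
    by apply: ler_pM => //; [exact: ltW|exact: ltW].
  have Z4 : 0 <= S^-1 * lam^-1 := mulr_ge0 (ltW iS0) (ltW li0).
  rewrite !normrM (gtr0_norm (phi_gt0 j)) (gtr0_norm iS0) (gtr0_norm li0).
  have W1 := ler_pM (ltW (phi_gt0 j)) (normr_ge0 _) (H6 j) Z2.
  have W2 := ler_pM (mulr_ge0 (ltW (phi_gt0 j)) (normr_ge0 _)) Z4 W1 Z3.
  have W3 := ler_pM (mulr_ge0 (mulr_ge0 (ltW (phi_gt0 j)) (normr_ge0 _)) Z4) (mulr_ge0 (normr_ge0 _) (normr_ge0 _)) W2 Z1.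
  apply: le_trans W3 _; rewrite le_eqVlt; apply/orP; left; apply/eqP; ring.
have d3 : `|s2 - 2 * t * s1 + t ^+ 2 - rform G b| <=
    (N%:R * (2 * k ^+ 7) + 2 * k ^+ 3 + k ^+ 5) * (beta ^+ 2 * (n * v)).
  have -> : s2 - 2 * t * s1 + t ^+ 2 - rform G b = (s2 - rform G b) + (t * t - 2 * (t * s1)) by ring.
  apply: le_trans (ler_normD _ _) _; rewrite -[X in _ <= X * _]addrA [leRHS]mulrDl; apply: lerD => //.
  apply: le_trans (ler_normB _ _) _.
  rewrite (normrM t t) (normrM 2) (normrM t s1) (ger0_norm (ler0n _ 2)).
  have T1 := ler_pM (normr_ge0 _) (normr_ge0 _) tb tb'.
  have T2 := ler_pM (normr_ge0 _) (normr_ge0 _) tb s1b.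
  apply: le_trans (lerD T1 (ler_wpM2l (ler0n _ 2) T2)) _.
  rewrite le_eqVlt; apply/orP; left; apply/eqP; ring.
have Eps1 : \sum_j w j * eps j = s1 - t.
  rewrite -[t]mul1r -Sw big_distrl/= -sumrB; apply: eq_bigr => j _; rewrite /eps; ring.
have Eps2 : \sum_j w j * eps j ^+ 2 = s2 - 2 * t * s1 + t ^+ 2.
  rewrite -[t ^+ 2 in RHS]mul1r -[X in _ + X * _]Sw big_distrl/= /s1 big_distrr/= -sumrB -big_split/=.
  by apply: eq_bigr => j _; rewrite /eps; ring.
have -> : chain_step phi dl (fun x => cos (th + dotp b (Y x))) x - (1 - rform G b / 2) * cos z =
  \sum_j w j * (cos (z + eps j) - (cos z - eps j * sin z - eps j ^+ 2 / 2 * cos z))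
  - (s1 - t) * sin z - (s2 - 2 * t * s1 + t ^+ 2 - rform G b) * (cos z / 2).
  have E0 : chain_step phi dl (fun x => cos (th + dotp b (Y x))) x = \sum_j w j * cos (z + eps j).
    by apply: eq_bigr => j _; rewrite ce.
  have C0 : \sum_j w j * cos z = cos z by rewrite -big_distrl/= Sw mul1r.
  have T : \sum_j w j * (cos (z + eps j) - (cos z - eps j * sin z - eps j ^+ 2 / 2 * cos z)) =
      \sum_j w j * cos (z + eps j) - \sum_j w j * cos z + (\sum_j w j * eps j) * sin z +
      (\sum_j w j * eps j ^+ 2) * (cos z / 2).
    rewrite !big_distrl/= -sumrB -!big_split/=; apply: eq_bigr => j _; ring.
  by rewrite T E0 C0 Eps1 Eps2; field.
have R1 : `|\sum_j w j * (cos (z + eps j) - (cos z - eps j * sin z - eps j ^+ 2 / 2 * cos z))|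
   <= (beta * (k + k ^+ 3)) ^+ 3.
  apply: le_trans (ler_norm_sum _ _ _) _; rewrite -[leRHS]mul1r -[X in _ <= X * _]Sw big_distrl/=.
  apply: ler_sum => j _; rewrite normrM (ger0_norm (w0 j)) ler_wpM2l//.
  apply: le_trans (cos_taylor _ _) _.
  by rewrite lerXn2r ?nnegrE// mulr_ge0// addr_ge0// exprn_ge0.
have R2 : `|(s1 - t) * sin z| <= beta * k ^+ 4 * (n ^+ 2 * v ^+ 2).
  by rewrite normrM; apply: le_trans d1; apply: ler_piMr => //; exact: sin_max.
have R3 : `|(s2 - 2 * t * s1 + t ^+ 2 - rform G b) * (cos z / 2)| <=
    (N%:R * (2 * k ^+ 7) + 2 * k ^+ 3 + k ^+ 5) * (beta ^+ 2 * (n * v)).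
  rewrite normrM; apply: le_trans d3; apply: ler_piMr => //.
  have h2 : 0 <= 2^-1 :> R by rewrite invr_ge0.
  by rewrite normrM (ger0_norm h2); have := cos_max z; lra.
apply: le_trans (ler_normB _ _) _; apply: le_trans (lerD (ler_normB _ _) R3) _.
apply: le_trans (lerD (lerD R1 R2) (lexx _)) _.
have -> : beta * q (Y x) / m%:R ^+ 2 = beta * (n ^+ 2 * v ^+ 2).
  by rewrite -[X in beta * X / _](nq_sqr hs) vE exprVn [RHS]mulrA.
have -> : beta ^+ 2 * n / m%:R = beta ^+ 2 * (n * v) by rewrite vE mulrA.
have E3 : 0 <= beta ^+ 3 by exact: exprn_ge0.
have E1 : 0 <= beta * (n ^+ 2 * v ^+ 2) by rewrite mulr_ge0// mulr_ge0 ?sqr_ge0.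
have E2 : 0 <= beta ^+ 2 * (n * v) by rewrite mulr_ge0 ?sqr_ge0// mulr_ge0// ltW.
have A0 : 0 <= k ^+ 4 by exact: exprn_ge0.
have B0 : 0 <= N%:R * (2 * k ^+ 7) + 2 * k ^+ 3 + k ^+ 5.
  by rewrite !addr_ge0// ?mulr_ge0// ?exprn_ge0// mulr_ge0// exprn_ge0.
have C0 : 0 <= (k + k ^+ 3) ^+ 3 by rewrite exprn_ge0// addr_ge0// exprn_ge0.
have dot3 (a1 a2 a3 e1 e2 e3 : R) : 0 <= a1 -> 0 <= a2 -> 0 <= a3 -> 0 <= e1 ->
    0 <= e2 -> 0 <= e3 ->
    a3 * e3 + a1 * e1 + a2 * e2 <= (a1 + a2 + a3) * (e1 + e2 + e3).
  move=> a10 a20 a30 e10 e20 e30; rewrite -subr_ge0.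
  have -> : (a1 + a2 + a3) * (e1 + e2 + e3) - (a3 * e3 + a1 * e1 + a2 * e2) =
    a1 * (e2 + e3) + a2 * (e1 + e3) + a3 * (e1 + e2) by ring.
  by rewrite !addr_ge0 ?mulr_ge0 ?addr_ge0.
have := dot3 _ _ _ _ _ _ A0 B0 C0 E1 E2 E3; apply: le_trans.
rewrite le_eqVlt; apply/orP; left; apply/eqP; ring.
Qed.

(* [second_moment] turns the pointwise bound into powers of m. *)
Lemma cf_mean : exists2 K, 0 <= K & forall m b beta th,
  (0 < m)%N -> 0 <= beta -> dual_le b beta ->
  `|EE m.+1 (fun x => cos (th + dotp b (Y x))) -
    (1 - rform G b / 2) *
      EE m (fun x => cos (th + dotp (b + m%:R^-1 *: (b *m C)) (Y x)))| <=
  K * (beta / m%:R + beta ^+ 2 / Num.sqrt m%:R + beta ^+ 3).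
Proof.
have [K K0 HK] := cf_step.
have [C0 C00 HC] := second_moment phi_gt0 dl_sum lam_gt0 phi_p mean_p hs_coord u_gt0
  u_jump c_lt hs_drift EEP.
exists (K * (C0 + 1)) => [|m b beta th m0 beta0 bb]; first by rewrite mulr_ge0 ?addr_ge0.
rewrite (EE_step EEP)// -(EEZ EEP) -(EEB EEP).
apply: le_trans (EE_abs EEP _ m0) _.
apply: (le_trans (EE_le EEP m0 (fun x xm => HK m x b beta th m0 xm beta0 bb))).
have mp : 0 < m%:R :> R by rewrite ltr0n.
have sp : 0 < Num.sqrt m%:R :> R by rewrite sqrtr_gt0.
have ss : Num.sqrt m%:R ^+ 2 = m%:R :> R by rewrite sqr_sqrtr// ltW.
rewrite (EEZ EEP) -mulrA ler_wpM2l//.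
pose s : R := Num.sqrt m%:R.
apply: (@le_trans _ _ (EE m (fun x => (beta / m%:R ^+ 2 + beta ^+ 2 / m%:R / (2 * s)) * q (Y x)
   + (beta ^+ 2 / m%:R * (s / 2) + beta ^+ 3) * 1))).
  apply: (EE_le EEP) => // x _.
  (* Young's inequality with the typical size sqrt m of Y, so that the first moment is controlled by
     the second. *)
  have N1 : nq (Y x) <= q (Y x) / (2 * s) + s / 2.
    rewrite -subr_ge0; have := nq_sqr hs (Y x); move: (nq (Y x)) => t <-.
    have -> : t ^+ 2 / (2 * s) + s / 2 - t = (t - s) ^+ 2 / (2 * s).
      by field; rewrite gt_eqF.
    by rewrite divr_ge0 ?sqr_ge0// mulr_ge0// ltW.
  have bm : 0 <= beta ^+ 2 / m%:R by rewrite divr_ge0 ?sqr_ge0// ltW.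
  have := ler_wpM2l bm N1.
  have -> : beta * q (Y x) / m%:R ^+ 2 = beta / m%:R ^+ 2 * q (Y x) by rewrite mulrAC.
  have -> : beta ^+ 2 * nq (Y x) / m%:R = beta ^+ 2 / m%:R * nq (Y x) by rewrite mulrAC.
  by rewrite mulrDr mulrDl; lra.
rewrite (EED EEP) !(EEZ EEP) (EE_cst EEP)// mulr1.
have bs : 0 <= beta ^+ 2 / m%:R / (2 * s) by rewrite !divr_ge0 ?sqr_ge0// ?mulr_ge0// ?ltW.
have b0 : 0 <= beta / m%:R ^+ 2 by rewrite divr_ge0// exprn_ge0// ltW.
have := ler_wpM2l (addr_ge0 b0 bs) (HC m m0).
have -> : (beta / m%:R ^+ 2 + beta ^+ 2 / m%:R / (2 * s)) * (C0 * m%:R) =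
    C0 * (beta / m%:R) + C0 / 2 * (beta ^+ 2 / s).
  field; apply/andP; split; by rewrite gt_eqF.
have -> : beta ^+ 2 / m%:R * (s / 2) = 2^-1 * (beta ^+ 2 / s).
  rewrite -ss -/s; field; by rewrite gt_eqF.
have e1 : 0 <= beta / m%:R by rewrite divr_ge0// ltW.
have e2 : 0 <= beta ^+ 2 / s by rewrite divr_ge0 ?sqr_ge0// ltW.
have e3 : 0 <= beta ^+ 3 by rewrite exprn_ge0.
have := mulr_ge0 C00 e1; have := mulr_ge0 C00 e2; have := mulr_ge0 C00 e3.
rewrite -/s; move: e1 e2 e3; move: (beta / m%:R) (beta ^+ 2 / s) (beta ^+ 3).
by move=> a1 a2 a3; lra.
Qed.

Variable S : 'M[R]_N.
Hypothesis SE : S = C *m S + S *m C^T + G.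

Lemma dual_le_mulmx (M : 'M[R]_N) : exists2 k, 0 <= k &
  forall b beta, 0 <= beta -> dual_le b beta -> dual_le (b *m M) (k * beta).
Proof.
have [k k0 H] := mulmx_nq hs_coord M; exists k => // b beta beta0 bb y.
rewrite dotp_mulmx; apply: le_trans (bb _) _.
by rewrite [k * _]mulrC -mulrA ler_wpM2l.
Qed.

Lemma rform_dual (M : 'M[R]_N) : exists2 k, 0 <= k &
  forall b beta, 0 <= beta -> dual_le b beta -> `|rform M b| <= k * beta ^+ 2.
Proof.
pose k := \sum_j \sum_i `|M i j| * nq (delta_mx i 0) * nq (delta_mx j 0).
exists k => [|b beta beta0 bb].
  by apply: sumr_ge0 => j _; apply: sumr_ge0 => i _; rewrite !mulr_ge0 ?nq_ge0.
have bi i : `|b 0 i| <= beta * nq (delta_mx i 0).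
  have := bb (delta_mx i 0); rewrite dotpE (bigD1 i)//= mxE !eqxx mulr1 big1 ?addr0//.
  by move=> j /negPf ji; rewrite mxE ji mulr0.
rewrite /rform -dotp_mulmx dotpE /k big_distrl/=.
apply: le_trans (ler_norm_sum _ _ _) _; apply: ler_sum => j _.
rewrite !mxE normrM; apply: (@le_trans _ _ (\sum_i `|b 0 i| * `|M i j| * `|b 0 j|)).
  rewrite -big_distrl/= ler_wpM2r//; apply: le_trans (ler_norm_sum _ _ _) _.
  by apply: ler_sum => i _; rewrite normrM.
rewrite big_distrl/=; apply: ler_sum => i _.
have := ler_pM (normr_ge0 _) (normr_ge0 _) (bi i) (bi j).
move=> /(ler_wpM2l (normr_ge0 (M i j))); lra.
Qed.

(** This is what the Sylvester equation is made for: along the backward recursion the exponent m b_m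
    S b_m^T loses exactly b G b^T per step, up to a term of order 1 / m. *)
Lemma rform_back m b : (0 < m)%N ->
  m%:R * rform S (b + m%:R^-1 *: (b *m C)) =
  m.+1%:R * rform S b - rform G b + m%:R^-1 * rform S (b *m C).
Proof.
move=> m0; have mne : m%:R != 0 :> R by rewrite pnatr_eq0 -lt0n.
have X : rform S b = dotp (b *m C) (S *m b^T) + dotp b (S *m (b *m C)^T) + rform G b.
  rewrite /rform {1}SE !mulmxDl !dotpDr; congr (_ + _ + _).
    by rewrite dotp_mulmx mulmxA.
  by rewrite trmx_mul mulmxA.
have -> : rform S (b + m%:R^-1 *: (b *m C)) =
    dotp (b + m%:R^-1 *: (b *m C)) (S *m (b^T + m%:R^-1 *: (b *m C)^T)).
  by congr (dotp _ (_ *m _)); apply/matrixP => i j; rewrite !mxE.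
move: (b *m C) X => bC X.
rewrite mulmxDr -scalemxAr !(dotpDl, dotpDr, dotpZl, dotpZr).
have CtE : m.+1%:R = m%:R + 1 :> R by rewrite -natr1.
rewrite CtE mulrDl mul1r [X in _ + X - _]X.
rewrite -/(rform S b) -/(rform S bC).
move: (dotp bC (S *m b^T)) (dotp b (S *m bC^T)) (rform G b) (rform S b) (rform S bC).
by move=> a1 a2 a3 a4 a5; field.
Qed.

(** Multiplied by exp (m b_m S b_m^T / 2), the characteristic function is almost constant in m: by
    [rform_back] the ratio of the two Gaussian factors is exp x with x close to - [rform G b] / 2,
    and 1 - [rform G b] / 2 differs from exp x by the 1 / m term and by O(x^2), where x^2 =
    O(beta^4) = O(beta^3) because beta <= 1. *)
Lemma cf_incr : exists2 K, 0 <= K & forall m b beta th B,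
  (0 < m)%N -> 0 <= beta -> beta <= 1 -> dual_le b beta ->
  expR (m.+1%:R * rform S b / 2) <= B ->
  let b' := b + m%:R^-1 *: (b *m C) in
  `|EE m.+1 (fun x => cos (th + dotp b (Y x))) * expR (m.+1%:R * rform S b / 2) -
    EE m (fun x => cos (th + dotp b' (Y x))) * expR (m%:R * rform S b' / 2)| <=
  K * B * (beta / m%:R + beta ^+ 2 / Num.sqrt m%:R + beta ^+ 3).
Proof.
have [K K0 HK] := cf_mean.
have [kG kG0 HG] := rform_dual G.
have [kS kS0 HS] := rform_dual S.
have [kC kC0 HC] := dual_le_mulmx C.
pose k := kG + kS * kC ^+ 2.
have k0 : 0 <= k by rewrite addr_ge0// mulr_ge0// sqr_ge0.
have [KE KE0 HE] := expR_taylor k.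
exists (K + k + KE * k ^+ 2) => [|m b beta th B m0 beta0 beta1 bb eB].
  by rewrite !addr_ge0// mulr_ge0// sqr_ge0.
rewrite /=; set b' := b + _.
have mp : 0 < m%:R :> R by rewrite ltr0n.
have m1 : 1 <= m%:R :> R by rewrite ler1n.
have sp : 0 < Num.sqrt m%:R :> R by rewrite sqrtr_gt0.
have s1 : 1 <= Num.sqrt m%:R :> R by rewrite -[leLHS]sqrtr1 ler_wsqrtr.
have ss : Num.sqrt m%:R ^+ 2 = m%:R :> R by rewrite sqr_sqrtr// ltW.
set E1 := EE m.+1 _; set E2 := EE m _.
set T := beta / _ + _ + _.
have D1 : `|E1 - (1 - rform G b / 2) * E2| <= K * T by exact: HK.
pose x := - (rform G b / 2) + m%:R^-1 * rform S (b *m C) / 2.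
have ex : expR (m%:R * rform S b' / 2) = expR (m.+1%:R * rform S b / 2) * expR x.
  by rewrite -expRD; congr expR; rewrite rform_back// /x; field; rewrite gt_eqF.
have g1 := HG _ _ beta0 bb.
have g2 : `|m%:R^-1 * rform S (b *m C)| <= kS * kC ^+ 2 * (beta ^+ 2 / m%:R).
  have iv : 0 <= m%:R^-1 :> R by rewrite invr_ge0 ltW.
  rewrite normrM (ger0_norm iv).
  have := HS _ _ (mulr_ge0 kC0 beta0) (HC _ _ beta0 bb).
  move=> /(ler_wpM2l iv); rewrite exprMn; lra.
have b2 : 0 <= beta ^+ 2 by exact: sqr_ge0.
have b21 : beta ^+ 2 <= 1 by rewrite expr_le1.
have g3 : kS * kC ^+ 2 * (beta ^+ 2 / m%:R) <= kS * kC ^+ 2 * beta ^+ 2.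
  rewrite ler_wpM2l ?mulr_ge0 ?sqr_ge0// ler_pdivrMr//.
  by rewrite ler_peMr.
have xk : `|x| <= k * beta ^+ 2.
  apply: le_trans (ler_normD _ _) _.
  rewrite normrN (normrM (rform G b)) (normrM (m%:R^-1 * _)).
  have h2 : `|2^-1 : R| = 2^-1 by rewrite ger0_norm.
  rewrite h2 /k mulrDl.
  have := normr_ge0 (rform G b); have := normr_ge0 (m%:R^-1 * rform S (b *m C)).
  by move: g1 g2 g3; lra.
have xk1 : `|x| <= k.
  by apply: le_trans xk _; rewrite ler_piMr.
have x2 : x ^+ 2 <= k ^+ 2 * beta ^+ 3.
  rewrite -real_normK ?num_real//.
  apply: (@le_trans _ _ ((k * beta ^+ 2) ^+ 2)).
    by rewrite lerXn2r ?nnegrE// mulr_ge0.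
  rewrite exprMn ler_wpM2l ?sqr_ge0// -exprM.
  by rewrite (exprD _ 3 1) expr1 ler_piMr// exprn_ge0.
have D2 : `|1 - rform G b / 2 - expR x| <= (k + KE * k ^+ 2) * T.
  have -> : 1 - rform G b / 2 - expR x = - (expR x - 1 - x) - m%:R^-1 * rform S (b *m C) / 2.
    by rewrite /x; ring.
  apply: le_trans (ler_normB _ _) _; rewrite normrN.
  have := HE x xk1; have := ler_wpM2l KE0 x2.
  have h2 : `|2^-1 : R| = 2^-1 by rewrite ger0_norm.
  rewrite (normrM (m%:R^-1 * _)) h2.
  have t1 : 0 <= beta / m%:R by rewrite divr_ge0// ltW.
  have t3 : 0 <= beta ^+ 3 by exact: exprn_ge0.
  have t2 : beta ^+ 2 / m%:R <= beta ^+ 2 / Num.sqrt m%:R.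
    rewrite ler_wpM2l// lef_pV2 ?posrE// -{2}ss expr2 ler_peMr// ltW//.
  have t20 : 0 <= beta ^+ 2 / m%:R by rewrite divr_ge0// ltW.
  have c1 : 0 <= kS * kC ^+ 2 by rewrite mulr_ge0// sqr_ge0.
  have := ler_wpM2l c1 t2.
  have T1 : beta ^+ 2 / Num.sqrt m%:R <= T by rewrite /T; lra.
  have T2 : beta ^+ 3 <= T by rewrite /T; move: t20 t2; lra.
  have KEk : 0 <= KE * k ^+ 2 by rewrite mulr_ge0// sqr_ge0.
  have := ler_wpM2l KEk T2.
  have T0 : 0 <= T by rewrite (le_trans t3 T2).
  have := ler_wpM2l c1 T1; have := mulr_ge0 kG0 T0.
  have := mulr_ge0 c1 (le_trans t20 t2).
  by move: g2; rewrite /k; move: T0; lra.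
have E21 : `|E2| <= 1.
  apply: le_trans (EE_abs EEP _ m0) _; apply: (EE_bnd EEP m0) => y _; exact: cos_max.
rewrite ex.
have -> : E1 * expR (m.+1%:R * rform S b / 2) - E2 * (expR (m.+1%:R * rform S b / 2) * expR x) =
  expR (m.+1%:R * rform S b / 2) * ((E1 - (1 - rform G b / 2) * E2) + E2 * (1 - rform G b / 2 - expR x)).
  by ring.
rewrite normrM ger0_norm ?expR_ge0//.
have -> : (K + k + KE * k ^+ 2) * B * T = B * ((K + k + KE * k ^+ 2) * T) by ring.
apply: ler_pM; rewrite ?expR_ge0//.
apply: le_trans (ler_normD _ _) _; rewrite -[X in _ <= X * _]addrA [leRHS]mulrDl; apply: lerD => //.
rewrite normrM; apply: le_trans D2; by rewrite ler_piMl.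
Qed.

End ChainCf.

(** * The backward recursion and the Gaussian limit *)

Section ChainLimit.
Variables (R : realType) (N : nat) (phi : 'rV[R]_N) (dl : 'I_N -> 'cV[R]_N).
Variables (lam : R) (p : 'cV[R]_N) (hs : seq 'rV[R]_N).
Hypothesis phi_gt0 : forall i, 0 < phi 0 i.
Hypothesis dl_sum : forall j, coord_sum (dl j) = 1.
Hypothesis lam_gt0 : 0 < lam.
Hypothesis phi_p : dotp phi p = lam.
Hypothesis mean_p : chain_mean phi dl *m p = lam *: p.
Hypothesis hs_coord : forall (x : 'cV[R]_N) i, x i 0 ^+ 2 <= qb hs x x.
Variables (u : 'rV[R]_N) (c : R) (EE : nat -> ('cV[R]_N -> R) -> R).
Hypothesis u_gt0 : forall i, 0 < u 0 i.
Hypothesis u_jump : forall j, phi 0 j * dotp u (dl j) = lam * u 0 j.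
Hypothesis c_lt : c < lam / 2.
Local Notation A' := (drift_mx phi dl p).
Hypothesis hs_drift : forall x, qb hs x (A' *m x) <= c * qb hs x x.
Hypothesis EEP : is_chain phi dl EE.

Local Notation q x := (qb hs x x).
Local Notation nq x := (Num.sqrt (qb hs x x)).
Local Notation Y := (centred p).
Local Notation C := (lam^-1 *: A').
Local Notation G := (chain_cov phi dl lam p).

Local Notation rform := (@rform R N).
Local Notation dual_le := (dual_le hs).
Variable S : 'M[R]_N.
Hypothesis SE : S = C *m S + S *m C^T + G.

(* [back b n k] is the row b_(n - k) of the backward recursion
   b_n = b, b_m = b_(m+1) (1 + C / m). *)
Fixpoint back (b : 'rV[R]_N) (n k : nat) : 'rV[R]_N :=
  if k is k'.+1 then
    back b n k' + (n - k)%:R^-1 *: (back b n k' *m C)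
  else b.

Let c1 := c / lam.

(** The rows of [back] evolve by the adjoint of y -> y + C y / m, so their dual norm is controlled
    by the growth of this map in the Lyapunov norm. *)
Lemma forward_growth : exists2 k, 0 <= k & forall m y, (0 < m)%N ->
  qb hs (y + m%:R^-1 *: (C *m y)) (y + m%:R^-1 *: (C *m y)) <=
  (1 + 2 * c1 / m%:R + k / m%:R ^+ 2) * q y.
Proof.
have [k k0 H] := mulmx_nq hs_coord C.
exists (k ^+ 2) => [|m y m0]; first exact: sqr_ge0.
rewrite qb_sqrD !(qbZl, qbZr).
have v0 : 0 <= m%:R^-1 :> R by rewrite invr_ge0.
have li0 : 0 <= lam^-1 by rewrite invr_ge0 ltW.
have D : qb hs y (C *m y) <= c1 * q y.
  rewrite -scalemxAl qbZr /c1 mulrAC [c * _ / _]mulrC; exact: ler_wpM2l.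
have E : q (C *m y) <= k ^+ 2 * q y.
  have := H y; rewrite -ler_sqr ?nnegrE ?nq_ge0 ?mulr_ge0 ?nq_ge0//.
  by rewrite exprMn !nq_sqr.
have := ler_wpM2l v0 D; have := ler_wpM2l (mulr_ge0 v0 v0) E.
rewrite -exprVn; move: (qb hs y (C *m y)) (q (C *m y)) (q y) m%:R^-1 => a1 a2 a3 v.
by lra.
Qed.

Lemma back_step b n m : (m < n)%N ->
  back b n (n - m) = back b n (n - m.+1) + m%:R^-1 *: (back b n (n - m.+1) *m C).
Proof.
by move=> mn; rewrite -(subnSK mn) /= subnSK// subKn// ltnW.
Qed.

(** Any exponent g above 2 c1 absorbs the second-order term k / m^2 from m0 on, and [powR_step]
    turns the product of the factors 1 + g / m into a power. The predecessor of m is the shift in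
    that lemma. *)
Lemma back_bound (g : R) : 2 * c1 < g -> 0 <= g -> exists2 m0, (1 < m0)%N &
  forall b ka n m, 0 <= ka -> (forall y, dotp b y ^+ 2 <= ka * q y) ->
    (m0 <= m <= n)%N -> forall y,
    dotp (back b n (n - m)) y ^+ 2 <= ka * (n%:R `^ g * m.-1%:R `^ (- g)) * q y.
Proof.
move=> cg g0; have [k k0 H] := forward_growth.
(* From this index on k / m <= g - 2 c1. *)
pose m0 := (Num.bound (k / (g - 2 * c1))).+2.
exists m0 => // b ka n m ka0 bb /andP[m0m mn].
have km l : (m0 <= l)%N -> k / l%:R <= g - 2 * c1.
  move=> ml; have l0 : 0 < l%:R :> R by rewrite ltr0n; exact: leq_trans ml.
  rewrite ler_pdivrMr// mulrC -ler_pdivrMr; last by lra.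
  have kk : 0 <= k / (g - 2 * c1) by rewrite divr_ge0//; lra.
  apply: le_trans (ltW (archi_boundP kk)) _.
  by rewrite ler_nat; apply: leq_trans ml; exact: leqW (leqW (leqnn _)).
have n1 : (1 < n)%N by apply: leq_trans mn; apply: leq_trans m0m.
move: m0m; rewrite -(subKn mn); move: (n - m)%N (leq_subr m n) => j jn.
rewrite (subKn jn).
elim: j jn => [|j IH] jn jm y.
  rewrite subn0 /=; apply: le_trans (bb y) _; rewrite ler_wpM2r ?qb_ge0// ler_peMr//.
  have n0 : 0 < n%:R :> R by rewrite ltr0n ltnW.
  have n10 : 0 < n.-1%:R :> R by rewrite ltr0n -subn1 subn_gt0.
  have E1 : n%:R `^ g * n%:R `^ (- g) = 1 :> R.
    by rewrite -powRD ?addrN ?powRr0// (gt_eqF n0) implybT.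
  rewrite -[leLHS]E1 ler_wpM2l ?powR_ge0// !powRN lef_pV2 ?posrE ?powR_gt0//.
  by rewrite ge0_ler_powR ?nnegrE ?(ltW n0) ?(ltW n10)// ler_nat leq_pred.
have jn' : (j <= n)%N by exact: ltnW.
have jm' : (m0 <= n - j)%N by apply: (leq_trans jm); rewrite leq_sub2l.
have {}IH := IH jn' jm'.
set l := (n - j.+1)%N in jm *.
have lE : (n - j = l.+1)%N by rewrite /l subnSK.
rewrite lE /= in IH.
have l1 : (1 < l)%N by apply: leq_trans jm.
have l0 : (0 < l)%N by exact: ltnW.
rewrite /= -/l dotpDl dotpZl dotp_mulmx -dotpZr -dotpDr.
apply: le_trans (IH _) _.
have kl := km l jm.
have lp : 0 < l%:R :> R by rewrite ltr0n.
have v0 : 0 <= l%:R^-1 :> R by rewrite invr_ge0 ltW.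
have Hl := H l y l0.
have G1 : qb hs (y + l%:R^-1 *: (C *m y)) (y + l%:R^-1 *: (C *m y)) <= (1 + g / l%:R) * q y.
  apply: le_trans Hl _; rewrite ler_wpM2r ?qb_ge0// -addrA lerD2l.
  have := ler_wpM2r v0 kl; rewrite -exprVn; lra.
have A0 : 0 <= ka * (n%:R `^ g * l%:R `^ (- g)) by rewrite !mulr_ge0 ?powR_ge0.
apply: le_trans (ler_wpM2l A0 G1) _.
have P := powR_step g0 l1.
have B0 : 0 <= ka * n%:R `^ g * q y by rewrite !mulr_ge0 ?powR_ge0 ?qb_ge0.
have := ler_wpM2l B0 P; move: (n%:R `^ g) (l%:R `^ (- g)) (l.-1%:R `^ (- g)) => a1 a2 a3; lra.
Qed.

Lemma powRN_cvg0 (s : R) : 0 < s -> (fun n : nat => n%:R `^ (- s) : R) @ \oo --> (0 : R).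
Proof.
move=> s0; apply/cvgrPdist_le => e e0.
pose n0 := (Num.bound (e^-1 `^ s^-1)).+1.
exists n0 => // n /= nn.
have n0' : 0 < n%:R :> R by rewrite ltr0n; apply: leq_trans nn.
rewrite sub0r normrN ger0_norm ?powR_ge0// powRN -[e]invrK lef_pV2 ?posrE ?powR_gt0 ?invr_gt0//.
have -> : e^-1 = (e^-1 `^ s^-1) `^ s :> R.
  by rewrite -powRrM mulVf ?gt_eqF// powRr1// invr_ge0 ltW.
rewrite ge0_ler_powR ?nnegrE ?powR_ge0 ?(ltW s0) ?(ltW n0')//.
have := archi_boundP (powR_ge0 (e^-1) s^-1) => /ltW h; apply: le_trans h _.
by rewrite ler_nat; apply: leq_trans nn; rewrite /n0 leqW.
Qed.

Lemma powR_sum (m0 n : nat) : (1 < m0)%N -> (m0 <= n)%N ->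
  \sum_(m0 <= m < n) m%:R `^ (- (5 / 4)) <= 4 :> R.
Proof.
(* By [powR_step] with s = 1/4, m^(-5/4) is at most 4 ((m - 1)^(-1/4) - m^(-1/4)), which
   telescopes. *)
move=> m01 mn; pose g m : R := - (4 * m.-1%:R `^ (- 4^-1)).
have H m : (m0 <= m)%N -> m%:R `^ (- (5 / 4)) <= g m.+1 - g m.
  move=> mm; have m1 : (1 < m)%N by exact: leq_trans mm.
  have mp : 0 < m%:R :> R by rewrite ltr0n ltnW.
  have q4 : 0 <= 4^-1 :> R by rewrite invr_ge0.
  have := powR_step q4 m1.
  have -> : m%:R `^ (- (5 / 4)) = m%:R `^ (- 4^-1) / m%:R :> R.
    rewrite -[X in _ = _ / X](powRr1 (ltW mp)) -powRN -powRD ?(gt_eqF mp) ?implybT//.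
    by congr (_ `^ _); lra.
  rewrite /g /=; move: (m%:R `^ (- 4^-1)) (m.-1%:R `^ (- 4^-1)) m%:R^-1 => a1 a2 a3; lra.
apply: (@le_trans _ _ (\sum_(m0 <= m < n) (g m.+1 - g m))).
  by apply: ler_sum_nat => m /andP[mm _]; exact: H.
rewrite telescope_sumr// /g.
have h1 : m0.-1%:R `^ (- 4^-1) <= 1 :> R.
  rewrite powRN invf_le1 ?powR_gt0 ?ltr0n -?subn1 ?subn_gt0//.
  by rewrite -[leLHS](powRr0 (m0 - 1)%:R) ler_powR ?invr_ge0// ler1n subn_gt0.
have h2 := powR_ge0 n.-1%:R (- 4^-1) : 0 <= _ :> R.
by lra.
Qed.

Lemma c1_lt : 2 * c1 < 1.
Proof. by rewrite /c1 mulrA ltr_pdivrMr// mul1r; move: c_lt; lra. Qed.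

(** The decay exponents are 1 + g/2, g + 1/2 and 3g/2. All are at least 5/4 once g >= 5/6, the cubic
    one being the binding constraint. *)
Lemma cf_errors (g : R) (m : nat) : 5 / 6 <= g -> (0 < m)%N ->
  let r := m%:R `^ (- (g / 2)) : R in let P := m%:R `^ (- (5 / 4)) in
  [/\ r / m%:R <= P, r ^+ 2 / Num.sqrt m%:R <= P & r ^+ 3 <= P].
Proof.
move=> g56 m0 r P; have mp : 0 < m%:R :> R by rewrite ltr0n.
have m1 : 1 <= m%:R :> R by rewrite ler1n.
have mi : (m%:R == 0 :> R) = false by rewrite gt_eqF.
split.
- rewrite /r -[X in _ / X](powRr1 (ltW mp)) -powRN -powRD ?mi ?implybT//.
  by rewrite ler_powR//; lra.
- rewrite /r -powR_mulrn ?powR_ge0// -powRrM -powR12_sqrt ?(ltW mp)// -powRN -powRD ?mi ?implybT//.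
  by rewrite ler_powR//; lra.
- rewrite /r -powR_mulrn ?powR_ge0// -powRrM.
  by rewrite ler_powR//; lra.
Qed.

Lemma EE_cos_near n b beta th : (0 < n)%N -> 0 <= beta -> dual_le b beta ->
  `|EE n (fun x => cos (th + dotp b (Y x))) - cos th| <=
  beta * (EE n (fun x => q (Y x)) + 1).
Proof.
move=> n0 beta0 bb.
rewrite -{1}(EE_cst EEP (cos th) n0) -(EEB EEP).
apply: le_trans (EE_abs EEP _ n0) _.
rewrite -[1 in leRHS](EE_cst EEP 1 n0) -(EED EEP) -(EEZ EEP).
apply: (EE_le EEP n0) => x _; apply: le_trans (cos_lip _ _) _.
rewrite addrAC subrr add0r; apply: le_trans (bb _) _; rewrite ler_wpM2l//.
have := sqr_ge0 (nq (Y x) - 1); have := nq_sqr hs (Y x).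
move: (nq (Y x)) => t; move: (q (Y x)) => s; have := sqr_ge0 t; rewrite !expr2; lra.
Qed.

Theorem chain_cf_limit (a : 'rV[R]_N) (th : R) :
  (fun n => EE n (fun x => cos (th + dotp ((Num.sqrt n%:R)^-1 *: a) (Y x)))) @ \oo -->
  cos th * expR (- (rform S a / 2)).
Proof.
(* The spectral gap, as 2 c1 < 1, leaves room for an exponent strictly between 2 c1 and 1; the value
   5/6 is the requirement of [cf_errors]. *)
pose g : R := Num.max (5 / 6) ((1 + 2 * c1) / 2).
have c11 := c1_lt.
have g56 : 5 / 6 <= g by rewrite le_max lexx.
have gc : 2 * c1 < g by rewrite lt_max; apply/orP; right; lra.
have g1 : g < 1 by rewrite gt_max; apply/andP; split; lra.
have g0 : 0 <= g by lra.
have [K K0 HK] := cf_incr phi_gt0 dl_sum lam_gt0 phi_p mean_p hs_coord u_gt0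
  u_jump c_lt hs_drift EEP SE.
have [m0 m01 Hm0] := back_bound gc g0.
have [s s0 Hs] := dotp_nq hs_coord a.
have [kS kS0 HS] := rform_dual hs S.
(* With b_n = a / sqrt n, [back_bound] gives |b_m|^2 <= s^2 n^(g - 1) (m - 1)^(- g). Here [nu n] is
   the square root of the factor n^(g - 1), which tends to 0 and makes every error vanish. *)
pose nu n : R := n%:R `^ (- ((1 - g) / 2)).
have nu0 n : 0 <= nu n := powR_ge0 _ _.
have nu_cvg : nu @ \oo --> (0 : R) by apply: powRN_cvg0; lra.
pose b n := (Num.sqrt n%:R)^-1 *: a.
pose bk n m := back (b n) n (n - m).
pose phi_ n m := EE m (fun x => cos (th + dotp (bk n m) (Y x))) * expR (m%:R * rform S (bk n m) / 2).
have bsq n (n0 : (0 < n)%N) y : dotp (b n) y ^+ 2 <= s ^+ 2 / n%:R * q y.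
  have np : 0 < n%:R :> R by rewrite ltr0n.
  have -> : dotp (b n) y ^+ 2 = dotp a y ^+ 2 * n%:R^-1.
    by rewrite /b dotpZl exprMn exprVn sqr_sqrtr ?(ltW np)// mulrC.
  rewrite [leRHS]mulrAC; apply: ler_wpM2r; first by rewrite invr_ge0 ltW.
  have := Hs y; rewrite normr_le_sqr ?mulr_ge0 ?nq_ge0//.
  by rewrite exprMn nq_sqr.
have bks n m (mn : (m0 <= m <= n)%N) y :
    dotp (bk n m) y ^+ 2 <= s ^+ 2 * nu n ^+ 2 * m.-1%:R `^ (- g) * q y.
  have n0 : (0 < n)%N.
    by case/andP: mn => h1 h2; apply: leq_trans h2; apply: leq_trans h1; exact: ltnW.
  have np : 0 < n%:R :> R by rewrite ltr0n.
  have := Hm0 (b n) (s ^+ 2 / n%:R) n m (divr_ge0 (sqr_ge0 _) (ltW np)) (bsq n n0) mn y.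
  congr (_ <= _); rewrite -/(bk n m); congr (_ * _).
  have -> : nu n ^+ 2 = n%:R `^ g / n%:R.
    rewrite /nu -powR_mulrn ?powR_ge0// -powRrM -[X in _ = _ / X](powRr1 (ltW np)) -powRN -powRD.
      by congr (_ `^ _); lra.
    by rewrite (gt_eqF np) implybT.
  by ring.
have dual_of_sq (b' : 'rV[R]_N) be : 0 <= be ->
    (forall y, dotp b' y ^+ 2 <= be ^+ 2 * q y) -> dual_le b' be.
  by move=> be0 H y; rewrite normr_le_sqr ?mulr_ge0 ?nq_ge0// exprMn nq_sqr.
pose be n m := s * nu n * m%:R `^ (- (g / 2)).
have be0 n m : 0 <= be n m by rewrite !mulr_ge0 ?powR_ge0.
have beE n m : be n m ^+ 2 = s ^+ 2 * nu n ^+ 2 * m%:R `^ (- g).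
  rewrite /be !exprMn; congr (_ * _); rewrite -powR_mulrn ?powR_ge0// -powRrM.
  by congr (_ `^ _); lra.
have bed n m (mn : (m0 <= m < n)%N) : dual_le (bk n m.+1) (be n m).
  apply: dual_of_sq => // y; rewrite beE; apply: bks.
  by case/andP: mn => h1 ->; rewrite leqW.
have b0d n (mn : (m0 <= n)%N) : dual_le (bk n m0) (s * nu n).
  apply: dual_of_sq => [|y]; first by rewrite mulr_ge0.
  have := bks n m0 _ y; rewrite leqnn mn => /(_ isT) h; apply: le_trans h _.
  rewrite ler_wpM2r ?qb_ge0// exprMn ler_piMr ?mulr_ge0 ?sqr_ge0//.
  rewrite powRN invf_le1 ?powR_gt0 ?ltr0n -?subn1 ?subn_gt0//.
  by rewrite -[leLHS](powRr0 (m0 - 1)%:R) ler_powR// ler1n subn_gt0.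
(* Since m (be n m)^2 <= s^2 (m / n)^(1 - g) <= s^2, the exponents in [cf_incr] are bounded
   uniformly in m < n. *)
pose B := expR (kS * s ^+ 2).
pose s' := s + s ^+ 2 + s ^+ 3.
have s'0 : 0 <= s' by rewrite !addr_ge0// exprn_ge0.
have nu1 n : (0 < n)%N -> nu n <= 1.
  move=> n0; rewrite -[leRHS](powRr0 (n%:R : R)) ler_powR ?ler1n//; lra.
have step n m : (m0 <= m < n)%N -> s * nu n <= 1 ->
    `|phi_ n m.+1 - phi_ n m| <= K * B * (s' * nu n * m%:R `^ (- (5 / 4))).
  move=> mn snu; case/andP: (mn) => m0m mltn.
  have m1 : (1 < m)%N by exact: leq_trans m0m.
  have mpos : (0 < m)%N by exact: ltnW.
  have mp : 0 < m%:R :> R by rewrite ltr0n.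
  have n0 : (0 < n)%N by exact: leq_ltn_trans mltn.
  have np : 0 < n%:R :> R by rewrite ltr0n.
  have r1 : m%:R `^ (- (g / 2)) <= 1 :> R.
    rewrite -[leRHS](powRr0 (m%:R : R)) ler_powR ?ler1n//; lra.
  have be1 : be n m <= 1.
    by rewrite /be; apply: le_trans snu; rewrite ler_piMr// mulr_ge0.
  have eB : expR (m.+1%:R * rform S (bk n m.+1) / 2) <= B.
    rewrite ler_expR.
    have h1 := HS _ _ (be0 n m) (bed n m mn).
    have h2 : m.+1%:R / 2 <= m%:R :> R.
      have m1r : 1 <= m%:R :> R by rewrite ler1n.
      by rewrite -natr1; lra.
    have h3 : m%:R * be n m ^+ 2 <= s ^+ 2.
      rewrite beE mulrCA -mulrA ler_piMr ?sqr_ge0//.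
      have -> : nu n ^+ 2 * (m%:R * m%:R `^ (- g)) = (m%:R / n%:R) `^ (1 - g).
        rewrite powRM ?invr_ge0 ?(ltW mp) ?(ltW np)// mulrC; congr (_ * _).
          by rewrite -[X in X * _](powRr1 (ltW mp)) -powRD// (gt_eqF mp) implybT.
        rewrite -powR_inv1 ?(ltW np)// -powRrM /nu -powR_mulrn ?powR_ge0// -powRrM.
        by congr (_ `^ _); lra.
      have E1 : 1 `^ (1 - g) = 1 by rewrite powR1.
      rewrite -[leRHS]E1 ge0_ler_powR ?nnegrE ?divr_ge0 ?(ltW mp) ?(ltW np)//.
        by lra.
      by rewrite ler_pdivrMr// mul1r ler_nat ltnW.
    have := le_trans (ler_norm _) h1; move: (rform _ _) => rf h4.
    have h5 : m.+1%:R / 2 * rf <= m.+1%:R / 2 * (kS * be n m ^+ 2).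
      by rewrite ler_wpM2l// divr_ge0.
    have h6 : m.+1%:R / 2 * (kS * be n m ^+ 2) <= m%:R * (kS * be n m ^+ 2).
      by rewrite ler_wpM2r// mulr_ge0// sqr_ge0.
    have := ler_wpM2l kS0 h3; lra.
  have := HK m (bk n m.+1) (be n m) th B mpos (be0 n m) be1 (bed n m mn) eB.
  rewrite /= -[X in EE m (fun x => cos (th + dotp X (Y x)))](back_step (b n) mltn).
  rewrite -(back_step (b n) mltn) -/(bk n m) -/(phi_ n m) -/(phi_ n m.+1) => H.
  apply: le_trans H _; apply: ler_wpM2l; first by rewrite mulr_ge0// expR_ge0.
  have [e1 e2 e3] := cf_errors g56 mpos.
  have nu1' := nu1 n n0.
  have nu2 : nu n ^+ 2 <= nu n by rewrite expr2 ler_piMr.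
  have nu3 : nu n ^+ 3 <= nu n.
    by rewrite exprS ler_piMr// expr_le1.
  set P := m%:R `^ (- (5 / 4)) in e1 e2 e3 *; set r := m%:R `^ (- (g / 2)) in e1 e2 e3 *.
  have P0 : 0 <= P by exact: powR_ge0.
  have r0 : 0 <= r by exact: powR_ge0.
  have -> : be n m = s * nu n * r by [].
  have q1 : s * nu n * r / m%:R <= s * (nu n * P).
    by rewrite -!mulrA !ler_wpM2l.
  have q2 : (s * nu n * r) ^+ 2 / Num.sqrt m%:R <= s ^+ 2 * (nu n * P).
    have -> : (s * nu n * r) ^+ 2 / Num.sqrt m%:R = s ^+ 2 * (nu n ^+ 2 * (r ^+ 2 / Num.sqrt m%:R)).
      by ring.
    apply: ler_wpM2l; first exact: sqr_ge0.
    apply: ler_pM => //; first exact: sqr_ge0.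
    by apply: divr_ge0; [exact: sqr_ge0|exact: sqrtr_ge0].
  have q3 : (s * nu n * r) ^+ 3 <= s ^+ 3 * (nu n * P).
    have -> : (s * nu n * r) ^+ 3 = s ^+ 3 * (nu n ^+ 3 * r ^+ 3) by ring.
    apply: ler_wpM2l; first exact: exprn_ge0.
    by apply: ler_pM => //; exact: exprn_ge0.
  have -> : s' * nu n * P = s * (nu n * P) + s ^+ 2 * (nu n * P) + s ^+ 3 * (nu n * P).
    by rewrite /s'; ring.
  exact: lerD (lerD q1 q2) q3.
(* At the fixed starting time m0 the row b_(m0) tends to 0 with n, so the initial state is
   forgotten: the cosine tends to cos th and the compensating factor to 1. *)
have cs : (fun n => EE m0 (fun x => cos (th + dotp (bk n m0) (Y x)))) @ \oo --> cos th.
  apply: (@cvg_le_dist0 _ _ (fun n => s * (EE m0 (fun x => q (Y x)) + 1) * nu n)).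
    exists m0 => // n /= mn; have m0p : (0 < m0)%N by exact: ltnW.
    have snu : 0 <= s * nu n by rewrite mulr_ge0.
    have := EE_cos_near th m0p snu (b0d n mn); lra.
  rewrite -(mulr0 (s * (EE m0 (fun x => q (Y x)) + 1))).
  by apply: cvgM => //; exact: cvg_cst.
have es : (fun n => expR (m0%:R * rform S (bk n m0) / 2)) @ \oo --> (1 : R).
  suff : (fun n => expR (m0%:R * rform S (bk n m0) / 2)) @ \oo --> (expR 0 : R).
    by rewrite expR0.
  apply: continuous_cvg; first exact: continuous_expR.
  apply: (@cvg_le_dist0 _ _ (fun n => m0%:R * kS * s ^+ 2 / 2 * (nu n * nu n))).
    exists m0 => // n /= mn; rewrite subr0.
    have snu : 0 <= s * nu n by rewrite mulr_ge0.
    have := HS _ _ snu (b0d n mn); rewrite -mulrA normrM ger0_norm//.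
    rewrite (normrM (rform _ _)) (_ : `|2^-1 : R| = 2^-1); last by rewrite ger0_norm.
    have m00 : 0 <= m0%:R / 2 :> R by rewrite divr_ge0.
    move=> /(ler_wpM2l m00); rewrite exprMn expr2; lra.
  rewrite -(mulr0 (m0%:R * kS * s ^+ 2 / 2)); apply: cvgM; first exact: cvg_cst.
  by rewrite -(mulr0 (0 : R)); exact: cvgM.
have ps : (fun n => phi_ n m0) @ \oo --> cos th.
  by rewrite -[cos th]mulr1; exact: cvgM.
have nus : (fun n => s * nu n) @ \oo --> (0 : R).
  by rewrite -(mulr0 s); apply: cvgM => //; exact: cvg_cst.
have ds : (fun n => phi_ n n - phi_ n m0) @ \oo --> (0 : R).
  apply: (@cvg_le_dist0 _ _ (fun n => K * B * s' * 4 * nu n)); last first.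
    by rewrite -(mulr0 (K * B * s' * 4)); apply: cvgM => //; exact: cvg_cst.
  have : \forall n \near \oo, s * nu n <= 1.
    have /cvgrPdist_le/(_ 1 ltr01) := nus; apply: filterS => n.
    by rewrite sub0r normrN ger0_norm// mulr_ge0.
  move=> [n1 _ Hn1]; exists (maxn n1 m0) => // n /=; rewrite geq_max => /andP[n1n m0n].
  have snu := Hn1 n n1n; rewrite subr0 -(telescope_sumr (phi_ n))//.
  apply: le_trans (ler_norm_sum _ _ _) _.
  apply: (@le_trans _ _ (\sum_(m0 <= m < n) K * B * (s' * nu n * m%:R `^ (- (5 / 4))))).
    by apply: ler_sum_nat => m mn; exact: step.
  under eq_bigr do rewrite !mulrA.
  rewrite -big_distrr/=; have := powR_sum m01 m0n => h.
  have c0 : 0 <= K * B * s' * nu n by rewrite !mulr_ge0// expR_ge0.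
  have := ler_wpM2l c0 h; lra.
have us : (fun n => phi_ n n) @ \oo --> cos th.
  suff -> : (fun n => phi_ n n) = (fun n => (phi_ n n - phi_ n m0) + phi_ n m0).
    by rewrite -[cos th]add0r; exact: cvgD.
  by apply/funext => n; rewrite subrK.
have E n : (0 < n)%N -> EE n (fun x => cos (th + dotp (b n) (Y x))) =
    phi_ n n * expR (- (rform S a / 2)).
  move=> n0; rewrite /phi_ /bk subnn /= -mulrA -expRD.
  have -> : n%:R * rform S (b n) / 2 + - (rform S a / 2) = 0.
    have np : 0 < n%:R :> R by rewrite ltr0n.
    have -> : rform S (b n) = n%:R^-1 * rform S a.
      rewrite /rform /b dotpZl linearZ/= -scalemxAr dotpZr mulrA -invfM -expr2.
      by rewrite sqr_sqrtr// ltW.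
    by field; rewrite gt_eqF.
  by rewrite expR0 mulr1.
have : (fun n => phi_ n n * expR (- (rform S a / 2))) @ \oo --> cos th * expR (- (rform S a / 2)).
  by apply: cvgM => //; exact: cvg_cst.
move=> H; apply: cvg_trans H; apply: near_eq_cvg; exists 1%N => // n /= n0.
by rewrite E.
Qed.

End ChainLimit.

(** * Normal laws *)

Section LebesgueAffine.
Variable R : realType.
Local Notation leb := (@lebesgue_measure R).

Definition affine (s b : R) (z : R) : R := s * z + b.

Lemma measurable_affine (s b : R) : measurable_fun [set: R] (affine s b).
Proof. by apply: measurable_funD => //; exact: measurable_funM. Qed.

HB.instance Definition _ (s b : R) :=
  isMeasurableFun.Build _ _ _ _ (affine s b) (measurable_affine s b).

Lemma affine_image (s b : R) : {mu : {measure set (measurableTypeR R) -> \bar R} |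
  mu = pushforward leb (affine s b) :> (set _ -> \bar R)}.
Proof.
unshelve eexists.
  unshelve refine (pushforward (T2 := measurableTypeR R) leb (affine s b) : {measure set (measurableTypeR R) -> \bar R}).
  exact: measurable_affine.
by [].
Qed.

(** By uniqueness it is enough to compare on the intervals ]x, y]; for s < 0 the preimage has its
    endpoints exchanged and is closed on the left, with the same length as before. *)
Lemma lebesgue_affine_set (s b : R) (A : set R) : s != 0 -> measurable A ->
  (leb A = `|s|%:E * leb (affine s b @^-1` A))%E.
Proof.
move=> s0 mA.
have sn : 0 < `|s| by rewrite normr_gt0.
pose phi := affine s b.
pose k : {nonneg R} := NngNum (normr_ge0 s).
have [pf pfE] := affine_image s b.
pose mu : {measure set (measurableTypeR R) -> \bar R} := mscale k pf.
have muE B : mu B = (`|s|%:E * leb (phi @^-1` B))%E by rewrite /mu /= /mscale/= pfE.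
rewrite -muE; apply: (@lebesgue_measure_unique R mu) mA.
move=> _ [[x y] _ <-] /=; rewrite muE.
have [s1|s1] := ltP 0 s.
  have -> : phi @^-1` `]x, y]%classic = `](x - b) / s, (y - b) / s]%classic.
    apply/seteqP; split => z /=; rewrite !in_itv/= => /andP[h1 h2]; apply/andP; split.
    - by rewrite ltr_pdivrMr// ltrBlDr mulrC.
    - by rewrite ler_pdivlMr// lerBrDr mulrC.
    - by rewrite -ltrBlDr mulrC -ltr_pdivrMr.
    - by rewrite -lerBrDr mulrC -ler_pdivlMr.
  rewrite !lebesgue_measure_itv/= !lte_fin ltr_pM2r ?invr_gt0// ltrD2r.
  case: ifP => _; last by rewrite mule0.
  rewrite -!EFinB -EFinM gtr0_norm//; congr EFin; field; by rewrite gt_eqF.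
have {}s1 : s < 0 by rewrite lt_neqAle s0.
have -> : phi @^-1` `]x, y]%classic = `[(y - b) / s, (x - b) / s[%classic.
  apply/seteqP; split => z /=; rewrite !in_itv/= => /andP[h1 h2]; apply/andP; split.
  - by rewrite ler_ndivrMr// lerBrDr mulrC.
  - by rewrite ltr_ndivlMr// ltrBlDr mulrC.
  - by rewrite -ltrBlDr mulrC -ltr_ndivlMr.
  - by rewrite -lerBrDr mulrC -ler_ndivrMr.
rewrite !lebesgue_measure_itv/= !lte_fin ltr_nM2r ?invr_lt0// ltrD2r.
case: ifP => _; last by rewrite mule0.
rewrite -!EFinB -EFinM ltr0_norm//; congr EFin; field; by rewrite lt_eqF.
Qed.

Lemma integral_affine (s b : R) (f : R -> \bar R) : s != 0 ->
  measurable_fun [set: R] f -> (forall x, 0 <= f x)%E ->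
  (\int[leb]_y f y = `|s|%:E * \int[leb]_z f (s * z + b)%R)%E.
Proof.
move=> s0 mf f0.
pose k : {nonneg R} := NngNum (normr_ge0 s).
have [pf pfE] := affine_image s b.
pose m2 : {measure set (measurableTypeR R) -> \bar R} := mscale k pf.
transitivity (\int[m2]_y f y)%E.
  apply: eq_measure_integral => A mA _; rewrite /m2 /= /mscale/= pfE.
  exact: lebesgue_affine_set.
rewrite /m2 ge0_integral_mscale//; congr (_ * _)%E.
by rewrite pfE ge0_integral_pushforward//; exact: measurable_affine.
Qed.

End LebesgueAffine.

Section NormalLaw.
Variable R : realType.
Local Notation leb := (@lebesgue_measure R).
Implicit Types (m s t x y : R).

Lemma integral_normal_prob m s (f : R -> \bar R) :
  measurable_fun [set: R] f -> (forall x, 0 <= f x)%E ->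
  (\int[normal_prob m s]_x f x < +oo)%E ->
  (\int[normal_prob m s]_x f x = \int[leb]_x (f x * (normal_pdf m s x)%:E))%E.
Proof.
move=> mf f0 finf.
rewrite -(Radon_Nikodym_change_of_variables (normal_prob_dominates m s))//=; last first.
  apply/integrableP; split => //.
  by under eq_integral do rewrite gee0_abs//.
apply: ae_eq_integral => //.
- apply: emeasurable_funM => //; apply: (measurable_int leb).
  by apply: Radon_Nikodym_integrable; exact: normal_prob_dominates.
- apply: emeasurable_funM => //=; apply/measurableT_comp => //=.
  exact: measurable_normal_pdf.
- apply: ae_eqe_mul2l => /=.
  rewrite Radon_NikodymE//=; first exact: normal_prob_dominates.
  move=> abmu.
  case: cid => /= h [h1 h2 h3].
  apply: integral_ae_eq => //=.
  + by apply/measurableT_comp =>//; exact: measurable_normal_pdf.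
  + by move=> E E01 mE; rewrite -h3.
Qed.

Lemma normal_pdf_scale x s z : s != 0 ->
  `|s| * normal_pdf x `|s| (s * z + x) = normal_pdf 0 1 z.
Proof.
move=> s0; have sn : `|s| != 0 by rewrite normr_eq0.
rewrite !normal_pdfE ?oner_neq0// /normal_peak /normal_fun mulrA.
have -> : Num.sqrt (`|s| ^+ 2 * pi *+ 2) = `|s| * Num.sqrt (1 ^+ 2 * pi *+ 2).
  rewrite -mulrnAr sqrtrM ?sqr_ge0// sqrtr_sqr normr_id.
  by rewrite expr1n mul1r.
rewrite invfM mulrA mulfV// mul1r; congr (_ * expR _).
rewrite addrK subr0 real_normK ?num_real// expr1n; field.
exact: s0.
Qed.

(** Bayes' formula for Gaussian densities, by completing the square: prior of x times likelihood of
    y equals the marginal of y times the posterior of x. *)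
Lemma normal_pdf_conv s t y x : 0 < s -> 0 < t ->
  let r := Num.sqrt (s ^+ 2 + t ^+ 2) in
  normal_pdf 0 s x * normal_pdf x t y =
  normal_pdf 0 r y * normal_pdf (s ^+ 2 / r ^+ 2 * y) (s * t / r) x.
Proof.
move=> s0 t0 r.
have r2 : r ^+ 2 = s ^+ 2 + t ^+ 2 by rewrite sqr_sqrtr// addr_ge0 ?sqr_ge0.
have r0 : 0 < r by rewrite sqrtr_gt0 addr_gt0 ?exprn_gt0.
have st0 : 0 < s * t / r by rewrite divr_gt0 ?mulr_gt0.
rewrite !normal_pdfE ?gt_eqF// /normal_peak /normal_fun.
have P q : 0 < q -> Num.sqrt (q ^+ 2 * pi *+ 2) = q * Num.sqrt (pi *+ 2 : R).
  by move=> q0; rewrite -mulrnAr sqrtrM ?sqr_ge0// sqrtr_sqr gtr0_norm.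
rewrite !P//; set c := Num.sqrt _.
have c0 : c != 0 by rewrite gt_eqF// sqrtr_gt0 mulrn_wgt0// pi_gt0.
rewrite mulrACA -expRD [RHS]mulrACA -expRD; congr (_ * expR _).
  by field; rewrite c0 !gt_eqF.
rewrite r2; have q0 : s ^+ 2 + t ^+ 2 != 0 by rewrite -r2 gt_eqF// exprn_gt0.
have -> : (s * t / r) ^+ 2 = s ^+ 2 * t ^+ 2 / (s ^+ 2 + t ^+ 2) by rewrite !exprMn exprVn r2.
field; rewrite q0 !gt_eqF//.
Qed.

Lemma measurable_normal_pdfE m s : measurable_fun [set: R] (fun y : R => (normal_pdf m s y)%:E).
Proof. by apply/measurable_EFinP; exact: measurable_normal_pdf. Qed.

Lemma normal_pdf_restr_ge0 m s (A : set R) y :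
  (0 <= ((fun y : R => (normal_pdf m s y)%:E) \_ A) y)%E.
Proof. by rewrite /patch; case: ifP => // _; rewrite lee_fin normal_pdf_ge0. Qed.

Lemma measurable_normal_pdf_restr m s (A : set R) : measurable A ->
  measurable_fun [set: R] ((fun y : R => (normal_pdf m s y)%:E) \_ A).
Proof.
move=> mA; apply/(measurable_restrictT _ mA)/measurable_funTS.
exact: measurable_normal_pdfE.
Qed.

Lemma normal_probE m s (A : set R) : measurable A ->
  normal_prob m s A = (\int[leb]_y ((fun y : R => (normal_pdf m s y)%:E) \_ A) y)%E.
Proof. by move=> mA; rewrite /normal_prob integral_mkcond. Qed.

Lemma measurable_affine_set x s (A : set R) : measurable A ->
  measurable [set z : R | A (x + s * z)].
Proof.
move=> mA; have := measurable_affine s x measurableT mA; rewrite setTI.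
by congr measurable; apply/seteqP; split => z /=; rewrite /affine addrC.
Qed.

Lemma normal_affine x s (A : set R) : s != 0 -> measurable A ->
  normal_prob 0 1 [set z | A (x + s * z)] = normal_prob x `|s| A.
Proof.
move=> s0 mA; rewrite (normal_probE _ _ (measurable_affine_set x s mA)) (normal_probE _ _ mA).
rewrite [RHS](@integral_affine R s x)//; last 2 first.
- exact: measurable_normal_pdf_restr.
- exact: normal_pdf_restr_ge0.
rewrite -ge0_integralZl//=; last 2 first.
- have ma := measurable_affine s x.
  have := measurableT_comp (measurable_normal_pdf_restr x `|s| mA) ma.
  exact.
- by move=> y _; exact: normal_pdf_restr_ge0.
apply: eq_integral => z _; rewrite /patch.
have -> : (z \in [set z | A (x + s * z)]) = (s * z + x \in A).
  by apply/idP/idP; rewrite !inE /= addrC.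
case: ifP => _; last by rewrite mule0.
by rewrite -EFinM normal_pdf_scale.
Qed.

Lemma measurable_normal_prob s (A : set R) : s != 0 -> measurable A ->
  measurable_fun [set: R] (fun x : R => normal_prob x `|s| A).
Proof.
move=> s0 mA.
pose B := [set z : R * R | A (z.1 + s * z.2)].
have mB : measurable B.
  have mf : measurable_fun [set: R * R] (fun z : R * R => z.1 + s * z.2).
    by apply: measurable_funD => //; exact: measurable_funM.
  by have := mf measurableT A mA; rewrite setTI.
have := @measurable_fun_xsection _ _ _ _ R (normal_prob 0 1) B mB.
apply: eq_measurable_fun => x _ /=.
rewrite -normal_affine//; congr normal_prob.
by apply/seteqP; split => z; rewrite /B /xsection /= inE.
Qed.

(** After exchanging the integrals, the posterior factor of [normal_pdf_conv] integrates to one and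
    the marginal density of y remains. *)
Lemma normal_conv s t (A : set R) : 0 < s -> 0 < t -> measurable A ->
  (\int[normal_prob 0 s]_x normal_prob x t A = normal_prob 0 (Num.sqrt (s ^+ 2 + t ^+ 2)) A)%E.
Proof.
move=> s0 t0 mA; set r := Num.sqrt _.
have r0 : 0 < r by rewrite sqrtr_gt0 addr_gt0 ?exprn_gt0.
have mpdf m q : measurable_fun [set: R] (fun y : R => (normal_pdf m q y)%:E).
  exact: measurable_normal_pdfE.
have mprob : measurable_fun [set: R] (fun x : R => normal_prob x t A).
  by rewrite -(gtr0_norm t0); apply: measurable_normal_prob => //; rewrite gt_eqF.
have m2 : measurable_fun [set: R * R] (fun z : R * R => (normal_pdf z.1 t z.2)%:E).
  apply/measurable_EFinP; rewrite (_ : (fun z : R * R => _) = fun z : R * R => normal_pdf 0 t (z.2 - z.1)).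
    apply: measurableT_comp; first exact: measurable_normal_pdf.
    exact: measurable_funB.
  by apply/funext => z; rewrite !normal_pdfE ?gt_eqF// /normal_fun subr0.
pose F (z : R * R) := ((normal_pdf 0 s z.1)%:E * ((fun y => (normal_pdf z.1 t y)%:E) \_ A) z.2)%E.
have F0 z : (0 <= F z)%E.
  by rewrite /F mule_ge0 ?lee_fin ?normal_pdf_ge0//; exact: normal_pdf_restr_ge0.
have mF : measurable_fun [set: R * R] F.
  apply: emeasurable_funM.
    exact: (measurableT_comp (mpdf 0 s) measurable_fst).
  rewrite (_ : (fun z : R * R => _) = (fun z => (normal_pdf z.1 t z.2)%:E) \_ (setT `*` A)).
    have mX : measurable ([set: R] `*` A) by exact: measurableX.
    apply: (iffLR (measurable_restrictT _ mX)); exact: measurable_funTS.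
  by apply/funext => z; rewrite /patch in_setX in_setT.
rewrite (@integral_normal_prob _ _ (fun x : R => normal_prob x t A))//; last first.
  apply: (@le_lt_trans _ _ (\int[normal_prob 0 s]_x (cst 1 x))%E); last first.
    rewrite integral_cst// mul1e.
    exact: le_lt_trans (probability_le1 (normal_prob 0 s) measurableT) (ltry _).
  apply: ge0_le_integral => //.
  by move=> x _; exact: probability_le1.
transitivity (\int[leb]_x \int[leb]_y F (x, y))%E.
  apply: eq_integral => x _; rewrite (normal_probE _ _ mA) muleC.
  rewrite -ge0_integralZl//.
  - exact: measurable_normal_pdf_restr.
  - by move=> y _; exact: normal_pdf_restr_ge0.
  - by rewrite lee_fin normal_pdf_ge0.
transitivity (\int[leb]_y \int[leb]_x F (x, y))%E.
  have H := @fubini_tonelli _ _ _ _ R leb leb F mF F0.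
  exact: H.
rewrite (normal_probE _ _ mA); apply: eq_integral => y _.
rewrite /F /= /patch; case: ifP => _; last first.
  by under eq_integral do rewrite mule0; rewrite integral0.
under eq_integral do rewrite -EFinM (normal_pdf_conv _ _ s0 t0) -/r EFinM.
rewrite ge0_integralZl//; last 2 first.
- by move=> x _; rewrite lee_fin normal_pdf_ge0.
- by rewrite lee_fin normal_pdf_ge0.
  by rewrite integral_normal_pdf mule1.
exact: mpdf.
Qed.

End NormalLaw.

(** * Measurability of vector-valued maps *)

Section BorelVectors.
Variables (R : realType) (m : nat).

Lemma continuous_borel_cV (g : 'cV[R]_m -> R) : continuous g ->
  measurable_fun [set: borel_cV R m] g.
Proof.
move=> cg; apply: (measurability _ (RGenOpens.measurableE R)).
move=> _ [_ [a [b ->] <-]]; rewrite setTI; apply: sub_sigma_algebra.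
by move/continuousP: cg; apply; exact: interval_open.
Qed.

(** The sigma-algebra is generated by open sets, not by cylinders. An open set is the union of the
    countably many rational boxes it contains, and these are described by coordinates. *)
Lemma measurable_borel_cV d (T : measurableType d) (phi : T -> borel_cV R m) :
  (forall i, measurable_fun [set: T] (fun t => (phi t : 'cV[R]_m) i 0)) ->
  measurable_fun [set: T] phi.
Proof.
move=> mphi; apply: (@measurability _ _ T (borel_cV R m) setT phi (@open 'cV[R]_m) erefl) => _ [U oU <-]; rewrite setTI.
pose box (ck : 'cV[rat]_m * nat) : set 'cV[R]_m :=
  [set x | forall i, `|x i 0 - ratr (ck.1 i 0)| < ck.2.+1%:R^-1].
pose F ck : set T := if `[< box ck `<=` U >] then phi @^-1` (box ck) else set0.
have -> : phi @^-1` U = \bigcup_ck F ck.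
  apply/seteqP; split => t; last first.
    by move=> [ck _]; rewrite /F; case: asboolP => // bU /bU.
  rewrite /= => Ut; have /nbhs_ballP[e /= e0 eU] : nbhs (phi t : 'cV[R]_m) U.
    by apply: open_nbhs_nbhs.
  have [k ke] : exists k : nat, k.+1%:R^-1 < e / 2.
    exists (Num.truncn (e / 2)^-1); rewrite invf_plt ?posrE ?divr_gt0//.
    by rewrite truncnS_gt.
  have k0 : 0 < k.+1%:R^-1 :> R by rewrite invr_gt0.
  have /choice[q qP] : forall i : 'I_m, exists q : rat, `|(phi t : 'cV[R]_m) i 0 - ratr q| < k.+1%:R^-1.
    move=> i; have [|q] := @rat_in_itvoo R ((phi t : 'cV[R]_m) i 0) ((phi t : 'cV[R]_m) i 0 + k.+1%:R^-1).
      by rewrite ltrDl.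
    rewrite in_itv /= => /andP[h1 h2]; exists q; rewrite distrC gtr0_norm ?subr_gt0//.
    by rewrite ltrBlDl.
  exists (\col_i q i, k) => //; rewrite /F.
  case: asboolP => [_|]; first by move=> i; rewrite /box /= mxE; exact: qP.
  case=> x xb; apply: eU; split => // i j; rewrite (ord1 j).
  have := xb i; rewrite /= mxE => h1; have h2 := qP i.
  rewrite /ball /=; have -> : (phi t : 'cV[R]_m) i 0 - x i 0 = ((phi t : 'cV[R]_m) i 0 - ratr (q i)) - (x i 0 - ratr (q i)).
    ring.
  apply: le_lt_trans (ler_normB _ _) _; rewrite [ltRHS]splitr.
  by rewrite ltrD// ?(lt_trans h1 ke) ?(lt_trans h2 ke).
apply: countable_bigcupT_measurable => // ck.
rewrite /F; case: ifP => // _.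
have -> : phi @^-1` box ck = ~` \bigcup_(i : 'I_m) ~` [set t | `|(phi t : 'cV[R]_m) i 0 - ratr (ck.1 i 0)| < ck.2.+1%:R^-1].
  rewrite setC_bigcup; apply/seteqP; split => t /= h i; last by move: (h i Logic.I); rewrite setCK.
  by move=> _; rewrite setCK; exact: h.
apply: measurableC; apply: countable_bigcupT_measurable => // i; apply: measurableC.
have mf : measurable_fun [set: T] (fun t => `|(phi t : 'cV[R]_m) i 0 - ratr (ck.1 i 0)|).
  by apply: measurableT_comp => //; exact: measurable_funB.
have mc : measurable_fun [set: T] (fun t : T => ck.2.+1%:R^-1 : R) by exact: measurable_cst.
have := measurable_fun_ltr mf mc.
by move=> /(_ measurableT [set true] Logic.I); rewrite setTI; congr measurable.
Qed.

End BorelVectors.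

(** * Multivariate normal laws by rank-one additions *)

Section NormalVector.
Variables (R : realType) (m : nat).
Implicit Types (S : 'M[R]_m) (u l : 'cV[R]_m).

Lemma normal_law0 : exists mu : probability (borel_cV R m) R, is_normal_law 0 mu.
Proof.
exists (dirac (0 : borel_cV R m)); split.
- by rewrite trmx0.
- by move=> u; rewrite /qform mulmx0 mul0mx mxE.
- move=> u A mA; rewrite /qform mulmx0 mul0mx mxE /centered_normal eqxx.
  rewrite !diracE; congr ((nat_of_bool _)%:R%:E).
  by apply/idP/idP; rewrite !inE /= mulmx0 mxE.
Qed.

Lemma linear_form_continuous u : continuous (fun x : 'cV[R]_m => (u^T *m x) 0 0).
Proof.
have -> : (fun x : 'cV[R]_m => (u^T *m x) 0 0) = \sum_(i < m) (fun x : 'cV[R]_m => u i 0 * x i 0).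
  by apply/funext => x; rewrite fct_sumE mxE; apply: eq_bigr => i _; rewrite mxE.
apply: (@big_ind _ (fun g : 'cV[R]_m -> R => continuous g)).
- exact: (@cst_continuous _ _ 0).
- by move=> f g cf cg x; exact: (cvgD (cf x) (cg x)).
- move=> i _ x.
  have h1 := @cst_continuous 'cV[R]_m R (u i 0) x.
  exact: (cvgM h1 (@coord_continuous R m 1 i 0 x)).
Qed.

Lemma qform_rank1 S l u : qform (S + l *m l^T) u = qform S u + ((u^T *m l) 0 0) ^+ 2.
Proof.
rewrite /qform mulmxDr mulmxDl mxE; congr (_ + _).
rewrite mulmxA -mulmxA mxE big_ord1 expr2; congr (_ * _).
by rewrite !mxE; apply: eq_bigr => i _; rewrite !mxE mulrC.
Qed.

(** Law of sqrt q Z + s Z' with independent standard Z, Z'. The cases q = 0 and s = 0 are separate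
    because the degenerate law is not an instance of [normal_prob]. *)
Lemma centered_normal_shift (q s : R) (A : set R) : 0 <= q -> measurable A ->
  centered_normal (q + s ^+ 2) A =
  if q == 0 then normal_prob 0 1 [set z | A (s * z)]
  else (\int[normal_prob 0 (Num.sqrt q)]_y normal_prob 0 1 [set z : R | A (y + s * z)%R])%E.
Proof.
move=> q0 mA; rewrite /centered_normal.
have [->|sn0] := eqVneq s 0.
  rewrite expr0n addr0; have [_|qn0] := eqVneq q 0.
    rewrite diracE; case: (pselect (A 0)) => A0.
      rewrite mem_set// (_ : [set z | _] = setT) ?probability_setT//.
      by apply/seteqP; split => z //=; rewrite mul0r.
    rewrite memNset// (_ : [set z | _] = set0) ?measure0//.
    by apply/seteqP; split => z //=; rewrite mul0r.
  transitivity (\int[normal_prob 0 (Num.sqrt q)]_y (\1_A y)%:E)%E.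
    by rewrite integral_indic// setIT.
  apply: eq_integral => y _; rewrite indicE; case: (pselect (A y)) => Ay.
    rewrite mem_set// (_ : [set z | _] = setT) ?probability_setT//.
    by apply/seteqP; split => z //=; rewrite mul0r addr0.
  rewrite memNset// (_ : [set z | _] = set0) ?measure0//.
  by apply/seteqP; split => z //=; rewrite mul0r addr0.
have s2 : 0 < s ^+ 2 by rewrite exprn_even_gt0.
rewrite gt_eqF ?ltr_wpDl//; have [->|qn0] := eqVneq q 0.
  rewrite add0r sqrtr_sqr -(normal_affine 0 sn0 mA); congr normal_prob.
  by apply/seteqP; split => z /=; rewrite add0r.
have qp : 0 < q by rewrite lt_neqAle eq_sym qn0.
have sq0 : 0 < Num.sqrt q by rewrite sqrtr_gt0.
have ns0 : 0 < `|s| by rewrite normr_gt0.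
have -> : q + s ^+ 2 = Num.sqrt q ^+ 2 + `|s| ^+ 2.
  by rewrite (sqr_sqrtr q0) (real_normK (num_real s)).
apply: (eq_trans (esym (normal_conv sq0 ns0 mA))).
by apply: eq_integral => y _; rewrite (normal_affine y sn0 mA).
Qed.

(** The law of X + Z l, with X of law mu and Z an independent standard normal variable, realised on
    the product space. *)
Lemma normal_law_add S l (mu : probability (borel_cV R m) R) : is_normal_law S mu ->
  exists nu : probability (borel_cV R m) R, is_normal_law (S + l *m l^T) nu.
Proof.
move=> [Ssym Spsd muS].
pose N01 : probability (measurableTypeR R) R := normal_prob 0 1.
pose phi (z : borel_cV R m * measurableTypeR R) : borel_cV R m := ((z.1 : 'cV[R]_m) + (z.2 : R) *: l).
have mcoord i : measurable_fun [set: borel_cV R m] (fun x : borel_cV R m => (x : 'cV[R]_m) i 0).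
  by apply: continuous_borel_cV; exact: coord_continuous.
have mphi : measurable_fun [set: borel_cV R m * measurableTypeR R] phi.
  apply: measurable_borel_cV => i.
  rewrite (_ : (fun t => _) = fun t : borel_cV R m * measurableTypeR R => (t.1 : 'cV[R]_m) i 0 + (t.2 : R) * l i 0); last first.
    by apply/funext => t; rewrite /phi !mxE.
  apply: measurable_funD; first exact: (measurableT_comp (mcoord i) measurable_fst).
  by apply: measurable_funM => //; exact: measurable_snd.
pose X : {mfun (borel_cV R m * measurableTypeR R)%type >-> borel_cV R m} := HB.pack phi (isMeasurableFun.Build _ _ _ _ phi mphi).
pose nu : probability (borel_cV R m) R := distribution (mu \x N01)%E X.
exists nu; split.
- by rewrite linearD /= trmx_mul trmxK Ssym.
- by move=> u; rewrite qform_rank1 addr_ge0 ?sqr_ge0.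
move=> u A mA; rewrite qform_rank1; set s := (u^T *m l) 0 0.
rewrite /nu /= /distribution /pushforward /product_measure1 /=.
rewrite centered_normal_shift//.
pose B (y : R) := normal_prob 0 1 [set z | A (y + s * z)].
transitivity (\int[mu]_x B ((u^T *m (x : 'cV[R]_m)) 0 0)%R)%E.
  apply: eq_integral => x _; rewrite /B; congr normal_prob.
  have E z : (u^T *m ((x : 'cV[R]_m) + z *: l)) 0 0 = (u^T *m (x : 'cV[R]_m)) 0 0 + s * z.
    by rewrite mulmxDr mxE -scalemxAr; congr (_ + _); rewrite mxE mulrC.
  by apply/seteqP; split => z; rewrite /xsection /= inE /= /phi /= E.
pose L (x : borel_cV R m) : measurableTypeR R := (u^T *m (x : 'cV[R]_m)) 0 0.
have mL : measurable_fun [set: borel_cV R m] L.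
  exact: continuous_borel_cV (@linear_form_continuous u).
have mB : measurable_fun [set: measurableTypeR R] (B : measurableTypeR R -> \bar R).
  have [s0|s0] := eqVneq s 0.
    rewrite (_ : (B : measurableTypeR R -> \bar R) = fun y => (\1_A y)%:E).
      by apply/measurable_EFinP; exact: measurable_indic.
    apply/funext => y; rewrite /B indicE s0; case: (pselect (A y)) => Ay.
      rewrite mem_set// (_ : [set z | _] = setT) ?probability_setT//.
      by apply/seteqP; split => z //=; rewrite mul0r addr0.
    rewrite memNset// (_ : [set z | _] = set0) ?measure0//.
    by apply/seteqP; split => z //=; rewrite mul0r addr0.
  rewrite (_ : (B : measurableTypeR R -> \bar R) = fun y => normal_prob y `|s| A).
    exact: measurable_normal_prob.
  by apply/funext => y; rewrite /B normal_affine.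
have B0 y : (0 <= B y)%E by exact: measure_ge0.
transitivity (\int[pushforward mu L]_y B y)%E.
  by rewrite ge0_integral_pushforward.
have [q0|q0] := eqVneq (qform S u) 0.
  transitivity (\int[dirac ((0:R)%R : measurableTypeR R)]_y B y)%E.
    apply: eq_measure_integral => C mC _; rewrite /pushforward/=.
    by rewrite [LHS](muS u C mC) q0 /centered_normal eqxx.
  by rewrite integral_dirac// diracT mul1e /B; congr normal_prob; apply/seteqP; split => z /=; rewrite add0r.
apply: eq_measure_integral => C mC _; rewrite /pushforward/=.
by rewrite [LHS](muS u C mC) /centered_normal (negbTE q0).
Qed.

End NormalVector.

(** * Expectations of bounded functions *)

Section BoundedExpectation.
Context d (T : measurableType d) (R : realType).
Implicit Types (P : probability T R) (g h : T -> R).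

Definition Ex (mu : set T -> \bar R) g : R := fine (\int[mu]_x (g x)%:E)%E.

Definition bdm g := measurable_fun [set: T] g /\ exists M, forall x, `|g x| <= M.

Lemma bdm_integrable P g : bdm g -> P.-integrable [set: T] (EFin \o g).
Proof.
case=> mg [M gM]; apply: measurable_bounded_integrable => //.
  exact: le_lt_trans (probability_le1 P measurableT) (ltry _).
exists M; split; first exact: num_real.
by move=> x Mx y _; apply: le_trans (gM y) (ltW Mx).
Qed.

Lemma ExE P g : bdm g -> (\int[P]_x (g x)%:E = (Ex P g)%:E)%E.
Proof.
by move=> bg; rewrite /Ex fineK//; apply: integrable_fin_num => //; exact: bdm_integrable.
Qed.

Lemma bdm_cst c : bdm (fun _ : T => c).
Proof. by split; [exact: measurable_cst|exists `|c|]. Qed.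

Lemma bdmD g h : bdm g -> bdm h -> bdm (fun x => g x + h x).
Proof.
move=> [mg [M gM]] [mh [N hN]]; split; first exact: measurable_funD.
by exists (M + N) => x; rewrite (le_trans (ler_normD _ _))// lerD.
Qed.

Lemma bdmM g h : bdm g -> bdm h -> bdm (fun x => g x * h x).
Proof.
move=> [mg [M gM]] [mh [N hN]]; split; first exact: measurable_funM.
by exists (M * N) => x; rewrite normrM ler_pM.
Qed.

Lemma bdmZ c g : bdm g -> bdm (fun x => c * g x).
Proof. by move=> bg; apply: bdmM => //; exact: bdm_cst. Qed.

Lemma bdmB g h : bdm g -> bdm h -> bdm (fun x => g x - h x).
Proof.
move=> bg bh; rewrite (_ : (fun x => _) = fun x => g x + (-1) * h x).
  by apply: bdmD => //; exact: bdmZ.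
by apply/funext => x; rewrite mulN1r.
Qed.

Lemma bdm_indic (A : set T) : measurable A -> bdm (\1_A : T -> R).
Proof.
move=> mA; split; first exact: measurable_indic.
by exists 1 => x; rewrite indicE; case: (_ \in _); rewrite ?normr1 ?normr0.
Qed.

Lemma bdm_sum (I : Type) (r : seq I) (g : I -> T -> R) :
  (forall i, bdm (g i)) -> bdm (fun x => \sum_(i <- r) g i x).
Proof.
move=> bg; elim: r => [|i r IH].
  by rewrite (_ : (fun _ => _) = cst 0); [exact: bdm_cst|apply/funext => x; rewrite big_nil].
rewrite (_ : (fun _ => _) = fun x => g i x + \sum_(i <- r) g i x); first exact: bdmD.
by apply/funext => x; rewrite big_cons.
Qed.

Lemma eq_Ex mu g h : (forall x, g x = h x) -> Ex mu g = Ex mu h.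
Proof. by move=> gh; congr Ex; apply/funext. Qed.

Lemma Ex_cst P c : Ex P (fun _ => c) = c.
Proof.
rewrite /Ex integral_cst//.
by have /= -> := probability_setT P; rewrite mule1.
Qed.

Lemma ExD P g h : bdm g -> bdm h -> Ex P (fun x => g x + h x) = Ex P g + Ex P h.
Proof.
move=> bg bh; apply: EFin_inj; rewrite EFinD -!ExE//; last exact: bdmD.
under eq_integral do rewrite EFinD.
by rewrite integralD//; exact: bdm_integrable.
Qed.

Lemma ExZ P c g : bdm g -> Ex P (fun x => c * g x) = c * Ex P g.
Proof.
move=> bg; apply: EFin_inj; rewrite EFinM -!ExE//; last exact: bdmZ.
under eq_integral do rewrite EFinM.
by rewrite integralZl//; exact: bdm_integrable.
Qed.

Lemma ExB P g h : bdm g -> bdm h -> Ex P (fun x => g x - h x) = Ex P g - Ex P h.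
Proof.
move=> bg bh; rewrite -mulN1r -ExZ// -ExD//; last exact: bdmZ.
by apply: eq_Ex => x; rewrite mulN1r.
Qed.

Lemma Ex_sum P (I : Type) (r : seq I) (g : I -> T -> R) : (forall i, bdm (g i)) ->
  Ex P (fun x => \sum_(i <- r) g i x) = \sum_(i <- r) Ex P (g i).
Proof.
move=> bg; elim: r => [|i r IH].
  by rewrite big_nil -[RHS](Ex_cst P 0); apply: eq_Ex => x; rewrite big_nil.
rewrite big_cons -IH -ExD//; last exact: bdm_sum.
by apply: eq_Ex => x; rewrite big_cons.
Qed.

Lemma Ex_ge0 P g : (forall x, 0 <= g x) -> 0 <= Ex P g.
Proof.
move=> g0; apply: fine_ge0; apply: integral_ge0 => x _.
by rewrite lee_fin.
Qed.

Lemma Ex_le P g h : bdm g -> bdm h -> (forall x, g x <= h x) -> Ex P g <= Ex P h.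
Proof.
move=> bg bh gh; rewrite -subr_ge0 -ExB//.
by apply: Ex_ge0 => x; rewrite subr_ge0.
Qed.

Lemma Ex_abs P g h : bdm g -> bdm h -> (forall x, `|g x| <= h x) -> `|Ex P g| <= Ex P h.
Proof.
move=> bg bh gh; rewrite ler_norml -mulN1r -ExZ//.
apply/andP; split; apply: Ex_le => //; first exact: bdmZ.
  by move=> x; rewrite mulN1r; have := gh x; rewrite ler_norml => /andP[].
by move=> x; have := gh x; rewrite ler_norml => /andP[].
Qed.

Lemma Ex_indic P A : measurable A -> Ex P \1_A = fine (P A).
Proof. by move=> mA; rewrite /Ex integral_indic// setIT. Qed.

End BoundedExpectation.

Section BoundedComposition.
Context d1 d2 (T1 : measurableType d1) (T2 : measurableType d2) (R : realType).

Lemma bdm_comp (g : T2 -> R) (phi : T1 -> T2) : measurable_fun [set: T1] phi ->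
  bdm g -> bdm (fun x => g (phi x)).
Proof.
move=> mphi [mg [M gM]]; split; first exact: (measurableT_comp mg mphi).
by exists M => x.
Qed.

Lemma Ex_law (P : probability T1 R) (phi : T1 -> T2) (mu : probability T2 R) (g : T2 -> R) :
  measurable_fun [set: T1] phi -> bdm g ->
  (forall A, measurable A -> mu A = P [set x | A (phi x)]) ->
  Ex mu g = Ex P (fun x => g (phi x)).
Proof.
move=> mphi bg muE; congr fine.
transitivity (\int[pushforward P phi]_y (g y)%:E)%E.
  by apply: eq_measure_integral => A mA _; exact: (muE A mA).
have bg2 := bdm_comp mphi bg.
rewrite integral_pushforward//; last exact: bdm_integrable.
by apply/measurable_EFinP; exact: bg.1.
Qed.

Lemma Ex_prod (P : probability T1 R) (Q : probability T2 R) (g : T1 * T2 -> R) : bdm g ->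
  bdm (fun x => Ex Q (fun y => g (x, y))) /\
  Ex (P \x Q)%E g = Ex P (fun x => Ex Q (fun y => g (x, y))).
Proof.
move=> bg; have [mg [M gM]] := bg.
have ig := bdm_integrable (P \x Q)%E bg.
have bg2 x : bdm (fun y => g (x, y)).
  split; last by exists M => y.
  exact: (measurableT_comp mg (measurable_pair1 x)).
have E x : (\int[Q]_y (EFin \o g) (x, y) = (Ex Q (fun y => g (x, y)))%:E)%E.
  exact: ExE.
have mF : measurable_fun [set: T1] (fun x => (\int[Q]_y (EFin \o g) (x, y))%E).
  exact: (measurable_fubini_F ig).
split.
  split; first by apply/measurable_EFinP; apply: eq_measurable_fun mF => x _; rewrite E.
  exists `|M| => x; rewrite -[leRHS](Ex_cst Q); apply: Ex_abs => //; first exact: bdm_cst.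
  by move=> y; rewrite (le_trans (gM _))// ler_norm.
rewrite [LHS]/Ex -(integral12_prod_meas1 ig) /Ex; congr fine.
by apply: eq_integral => x _; exact: E.
Qed.

End BoundedComposition.

Section NormalExistence.
Variables (R : realType) (m : nat).
Implicit Types (S : 'M[R]_m) (u v : 'cV[R]_m).

Lemma qformD S u v (t : R) : S^T = S ->
  qform S (u + t *: v) = qform S u + 2 * t * (u^T *m S *m v) 0 0 + t ^+ 2 * qform S v.
Proof.
move=> Ssym; have E : (v^T *m S *m u) 0 0 = (u^T *m S *m v) 0 0.
  have -> : v^T *m S *m u = (u^T *m S *m v)^T by rewrite !trmx_mul trmxK Ssym mulmxA.
  by rewrite mxE.
have D (A B : 'M[R]_1) : (A + B) 0 0 = A 0 0 + B 0 0 by rewrite mxE.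
have Z a (A : 'M[R]_1) : (a *: A) 0 0 = a * A 0 0 by rewrite mxE.
rewrite /qform; have -> : (u + t *: v)^T = u^T + t *: v^T.
  by apply/matrixP => i j; rewrite !mxE.
rewrite !mulmxDl !mulmxDr -!scalemxAl -!scalemxAr !(D, Z) E; ring.
Qed.

(** Otherwise the form along u + t v would be affine in t with nonzero slope and would take the
    value -1. *)
Lemma psd_ortho S u v : S^T = S -> (forall u, 0 <= qform S u) -> qform S v = 0 ->
  (u^T *m S *m v) 0 0 = 0.
Proof.
move=> Ssym S0 v0; set b := (u^T *m S *m v) 0 0.
have [//|b0] := eqVneq b 0.
have := S0 (u + (- (qform S u + 1) / (2 * b)) *: v).
rewrite qformD// v0 mulr0 addr0 -/b.
have -> : qform S u + 2 * (- (qform S u + 1) / (2 * b)) * b = - 1 by field.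
by rewrite ler0N1.
Qed.

(** Cholesky elimination, with k the number of rows not yet cleared. A zero pivot forces its whole
    row to vanish by [psd_ortho]; a positive pivot is removed by a rank-one matrix, and the
    remaining Schur complement is again positive semidefinite. *)
Lemma psd_normal_law S : S^T = S -> (forall u, 0 <= qform S u) ->
  exists mu : probability (borel_cV R m) R, is_normal_law S mu.
Proof.
suff H k : (k <= m)%N -> forall S, S^T = S -> (forall u, 0 <= qform S u) ->
    (forall i j : 'I_m, (i < m - k)%N -> S i j = 0) ->
    exists mu : probability (borel_cV R m) R, is_normal_law S mu.
  by move=> Ssym S0; apply: (H m (leqnn m)) => // i j; rewrite subnn.
elim: k => [|k IH] km {}S Ssym S0 Sz.
  have -> : S = 0 by apply/matrixP => i j; rewrite Sz ?subn0 ?mxE.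
  exact: normal_law0.
have km1 : (m - k.+1 < m)%N by rewrite ltn_subrL /= (leq_trans _ km).
pose i0 := Ordinal km1; pose e : 'cV[R]_m := delta_mx i0 0.
have Se i : (S *m e) i 0 = S i i0 by rewrite -colE mxE.
have uSe u : (u^T *m S *m e) 0 0 = (u^T *m (S *m e)) 0 0 by rewrite mulmxA.
have qe : qform S e = S i0 i0.
  by rewrite /qform -mulmxA trmx_delta -rowE mxE Se.
have [s0|s0] := eqVneq (S i0 i0) 0.
  apply: (IH (ltnW km)) => // i j ik.
  have [im|im] := ltnP i (m - k.+1); first exact: Sz.
  have -> : i = i0.
    apply/val_inj/eqP; rewrite eqn_leq im andbT /=.
    by rewrite -ltnS -subSn// subSS.
  rewrite -Ssym mxE; have := @psd_ortho S (delta_mx j 0) e Ssym S0 (etrans qe s0).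
  by rewrite uSe trmx_delta -rowE mxE Se.
have sp : 0 < S i0 i0 by rewrite lt_neqAle eq_sym s0 -qe S0.
pose l : 'cV[R]_m := (Num.sqrt (S i0 i0))^-1 *: (S *m e).
pose S' := S - l *m l^T.
have SE : S = S' + l *m l^T by rewrite subrK.
have lE i : l i 0 = S i i0 / Num.sqrt (S i0 i0) by rewrite mxE Se mulrC.
have llE i j : (l *m l^T) i j = S i i0 * S j i0 / S i0 i0.
  rewrite mxE big_ord1 [l^T _ _]mxE !lE mulrACA -invfM -expr2 sqr_sqrtr ?ltW//.
rewrite SE; have [] := IH (ltnW km) S'.
- by rewrite /S' linearB /= trmx_mul trmxK Ssym.
- move=> u; have := qform_rank1 S' l u; rewrite -SE => h.
  (* This is the minimiser of the form of S on the line u + t e, and the minimum is the Schur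
     complement form at u. *)
  have := S0 (u + (- (u^T *m S *m e) 0 0 / S i0 i0) *: e).
  rewrite qformD// qe h.
  have -> : (u^T *m l) 0 0 = (u^T *m S *m e) 0 0 / Num.sqrt (S i0 i0).
    by rewrite /l -scalemxAr mxE uSe mulrC.
  set b := (u^T *m S *m e) 0 0; set r := Num.sqrt (S i0 i0).
  have r0 : r != 0 by rewrite gt_eqF// sqrtr_gt0.
  have <- : r ^+ 2 = S i0 i0 by rewrite sqr_sqrtr// ltW.
  have -> : qform S' u + (b / r) ^+ 2 + 2 * (- b / r ^+ 2) * b +
    (- b / r ^+ 2) ^+ 2 * r ^+ 2 = qform S' u by field.
  by [].
- move=> i j ik; rewrite /S' mxE [X in _ + X]mxE llE.
  have [im|im] := ltnP i (m - k.+1).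
    by rewrite !(Sz i _ im) !mul0r subrr.
  have -> : i = i0.
    apply/val_inj/eqP; rewrite eqn_leq im andbT /=.
    by rewrite -ltnS -subSn// subSS.
  by rewrite -{1}Ssym mxE mulrAC mulfV// mul1r subrr.
move=> mu; exact: normal_law_add.
Qed.

End NormalExistence.

(** * Characteristic functions of normal laws *)

Section NormalCf.
Variable R : realType.
Local Notation leb := (@lebesgue_measure R).
Local Notation N01 := (normal_prob (0 : R) 1).
Implicit Types (t s x y v : R).

Lemma expRN_quad v : 0 <= v -> 0 <= 1 - v + v ^+ 2 / 2 - expR (- v).
Proof.
apply: (@derive_ge0 _ (fun v => 1 - v + v ^+ 2 / 2 - expR (- v)) (fun v => v - 1 + expR (- v))) => [y|y _|].
- apply: is_derive_eq; rewrite /GRing.scale/=; lra.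
- by have := expR_ge1Dx (- y); lra.
- by rewrite oppr0 expR0; lra.
Qed.

Lemma cos_le_quart x : 0 <= x -> 0 <= x ^+ 4 / 24 - x ^+ 2 / 2 + 1 - cos x.
Proof.
apply: (@derive_ge0 _ (fun x => x ^+ 4 / 24 - x ^+ 2 / 2 + 1 - cos x)
  (fun x => x ^+ 3 / 6 - x + sin x)) => [y|y|].
- apply: is_derive_eq; rewrite /GRing.scale/=; lra.
- exact: sin_ge_cubic.
- by rewrite cos0; lra.
Qed.

Lemma cos_gauss y : `|cos y - expR (- (y ^+ 2 / 2))| <= y ^+ 4 / 8.
Proof.
have [-> ->] : cos y = cos `|y| /\ y ^+ 2 = `|y| ^+ 2.
  by rewrite real_normK ?num_real//; split => //; case: (ger0P y) => // _; rewrite cosN.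
have E4 (z : R) : z ^+ 4 = (z ^+ 2) ^+ 2 by rewrite -exprM.
have -> : y ^+ 4 = `|y| ^+ 4 by rewrite !E4 real_normK ?num_real.
have := normr_ge0 y; move: `|y| => z z0.
have h1 := cos_ge_quad z0; have h2 := cos_le_quart z0.
have z2 : 0 <= z ^+ 2 / 2 by rewrite divr_ge0 ?sqr_ge0.
have h3 := expRN_quad z2; have h4 := expR_ge1Dx (- (z ^+ 2 / 2)).
have E : (z ^+ 2 / 2) ^+ 2 / 2 = z ^+ 4 / 8 by field.
have z4 : 0 <= z ^+ 4 by rewrite exprn_ge0.
by rewrite ler_norml; lra.
Qed.

(** Used to dominate x^4 times the standard normal density by a multiple of the density of N(0,
    2). *)
Lemma quart_le_exp x : x ^+ 4 <= 32 * expR (x ^+ 2 / 4).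
Proof.
have z2 : 0 <= x ^+ 2 / 4 by rewrite divr_ge0 ?sqr_ge0.
have h := @derive_ge0 R (fun v => expR v - 1 - v - v ^+ 2 / 2) (fun v => expR v - 1 - v).
have {}h : 0 <= expR (x ^+ 2 / 4) - 1 - x ^+ 2 / 4 - (x ^+ 2 / 4) ^+ 2 / 2.
  apply: h => //.
  - move=> y; apply: is_derive_eq; rewrite /GRing.scale/=; lra.
  - by move=> y y0; have := expR_ge1Dx y; lra.
  - by rewrite expR0; lra.
have E : (x ^+ 2 / 4) ^+ 2 / 2 = x ^+ 4 / 32 by field.
lra.
Qed.

Lemma normal_pdf_gauss r x : 0 < r ->
  expR (x ^+ 2 / 2 - x ^+ 2 / (2 * r ^+ 2)) * normal_pdf 0 1 x = r * normal_pdf 0 r x.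
Proof.
move=> r0; rewrite !normal_pdfE ?oner_neq0 ?gt_eqF// /normal_peak /normal_fun subr0.
have P q : 0 < q -> Num.sqrt (q ^+ 2 * pi *+ 2) = q * Num.sqrt (pi *+ 2 : R).
  by move=> q0; rewrite -mulrnAr sqrtrM ?sqr_ge0// sqrtr_sqr gtr0_norm.
rewrite !P//; set c := Num.sqrt _.
have c0 : c != 0 by rewrite gt_eqF// sqrtr_gt0 mulrn_wgt0// pi_gt0.
rewrite mulrCA -expRD [RHS]mulrA; congr (_ * expR _).
  by field; rewrite c0 gt_eqF.
by field; rewrite gt_eqF.
Qed.

Definition kap t : R := Ex N01 (fun x : R => cos (t * x)).

Lemma measurable_trig (g : R -> R) t : continuous g -> measurable_fun [set: R] (fun x : R => g (t * x)).
Proof.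
move=> cg; apply: measurableT_comp; first exact: continuous_measurable_fun.
exact: measurable_funM.
Qed.

Lemma bdm_cos_lin th t : bdm (fun x : measurableTypeR R => cos (th + t * (x : R))).
Proof.
split; last by exists 1 => x; rewrite ler_norml cos_geN1 cos_le1.
have mc : measurable_fun [set: R] (@cos R) by apply: continuous_measurable_fun; exact: continuous_cos.
apply: (measurableT_comp mc); apply: measurable_funD => //; exact: measurable_funM.
Qed.

Lemma bdm_sin_lin t : bdm (fun x : measurableTypeR R => sin (t * (x : R))).
Proof.
split; last by exists 1 => x; rewrite ler_norml sin_geN1 sin_le1.
have mc : measurable_fun [set: R] (@sin R) by apply: continuous_measurable_fun; exact: continuous_sin.
apply: (measurableT_comp mc); exact: measurable_funM.
Qed.

Lemma bdm_cos_lin0 t : bdm (fun x : measurableTypeR R => cos (t * (x : R))).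
Proof.
rewrite (_ : (fun _ => _) = fun x : measurableTypeR R => cos (0 + t * (x : R))).
  exact: bdm_cos_lin.
by apply/funext => x; rewrite add0r.
Qed.

(** The summand 1 makes the integrand nonnegative, so that the rules for nonnegative integrals apply
    throughout. *)
Lemma kap_pdf t : ((1 + kap t)%:E =
  \int[leb]_x ((1 + cos (t * x)) * normal_pdf 0 1 x)%:E)%E.
Proof.
have b1 := bdmD (bdm_cst (measurableTypeR R) (1 : R)) (bdm_cos_lin0 t).
have -> : 1 + kap t = Ex N01 (fun x : R => 1 + cos (t * x)).
  have := ExD (normal_prob 0 1) (bdm_cst (measurableTypeR R) (1 : R)) (bdm_cos_lin0 t).
  by rewrite Ex_cst => ->.
have := ExE (normal_prob 0 1) b1 => E.
rewrite -[LHS]E.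
transitivity (\int[leb]_x ((1 + cos (t * x))%:E * (normal_pdf 0 1 x)%:E))%E; last first.
  by apply: eq_integral => x _; rewrite EFinM.
apply: (integral_normal_prob (f := fun x : R => (1 + cos (t * x))%:E)).
- by apply/measurable_EFinP; case: b1.
- by move=> x; rewrite lee_fin; have := cos_geN1 (t * x); lra.
- by rewrite [X in (X < _)%E]E ltry.
Qed.

Lemma kap_le1 t : `|kap t| <= 1.
Proof.
have h := @Ex_abs _ _ _ (normal_prob 0 1) _ _ (bdm_cos_lin0 t) (bdm_cst (measurableTypeR R) (1 : R)).
rewrite -[leRHS](Ex_cst (normal_prob 0 1 : probability (measurableTypeR R) R)); apply: h.
by move=> x; rewrite ler_norml cos_geN1 cos_le1.
Qed.

Lemma mpdf0 r c : measurable_fun [set: R] (fun x : R => (c * normal_pdf 0 r x)%:E).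
Proof.
by apply/measurable_EFinP; apply: measurable_funM => //; exact: measurable_normal_pdf.
Qed.

Lemma integral_pdf_scale r c : 0 <= c -> (\int[leb]_x (c * normal_pdf 0 r x)%:E = c%:E)%E.
Proof.
move=> c0; under eq_integral do rewrite EFinM.
rewrite ge0_integralZl//; first by rewrite integral_normal_pdf mule1.
- exact: measurable_normal_pdfE.
- by move=> x _; rewrite lee_fin normal_pdf_ge0.
Qed.

Lemma integral_pdf3 r1 r2 c1 c2 : 0 <= c1 -> 0 <= c2 ->
  (\int[leb]_x (normal_pdf 0 1 x + c1 * normal_pdf 0 r1 x + c2 * normal_pdf 0 r2 x)%:E =
   (1 + c1 + c2)%:E)%E.
Proof.
move=> h1 h2; under eq_integral do rewrite 2!EFinD.
have m1 := mpdf0 r1 c1; have m2 := mpdf0 r2 c2; have m0 := measurable_normal_pdfE 0 (1 : R).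
rewrite ge0_integralD//.
- rewrite ge0_integralD//.
  + by rewrite integral_normal_pdf !integral_pdf_scale// !EFinD.
  + by move=> x _; rewrite lee_fin normal_pdf_ge0.
  + by move=> x _; rewrite lee_fin mulr_ge0// normal_pdf_ge0.
- by move=> x _; rewrite -EFinD lee_fin addr_ge0// ?mulr_ge0// normal_pdf_ge0.
- exact: emeasurable_funD.
- by move=> x _; rewrite lee_fin mulr_ge0// normal_pdf_ge0.
Qed.

(** With cos (t x) replaced by exp (- (t x)^2 / 2), the integrand becomes r times the density of
    N(0, r^2), of integral r. The error t^4 x^4 / 8 is integrated through [quart_le_exp]: 32 / 8 =
    4, and sqrt 2 is the normalisation of N(0, 2). *)
Lemma kap_gauss t : `|kap t - (Num.sqrt (1 + t ^+ 2))^-1| <= 4 * Num.sqrt 2 * t ^+ 4.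
Proof.
set r := _^-1; set c2 := 4 * _ * _.
have t2 : 0 < 1 + t ^+ 2 by rewrite ltr_pwDl// sqr_ge0.
have r0 : 0 < r by rewrite invr_gt0 sqrtr_gt0.
have t4 : 0 <= t ^+ 4 by rewrite (_ : t ^+ 4 = (t ^+ 2) ^+ 2) ?sqr_ge0// -exprM.
have s2 : 0 < Num.sqrt (2 : R) by rewrite sqrtr_gt0.
have c20 : 0 <= c2 by rewrite mulr_ge0// mulr_ge0// ltW.
have r2 : r ^+ 2 = (1 + t ^+ 2)^-1 by rewrite exprVn sqr_sqrtr// ltW.
have P x : `|cos (t * x) * normal_pdf 0 1 x - r * normal_pdf 0 r x| <= c2 * normal_pdf 0 (Num.sqrt 2) x.
  rewrite -(normal_pdf_gauss x r0) -mulrBl normrM (ger0_norm (normal_pdf_ge0 _ _ _)).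
  have -> : c2 * normal_pdf 0 (Num.sqrt 2) x = 4 * t ^+ 4 * (expR (x ^+ 2 / 4) * normal_pdf 0 1 x).
    have -> : x ^+ 2 / 4 = x ^+ 2 / 2 - x ^+ 2 / (2 * Num.sqrt 2 ^+ 2).
      by rewrite sqr_sqrtr//; field.
    by rewrite (normal_pdf_gauss x s2) /c2; ring.
  rewrite mulrA ler_wpM2r ?normal_pdf_ge0//.
  have -> : x ^+ 2 / 2 - x ^+ 2 / (2 * r ^+ 2) = - ((t * x) ^+ 2 / 2).
    by rewrite r2; field; rewrite gt_eqF.
  apply: le_trans (cos_gauss _) _; rewrite exprMn.
  by have := ler_wpM2l t4 (quart_le_exp x); lra.
have m0 := measurable_normal_pdfE 0 (1 : R).
have mc : measurable_fun [set: R] (fun x : R => ((1 + cos (t * x)) * normal_pdf 0 1 x)%:E).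
  apply/measurable_EFinP; apply: measurable_funM; last exact: measurable_normal_pdf.
  by apply: measurable_funD => //; apply: measurable_trig; exact: continuous_cos.
have mm a b : measurable_fun [set: R] (fun x : R => (normal_pdf 0 1 x + a * normal_pdf 0 r x + b * normal_pdf 0 (Num.sqrt 2) x)%:E).
  by apply/measurable_EFinP; repeat apply: measurable_funD; try apply: measurable_funM => //; exact: measurable_normal_pdf.
have c0 x : 0 <= (1 + cos (t * x)) * normal_pdf 0 1 x.
  by rewrite mulr_ge0 ?normal_pdf_ge0//; have := cos_geN1 (t * x); lra.
have m2 := mpdf0 (Num.sqrt 2) c2.
have U : 1 + kap t <= 1 + r + c2.
  rewrite -lee_fin kap_pdf -(integral_pdf3 r (Num.sqrt 2) (ltW r0) c20).
  apply: ge0_le_integral => //.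
  - by move=> x _; rewrite lee_fin.
  - exact: mm.
  - by move=> x _; rewrite lee_fin; have := P x; rewrite ler_norml => /andP[_]; lra.
have V : 1 + r + 0 <= 1 + kap t + c2.
  rewrite -lee_fin EFinD [X in (_ <= X)%E]EFinD kap_pdf -(integral_pdf_scale (Num.sqrt 2) c20).
  rewrite -EFinD -(integral_pdf3 r (Num.sqrt 2) (ltW r0) (lexx 0)) -ge0_integralD//.
  - apply: ge0_le_integral => //.
    + by move=> x _; rewrite lee_fin !addr_ge0// ?mulr_ge0// ?normal_pdf_ge0// ltW.
    + exact: mm.
    + exact: emeasurable_funD.
    + by move=> x _; rewrite -EFinD lee_fin; have := P x; rewrite ler_norml => /andP[]; lra.
  - by move=> x _; rewrite lee_fin.
  - by move=> x _; rewrite lee_fin mulr_ge0// normal_pdf_ge0.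
by rewrite ler_norml; lra.
Qed.

Lemma inv_sqrt_gauss t : t ^+ 2 <= 1 ->
  `|(Num.sqrt (1 + t ^+ 2))^-1 - expR (- (t ^+ 2 / 2))| <= t ^+ 4.
Proof.
have u0 := sqr_ge0 t; have -> : t ^+ 4 = (t ^+ 2) ^+ 2 by rewrite -exprM.
move: (t ^+ 2) u0 => u u0 u1.
have p0 : 0 < 1 + u by lra.
have v0 : 0 <= u / 2 by lra.
have h3 := expRN_quad v0; have h4 := expR_ge1Dx (- (u / 2)).
set r := _^-1; have r0 : 0 < r by rewrite invr_gt0 sqrtr_gt0.
have r2 : r ^+ 2 * (1 + u) = 1 by rewrite exprVn sqr_sqrtr ?ltW// mulVf// gt_eqF.
have a : 1 - u / 2 <= r.
  rewrite -ler_sqr ?nnegrE; [|lra|lra].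
  have : (1 - u / 2) ^+ 2 * (1 + u) <= r ^+ 2 * (1 + u) by rewrite r2; nra.
  by rewrite ler_pM2r.
have b : r <= 1 - u / 2 + u ^+ 2.
  rewrite -ler_sqr ?nnegrE; [|lra|nra].
  have : r ^+ 2 * (1 + u) <= (1 - u / 2 + u ^+ 2) ^+ 2 * (1 + u).
    have -> : (1 - u / 2 + u ^+ 2) ^+ 2 * (1 + u) = 1 + (5 / 4 * u ^+ 2 + 5 / 4 * u ^+ 3 + u ^+ 5) by field.
    by rewrite r2 lerDl !addr_ge0// ?mulr_ge0// ?exprn_ge0.
  by rewrite ler_pM2r.
have u2 := sqr_ge0 u.
have E : (u / 2) ^+ 2 / 2 = u ^+ 2 / 8 by field.
by rewrite ler_norml; lra.
Qed.

Lemma kap_expR t : t ^+ 2 <= 1 -> `|kap t - expR (- (t ^+ 2 / 2))| <= 9 * t ^+ 4.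
Proof.
move=> t1; have h1 := kap_gauss t; have h2 := inv_sqrt_gauss t1.
have t4 : 0 <= t ^+ 4 by rewrite (_ : t ^+ 4 = (t ^+ 2) ^+ 2) ?sqr_ge0// -exprM.
have s2 : Num.sqrt (2 : R) <= 2.
  by rewrite -[leRHS](ger0_norm (ler0n _ 2)) -sqrtr_sqr ler_wsqrtr// expr2; lra.
have := ler_normD (kap t - (Num.sqrt (1 + t ^+ 2))^-1) ((Num.sqrt (1 + t ^+ 2))^-1 - expR (- (t ^+ 2 / 2))).
rewrite subrKA => /le_trans; apply.
have := ler_wpM2r t4 s2; lra.
Qed.

Lemma dist_expr_le (a b : R) n : `|a| <= 1 -> `|b| <= 1 -> `|a ^+ n - b ^+ n| <= n%:R * `|a - b|.
Proof.
move=> a1 b1; elim: n => [|n IH]; first by rewrite !expr0 subrr normr0 mul0r.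
have -> : a ^+ n.+1 - b ^+ n.+1 = a * (a ^+ n - b ^+ n) + (a - b) * b ^+ n by rewrite !exprS; ring.
apply: le_trans (ler_normD _ _) _; rewrite !normrM -natr1 mulrDl mul1r lerD//.
  by apply: le_trans IH; rewrite ler_piMl.
by rewrite ler_piMr// normrX exprn_ile1.
Qed.

Lemma normal_prob_scale s (A : set R) : s != 0 -> measurable A ->
  normal_prob 0 `|s| A = N01 [set z | A (s * z)].
Proof.
move=> s0 mA; rewrite -(normal_affine 0 s0 mA); congr normal_prob.
by apply/seteqP; split => z /=; rewrite add0r.
Qed.

Lemma normal_prob_pos_scale s (A : set R) : 0 < s -> measurable A ->
  normal_prob 0 s A = N01 [set z | A (s * z)].
Proof. by move=> s0 mA; rewrite -(normal_prob_scale (lt0r_neq0 s0) mA) gtr0_norm. Qed.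

Lemma Ex_sin t : Ex N01 (fun x : R => sin (t * x)) = 0.
Proof.
have mN : measurable_fun [set: measurableTypeR R] (fun x : measurableTypeR R => - (x : R) : measurableTypeR R).
  exact: measurable_funN.
have n1 : (-1 : R) != 0 by rewrite oppr_eq0 oner_neq0.
have E : Ex N01 (fun x : R => sin (t * x)) = Ex N01 (fun x : R => - sin (t * x)).
  rewrite (@Ex_law _ _ (measurableTypeR R) (measurableTypeR R) R N01 _ N01 _ mN (bdm_sin_lin t)).
    by apply: eq_Ex => x; rewrite mulrN sinN.
  move=> A mA; have := normal_prob_scale n1 mA; rewrite normrN1 => h.
  apply: (etrans h); congr normal_prob; by apply/seteqP; split => z /=; rewrite mulN1r.
have := ExZ N01 (-1) (bdm_sin_lin t).
rewrite (@eq_Ex _ (measurableTypeR R) R N01 (fun x : R => -1 * sin (t * x)) (fun x : R => - sin (t * x))); last first.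
  by move=> x; rewrite mulN1r.
by rewrite -E => h; lra.
Qed.

Lemma Ex_cos_lin th t : Ex N01 (fun x : R => cos (th + t * x)) = cos th * kap t.
Proof.
have b1 := bdm_cos_lin0 t; have b2 := bdm_sin_lin t.
have -> : Ex N01 (fun x : R => cos (th + t * x)) =
    Ex N01 (fun x : R => cos th * cos (t * x) - sin th * sin (t * x)).
  by apply: eq_Ex => x; rewrite cosD.
have := ExB N01 (bdmZ (cos th) b1) (bdmZ (sin th) b2) => ->.
by rewrite !ExZ// Ex_sin mulr0 subr0.
Qed.

(** Both sides are the characteristic function of the sum of two independent standard normal
    variables, whose law is N(0, 2); the sine part vanishes by symmetry. *)
Lemma kap_sqrt2 t : kap (t * Num.sqrt 2) = kap t ^+ 2.
Proof.
have s2 : 0 < Num.sqrt (2 : R) by rewrite sqrtr_gt0.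
have ms : measurable_fun [set: measurableTypeR R] (fun x : measurableTypeR R => (Num.sqrt 2 * (x : R)) : measurableTypeR R).
  exact: measurable_funM.
have mD : measurable_fun [set: measurableTypeR R * measurableTypeR R]
    (fun z : measurableTypeR R * measurableTypeR R => ((z.1 : R) + (z.2 : R)) : measurableTypeR R).
  exact: measurable_funD.
have L1 : Ex (normal_prob 0 (Num.sqrt 2)) (fun x : R => cos (t * x)) = kap (t * Num.sqrt 2).
  rewrite (@Ex_law _ _ (measurableTypeR R) (measurableTypeR R) R N01 _ (normal_prob 0 (Num.sqrt 2)) _ ms (bdm_cos_lin0 t)).
    by apply: eq_Ex => x; rewrite mulrA.
  by move=> A mA; exact: (normal_prob_pos_scale s2 mA).
have L2 : Ex (normal_prob 0 (Num.sqrt 2)) (fun x : R => cos (t * x)) =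
    Ex (N01 \x N01)%E (fun z : R * R => cos (t * (z.1 + z.2))).
  apply: (@Ex_law _ _ (measurableTypeR R * measurableTypeR R)%type (measurableTypeR R) R (N01 \x N01)%E _ (normal_prob 0 (Num.sqrt 2)) _ mD (bdm_cos_lin0 t)).
  move=> A mA; have o1 : (0 : R) < 1 by [].
  have E2 : (1 : R) ^+ 2 + 1 ^+ 2 = 2 by rewrite expr1n.
  have h := normal_conv o1 o1 mA.
  apply: (eq_trans (eq_trans (congr1 (fun r : R => normal_prob 0 (Num.sqrt r) A) (esym E2)) (esym h))).
  apply: eq_integral => x _ /=.
  have h1 := normal_affine x (oner_neq0 R) mA; rewrite normr1 in h1.
  apply: (eq_trans (esym h1)).
  by congr normal_prob; apply/seteqP; split => z; rewrite /xsection /= ?inE /= mul1r.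
have bz : bdm (fun z : measurableTypeR R * measurableTypeR R => cos (t * ((z.1 : R) + (z.2 : R)))).
  exact: (bdm_comp mD (bdm_cos_lin0 t)).
have [_ L3] := Ex_prod N01 N01 bz.
rewrite -L1 L2 L3 expr2 -ExZ; last exact: bdm_cos_lin0.
apply: eq_Ex => x; rewrite mulrC -Ex_cos_lin; apply: eq_Ex => y /=.
by rewrite mulrDr.
Qed.

Lemma kap_pow t k : kap t = kap (t / Num.sqrt 2 ^+ k) ^+ (2 ^ k).
Proof.
have s2 : Num.sqrt (2 : R) != 0 by rewrite gt_eqF// sqrtr_gt0.
elim: k => [|k ->]; first by rewrite expr0 divr1 expn0 expr1.
rewrite expnS exprM -kap_sqrt2; congr (kap _ ^+ _); rewrite exprS; field.
by rewrite expf_neq0.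
Qed.

(* kap (t sqrt 2) = kap t ^ 2 and kap t = exp (- t^2 / 2) + O(t^4). *)
Lemma kapE t : kap t = expR (- (t ^+ 2 / 2)).
Proof.
have s20 : Num.sqrt (2 : R) != 0 by rewrite gt_eqF// sqrtr_gt0.
pose x (k : nat) := kap t.
have H : x @ \oo --> expR (- (t ^+ 2 / 2)).
  (* The error 9 (t^2 / 2^k)^2 at the scale t / sqrt 2^k is multiplied by at most 2^k when the
     2^k-th power is taken. *)
  apply: (@cvg_le_dist0 _ _ (fun k => 9 * t ^+ 4 * 2^-1 ^+ k)); last first.
    rewrite -[X in _ --> X](mulr0 (9 * t ^+ 4)).
    apply: cvgM; first exact: cvg_cst.
    by apply: cvg_expr; rewrite ger0_norm; lra.
  have [k0 tk] : exists k0, t ^+ 2 * 2^-1 ^+ k0 <= 1.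
    have /cvgrPdist_le/(_ 1 ltr01)[k0 _ h] : (fun k => t ^+ 2 * 2^-1 ^+ k) @ \oo --> (0 : R).
      rewrite -[X in _ --> X](mulr0 (t ^+ 2)); apply: cvgM; first exact: cvg_cst.
      by apply: cvg_expr; rewrite ger0_norm; lra.
    exists k0; have := h k0 (leqnn k0); rewrite sub0r normrN ger0_norm//.
    by rewrite mulr_ge0 ?sqr_ge0// exprn_ge0// invr_ge0.
  exists k0 => // k /= k0k; set u := t / Num.sqrt 2 ^+ k.
  have u2 : u ^+ 2 = t ^+ 2 * 2^-1 ^+ k.
    by rewrite expr_div_n -exprM mulnC exprM sqr_sqrtr// exprVn.
  have u21 : u ^+ 2 <= 1.
    rewrite u2; apply: le_trans tk; rewrite ler_wpM2l ?sqr_ge0//.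
    by rewrite ler_wiXn2l// ?invr_ge0// invf_le1// ler1n.
  rewrite /x (kap_pow t k) -/u.
  have -> : expR (- (t ^+ 2 / 2)) = expR (- (u ^+ 2 / 2)) ^+ (2 ^ k).
    rewrite -expRM_natl; congr expR; rewrite u2 natrX exprVn.
    by field; rewrite expf_neq0.
  apply: le_trans (dist_expr_le _ (kap_le1 _) _) _.
    by rewrite ger0_norm ?expR_ge0// -[leRHS]expR0 ler_expR oppr_le0 divr_ge0 ?sqr_ge0.
  apply: le_trans (ler_wpM2l (ler0n _ _) (kap_expR u21)) _.
  have -> : u ^+ 4 = (u ^+ 2) ^+ 2 by rewrite -exprM.
  have -> : t ^+ 4 = (t ^+ 2) ^+ 2 by rewrite -exprM.
  rewrite u2 natrX exprVn le_eqVlt; apply/orP; left; apply/eqP.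
  by field; rewrite expf_neq0.
have H0 : x @ \oo --> kap t by exact: cvg_cst.
by rewrite (cvg_unique _ H0 H).
Qed.

End NormalCf.

Section NormalVectorCf.
Variables (R : realType) (m : nat).

Lemma bdm_cos_form th (u : 'cV[R]_m) :
  bdm (fun x : borel_cV R m => cos (th + (u^T *m (x : 'cV[R]_m)) 0 0)).
Proof.
split; last by exists 1 => x; rewrite ler_norml cos_geN1 cos_le1.
apply: continuous_borel_cV => x.
apply: continuous_comp; last exact: continuous_cos.
exact: (cvgD (@cst_continuous 'cV[R]_m R th x) (@linear_form_continuous R m u x)).
Qed.

Lemma normal_law_cf (S : 'M[R]_m) (mu : probability (borel_cV R m) R) th (u : 'cV[R]_m) :
  is_normal_law S mu ->
  Ex mu (fun x : 'cV[R]_m => cos (th + (u^T *m x) 0 0)) = cos th * expR (- (qform S u / 2)).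
Proof.
move=> [Ssym S0 muS].
pose L (x : borel_cV R m) : measurableTypeR R := (u^T *m (x : 'cV[R]_m)) 0 0.
have mL : measurable_fun [set: borel_cV R m] L.
  exact: continuous_borel_cV (@linear_form_continuous _ _ u).
have bc : bdm (fun x : measurableTypeR R => cos (th + (x : R))).
  rewrite (_ : (fun _ => _) = fun x : measurableTypeR R => cos (th + 1 * (x : R))).
    exact: bdm_cos_lin.
  by apply/funext => x; rewrite mul1r.
have [q0|q0] := eqVneq (qform S u) 0.
  rewrite q0 mul0r oppr0 expR0 mulr1.
  rewrite -(@Ex_law _ _ _ (measurableTypeR R) R mu L (dirac (0%R : measurableTypeR R)) _ mL bc).
    by rewrite /Ex integral_dirac// ?diracT ?mul1e ?addr0//; apply/measurable_EFinP; case: bc.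
  by move=> A mA; rewrite (muS u A mA) q0 /centered_normal eqxx.
have sq : 0 < Num.sqrt (qform S u) by rewrite sqrtr_gt0 lt_neqAle eq_sym q0 S0.
rewrite -(@Ex_law _ _ _ (measurableTypeR R) R mu L (normal_prob 0 (Num.sqrt (qform S u))) _ mL bc); last first.
  by move=> A mA; rewrite (muS u A mA) /centered_normal (negbTE q0).
have ms : measurable_fun [set: measurableTypeR R] (fun x : measurableTypeR R => (Num.sqrt (qform S u) * (x : R)) : measurableTypeR R).
  exact: measurable_funM.
rewrite (@Ex_law _ _ (measurableTypeR R) (measurableTypeR R) R (normal_prob 0 1) _ (normal_prob 0 (Num.sqrt (qform S u))) _ ms bc); last first.
  by move=> A mA; exact: (normal_prob_pos_scale sq mA).
by rewrite Ex_cos_lin kapE sqr_sqrtr.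
Qed.

End NormalVectorCf.

(** * Trigonometric polynomials and continuity theorem *)

Section TrigPolynomials.
Variables (R : realType) (m : nat).
Implicit Types (h k : 'cV[R]_m -> R) (x u : 'cV[R]_m).

Definition lform u x : R := (u^T *m x) 0 0.

Lemma lformD u v x : lform (u + v) x = lform u x + lform v x.
Proof.
rewrite /lform; have -> : (u + v)^T = u^T + v^T by apply/matrixP => i j; rewrite !mxE.
by rewrite mulmxDl mxE.
Qed.

Lemma lformN u x : lform (- u) x = - lform u x.
Proof.
rewrite /lform; have -> : (- u)^T = - u^T by apply/matrixP => i j; rewrite !mxE.
by rewrite mulNmx mxE.
Qed.

(** The phase in each term makes constants and sines instances, and the product-to-sum formulas keep
    the class closed under multiplication. *)
Definition trig h := exists s : seq (R * R * 'cV[R]_m),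
  forall x, h x = \sum_(q <- s) q.1.1 * cos (q.1.2 + lform q.2 x).

Lemma trig_cos a th u : trig (fun x => a * cos (th + lform u x)).
Proof. by exists [:: (a, th, u)] => x; rewrite big_seq1. Qed.

Lemma eq_trig h k : (forall x, h x = k x) -> trig h -> trig k.
Proof. by move=> hk [s sP]; exists s => x; rewrite -hk. Qed.

Lemma trig_cst a : trig (fun _ => a).
Proof.
apply: eq_trig (trig_cos a 0 0) => x.
by rewrite /lform trmx0 mul0mx mxE addr0 cos0 mulr1.
Qed.

Lemma trigD h k : trig h -> trig k -> trig (fun x => h x + k x).
Proof. by move=> [s sP] [t tP]; exists (s ++ t) => x; rewrite big_cat sP tP. Qed.

Lemma trig_sum (I : Type) (r : seq I) (h : I -> 'cV[R]_m -> R) :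
  (forall i, trig (h i)) -> trig (fun x => \sum_(i <- r) h i x).
Proof.
move=> th; elim: r => [|i r IH].
  by apply: eq_trig (trig_cst 0) => x; rewrite big_nil.
by apply: eq_trig (trigD (th i) IH) => x; rewrite big_cons.
Qed.

Lemma trigM h k : trig h -> trig k -> trig (fun x => h x * k x).
Proof.
move=> [s sP] [t tP].
have T : trig (fun x => \sum_(p <- s) \sum_(q <- t)
    (p.1.1 * cos (p.1.2 + lform p.2 x)) * (q.1.1 * cos (q.1.2 + lform q.2 x))).
  apply: trig_sum => p; apply: trig_sum => q.
  apply: eq_trig (trigD (trig_cos (p.1.1 * q.1.1 / 2) (p.1.2 + q.1.2) (p.2 + q.2))
    (trig_cos (p.1.1 * q.1.1 / 2) (p.1.2 - q.1.2) (p.2 + (- q.2)))) => x.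
  have -> : p.1.2 + q.1.2 + lform (p.2 + q.2) x = (p.1.2 + lform p.2 x) + (q.1.2 + lform q.2 x).
    by rewrite lformD; ring.
  have -> : p.1.2 - q.1.2 + lform (p.2 + (- q.2)) x = (p.1.2 + lform p.2 x) - (q.1.2 + lform q.2 x).
    by rewrite lformD lformN; ring.
  by move: (p.1.2 + lform p.2 x) (q.1.2 + lform q.2 x) => a b; rewrite cosD cosB; field.
by apply: eq_trig T => x; rewrite sP tP big_distrlr.
Qed.

Lemma trig_bound h : trig h -> exists M, forall x, `|h x| <= M.
Proof.
move=> [s sP]; exists (\sum_(q <- s) `|q.1.1|) => x; rewrite sP.
apply: le_trans (ler_norm_sum _ _ _) _; apply: ler_sum => q _.
by rewrite normrM ler_piMr// ler_norml cos_geN1 cos_le1.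
Qed.

(** The approximation is uniform on the whole space, not only on a box: this keeps the final
    approximant bounded off the box, where only tightness is available. *)
Definition utrig h := forall e : R, 0 < e -> exists2 t, trig t & forall x, `|h x - t x| <= e.

Lemma trig_utrig h : trig h -> utrig h.
Proof. by move=> th e e0; exists h => // x; rewrite subrr normr0 ltW. Qed.

Lemma utrig_cst a : utrig (fun _ => a).
Proof. exact/trig_utrig/trig_cst. Qed.

Lemma utrig_bound h : utrig h -> exists2 M, 0 < M & forall x, `|h x| <= M.
Proof.
move=> /(_ 1 ltr01)[t tt ht]; have [M tM] := trig_bound tt.
exists (`|M| + 1) => [|x]; first by rewrite ltr_wpDl.
have := tM x; have := ht x; have := ler_norm M.
by have := ler_normD (h x - t x) (t x); rewrite subrK; lra.
Qed.

Lemma eq_utrig h k : (forall x, h x = k x) -> utrig h -> utrig k.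
Proof. by move=> hk uh e e0; have [t tt th] := uh e e0; exists t => // x; rewrite -hk. Qed.

Lemma utrigD h k : utrig h -> utrig k -> utrig (fun x => h x + k x).
Proof.
move=> uh uk e e0; have e2 : 0 < e / 2 by rewrite divr_gt0.
have [s ts hs] := uh _ e2; have [t tt kt] := uk _ e2.
exists (fun x => s x + t x); first exact: trigD.
move=> x; have := hs x; have := kt x; rewrite !ler_norml => /andP[a b] /andP[c d].
by apply/andP; split; lra.
Qed.

Lemma utrigM h k : utrig h -> utrig k -> utrig (fun x => h x * k x).
Proof.
move=> uh uk e e0.
have [A A0 hA] := utrig_bound uh; have [B B0 kB] := utrig_bound uk.
pose e1 := Num.min 1 (e / (2 * A)); pose e2 := e / (2 * (B + 1)).
have e10 : 0 < e1 by rewrite lt_min ltr01 divr_gt0// mulr_gt0.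
have e20 : 0 < e2 by rewrite divr_gt0// mulr_gt0// addr_gt0.
have [s ts hs] := uh _ e20; have [t tt kt] := uk _ e10.
exists (fun x => s x * t x); first exact: trigM.
move=> x; have -> : h x * k x - s x * t x = h x * (k x - t x) + (h x - s x) * t x by ring.
apply: le_trans (ler_normD _ _) _; rewrite !normrM.
have t1 : `|t x| <= B + 1.
  have := kB x; have := kt x; rewrite le_min => /andP[+ _].
  by have := ler_normB (k x) (k x - t x); rewrite subKr; lra.
have a1 : `|h x| * `|k x - t x| <= A * (e / (2 * A)).
  by apply: ler_pM => //; have := kt x; rewrite le_min => /andP[].
have a2 : `|h x - s x| * `|t x| <= e2 * (B + 1) by apply: ler_pM.
have E1 : A * (e / (2 * A)) = e / 2 by field; rewrite gt_eqF.
have E2 : e2 * (B + 1) = e / 2 by rewrite /e2; field; rewrite gt_eqF// addr_gt0.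
by lra.
Qed.

Lemma utrigZ a h : utrig h -> utrig (fun x => a * h x).
Proof. by move=> uh; apply: utrigM => //; exact: utrig_cst. Qed.

Lemma utrigB h k : utrig h -> utrig k -> utrig (fun x => h x - k x).
Proof.
move=> uh uk; apply: eq_utrig (utrigD uh (utrigZ (-1) uk)) => x.
by rewrite mulN1r.
Qed.

Lemma utrig_lim h : (forall e, 0 < e -> exists2 k, utrig k & forall x, `|h x - k x| <= e) -> utrig h.
Proof.
move=> H e e0; have e2 : 0 < e / 2 by rewrite divr_gt0.
have [k uk hk] := H _ e2; have [t tt kt] := uk _ e2; exists t => // x.
by have := ler_normD (h x - k x) (k x - t x); rewrite subrKA; have := hk x; have := kt x; lra.
Qed.

(** The classical polynomial iteration increasing to |t| on [-1, 1]; using ring operations only, it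
    stays inside the algebra [utrig]. *)
Fixpoint abs_approx (t : R) (n : nat) : R :=
  if n is n'.+1 then abs_approx t n' + (t ^+ 2 - abs_approx t n' ^+ 2) / 2 else 0.

(* With [e = |t| - p], one Newton step gives [e * (1 - (|t| + p) / 2)]. *)
Lemma abs_approxP (t : R) n : `|t| <= 1 ->
  0 <= abs_approx t n <= `|t| /\ (`|t| - abs_approx t n) * (2 + n%:R * `|t|) <= 2 * `|t|.
Proof.
have := normr_ge0 t.
have E j : abs_approx t j.+1 = abs_approx t j + (`|t| ^+ 2 - abs_approx t j ^+ 2) / 2.
  by rewrite /= real_normK ?num_real.
move: E; move: `|t| => a E a0 a1; elim: n => [|n [/andP[p0 pa] IH]].
  by rewrite /= lexx a0 subr0 mul0r addr0 mulrC.
rewrite E; move: (abs_approx t n) p0 pa IH => p p0 pa IH.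
have Ep : a - (p + (a ^+ 2 - p ^+ 2) / 2) = (a - p) * (1 - (a + p) / 2) by field.
have n0 := ler0n R n; have ap : 0 <= a - p by lra.
have na : 0 <= n%:R * a by rewrite mulr_ge0.
split.
  apply/andP; split; first by rewrite addr_ge0// divr_ge0// subr_ge0 ler_sqr ?nnegrE.
  by rewrite -subr_ge0 Ep mulr_ge0//; lra.
rewrite Ep -mulrA; apply: le_trans IH; rewrite ler_wpM2l// -[n.+1%:R]natr1.
have h : (1 - (a + p) / 2) * (2 + (n%:R + 1) * a) <= (1 - a / 2) * (2 + (n%:R + 1) * a).
  by rewrite ler_wpM2r//; lra.
apply: le_trans h _.
have := mulr_ge0 na a0; have := sqr_ge0 a; rewrite expr2; lra.
Qed.

Lemma utrig_abs h : utrig h -> utrig (fun x => `|h x|).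
Proof.
move=> uh; have [A A0 hA] := utrig_bound uh.
pose p n x := A * abs_approx (A^-1 * h x) n.
have up n : utrig (p n).
  apply: utrigZ; elim: n => [|n IH] /=; first exact: utrig_cst.
  apply: utrigD => //; apply: (@eq_utrig (fun x => 2^-1 * ((A^-1 * h x) * (A^-1 * h x) - abs_approx (A^-1 * h x) n * abs_approx (A^-1 * h x) n))).
    by move=> x; rewrite -!expr2 mulrC.
  by apply: utrigZ; apply: utrigB; apply: utrigM => //; exact: utrigZ.
apply: utrig_lim => e e0.
(* After rescaling by the bound A, [abs_approxP] leaves an error of at most 2 / n, hence 2 A / n for
   h. *)
have [n n0 ne] : exists2 n : nat, 0 < n%:R :> R & A * 2 <= e * n%:R.
  exists (Num.truncn (A * 2 / e)).+1; first by rewrite ltr0n.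
  by rewrite [leRHS]mulrC -ler_pdivrMr// ltW// truncnS_gt.
exists (p n) => // x.
set t := A^-1 * h x; have hE : h x = A * t by rewrite /t mulVKf// gt_eqF.
have t1 : `|t| <= 1 by rewrite normrM gtr0_norm ?invr_gt0// mulrC ler_pdivrMr// mul1r.
have [/andP[p0 pt] H] := abs_approxP n t1.
rewrite hE normrM (gtr0_norm A0) -mulrBr normrM (gtr0_norm A0) ger0_norm ?subr_ge0//.
rewrite -(ler_pM2r n0); apply: le_trans ne.
rewrite -mulrA ler_pM2l//.
rewrite -/t; have [t0|t0] := eqVneq t 0.
  move: p0 pt; rewrite t0 normr0 => h1 h2.
  by rewrite (_ : abs_approx 0 n = 0) ?subr0 ?mul0r//; apply/eqP; rewrite eq_le h1 h2.
have tp : 0 < `|t| by rewrite normr_gt0.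
rewrite -(ler_pM2r tp); apply: le_trans H.
by rewrite -mulrA mulrDr lerDr mulr_ge0// subr_ge0.
Qed.

Lemma utrig_min h k : utrig h -> utrig k -> utrig (fun x => Num.min (h x) (k x)).
Proof.
move=> uh uk; apply: (@eq_utrig (fun x => 2^-1 * (h x + k x - `|h x - k x|))).
  move=> x; rewrite minEle; case: ifPn => [hk|]; last rewrite -ltNge => /ltW hk.
    by rewrite ler0_norm ?subr_le0//; field.
  by rewrite ger0_norm ?subr_ge0//; field.
by apply: utrigZ; apply: utrigB; [exact: utrigD|apply: utrig_abs; exact: utrigB].
Qed.

Lemma utrig_max h k : utrig h -> utrig k -> utrig (fun x => Num.max (h x) (k x)).
Proof.
move=> uh uk; apply: (@eq_utrig (fun x => -1 * Num.min (-1 * h x) (-1 * k x))).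
  by move=> x; rewrite !mulN1r oppr_min !opprK.
by apply: utrigZ; apply: utrig_min; exact: utrigZ.
Qed.

(** A trigonometric substitute for the squared distance: as long as |dl (x_i - y_i)| <= 1 it lies
    between dl^2 |x - y|^2 / 4 and dl^2 |x - y|^2. *)
Definition sqdist (dl : R) (y x : 'cV[R]_m) : R := \sum_i sin (dl * (x i 0 - y i 0)) ^+ 2.

Lemma trig_sqdist dl y : trig (sqdist dl y).
Proof.
apply: trig_sum => i.
apply: eq_trig (trigD (trig_cst 2^-1) (trig_cos (- 2^-1) (- (2 * dl * y i 0)) ((2 * dl) *: delta_mx i 0))) => x.
have -> : lform ((2 * dl) *: delta_mx i 0) x = 2 * dl * x i 0.
  rewrite /lform; have -> : ((2 * dl) *: delta_mx i 0 : 'cV[R]_m)^T = (2 * dl) *: delta_mx 0 i.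
    by apply/matrixP => a b; rewrite !mxE andbC.
  by rewrite -scalemxAl mxE -rowE mxE.
have -> : - (2 * dl * y i 0) + 2 * dl * x i 0 = (dl * (x i 0 - y i 0)) + (dl * (x i 0 - y i 0)) by ring.
move: (dl * _) => a; by rewrite cosD -!expr2 cos2sin2; field.
Qed.

Lemma sin_sqr_ge (v : R) : `|v| <= 1 -> v ^+ 2 / 4 <= sin v ^+ 2.
Proof.
have H (z : R) : 0 <= z -> z <= 1 -> z ^+ 2 / 4 <= sin z ^+ 2.
  move=> z0 z1; have h := sin_ge_cubic z0.
  have z3 : z ^+ 3 <= z by rewrite -[leRHS]expr1 ler_wiXn2l.
  have {}h : z / 2 <= sin z by lra.
  have -> : z ^+ 2 / 4 = (z / 2) ^+ 2 by field.
  by rewrite ler_sqr ?nnegrE//; lra.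
move=> v1; have [v0|v0] := leP 0 v; first by apply: H => //; rewrite -(ger0_norm v0).
have := H (- v); rewrite sinN !sqrrN; apply; first by rewrite oppr_ge0 ltW.
by rewrite -ltr0_norm.
Qed.

Lemma sin_sqr_le (v : R) : sin v ^+ 2 <= v ^+ 2.
Proof.
have H (z : R) : 0 <= z -> sin z ^+ 2 <= z ^+ 2.
  move=> z0; have [z1|z1] := leP z 1; last first.
    apply: (@le_trans _ _ 1); last by rewrite exprn_ege1// ltW.
    by rewrite -[leRHS](cos2Dsin2 z) lerDr sqr_ge0.
  have h1 := sin_le z0; have h2 := sin_ge_cubic z0.
  have z3 : z ^+ 3 <= z by rewrite -[leRHS]expr1 ler_wiXn2l.
  by rewrite ler_sqr ?nnegrE//; lra.
have [v0|v0] := leP 0 v; first exact: H.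
by have := H (- v); rewrite sinN !sqrrN; apply; rewrite oppr_ge0 ltW.
Qed.

End TrigPolynomials.

(** * Approximation of continuous functions on a box *)

Section BoxApproximation.
Variables (R : realType) (m : nat).
Implicit Types (g h : 'cV[R]_m -> R) (x y : 'cV[R]_m).

Definition box (B : R) x := forall i, `|x i 0| <= B.

Lemma nat_inv_lt (e : R) : 0 < e -> exists k : nat, forall j, (k <= j)%N -> j.+1%:R^-1 < e.
Proof.
move=> e0; exists (Num.truncn e^-1) => j kj; rewrite invf_plt ?posrE//.
by apply: lt_le_trans (truncnS_gt _) _; rewrite ler_nat ltnS.
Qed.

Lemma box_unif_cont g (B e : R) : continuous g -> 0 < e ->
  exists2 eta, 0 < eta & forall x y, box B x -> (forall i, `|y i 0 - x i 0| < eta) -> `|g y - g x| <= e.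
Proof.
move=> cg e0.
pose K := [set v : 'rV[R]_m | forall i, `[- B, B]%classic (v ord0 i)].
have cK : compact K by apply: (@rV_compact R m (fun _ => `[- B, B]%classic)) => i; exact: segment_compact.
pose Q (k : nat) (v : 'rV[R]_m) := forall y, (forall i, `|y i 0 - v 0 i| < k.+1%:R^-1) -> `|g y - g v^T| <= e.
have /compact_near_coveringP/(_ nat \oo Q _)[] := cK.
  move=> v _; have e2 : 0 < e / 2 by rewrite divr_gt0.
  have /nbhs_ballP[d /= d0 dP] := (@cvgr_distC_le _ _ _ _ (nbhs_filter v^T) g (g v^T) (cg v^T) _ e2).
  have d2 : 0 < d / 2 by rewrite divr_gt0.
  have [k kP] := nat_inv_lt d2.
  exists (ball v (d / 2), [set j | (k <= j)%N]) => /=.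
    by split; [exact: nbhsx_ballx|exists k].
  move=> [v' j] /= [vv' kj] y yv'.
  have h1 : `|g v'^T - g v^T| <= e / 2.
    apply: dP; split => // a b; rewrite (ord1 b) !mxE.
    by case: vv' => _ /(_ 0 a); rewrite /ball /= => /lt_trans; apply; lra.
  have h2 : `|g y - g v^T| <= e / 2.
    apply: dP; split => // a b; rewrite (ord1 b) !mxE /ball /=.
    case: vv' => _ /(_ 0 a); rewrite /ball /= => h3.
    have := yv' a; rewrite distrC => h4; have h5 := kP _ kj.
    apply: le_lt_trans (ler_distD (v' 0 a) _ _) _.
    by rewrite [ltRHS]splitr ltrD// (lt_trans h4).
  have := ler_normD (g y - g v^T) (g v^T - g v'^T); rewrite subrKA.
  by rewrite [X in _ <= _ + X]distrC; lra.
move=> k _ /(_ k (leqnn k)) kP; exists k.+1%:R^-1; first by rewrite invr_gt0.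
move=> x y xB xy; have := kP x^T; rewrite /Q trmxK; apply.
  by move=> i; rewrite /= in_itv /= mxE -ler_norml; exact: xB.
by move=> i; rewrite mxE; exact: xy.
Qed.

Lemma box_net (B rho : R) : 0 < B -> 0 < rho -> exists s : seq 'cV[R]_m,
  (forall y, y \in s -> box B y) /\
  (forall x, box B x -> exists2 y, y \in s & forall i, `|x i 0 - y i 0| <= rho).
Proof.
move=> B0 rho0.
pose N := (Num.truncn (2 * B / rho)).+1; have N0 : 0 < N%:R :> R by rewrite ltr0n.
have NP : 2 * B / N%:R <= rho by rewrite ler_pdivrMr// [leRHS]mulrC -ler_pdivrMr// ltW// truncnS_gt.
pose pt (k : {ffun 'I_m -> 'I_N.+1}) : 'cV[R]_m := \col_i (- B + 2 * B * (k i)%:R / N%:R).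
exists [seq pt k | k : {ffun 'I_m -> 'I_N.+1}]; split.
  move=> _ /mapP[k _ ->] i; rewrite mxE.
  have kN : (k i)%:R <= N%:R :> R by rewrite ler_nat -ltnS.
  have : 2 * B * (k i)%:R / N%:R <= 2 * B by rewrite ler_pdivrMr// ler_wpM2l//; lra.
  have : 0 <= 2 * B * (k i)%:R / N%:R by rewrite divr_ge0// mulr_ge0//; lra.
  by rewrite ler_norml; lra.
move=> x xB.
pose t i := (x i 0 + B) * N%:R / (2 * B).
have t0 i : 0 <= t i by rewrite divr_ge0// ?mulr_ge0//; have := xB i; rewrite ler_norml; lra.
have tN i : t i <= N%:R.
  rewrite ler_pdivrMr; last lra.
  by rewrite [leRHS]mulrC ler_wpM2r//; have := xB i; rewrite ler_norml; lra.
have tr i : (Num.truncn (t i) < N.+1)%N.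
  rewrite ltnS -(ler_nat R); by apply: le_trans (tN i); rewrite truncn_le.
pose k := [ffun i => Ordinal (tr i)].
exists (pt k); first by apply: map_f; rewrite mem_enum.
move=> i; rewrite mxE ffunE /=.
have h1 : (Num.truncn (t i))%:R <= t i by rewrite truncn_le.
have h2 : t i <= (Num.truncn (t i))%:R + 1 by rewrite natr1 ltW// truncnS_gt.
have xE : x i 0 = - B + 2 * B * t i / N%:R.
  by rewrite /t; field; rewrite !gt_eqF.
rewrite {1}xE.
have -> : - B + 2 * B * t i / N%:R - (- B + 2 * B * (Num.truncn (t i))%:R / N%:R) =
  2 * B / N%:R * (t i - (Num.truncn (t i))%:R) by field; rewrite gt_eqF.
apply: le_trans NP; rewrite normrM ger0_norm; last by rewrite divr_ge0//; lra.
by rewrite ler_piMr ?ler_norml ?divr_ge0//; lra.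
Qed.

Lemma sqdist_ge0 (dl : R) y x : 0 <= sqdist dl y x.
Proof. by apply: sumr_ge0 => i _; exact: sqr_ge0. Qed.

(* Approximate g by the minimum over a fine net of the functions
   x |-> g y + N sqdist y x, which is a uniform limit of trigonometric sums. *)
Lemma trig_box_approx g (M B e : R) : continuous g -> (forall x, `|g x| <= M) -> 0 < B -> 0 < e ->
  exists t, [/\ trig t, forall x, `|t x| <= M + e & forall x, box B x -> `|t x - g x| <= e].
Proof.
move=> cg gM B0 e0.
have M0 : 0 <= M by apply: le_trans (gM 0).
have e4 : 0 < e / 4 by rewrite divr_gt0.
have [eta eta0 etaP] := box_unif_cont B cg e4.
(* This scale keeps dl (x_i - y_i) in [-1, 1] for x and y in the box, the range of [sin_sqr_ge]. *)
pose dl := (2 * B)^-1; have dl0 : 0 < dl by rewrite invr_gt0 mulr_gt0.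
have lowb x y i : box B x -> box B y -> eta <= `|x i 0 - y i 0| ->
    dl ^+ 2 * eta ^+ 2 / 4 <= sqdist dl y x.
  move=> xB yB xy; rewrite /sqdist (bigD1 i)//=.
  have hi : dl ^+ 2 * eta ^+ 2 / 4 <= sin (dl * (x i 0 - y i 0)) ^+ 2.
    apply: le_trans (sin_sqr_ge _); last first.
      rewrite normrM gtr0_norm// mulrC -ler_pdivlMr// invrK mul1r.
      apply: le_trans (ler_normB _ _) _; have := xB i; have := yB i; lra.
    rewrite exprMn ler_wpM2r ?invr_ge0// ler_wpM2l ?sqr_ge0//.
    by rewrite -[leRHS]real_normK ?num_real// ler_sqr ?nnegrE// ltW.
  by apply: le_trans hi _; rewrite lerDl sumr_ge0// => j _; exact: sqr_ge0.
(* A net point at distance at least eta in some coordinate then pays a penalty of at least 2 M, so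
   it cannot bring the minimum below g x. *)
pose L := 2 * M / (dl ^+ 2 * eta ^+ 2 / 4).
have q0 : 0 < dl ^+ 2 * eta ^+ 2 / 4 by rewrite divr_gt0// mulr_gt0// exprn_gt0.
have L0 : 0 <= L by rewrite divr_ge0// ?mulr_ge0// ltW.
pose c := L * m%:R * dl ^+ 2 + 1.
have c0 : 0 < c by rewrite ltr_wpDl// mulr_ge0 ?sqr_ge0// mulr_ge0.
(* Mesh of the net: below eta for uniform continuity at the nearest net point, at most 1 so that
   rho^2 <= rho, and with rho c <= e / 4 so that the penalty of that point is small. *)
pose rho := Num.min (eta / 2) (Num.min 1 (e / (4 * c))).
have rho0 : 0 < rho by rewrite !lt_min !divr_gt0// ?ltr01// mulr_gt0.
have rho1 : rho <= 1 by rewrite /rho !ge_min lexx orbT.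
have rhoeta : rho < eta.
  by apply: (@le_lt_trans _ _ (eta / 2)); [rewrite /rho ge_min lexx|lra].
have rhoc : rho * c <= e / 4.
  have : rho <= e / (4 * c) by rewrite /rho !ge_min lexx !orbT.
  move=> h; apply: le_trans (ler_wpM2r (ltW c0) h) _.
  by have -> : e / (4 * c) * c = e / 4 by field; rewrite gt_eqF.
have [s [sB sN]] := box_net B0 rho0.
(* The starting value M of the fold, and the cut at - M in [h], give |h| <= M everywhere; on the box
   they are harmless because |g| <= M. *)
pose h0 x := foldr (fun y a => Num.min (g y + L * sqdist dl y x) a) M s.
pose h x := Num.max (- M) (h0 x).
have uh : utrig h.
  apply: utrig_max; first exact: utrig_cst.
  rewrite /h0; elim: (s) => [|y r IH] /=; first exact: utrig_cst.
  apply: utrig_min => //; apply: utrigD; first exact: utrig_cst.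
  by apply: utrigZ; apply: trig_utrig; exact: trig_sqdist.
have hM x : `|h x| <= M.
  have h0M : h0 x <= M by rewrite /h0; elim: (s) => [|y r IH] //=; rewrite ge_min IH orbT.
  by rewrite ler_norml /h le_max lexx /= ge_max h0M andbT; lra.
have low x : box B x -> g x - e / 4 <= h x.
  move=> xB; rewrite /h le_max; apply/orP; right; rewrite /h0.
  have : {in s, forall y, box B y} by [].
  elim: (s) => [|y r IH] rB /=.
    by have := gM x; rewrite ler_norml; lra.
  rewrite le_min IH ?andbT; last by move=> z zr; apply: rB; rewrite inE zr orbT.
  have yB : box B y by apply: rB; rewrite mem_head.
  have [near|/existsNP[i /negP far]] := pselect (forall i, `|x i 0 - y i 0| < eta).
    have := etaP y x yB near; rewrite ler_norml.
    have := mulr_ge0 L0 (sqdist_ge0 dl y x); lra.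
  move: far; rewrite -leNgt => /(lowb _ _ _ xB yB) h1.
  have := ler_wpM2l L0 h1; rewrite {1}/L divfK ?gt_eqF//.
  by have := gM x; have := gM y; rewrite !ler_norml; lra.
have up x : box B x -> h x <= g x + e / 2.
  move=> xB; rewrite /h ge_max; apply/andP; split.
    by have := gM x; rewrite ler_norml; lra.
  have [y ys xy] := sN x xB; have yB := sB y ys.
  have h1 : h0 x <= g y + L * sqdist dl y x.
    rewrite /h0; elim: (s) ys => [//|z r IH]; rewrite inE => /predU1P[<-|yr] /=.
      by rewrite ge_min lexx.
    by rewrite ge_min IH ?orbT.
  have h2 : sqdist dl y x <= m%:R * (dl ^+ 2 * rho).
    apply: (@le_trans _ _ (\sum_(i < m) dl ^+ 2 * rho)); last first.
      by rewrite sumr_const card_ord mulr_natl.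
    apply: ler_sum => i _; apply: le_trans (sin_sqr_le _) _.
    rewrite exprMn ler_wpM2l ?sqr_ge0// -real_normK ?num_real//.
    apply: (@le_trans _ _ (rho ^+ 2)); first by rewrite ler_sqr ?nnegrE// ltW.
    by rewrite expr2 ler_piMr// ltW.
  have h3 : L * sqdist dl y x <= e / 4.
    apply: le_trans (ler_wpM2l L0 h2) _; apply: le_trans rhoc.
    have -> : L * (m%:R * (dl ^+ 2 * rho)) = rho * (L * m%:R * dl ^+ 2) by ring.
    by apply: ler_wpM2l; [exact: ltW|rewrite /c lerDl].
  have h4 : `|g x - g y| <= e / 4.
    by apply: (etaP y x yB) => i; exact: le_lt_trans (xy i) rhoeta.
  by move: h4; rewrite ler_norml; lra.
have e2 : 0 < e / 2 by rewrite divr_gt0.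
have [t tt ht] := uh _ e2; exists t; split => // x.
  by have := ler_normB (h x) (h x - t x); rewrite subKr; have := ht x; have := hM x; lra.
move=> xB; have := low x xB; have := up x xB; have := ht x; rewrite !ler_norml; lra.
Qed.

End BoxApproximation.

(** * Convergence in distribution from characteristic functions *)

Section Levy.
Context (R : realType) (m : nat) d (T : measurableType d) (P : probability T R).
Implicit Types (mu : probability (borel_cV R m) R) (X : nat -> T -> 'cV[R]_m).

Lemma bdm_cont (g : 'cV[R]_m -> R) : continuous g -> (exists M, forall x, `|g x| <= M) ->
  bdm (g : borel_cV R m -> R).
Proof. by move=> cg gM; split => //; exact: continuous_borel_cV. Qed.

Lemma trig_bdm (t : 'cV[R]_m -> R) : trig t -> bdm (t : borel_cV R m -> R).
Proof.
move=> [s sP]; have -> : t = fun x => \sum_(q <- s) q.1.1 * cos (q.1.2 + lform q.2 x) by apply/funext.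
by apply: bdm_sum => q; apply: bdmZ; exact: bdm_cos_form.
Qed.

Lemma measurable_box (B : R) : measurable (box B : set (borel_cV R m)).
Proof.
have -> : (box B : set (borel_cV R m)) = ~` \bigcup_(i : 'I_m) ~` [set x | `|(x : 'cV[R]_m) i 0| <= B].
  rewrite setC_bigcup; apply/seteqP; split => x /= h i; last by move: (h i Logic.I); rewrite setCK.
  by move=> _; rewrite setCK; exact: h.
apply: measurableC; apply: countable_bigcupT_measurable => // i; apply: measurableC.
have mi : measurable_fun [set: borel_cV R m] (fun x : borel_cV R m => `|(x : 'cV[R]_m) i 0|).
  apply: measurableT_comp => //; apply: continuous_borel_cV; exact: coord_continuous.
have mc : measurable_fun [set: borel_cV R m] (fun _ : borel_cV R m => B) by exact: measurable_cst.
have := measurable_fun_ler mi mc.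
by move=> /(_ measurableT [set true] Logic.I); rewrite setTI; congr measurable.
Qed.

Lemma box_tight mu (e : R) : 0 < e -> exists2 B, 0 < B & fine (mu (~` box B)) <= e.
Proof.
move=> e0.
pose F (k : nat) : set (borel_cV R m) := ~` box k.+1%:R.
have mF k : measurable (F k) by apply: measurableC; exact: measurable_box.
have F0 : \bigcap_k F k = set0.
  apply/seteqP; split => // x Fx.
  pose c := \sum_i `|(x : 'cV[R]_m) i 0|.
  have := Fx (Num.truncn c) Logic.I; apply => i.
  apply: (@le_trans _ _ c); last by rewrite ltW// truncnS_gt.
  by rewrite /c (bigD1 i)//= lerDl sumr_ge0.
have nF : nonincreasing_seq F.
  move=> a b ab; apply/subsetPset => x Fx bx; apply: Fx => i.
  by apply: le_trans (bx i) _; rewrite ler_nat.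
have fin0 : (mu (F 0%N) < +oo)%E by exact: le_lt_trans (probability_le1 mu (mF 0%N)) (ltry _).
have mcap : measurable (\bigcap_k F k) by rewrite F0.
have := nonincreasing_cvg_mu fin0 mF mcap nF.
rewrite F0 measure0 => /fine_cvgP[_ /cvgrPdist_le/(_ e e0)[k _ kP]].
exists k.+1%:R => //; have := kP k (leqnn k); rewrite sub0r normrN.
by apply: le_trans; exact: ler_norm.
Qed.

(** The limit law is given and tightness is assumed, so it suffices to compare three quantities: g
    is replaced by a trigonometric polynomial on a box carrying almost all mass of both laws, and
    the expectations of the polynomial converge term by term. *)
Lemma levy mu X :
  (forall n, measurable_fun [set: T] (X n : T -> borel_cV R m)) ->
  (forall e, 0 < e -> exists2 B, 0 < B &
     \forall n \near \oo, fine (P [set w | ~ box B (X n w)]) <= e) ->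
  (forall th u, (fun n => Ex P (fun w => cos (th + lform u (X n w)))) @ \oo -->
     Ex mu (fun x : 'cV[R]_m => cos (th + lform u x))) ->
  cvg_in_distribution P X mu.
Proof.
move=> mX tX cX g cg [M gM].
have bg : bdm (g : borel_cV R m -> R) by apply: bdm_cont => //; exists M.
have bgX n : bdm (fun w => g (X n w)) by exact: (bdm_comp (mX n) bg).
suff H : (fun n => Ex P (fun w => g (X n w))) @ \oo --> Ex mu g.
  rewrite (ExE mu bg); under eq_fun do rewrite ExE//.
  by apply: cvg_EFin; [exact: nearW|exact: H].
have M0 : 0 <= M by apply: le_trans (gM 0).
apply/cvgrPdist_le => e e0.
(* A bound for the distance of g and its approximant off the box. *)
pose q := 2 * M + e + 1; have q0 : 0 < q by rewrite /q; lra.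
pose e1 := Num.min (e / 8) (e / (8 * q)).
have e10 : 0 < e1 by rewrite lt_min !divr_gt0// mulr_gt0.
have e18 : e1 <= e / 8 by rewrite /e1 ge_min lexx.
have e1q : q * e1 <= e / 8.
  have : e1 <= e / (8 * q) by rewrite /e1 ge_min lexx orbT.
  move=> /(ler_wpM2l (ltW q0)) h; apply: le_trans h _.
  by have -> : q * (e / (8 * q)) = e / 8 by field; rewrite gt_eqF.
have [B1 B10 muB] := box_tight mu e10.
have [B2 B20 XB] := tX _ e10.
pose B := Num.max B1 B2; have B0 : 0 < B by rewrite lt_max B10.
have boxS B' : B' <= B -> [set x : 'cV[R]_m | ~ box B x] `<=` [set x | ~ box B' x].
  by move=> BB x nx bx; apply: nx => i; apply: le_trans (bx i) BB.
have [t [tt tM tg]] := trig_box_approx cg gM B0 e10.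
have bt := trig_bdm tt.
have btX n : bdm (fun w => t (X n w)) by exact: (bdm_comp (mX n) bt).
have mBc B' : measurable (~` (box B' : set (borel_cV R m))) by apply: measurableC; exact: measurable_box.
have pt x : `|t x - g x| <= e1 + q * \1_(~` (box B : set (borel_cV R m))) x.
  rewrite indicE; have [xB|xB] := pselect (box B x).
    rewrite memNset ?mulr0 ?addr0; first exact: tg.
    by move=> /(_ xB).
  rewrite mem_set// mulr1; have := ler_normB (t x) (g x); have := tM x; have := gM x.
  rewrite /q; lra.
have bR : bdm (fun x : borel_cV R m => e1 + q * \1_(~` (box B : set (borel_cV R m))) x).
  by apply: bdmD; [exact: bdm_cst|apply: bdmZ; exact: bdm_indic].
have tailmu : `|Ex mu t - Ex mu g| <= e / 4.
  rewrite -ExB//; apply: le_trans (Ex_abs mu (bdmB bt bg) bR pt) _.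
  rewrite ExD ?ExZ ?Ex_cst ?Ex_indic//; [|exact: bdm_indic|exact: bdm_cst|by apply: bdmZ; exact: bdm_indic].
  have : fine (mu (~` box B)) <= e1.
    apply: le_trans muB; apply: fine_le; rewrite ?fin_num_measure//; try exact: mBc.
    by apply: le_measure; rewrite ?inE//; apply: boxS; rewrite /B le_max lexx.
  by move=> /(ler_wpM2l (ltW q0)); lra.
have tailX : \forall n \near \oo, `|Ex P (fun w => t (X n w)) - Ex P (fun w => g (X n w))| <= e / 4.
  near=> n; rewrite -ExB//.
  have mA B' : measurable [set w | ~ box B' (X n w)].
    by have := mX n measurableT _ (mBc B'); rewrite setTI.
  have bRX := bdm_comp (mX n) bR.
  apply: le_trans (Ex_abs P (bdmB (btX n) (bgX n)) bRX (fun w => pt (X n w))) _.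
  have bI : bdm (fun w => \1_(~` (box B : set (borel_cV R m))) (X n w) : R).
    by apply: (bdm_comp (mX n)); exact: bdm_indic.
  rewrite ExD ?ExZ ?Ex_cst//; [|exact: bdm_cst|exact: bdmZ].
  have -> : Ex P (fun w => \1_(~` (box B : set (borel_cV R m))) (X n w)) = fine (P [set w | ~ box B (X n w)]).
    by rewrite -Ex_indic.
  have : fine (P [set w | ~ box B (X n w)]) <= e1.
    apply: (@le_trans _ _ (fine (P [set w | ~ box B2 (X n w)]))); last by near: n.
    apply: fine_le; rewrite ?fin_num_measure//.
    apply: le_measure; rewrite ?inE// => w; apply: (boxS B2); by rewrite /B le_max lexx orbT.
  by move=> /(ler_wpM2l (ltW q0)); lra.
have ct : (fun n => Ex P (fun w => t (X n w))) @ \oo --> Ex mu t.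
  have [s sP] := tt.
  have b1 q' : bdm (fun x : borel_cV R m => q'.1.1 * cos (q'.1.2 + lform q'.2 x)) by move=> *; apply: bdmZ; exact: bdm_cos_form.
  have -> : Ex mu t = \sum_(q <- s) q.1.1 * Ex mu (fun x : 'cV[R]_m => cos (q.1.2 + lform q.2 x)).
    rewrite (eq_Ex mu sP) Ex_sum//; apply: eq_bigr => q' _; rewrite ExZ//; exact: bdm_cos_form.
  have -> : (fun n => Ex P (fun w => t (X n w))) = fun n => \sum_(q <- s) q.1.1 * Ex P (fun w => cos (q.1.2 + lform q.2 (X n w))).
    apply/funext => n; rewrite (eq_Ex P (fun w => sP (X n w))) Ex_sum; last by move=> q'; exact: (bdm_comp (mX n) (b1 q')).
    apply: eq_bigr => q' _; rewrite ExZ//; exact: (bdm_comp (mX n) (bdm_cos_form _ _)).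
  elim: (s) => [|q' r IH].
    by rewrite big_nil; under eq_fun do rewrite big_nil; exact: cvg_cst.
  rewrite big_cons; under eq_fun do rewrite big_cons.
  apply: cvgD IH; apply: cvgM; [exact: cvg_cst|exact: cX].
have e4 : 0 < e / 4 by rewrite divr_gt0.
move/cvgrPdist_le/(_ _ e4): ct => ct.
near=> n.
have h1 : `|Ex mu t - Ex P (fun w => t (X n w))| <= e / 4 by near: n.
have h2 : `|Ex P (fun w => t (X n w)) - Ex P (fun w => g (X n w))| <= e / 4 by near: n.
move: h1 h2 tailmu; move: (Ex mu t) (Ex mu g) (Ex P _) (Ex P _) => a b c c'.
rewrite !ler_norml; lra.
Unshelve. all: by end_near.
Qed.

End Levy.

(** * Series of eventually constant sequences *)

Section EventuallyConstantSeries.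
Variables (R : realType) (V : normedModType R) (K : nat) (T : nat -> R) (s : R) (h : nat -> V).
Hypothesis K0 : (0 < K)%N.
Hypothesis hT : (fun k => k%:R * T k) @ \oo --> (0 : R).
Hypothesis hs : (fun M => \sum_(1 <= k < M) T k) @ \oo --> s.
Hypothesis hK : forall k, (K <= k)%N -> h k = h K.

(** Here T k plays the role of the mass above k, possibly signed, and s of the sum of all T k.
    Against a function constant from K on, index K receives everything that remains: the rest of the
    sum of tails, respectively the mass T (K - 1) of all indices from K on. *)
Definition tail_wt (k : nat) : R := if (k < K)%N then T k else s - \sum_(1 <= j < K) T j.
Definition mass_wt (k : nat) : R := if (k < K)%N then T k.-1 - T k else T k.-1.

Lemma tails_cvg0 : T @ \oo --> (0 : R).
Proof.
apply: (@cvg_le_dist0 _ _ (fun k => `|k%:R * T k|)).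
  exists 1%N => // k /= k1; rewrite subr0 normrM ler_peMl// normr_nat ler1n; lia.
by rewrite -(normr0 R); exact: cvg_norm hT.
Qed.

Lemma near_cvg (W : normedModType R) (a b : nat -> W) (l : W) :
  (\forall n \near \oo, a n = b n) -> b @ \oo --> l -> a @ \oo --> l.
Proof. by move=> ab; apply: cvg_trans; apply: near_eq_cvg; apply: filterS ab => n ->. Qed.

Lemma tail_series_cvg :
  (fun M => \sum_(1 <= k < M) T k *: h k) @ \oo --> \sum_(1 <= k < K.+1) tail_wt k *: h k.
Proof.
rewrite big_nat_recr//= {2}/tail_wt ltnn.
rewrite (eq_big_nat _ _ (F2 := fun k => T k *: h k)); last first.
  by move=> k /andP[_ kK]; rewrite /tail_wt kK.
apply: (@near_cvg _ _ (fun M => \sum_(1 <= k < K) T k *: h k + (\sum_(1 <= k < M) T k - \sum_(1 <= j < K) T j) *: h K)).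
  exists K => // M /= KM; rewrite (big_cat_nat (n := K))//=; congr (_ + _).
  rewrite [X in X - _](big_cat_nat (n := K))//= addrAC subrr add0r scaler_suml.
  by apply: eq_big_nat => k /andP[Kk _]; rewrite hK.
apply: cvgD; first exact: cvg_cst.
apply: cvgZ; last exact: cvg_cst.
by apply: cvgB => //; exact: cvg_cst.
Qed.

Lemma mass_series_cvg :
  (fun M => \sum_(1 <= k < M) (T k.-1 - T k) *: h k) @ \oo --> \sum_(1 <= k < K.+1) mass_wt k *: h k.
Proof.
rewrite big_nat_recr//= {2}/mass_wt ltnn.
rewrite (eq_big_nat _ _ (F2 := fun k => (T k.-1 - T k) *: h k)); last first.
  by move=> k /andP[_ kK]; rewrite /mass_wt kK.
rewrite -cvg_shiftS /=.
apply: (@near_cvg _ _ (fun M => \sum_(1 <= k < K) (T k.-1 - T k) *: h k + (T K.-1 - T M) *: h K)).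
  exists K => // M /= KM; rewrite (big_cat_nat (n := K))//=; last lia.
  congr (_ + _).
  rewrite (eq_big_nat _ _ (F2 := fun k => (T k.-1 - T k) *: h K)); last first.
    by move=> k /andP[Kk _]; rewrite hK.
  rewrite -scaler_suml; congr (_ *: _).
  rewrite -(prednK K0) in KM *; rewrite big_add1 /=.
  rewrite -[RHS]opprB -(telescope_sumr T) -?sumrN; last lia.
  by apply: eq_bigr => i _; rewrite opprB.
apply: cvgD; first exact: cvg_cst.
apply: cvgZ; last exact: cvg_cst.
rewrite -[X in _ --> X]subr0; apply: cvgB; [exact: cvg_cst|exact: tails_cvg0].
Qed.

Lemma cum_seriesE M : \sum_(1 <= k < M.+1) (T k.-1 - T k) *: (\sum_(1 <= j < k) h j) =
  \sum_(1 <= j < M) T j *: h j - T M *: \sum_(1 <= j < M) h j.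
Proof.
elim: M => [|M IH]; first by rewrite !big_geq// scaler0 subr0.
case: M IH => [|M] IH; first by rewrite big_nat1 !big_geq// !scaler0 subr0.
rewrite big_nat_recr//= IH [in RHS]big_nat_recr//= [\sum_(1 <= j < M.+2) h j]big_nat_recr//=.
rewrite scalerBl !scalerDr; move: (\sum_(_ <= _ < _) _) => a; move: (T _ *: \sum_(_ <= _ < _) _) => b.
rewrite opprD !addrA; congr (_ - _ - _).
by rewrite -!addrA; congr (_ + _); rewrite addrA addNr add0r.
Qed.

(** Summation by parts turns the cumulated sums of the first block of [F_stat] into a series against
    the tails. The boundary term T M times a sum of M bounded terms vanishes because M T M tends to
    0. *)
Lemma cum_series_cvg :
  (fun M => \sum_(1 <= k < M) (T k.-1 - T k) *: (\sum_(1 <= j < k) h j)) @ \oo -->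
  \sum_(1 <= k < K.+1) tail_wt k *: h k.
Proof.
rewrite -cvg_shiftS /=.
apply: (@near_cvg _ _ (fun M => \sum_(1 <= j < M) T j *: h j - T M *: \sum_(1 <= j < M) h j)).
  by exists 0%N => // M _; exact: cum_seriesE.
rewrite -[X in _ --> X]subr0; apply: cvgB; first exact: tail_series_cvg.
pose C := \sum_(1 <= k < K.+1) `|h k|.
have hC k : (0 < k)%N -> `|h k| <= C.
  move=> k0; pose k' := minn k K.
  have -> : h k = h k' by rewrite /k'; case: (leqP k K) => kK //; rewrite hK// ltnW.
  rewrite /C (big_rem k')/=; last by rewrite mem_index_iota /k'; lia.
  by rewrite lerDl sumr_ge0.
have C0 : 0 <= C by exact: sumr_ge0.
apply/norm_cvg0P; apply: (@cvg_le_dist0 _ _ (fun M => C * `|M%:R * T M|)).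
  near=> M; rewrite subr0 normr_id normrZ.
  have : `|\sum_(1 <= j < M) h j| <= C * M%:R.
    apply: le_trans (ler_norm_sum _ _ _) _.
    apply: (@le_trans _ _ (\sum_(1 <= j < M) C)).
      by rewrite !big_nat; apply: ler_sum => j /andP[j0 _]; exact: hC.
    by rewrite sumr_const_nat -[leLHS]mulr_natr ler_wpM2l// ler_nat leq_subr.
  move=> /(ler_wpM2l (normr_ge0 (T M))) /le_trans; apply.
  rewrite normrM normr_nat.
  by have -> : `|T M| * (C * M%:R) = C * (M%:R * `|T M|) by ring.
rewrite -(mulr0 C) -{1}(normr0 R); apply: cvgM; first exact: cvg_cst.
exact: cvg_norm hT.
Unshelve. all: by end_near.
Qed.

End EventuallyConstantSeries.

Lemma natmul_expr_cvg0 (R : realType) (q : R) : 0 <= q -> q < 1 ->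
  (fun k => k%:R * q ^+ k) @ \oo --> (0 : R).
Proof.
move=> q0 q1; have [->|qn0] := eqVneq q 0.
  apply: (@near_cvg R R _ (fun _ => 0)); last exact: cvg_cst.
  by exists 1%N => // k /= k1; rewrite expr0n eqn0Ngt k1 mulr0.
have qp : 0 < q by rewrite lt_neqAle eq_sym qn0.
(* Write q^k as r^k r^k: Bernoulli's inequality bounds k r^k, and the other factor tends to 0. *)
pose r := Num.sqrt q; have r0 : 0 < r by rewrite sqrtr_gt0.
have r2 : r ^+ 2 = q by rewrite sqr_sqrtr.
have r1 : r < 1 by rewrite -(@ltr_sqr _ r 1) ?nnegrE// ?ltW// r2 expr1n.
pose e := r^-1 - 1; have e0 : 0 < e by rewrite subr_gt0 invf_gt1.
have B k : k%:R * r ^+ k <= e^-1.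
  have : 1 + k%:R * e <= (r^-1) ^+ k.
    elim: k => [|k IH]; first by rewrite mul0r addr0 expr0.
    rewrite exprSr; have -> : r^-1 = 1 + e by rewrite /e addrC subrK.
    have h : 0 <= 1 + e by rewrite addr_ge0// ltW.
    apply: (@le_trans _ _ ((1 + k%:R * e) * (1 + e))); last first.
      by rewrite ler_wpM2r//; move: IH; have -> : r^-1 = 1 + e by rewrite /e addrC subrK.
    rewrite -natr1; have := sqr_ge0 e; have := ler0n R k; move: (k%:R) => a a0 e2.
    have := mulr_ge0 a0 e2; rewrite expr2; lra.
  rewrite exprVn => h; rewrite -(ler_pM2r e0) mulVf ?gt_eqF// mulrAC.
  rewrite -ler_pdivlMr ?exprn_gt0// mul1r; apply: le_trans h.
  by rewrite lerDr.
apply: (@cvg_le_dist0 _ _ (fun k => e^-1 * r ^+ k)).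
  apply: nearW => k; rewrite subr0 ger0_norm ?mulr_ge0 ?exprn_ge0//.
  by rewrite -r2 -exprM mulnC exprM expr2 mulrA ler_wpM2r// ?exprn_ge0// ltW.
rewrite -(mulr0 e^-1); apply: cvgM; first exact: cvg_cst.
by apply: cvg_expr; rewrite gtr0_norm.
Qed.

(** * Tails of the limiting degree distribution *)

Section SurvivalSeries.
Variables (R : realType) (f : nat -> R) (lam : R) (K : nat).
Hypothesis f0 : forall k, (0 < k)%N -> 0 < f k.
Hypothesis K0 : (0 < K)%N.
Hypothesis fK : forall k, (K <= k)%N -> f k = f K.
Hypothesis malP : is_malthusian f lam.
Local Notation pi_ := (surv f lam).

Lemma mal_lam0 : 0 < lam. Proof. by case: malP. Qed.

Lemma surv_sum_cvg : (fun M => \sum_(1 <= k < M) pi_ k) @ \oo --> (1 : R).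
Proof. by case: malP. Qed.

Lemma surv_natmul_cvg0 : (fun k => k%:R * pi_ k) @ \oo --> (0 : R).
Proof.
have l0 := mal_lam0; have fp := f0 K0.
pose q := f K / (lam + f K).
have q0 : 0 <= q by rewrite divr_ge0// ?addr_ge0// ltW.
have q1 : q < 1 by rewrite ltr_pdivrMr ?addr_gt0// mul1r ltrDr.
have qp : 0 < q by rewrite divr_gt0// addr_gt0.
have E k : (K <= k)%N -> pi_ k = pi_ K / q ^+ K * q ^+ k.
  elim: k => [|k IH]; first by rewrite leqn0 => /eqP KE; move: K0; rewrite KE.
  rewrite leq_eqVlt => /predU1P[<-|]; first by rewrite divfK// expf_neq0// gt_eqF.
  by rewrite ltnS => Kk; rewrite survS IH// fK ?(leq_trans Kk)// -/q exprSr mulrA.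
apply: (@near_cvg R R _ (fun k => pi_ K / q ^+ K * (k%:R * q ^+ k))).
  by exists K => // k /= Kk; rewrite E// mulrCA.
rewrite -(mulr0 (pi_ K / q ^+ K)); apply: cvgM; first exact: cvg_cst.
exact: natmul_expr_cvg0.
Qed.

Lemma surv_cvg0 : pi_ @ \oo --> (0 : R).
Proof. exact: (tails_cvg0 K0 surv_natmul_cvg0). Qed.

(** From K on, lam [surv l] = f(K) ([surv (l - 1)] - [surv l]), so the rest of the Malthusian series
    telescopes to f(K) / lam times the tail at K - 1. *)
Lemma malthus_finite : \sum_(1 <= l < K) pi_ l + pi_ K.-1 * f K / lam = 1.
Proof.
have l0 := mal_lam0.
have H : (fun M => \sum_(1 <= k < M.+1) pi_ k) @ \oo --> \sum_(1 <= l < K) pi_ l + (f K / lam) * (pi_ K.-1 - 0).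
  apply: (@near_cvg R R _ (fun M => \sum_(1 <= l < K) pi_ l + (f K / lam) * (pi_ K.-1 - pi_ M))).
    exists K => // M /= KM; rewrite (big_cat_nat (n := K))//=; last lia.
    congr (_ + _); rewrite -(prednK K0) in KM *; rewrite big_add1 /=.
    rewrite -opprB -(telescope_sumr pi_); last lia.
    rewrite -sumrN big_distrr/= !big_nat; apply: eq_bigr => l /andP[Kl lM].
    rewrite opprB -mulrA mulrCA.
    have := surv_rec f0 l0 l; rewrite fK; last lia.
    by rewrite prednK// => ->; rewrite mulKf// gt_eqF.
  apply: cvgD; first exact: cvg_cst.
  apply: cvgM; first exact: cvg_cst.
  by apply: cvgB; [exact: cvg_cst|exact: surv_cvg0].
have := surv_sum_cvg; rewrite -cvg_shiftS => H1.
have E : 1 = \sum_(1 <= l < K) pi_ l + (f K / lam) * (pi_ K.-1 - 0) by exact: cvg_unique H1 H.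
by rewrite [RHS]E subr0; congr (_ + _); ring.
Qed.

Lemma limit_tailE k : limit_tail f lam k = pi_ k.
Proof.
have l0 := mal_lam0.
apply: cvg_lim => //; rewrite -cvg_shiftS.
apply: (@near_cvg R R _ (fun M => pi_ k - pi_ M)).
  exists k => // M /= kM; rewrite big_add1 /=.
  under eq_bigr do rewrite limit_degE//.
  rewrite -opprB -(telescope_sumr pi_)// -sumrN.
  by apply: eq_bigr => l _; rewrite opprB.
by rewrite -[X in _ --> X]subr0; apply: cvgB; [exact: cvg_cst|exact: surv_cvg0].
Qed.

End SurvivalSeries.

Lemma size_le_sumn (s : seq nat) : (forall d, d \in s -> (0 < d)%N) -> (size s <= sumn s)%N.
Proof.
elim: s => //= a s IH s1; have := s1 a (mem_head _ _).
have := IH (fun x xs => s1 x (mem_behead (s := a :: s) xs)); lia.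
Qed.

(** * Tails of the empirical degree distribution *)

Section DegreeSeries.
Variables (R : realType) (D : seq nat).
Hypothesis D0 : (0 < size D)%N.
Hypothesis D1 : forall d, d \in D -> (0 < d)%N.
Hypothesis Dsum : sumn D = (2 * size D).-1.
Local Notation n := (size D).

Definition deg_above (k : nat) : R := (count (fun d => (k < d)%N) D)%:R / n%:R.

Lemma deg_above_eq0 k : (sumn D <= k)%N -> deg_above k = 0.
Proof.
move=> Dk; rewrite /deg_above (_ : count _ _ = 0%N) ?mul0r//.
apply/eqP; rewrite -leqn0 leqNgt -has_count; apply/hasPn => d dD; rewrite -leqNgt.
apply: leq_trans Dk; elim: (D) dD => //= a s IH; rewrite inE => /predU1P[->|/IH]; lia.
Qed.

Lemma deg_above_natmul_cvg0 : (fun k => k%:R * deg_above k) @ \oo --> (0 : R).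
Proof.
apply: (@near_cvg R R _ (fun _ => 0)); last exact: cvg_cst.
by exists (sumn D) => // k /= Dk; rewrite deg_above_eq0// mulr0.
Qed.

Lemma deg_above0 : deg_above 0 = 1.
Proof.
rewrite /deg_above (_ : count _ _ = n) ?divff// ?pnatr_eq0 -?lt0n//.
by apply/eqP; rewrite -all_count; apply/allP => d; exact: D1.
Qed.

(** The sum of the tails from 1 on is the mean of d - 1. The n - 1 edges and the loose edge of the
    root give total degree 2 n - 1, so the value is (n - 1) / n whatever the shape of the tree. *)
Lemma deg_above_sum_cvg : (fun M => \sum_(1 <= k < M) deg_above k) @ \oo --> (1 - n%:R^-1 : R).
Proof.
apply: (@near_cvg R R _ (fun _ => 1 - n%:R^-1)); last exact: cvg_cst.
exists (sumn D).+1 => // M /= DM.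
have nn : n%:R != 0 :> R by rewrite pnatr_eq0 -lt0n.
have E : (\sum_(1 <= k < M) count (fun d => k < d) D = sumn D - n)%N.
  have sD : forall d, d \in D -> (d <= M)%N.
    move=> d dD; apply: leq_trans (ltnW DM); elim: (D) dD => //= a s IH; rewrite inE => /predU1P[->|/IH]; lia.
  elim: (D) D1 sD => [|d s IH] s1 sM /=; first by rewrite big1.
  rewrite big_split /= IH; last 2 first.
  - by move=> x xs; apply: s1; rewrite inE xs orbT.
  - by move=> x xs; apply: sM; rewrite inE xs orbT.
  have d1 := s1 d (mem_head _ _); have dM := sM d (mem_head _ _).
  have -> : (\sum_(1 <= k < M) (k < d) = d.-1)%N.
    rewrite (big_cat_nat (n := d))//= [X in (_ + X)%N](eq_big_nat _ _ (F2 := fun _ => 0%N)); last first.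
      by move=> k /andP[dk _]; rewrite ltnNge dk.
    rewrite big1_eq addn0.
    rewrite (eq_big_nat _ _ (F2 := fun _ => 1%N)); last by move=> k /andP[_ ->].
    by rewrite sum_nat_const_nat muln1 subn1.
  have ss : (size s <= sumn s)%N by apply: size_le_sumn => x xs; apply: s1; rewrite inE xs orbT.
  lia.
rewrite /deg_above -mulr_suml -natr_sum E Dsum.
have -> : ((2 * n).-1 - n)%N = n.-1 by lia.
have -> : n.-1%:R = n%:R - 1 :> R by rewrite -[in RHS](prednK D0) -natr1 addrK.
by field.
Qed.

Lemma deg_prop_above (Ds : nat -> seq nat) m k : Ds m = D -> size D = m -> (0 < k)%N ->
  deg_prop R Ds m k = deg_above k.-1 - deg_above k.
Proof.
move=> DE Dm k0; rewrite -Dm in DE *; rewrite /deg_prop /deg_count /deg_above DE -mulrBl; congr (_ / _).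
rewrite -[LHS]addr0 -(subrr (count (fun d => (k < d)%N) D)%:R) addrA -natrD; congr (_%:R - _).
rewrite -count_predUI [X in (_ + X)%N](_ : _ = 0%N) ?addn0; last first.
  apply/eqP; rewrite -leqn0 leqNgt -has_count; apply/hasPn => d _ /=.
  by case: eqVneq => //= ->; rewrite ltnn.
by apply: eq_count => d /=; rewrite eq_sym; lia.
Qed.

Lemma deg_tail_above (Ds : nat -> seq nat) m k : Ds m = D -> size D = m ->
  deg_tail R Ds m k = deg_above k.
Proof.
move=> DE Dm; apply: cvg_lim => //; rewrite -cvg_shiftS.
apply: (@near_cvg R R _ (fun _ => deg_above k)); last exact: cvg_cst.
exists (sumn D + k)%N => // M /= kM; rewrite big_add1 /=.
rewrite (eq_big_nat _ _ (F2 := fun l => deg_above l - deg_above l.+1)); last first.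
  by move=> l _; rewrite (deg_prop_above DE Dm).
have -> : deg_above k = deg_above k - deg_above M by rewrite (@deg_above_eq0 M) ?subr0//; lia.
rewrite -opprB -(telescope_sumr deg_above); last lia.
by rewrite -sumrN; apply: eq_bigr => l _; rewrite opprB.
Qed.

End DegreeSeries.

Section MatrixLimits.
Variable R : realType.

Lemma cvg_col_mx m1 m2 (a : nat -> 'cV[R]_m1) (b : nat -> 'cV[R]_m2) (la : 'cV[R]_m1) (lb : 'cV[R]_m2) :
  a @ \oo --> la -> b @ \oo --> lb -> (fun n => col_mx (a n) (b n)) @ \oo --> col_mx la lb.
Proof.
move=> /cvg_ballP ha /cvg_ballP hb; apply/cvg_ballP => e e0.
near=> n; split => // i j; rewrite !mxE; case: splitP => k _.
  have : ball la e (a n) by near: n; exact: ha.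
  by case=> _; apply.
have : ball lb e (b n) by near: n; exact: hb.
by case=> _; apply.
Unshelve. all: by end_near.
Qed.

Lemma sum_col_mx m1 m2 (I : Type) (r : seq I) (a : I -> 'cV[R]_m1) (b : I -> 'cV[R]_m2) :
  \sum_(i <- r) col_mx (a i) (b i) = col_mx (\sum_(i <- r) a i) (\sum_(i <- r) b i).
Proof.
elim: r => [|i r IH]; first by rewrite !big_nil col_mx0.
by rewrite !big_cons IH add_col_mx.
Qed.

Lemma cvg_scalar_mx (a : nat -> R) (la : R) : a @ \oo --> la ->
  (fun n => (a n)%:M : 'cV[R]_1) @ \oo --> (la%:M : 'cV[R]_1).
Proof.
move=> /cvg_ballP ha; apply/cvg_ballP => e e0.
near=> n; split => // i j; rewrite !mxE (ord1 i) (ord1 j) !mulr1n.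
by near: n; exact: ha.
Unshelve. all: by end_near.
Qed.

End MatrixLimits.

(** * Score, likelihood and limit matrices as finite sums *)

Section SeriesValues.
Variables (R : realType) (K : nat) (D : seq nat) (Ds : nat -> seq nat) (m : nat).
Hypothesis K0 : (0 < K)%N.
Hypothesis D0 : (0 < size D)%N.
Hypothesis D1 : forall d, d \in D -> (0 < d)%N.
Hypothesis Dsum : sumn D = (2 * size D).-1.
Hypothesis DE : Ds m = D.
Hypothesis Dm : size D = m.

Definition deg_tw (k : nat) : R := tail_wt K (deg_above R D) (1 - m%:R^-1) k.
Definition deg_mw (k : nat) : R := mass_wt K (deg_above R D) k.

Let Dh : (fun k => k%:R * deg_above R D k) @ \oo --> (0 : R) .
Proof. exact: deg_above_natmul_cvg0. Qed.
Let Ds' : (fun M => \sum_(1 <= k < M) deg_above R D k) @ \oo --> (1 - m%:R^-1 : R).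
Proof. by rewrite -Dm; exact: deg_above_sum_cvg. Qed.

Lemma deg_sumE (V : normedModType R) (h : nat -> V) : (forall k, (K <= k)%N -> h k = h K) ->
  deg_sum h Ds m = m%:R *: \sum_(1 <= k < K.+1) deg_mw k *: h k.
Proof.
move=> hK; apply: cvg_lim => //.
have mn : m%:R != 0 :> R by rewrite -Dm pnatr_eq0 -lt0n.
apply: (@near_cvg R V _ (fun M => m%:R *: \sum_(1 <= k < M) (deg_above R D k.-1 - deg_above R D k) *: h k)).
  apply: nearW => M; rewrite scaler_sumr !big_nat; apply: eq_bigr => k /andP[k1 _].
  rewrite -(deg_prop_above R D0 Dsum DE Dm k1) /deg_prop scalerA mulrCA mulfV// mulr1.
  by rewrite scaler_nat.
by apply: cvgZl_tmp; exact: (mass_series_cvg K0 Dh hK).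
Qed.

Lemma tail_seriesE (V : normedModType R) (h : nat -> V) : (forall k, (K <= k)%N -> h k = h K) ->
  \sum_(1 <= k <oo) deg_tail R Ds m k *: h k = \sum_(1 <= k < K.+1) deg_tw k *: h k.
Proof.
move=> hK; apply: cvg_lim => //; under eq_fun do under eq_bigr do rewrite (deg_tail_above R D0 Dsum _ DE Dm).
exact: (tail_series_cvg K0 Ds' hK).
Qed.

Lemma pseudo_scoreE d (f : nat -> R) (df : nat -> 'cV[R]_d) :
  (forall k, (K <= k)%N -> f k = f K) -> (forall k, (K <= k)%N -> df k = df K) ->
  pseudo_score f df Ds m = \sum_(1 <= k < K.+1) deg_tw k *: ((f k)^-1 *: df k) -
    (\sum_(1 <= k < K.+1) deg_mw k * f k)^-1 *: \sum_(1 <= k < K.+1) deg_mw k *: df k.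
Proof.
move=> fK dfK; rewrite /pseudo_score; congr (_ - _).
  rewrite -(@tail_seriesE _ (fun k => (f k)^-1 *: df k)); last by move=> k Kk; rewrite fK// dfK.
  by congr (limn _); apply/funext => M; apply: eq_bigr => k _; rewrite scalerA.
rewrite deg_sumE// deg_sumE//.
have mn : m%:R != 0 :> R by rewrite -Dm pnatr_eq0 -lt0n.
rewrite scalerA; congr (_ *: _); rewrite invfM mulrAC mulVf// mul1r.
by [].
Qed.

Lemma pseudo_loglikE (f : nat -> R) : (forall k, (0 < k)%N -> 0 < f k) ->
  (forall k, (K <= k)%N -> f k = f K) ->
  pseudo_loglik f Ds m = \sum_(1 <= k < K.+1) deg_tw k * ln (f k) -
    ln (m%:R * \sum_(1 <= k < K.+1) deg_mw k * f k).
Proof.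
move=> f0 fK; rewrite /pseudo_loglik deg_sumE//; congr (_ - _).
rewrite -(@tail_seriesE R^o (fun k => ln (f k))); last by move=> k Kk; rewrite fK.
by congr (limn _); apply/funext => M; apply: eq_bigr => k _; rewrite mulrC.
Qed.

End SeriesValues.

Section LimitValues.
Variables (R : realType) (K : nat) (f : nat -> R) (lam : R) (d : nat) (df : nat -> 'cV[R]_d).
Hypothesis K0 : (0 < K)%N.
Hypothesis f0 : forall k, (0 < k)%N -> 0 < f k.
Hypothesis fK : forall k, (K <= k)%N -> f k = f K.
Hypothesis dfK : forall k, (K <= k)%N -> df k = df K.
Hypothesis malP : is_malthusian f lam.

Definition lim_tw (k : nat) : R := tail_wt K (surv f lam) 1 k.
Definition lim_mw (k : nat) : R := mass_wt K (surv f lam) k.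

Lemma V0_matrixE : V0_matrix f df lam =
  let b := \sum_(1 <= k < K.+1) lim_tw k *: ((f k)^-1 *: df k) in
  \sum_(1 <= k < K.+1) lim_tw k *: (((f k)^-1 *: df k) *m ((f k)^-1 *: df k)^T) - b *m b^T.
Proof.
rewrite /V0_matrix /=.
have gK k : (K <= k)%N -> (f k)^-1 *: df k = (f K)^-1 *: df K by move=> Kk; rewrite fK// dfK.
have -> : \sum_(1 <= k <oo) (limit_tail f lam k / f k *: df k) = \sum_(1 <= k < K.+1) lim_tw k *: ((f k)^-1 *: df k).
  apply: cvg_lim => //; have := tail_series_cvg K0 (surv_sum_cvg malP) gK.
  apply: near_cvg; apply: nearW => M; apply: eq_bigr => k _.
  by rewrite (limit_tailE f0 K0 fK malP) scalerA.
congr (_ - _); apply: cvg_lim => //.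
have ggK k : (K <= k)%N -> ((f k)^-1 *: df k) *m ((f k)^-1 *: df k)^T = ((f K)^-1 *: df K) *m ((f K)^-1 *: df K)^T by move=> Kk; rewrite gK.
have := tail_series_cvg K0 (surv_sum_cvg malP) ggK.
apply: near_cvg; apply: nearW => M; apply: eq_bigr => k _.
rewrite (limit_tailE f0 K0 fK malP) linearZ /= -scalemxAl -scalemxAr !scalerA; congr (_ *: _).
by rewrite expr2 invfM mulrA.
Qed.

(** The equilibrium identity f(k) p_k = lam p_{>k}; at k = K, where all larger degrees are
    collapsed, it is the Malthusian equation. It yields s3 = lam, and s2 = lam times the sum of the
    df / f against the tails. *)
Lemma lim_mw_tw k : (0 < k)%N -> (k <= K)%N -> lim_mw k * f k = lam * lim_tw k.
Proof.
move=> k0 kK; have l0 := mal_lam0 malP; rewrite /lim_mw /lim_tw /mass_wt /tail_wt; case: ifP => kK1.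
  by have := surv_rec f0 l0 k.-1; rewrite prednK// mulrC => ->.
have -> : k = K by lia.
have := malthus_finite f0 K0 fK malP; move: (\sum_(_ <= _ < _) _) => a aE.
have -> : 1 - a = surv f lam K.-1 * f K / lam by rewrite -aE; ring.
by field; rewrite gt_eqF.
Qed.

Lemma lim_tw_sum : \sum_(1 <= k < K.+1) lim_tw k = 1.
Proof.
rewrite big_nat_recr//= {2}/lim_tw /tail_wt ltnn.
rewrite (eq_big_nat _ _ (F2 := surv f lam)); first by rewrite addrC subrK.
by move=> k /andP[_ kK]; rewrite /lim_tw /tail_wt kK.
Qed.

Lemma M_matrixE : M_matrix f df lam =
  row_mx (row_mx 1%:M (- lam^-1 *: 1%:M)) (lam^-1 *: \sum_(1 <= k < K.+1) lim_tw k *: ((f k)^-1 *: df k)).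
Proof.
have l0 := mal_lam0 malP; rewrite /M_matrix /=.
have twsum := lim_tw_sum.
have -> : \sum_(1 <= k <oo) (f k * limit_deg f lam k) = lam.
  apply: cvg_lim => //.
  have := @mass_series_cvg R R^o K (surv f lam) f K0 (surv_natmul_cvg0 f0 K0 fK malP) fK.
  have -> : \sum_(1 <= k < K.+1) mass_wt K (surv f lam) k *: (f k : R^o) = lam.
    rewrite -[RHS]mulr1 -twsum mulr_sumr !big_nat; apply: eq_bigr => k /andP[k0 kK].
    exact: lim_mw_tw.
  apply: near_cvg; apply: nearW => M; rewrite !big_nat; apply: eq_bigr => k /andP[k0 _].
  by rewrite -[in limit_deg _ _ _](prednK k0) limit_degE// prednK// mulrC.
have -> : \sum_(1 <= k <oo) (limit_deg f lam k *: df k) = lam *: \sum_(1 <= k < K.+1) lim_tw k *: ((f k)^-1 *: df k).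
  apply: cvg_lim => //.
  have := mass_series_cvg K0 (surv_natmul_cvg0 f0 K0 fK malP) dfK.
  have -> : \sum_(1 <= k < K.+1) mass_wt K (surv f lam) k *: df k = lam *: \sum_(1 <= k < K.+1) lim_tw k *: ((f k)^-1 *: df k).
    rewrite scaler_sumr !big_nat; apply: eq_bigr => k /andP[k0 kK].
    by rewrite !scalerA -lim_mw_tw// mulfK// gt_eqF// f0.
  apply: near_cvg; apply: nearW => M; rewrite !big_nat; apply: eq_bigr => k /andP[k0 _].
  by rewrite -[in limit_deg _ _ _](prednK k0) limit_degE// prednK.
congr (row_mx _ _); rewrite scalerA; congr (_ *: _).
by rewrite expr2 invfM mulrVK// unitfE gt_eqF.
Qed.

End LimitValues.

Section FluctuationValue.
Variables (R : realType) (K : nat) (D : seq nat) (Ds : nat -> seq nat) (m : nat).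
Hypothesis K0 : (0 < K)%N.
Hypothesis D0 : (0 < size D)%N.
Hypothesis D1 : forall d, d \in D -> (0 < d)%N.
Hypothesis Dsum : sumn D = (2 * size D).-1.
Hypothesis DE : Ds m = D.
Hypothesis Dm : size D = m.
Variables (f : nat -> R) (lam : R) (d : nat) (df : nat -> 'cV[R]_d).
Hypothesis f0 : forall k, (0 < k)%N -> 0 < f k.
Hypothesis fK : forall k, (K <= k)%N -> f k = f K.
Hypothesis dfK : forall k, (K <= k)%N -> df k = df K.
Hypothesis malP : is_malthusian f lam.

Local Notation dtw := (deg_tw R K D m).
Local Notation dmw := (deg_mw R K D).
Local Notation ltw := (lim_tw K f lam).
Local Notation lmw := (lim_mw K f lam).

Lemma F_fluctuationE : F_fluctuation f df lam Ds m = Num.sqrt m%:R *: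
  col_mx (col_mx (\sum_(1 <= k < K.+1) (dtw k - ltw k) *: ((f k)^-1 *: df k))
                 (\sum_(1 <= k < K.+1) (dmw k - lmw k) *: df k))
         (\sum_(1 <= k < K.+1) (dmw k - lmw k) * f k)%:M.
Proof.
have l0 := mal_lam0 malP.
(* All blocks are series against these signed tails. They sum to - 1 / m, as the empirical tails sum
   to 1 - 1 / m and the limiting ones to 1. *)
pose T k : R := deg_above R D k - surv f lam k.
have hT : (fun k => k%:R * T k) @ \oo --> (0 : R).
  rewrite -(subr0 (0 : R)); under eq_fun do rewrite mulrBr.
  by apply: cvgB; [exact: deg_above_natmul_cvg0|exact: (surv_natmul_cvg0 f0 K0 fK malP)].
have hs : (fun M => \sum_(1 <= k < M) T k) @ \oo --> (1 - m%:R^-1 - 1 : R).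
  under eq_fun do rewrite sumrB.
  by apply: cvgB; [by rewrite -Dm; exact: deg_above_sum_cvg|exact: (surv_sum_cvg malP)].
have gK k : (K <= k)%N -> (f k)^-1 *: df k = (f K)^-1 *: df K by move=> Kk; rewrite fK// dfK.
have c1 := cum_series_cvg K0 hT hs gK.
have c2 := mass_series_cvg K0 hT dfK.
have c3 := @mass_series_cvg R R^o K T f K0 hT fK.
have tE k : tail_wt K T (1 - m%:R^-1 - 1) k = dtw k - ltw k.
  rewrite /deg_tw /lim_tw /tail_wt; case: ifP => // _; rewrite /T sumrB.
  by rewrite !opprB !addrA; ring.
have mE k : mass_wt K T k = dmw k - lmw k.
  by rewrite /deg_mw /lim_mw /mass_wt /T; case: ifP => // _; ring.
apply: cvg_lim => //.
apply: (@near_cvg R _ _ (fun M => Num.sqrt m%:R *: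
  col_mx (col_mx (\sum_(1 <= k < M) (T k.-1 - T k) *: \sum_(1 <= j < k) ((f j)^-1 *: df j))
     (\sum_(1 <= k < M) (T k.-1 - T k) *: df k)) (\sum_(1 <= k < M) (T k.-1 - T k) * f k)%:M)).
  apply: nearW => M.
  rewrite (eq_big_nat _ _ (F2 := fun k => Num.sqrt m%:R *: col_mx
    (col_mx ((T k.-1 - T k) *: \sum_(1 <= j < k) ((f j)^-1 *: df j)) ((T k.-1 - T k) *: df k))
    ((T k.-1 - T k) * f k)%:M)); last first.
    move=> k /andP[k0 _]; rewrite -scalerA; congr (_ *: _).
    have -> : deg_prop R Ds m k - limit_deg f lam k = T k.-1 - T k.
      rewrite (deg_prop_above R D0 Dsum DE Dm k0) -[in limit_deg _ _ _](prednK k0) limit_degE// prednK//.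
      by rewrite /T; ring.
    by rewrite /F_stat !scale_col_mx scale_scalar_mx.
  rewrite -scaler_sumr !sum_col_mx; congr (_ *: col_mx _ _).
  by rewrite [RHS](raddf_sum (@scalar_mx R 1)).
apply: cvgZl_tmp; apply: cvg_col_mx; last first.
  apply: cvg_scalar_mx; move: c3; rewrite (eq_bigr _ (fun k _ => congr1 (fun a => a *: f k) (mE k))).
  exact.
apply: cvg_col_mx.
  by move: c1; rewrite (eq_bigr _ (fun k _ => congr1 (fun a => a *: _) (tE k))).
by move: c2; rewrite (eq_bigr _ (fun k _ => congr1 (fun a => a *: df k) (mE k))).
Qed.

End FluctuationValue.

(** * Attachment histories *)

Section DegreeState.
Variables (R : realType) (K : nat).

Definition deg_type (d : nat) : 'I_K.+1 := inord (minn d.-1 K).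

Definition deg_state (D : seq nat) : 'cV[R]_K.+1 := \sum_(d <- D) delta_mx (deg_type d) 0.

Lemma deg_typeE d : deg_type d = minn d.-1 K :> nat.
Proof. by rewrite inordK// ltnS geq_minr. Qed.

Lemma deg_stateE D (i : 'I_K.+1) :
  deg_state D i 0 = (count (fun d => deg_type d == i) D)%:R.
Proof.
rewrite /deg_state; elim: D => [|d D IH]; first by rewrite big_nil mxE.
by rewrite big_cons mxE IH mxE eqxx andbT /= natrD eq_sym.
Qed.

Lemma deg_state_rcons D d : deg_state (rcons D d) = deg_state D + delta_mx (deg_type d) 0.
Proof. by rewrite /deg_state -cats1 big_cat big_seq1. Qed.

Lemma deg_state_incr D i : (i < size D)%N ->
  deg_state (incr_nth D i) =
  deg_state D - delta_mx (deg_type (nth 0%N D i)) 0 + delta_mx (deg_type (nth 0%N D i).+1) 0.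
Proof.
rewrite /deg_state; elim: D i => [|d D IH] [|i] //= iD; rewrite !big_cons.
  by rewrite [_ + _ - _]addrAC subrr add0r addrC.
by rewrite IH// !addrA.
Qed.

Lemma attach_state D i : (i < size D)%N -> (0 < nth 0%N D i)%N ->
  deg_state (attach D i) = deg_state D + urn_jump R (deg_type (nth 0%N D i)).
Proof.
move=> iD d0; rewrite /attach deg_state_rcons deg_state_incr//.
set d := nth _ _ _ in d0 *; rewrite -!addrA; congr (_ + _).
apply/colP => j; rewrite !mxE !eqxx !andbT -!val_eqE /= !deg_typeE.
case: (ltnP (minn d.-1 K) K) => dK.
  have -> : minn d.+1.-1 K = d by lia.
  have -> : minn 1.-1 K = 0%N by lia.
  have -> : (minn d.-1 K).+1 = d by lia.
  by rewrite mul1r; ring.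
have -> : minn d.+1.-1 K = minn d.-1 K by lia.
have -> : minn 1.-1 K = 0%N by lia.
by rewrite mul0r; ring.
Qed.

Lemma sum_deg_type D (F : 'I_K.+1 -> R) :
  \sum_(i < size D) F (deg_type (nth 0%N D i)) = \sum_j deg_state D j 0 * F j.
Proof.
have -> : \sum_(i < size D) F (deg_type (nth 0%N D i)) = \sum_(d <- D) F (deg_type d).
  by rewrite (big_nth 0%N) big_mkord.
rewrite /deg_state; elim: D => [|d D IH].
  by rewrite big_nil big1// => j _; rewrite big_nil mxE mul0r.
rewrite big_cons IH; under [RHS]eq_bigr => j _ do rewrite big_cons mxE mulrDl.
rewrite big_split /=; congr (_ + _).
rewrite (bigD1 (deg_type d))//= mxE !eqxx mul1r big1 ?addr0// => j jd.
by rewrite mxE (negbTE jd) mul0r.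
Qed.

Lemma coord_sum_state D : coord_sum (deg_state D) = (size D)%:R.
Proof.
have := sum_deg_type D (fun _ => 1); rewrite sumr_const card_ord => ->.
by rewrite /coord_sum; under [RHS]eq_bigr do rewrite mulr1.
Qed.

End DegreeState.

Definition valid_degrees (D : seq nat) (n : nat) : Prop :=
  [/\ size D = n, forall d, d \in D -> (0 < d)%N & sumn D = (2 * n).-1].

(** The support of the law of the history of length k. Attachment to an existing node holds only
    almost surely, so expectations are reduced to this list. *)
Fixpoint histories (k : nat) : seq (seq nat) :=
  if k is k'.+1 then [seq rcons h i | h <- histories k', i <- iota 0 k] else [:: [::]].

Lemma degrees_rcons h i : degrees (rcons h i) = attach (degrees h) i.
Proof. by rewrite /degrees -cats1 foldl_cat. Qed.

Lemma mem_histories k h i : (rcons h i \in histories k.+1) = (h \in histories k) && (i < k.+1)%N.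
Proof.
apply/allpairsPdep/andP.
  move=> [h' [i' [hh ii /rcons_inj[-> ->]]]]; split => //.
  by move: ii; rewrite mem_iota add0n.
by move=> [hh ik]; exists h, i; split => //; rewrite mem_iota add0n.
Qed.

Lemma histories_uniq k : uniq (histories k).
Proof.
elim: k => [//|k IH]; rewrite [histories _]/=; apply: (@allpairs_uniq _ _ _ (fun h i => rcons h i) _ (iota 0 k.+1)) => //; first exact: iota_uniq.
by move=> [h i] [h' i'] _ _ /= /rcons_inj[-> ->].
Qed.

Lemma histories_valid k h : h \in histories k -> size h = k /\ valid_degrees (degrees h) k.+1.
Proof.
elim: k h => [|k IH] h; first by rewrite inE => /eqP ->; split => //; split => // d; rewrite inE => /eqP ->.
case/lastP: h => [|h i]; first by move=> /allpairsPdep[h' [i' [_ _ E]]]; move: (congr1 size E); rewrite size_rcons.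
rewrite mem_histories => /andP[/IH[sh [sD D1 Dsum]] ik]; split; first by rewrite size_rcons sh.
have iD : (i < size (degrees h))%N by rewrite sD.
rewrite degrees_rcons /attach; split.
- by rewrite size_rcons size_incr_nth iD sD.
- move=> d; rewrite mem_rcons inE => /predU1P[->//|].
  move=> /(nthP 0%N)[j jD <-]; rewrite nth_incr_nth.
  move: jD; rewrite size_incr_nth iD => jD.
  by rewrite ltn_addl// D1// mem_nth.
- have -> : sumn (rcons (incr_nth (degrees h) i) 1) = (sumn (incr_nth (degrees h) i)).+1.
    by rewrite sumn_rcons addn1.
  have -> : sumn (incr_nth (degrees h) i) = (sumn (degrees h)).+1.
    elim: (degrees h) i iD {ik D1 Dsum sD} => [|a D IHD] [|i] //= iD.
    by rewrite IHD// addnS.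
  by rewrite Dsum; lia.
Qed.

Lemma historyS (T : Type) (c : nat -> T -> nat) n w : (0 < n)%N ->
  history c n.+1 w = rcons (history c n w) (c n w).
Proof.
case: n => // n _; rewrite /history /= -[LHS]/([seq c m w | m <- iota 1 n.+1]).
by rewrite -[in LHS](addn1 n) iotaD map_cat /= cats1 add1n.
Qed.

Lemma size_history (T : Type) (c : nat -> T -> nat) n w : size (history c n w) = n.-1.
Proof. by rewrite size_map size_iota. Qed.

(** * The law of the attachment history *)

Section HistoryLaw.
Context (R : realType) (disp : measure_display) (T : measurableType disp) (P : probability T R).
Variable c : nat -> {RV P >-> nat}.
Local Notation hist n := (history (fun m => c m : T -> nat) n).

Lemma measurable_history_eq n h : measurable [set w | hist n w = h].
Proof.
have mc m i : measurable [set w | c m w = i].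
  by have := @measurable_funPT _ _ _ _ (c m) measurableT [set i] Logic.I; rewrite setTI.
case: n => [|n].
  rewrite (_ : [set w | _] = if h == [::] then setT else set0); first by case: ifP.
  by case: eqVneq => [->|h0]; apply/seteqP; split => w //= E; move: h0; rewrite -E eqxx.
elim: n h => [|n IH] h.
  rewrite (_ : [set w | _] = if h == [::] then setT else set0); first by case: ifP.
  by case: eqVneq => [->|h0]; apply/seteqP; split => w //= E; move: h0; rewrite -E eqxx.
case/lastP: h => [|h i].
  rewrite (_ : [set w | _] = set0)//; apply/seteqP; split; last by [].
  by move=> w E; have := size_history (fun m => c m : T -> nat) n.+2 w; rewrite E.
rewrite (_ : [set w | _] = [set w | hist n.+1 w = h] `&` [set w | c n.+1 w = i]).
  by apply: measurableI.
apply/seteqP; split => w /=; rewrite (@historyS _ _ n.+1)//; first by move=> /rcons_inj[-> ->].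
by move=> [-> ->].
Qed.

(** The history has countably many possible values, so every event and every statistic expressed
    through it is measurable. *)
Lemma measurable_history n (Q : seq nat -> Prop) : measurable [set w | Q (hist n w)].
Proof.
pose F h := if `[< Q h >] then [set w | hist n w = h] else set0.
have -> : [set w | Q (hist n w)] = \bigcup_h F h.
  apply/seteqP; split => w /=.
    by move=> Qw; exists (hist n w) => //; rewrite /F asboolT.
  by move=> [h _]; rewrite /F; case: asboolP => // Qh /= ->.
apply: countable_bigcupT_measurable => // h; rewrite /F; case: ifP => // _.
exact: measurable_history_eq.
Qed.

Lemma measurable_of_history d' (T' : measurableType d') n (G : seq nat -> T') :
  measurable_fun [set: T] (fun w => G (hist n w)).
Proof. by move=> _ A mA; rewrite setTI; exact: (measurable_history n (fun h => A (G h))). Qed.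

Definition hist_prob n h : R := fine (P [set w | hist n w = h]).

Lemma hist_prob_ge0 n h : 0 <= hist_prob n h. Proof. by rewrite fine_ge0. Qed.

Lemma hist_probE n h : P [set w | hist n w = h] = (hist_prob n h)%:E.
Proof. by rewrite fineK// fin_num_measure//; exact: measurable_history_eq. Qed.

Variable f : nat -> R.
Hypothesis f_gt0 : forall k, (0 < k)%N -> 0 < f k.
Hypothesis cP : is_PA_tree f c.

Lemma hist_prob_rcons n h i : (0 < n)%N -> size h = n.-1 -> (i < n)%N ->
  hist_prob n.+1 (rcons h i) = hist_prob n h * (f (nth 0%N (degrees h) i) /
      \sum_(j < n) f (nth 0%N (degrees h) j)).
Proof.
move=> n0 sh ni; apply: EFin_inj; rewrite EFinM -!hist_probE -(cP n0 sh ni).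
congr (P _); apply/seteqP; split => w /=; rewrite historyS//; first by move=> /rcons_inj[-> ->].
by move=> [-> ->].
Qed.

Definition hist_mean n (g : seq nat -> R) : R := \sum_(h <- histories n.-1) hist_prob n h * g h.

Lemma hist_mean_step n g : (0 < n)%N -> hist_mean n.+1 g =
  hist_mean n (fun h => \sum_(i < n) f (nth 0%N (degrees h) i) /
      (\sum_(j < n) f (nth 0%N (degrees h) j)) * g (rcons h i)).
Proof.
case: n => // n _; rewrite /hist_mean.
have -> : histories n.+2.-1 = [seq rcons h i | h <- histories n, i <- iota 0 n.+1] by [].
rewrite big_allpairs_dep /= !big_seq.
apply: eq_bigr => h hh; rewrite -[0%N :: iota 1 n]/(iota 0 n.+1) mulr_sumr.
have -> : iota 0 n.+1 = index_iota 0 n.+1 by rewrite /index_iota subn0.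
rewrite big_mkord; apply: eq_bigr => i _.
have [sh _] := histories_valid hh.
by rewrite hist_prob_rcons// -mulrA.
Qed.

Lemma hist_mean1 n : (0 < n)%N -> hist_mean n (fun=> 1) = 1.
Proof.
case: n => // n _; elim: n => [|n IH].
  rewrite /hist_mean /= big_seq1 mulr1 /hist_prob.
  rewrite (_ : [set w | _] = setT) ?probability_setT//.
  by apply/seteqP; split.
rewrite hist_mean_step// -[RHS]IH /hist_mean !big_seq; apply: eq_bigr => h hh; congr (_ * _).
have [_ [sD D1 _]] := histories_valid hh.
under eq_bigr do rewrite mulr1.
rewrite -mulr_suml mulfV// gt_eqF//.
rewrite (bigD1 ord0)//= ltr_pwDl//; first by rewrite f_gt0// D1// mem_nth// sD.
by apply: sumr_ge0 => j _; rewrite ltW// f_gt0// D1// mem_nth// sD.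
Qed.

(** The listed histories carry total mass one by [hist_mean1]. Hence their complement is null, and a
    bounded function may be replaced by its restriction to the list. *)
Lemma Ex_history n (g : seq nat -> R) : (0 < n)%N -> bdm (fun w => g (hist n w)) ->
  Ex P (fun w => g (hist n w)) = hist_mean n g.
Proof.
move=> n0 bg; have [mg [M gM]] := bg.
pose N := [set w | hist n w \notin histories n.-1].
have mN : measurable N by exact: (measurable_history n (fun h => h \notin histories n.-1)).
have bI h : bdm (\1_[set w | hist n w = h] : T -> R) by apply: bdm_indic; exact: measurable_history_eq.
have bS (a : seq nat -> R) : bdm (fun w => \sum_(h <- histories n.-1) a h * \1_[set w | hist n w = h] w).
  by apply: bdm_sum => h; exact: bdmZ.
have S (a : seq nat -> R) w : hist n w \in histories n.-1 ->
    \sum_(h <- histories n.-1) a h * \1_[set w | hist n w = h] w = a (hist n w).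
  move=> hw; rewrite (big_rem (hist n w))//= indicE mem_set// mulr1 big1_seq ?addr0// => h /= hr.
  have hne : hist n w <> h.
    by move=> E; move: hr; rewrite E mem_rem_uniqF// histories_uniq.
  by rewrite indicE memNset ?mulr0.
have SE (a : seq nat -> R) : Ex P (fun w => \sum_(h <- histories n.-1) a h * \1_[set w | hist n w = h] w) = hist_mean n a.
  rewrite Ex_sum; last by move=> h; exact: bdmZ.
  apply: eq_bigr => h _; rewrite ExZ// Ex_indic; last exact: measurable_history_eq.
  by rewrite mulrC.
have N0 : Ex P \1_N = 0.
  have : Ex P (fun w => \sum_(h <- histories n.-1) 1 * \1_[set w | hist n w = h] w + \1_N w) = 1.
    rewrite -[RHS](Ex_cst P); apply: eq_Ex => w; rewrite indicE.
    have [hw|hw] := boolP (hist n w \in histories n.-1).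
      by rewrite (S (fun=> 1))// memNset ?addr0// /N /= hw.
    rewrite mem_set// big1_seq ?add0r// => h /= hh.
    rewrite indicE memNset ?mulr0//= => E; move: hw; by rewrite E hh.
  rewrite ExD//; last exact: bdm_indic.
  by rewrite SE hist_mean1// => h; lra.
rewrite -SE; apply/eqP; rewrite -subr_eq0 -normr_le0 -ExB//.
apply: (@le_trans _ _ (Ex P (fun w => M * \1_N w))); last by rewrite ExZ ?N0 ?mulr0//; exact: bdm_indic.
apply: Ex_abs; [exact: (bdmB bg (bS g))|by apply: bdmZ; exact: bdm_indic|] => w.
rewrite indicE; have [hw|hw] := boolP (hist n w \in histories n.-1).
  by rewrite S// subrr normr0 memNset ?mulr0// /N /= hw.
rewrite mem_set// mulr1 big1_seq ?subr0// => h /= hh.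
by rewrite indicE memNset ?mulr0//= => E; move: hw; rewrite E hh.
Qed.

Lemma history_null n : (0 < n)%N -> P [set w | hist n w \notin histories n.-1] = 0%E.
Proof.
move=> n0; set N := [set w | _].
have mN : measurable N by exact: (measurable_history n (fun h => h \notin histories n.-1)).
rewrite -[LHS]fineK ?fin_num_measure// -Ex_indic//; congr EFin.
have E : (\1_N : T -> R) = fun w => (hist n w \notin histories n.-1)%:R.
  apply/funext => w; rewrite indicE; congr (nat_of_bool _)%:R.
  by apply/idP/idP => [/set_mem|h]; [|exact: mem_set].
rewrite E (Ex_history (g := fun h => (h \notin histories n.-1)%:R))//.
  by rewrite /hist_mean big1_seq// => h /= ->; rewrite mulr0.
by rewrite -E; exact: bdm_indic.
Qed.

Variable K : nat.
Hypothesis K0 : (0 < K)%N.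
Hypothesis fK : forall k, (K <= k)%N -> f k = f K.

Definition urn_mean n (G : 'cV[R]_K.+1 -> R) : R :=
  hist_mean n (fun h => G (deg_state R K (degrees h))).

Lemma urn_mean_chain : is_chain (urn_phi f K) (@urn_jump R K) urn_mean.
Proof.
split.
- move=> n G H n0 GH; rewrite /urn_mean /hist_mean !big_seq; apply: ler_sum => h hh.
  rewrite ler_wpM2l ?hist_prob_ge0//; apply: GH.
  have [_ [sD _ _]] := histories_valid hh; rewrite prednK// in sD.
  by split=> [|i]; rewrite ?coord_sum_state ?sD// deg_stateE.
- move=> n a b G H; rewrite /urn_mean /hist_mean !mulr_sumr -big_split /=.
  by apply: eq_bigr => h _; ring.
- by move=> n n0; exact: hist_mean1.
move=> n G n0; rewrite /urn_mean hist_mean_step// /hist_mean !big_seq; apply: eq_bigr => h hh; congr (_ * _).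
have [_ [sD D1 _]] := histories_valid hh; rewrite prednK// in sD.
(* The type determines the attachment weight, since f is constant from K on. *)
have fT d : (0 < d)%N -> f d = urn_phi f K 0 (deg_type K d).
  move=> d0; rewrite mxE deg_typeE; have [dK|dK] := leqP d K.
    by congr f; lia.
  by rewrite !fK//; lia.
have n1 (i : 'I_n) : (0 < nth 0%N (degrees h) i)%N by apply: D1; rewrite mem_nth// sD.
have -> : \sum_(j < n) f (nth 0%N (degrees h) j) = dotp (urn_phi f K) (deg_state R K (degrees h)).
  rewrite dotpE; have := @sum_deg_type R K (degrees h) (fun j => urn_phi f K 0 j); rewrite sD => E.
  under [RHS]eq_bigr do rewrite mulrC.
  by rewrite -E; apply: eq_bigr => i _; rewrite -fT.
rewrite /chain_step; set S := dotp _ _; set X := deg_state R K _.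
have := @sum_deg_type R K (degrees h) (fun j => urn_phi f K 0 j / S * G (X + urn_jump R j)); rewrite sD => E.
transitivity (\sum_j X j 0 * (urn_phi f K 0 j / S * G (X + urn_jump R j))).
  rewrite -E; apply: eq_bigr => i _; rewrite degrees_rcons attach_state ?sD// ?n1//.
  by rewrite -fT.
by apply: eq_bigr => j _; rewrite -!mulrA mulrCA.
Qed.

End HistoryLaw.

(** * Fluctuations of the degrees *)

Lemma inv_sqrt_cvg0 (R : realType) : (fun n => (Num.sqrt n%:R)^-1) @ \oo --> (0 : R).
Proof.
rewrite -cvg_shiftS; have -> : (fun n => (Num.sqrt n.+1%:R)^-1) = fun n => Num.sqrt (harmonic n) :> R.
  by apply/funext => n; rewrite /harmonic sqrtrV.
have := cvg_comp _ _ (@cvg_harmonic R) (@sqrt_continuous R 0).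
rewrite /continuous_at sqrtr0 => h; exact: h.
Qed.

Section UrnDeviation.
Variables (R : realType) (f : nat -> R) (lam : R) (K : nat).
Hypothesis f0 : forall k, (0 < k)%N -> 0 < f k.
Hypothesis K0 : (0 < K)%N.
Hypothesis fK : forall k, (K <= k)%N -> f k = f K.
Hypothesis malP : is_malthusian f lam.
Local Notation p := (urn_p f lam K).

Definition urn_dev (h : seq nat) : 'cV[R]_K.+1 := centred p (deg_state R K (degrees h)).

Definition tau_row (k : nat) : 'rV[R]_K.+1 := \row_i (k <= i)%:R.
(** The last tail weight is the deterministic total 1 - 1 / n minus the earlier tails, hence the
    negated sum. The discrepancy 1 / n with the limiting total 1 is the origin of [fluct_bias]. *)
Definition tw_row (k : nat) : 'rV[R]_K.+1 :=
  if (k < K)%N then tau_row k else - \sum_(1 <= j < K) tau_row j.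
Definition mw_row (k : nat) : 'rV[R]_K.+1 :=
  if (k < K)%N then tau_row k.-1 - tau_row k else tau_row k.-1.

Lemma tau_row_p k : (k <= K)%N -> dotp (tau_row k) p = surv f lam k.
Proof.
move=> kK; rewrite dotpE; under eq_bigr do rewrite !mxE.
rewrite -(big_mkord xpredT (fun i => (k <= i)%:R * (if (i < K)%N then surv f lam i - surv f lam i.+1 else surv f lam K))).
rewrite big_nat_recr//= ltnn kK mul1r (big_cat_nat (n := k))//= big_nat_cond big1 ?add0r; last first.
  by move=> i /andP[/andP[_ ik] _]; rewrite leqNgt ik mul0r.
rewrite (eq_big_nat _ _ (F2 := fun i => surv f lam i - surv f lam i.+1)); last first.
  by move=> i /andP[ki iK]; rewrite ki iK mul1r.
have := telescope_sumr (surv f lam) kK => E.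
rewrite (eq_bigr (fun i => - (surv f lam i.+1 - surv f lam i))); last by move=> i _; rewrite opprB.
by rewrite sumrN E opprB subrK.
Qed.

Lemma tau_row_state D k : (forall d, d \in D -> (0 < d)%N) -> (k <= K)%N ->
  dotp (tau_row k) (deg_state R K D) = (count (fun d => (k < d)%N) D)%:R.
Proof.
move=> D1 kK; rewrite dotpE.
rewrite (eq_bigr (fun j => deg_state R K D j 0 * (k <= j)%:R)); last by move=> j _; rewrite mxE mulrC.
rewrite -(sum_deg_type (K := K) D (fun j => (k <= j)%:R)) -sum1_count natr_sum (big_nth 0%N) big_mkord [RHS]big_mkcond /=.
apply: eq_bigr => i _; have := D1 _ (mem_nth 0%N (ltn_ord i)); rewrite deg_typeE.
move: (nth _ _ _) => d d0; have -> : (k <= minn d.-1 K)%N = (k < d)%N by lia.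
by case: ifP.
Qed.

Variables (h : seq nat) (n : nat).
Hypothesis n0 : (0 < n)%N.
Hypothesis hv : valid_degrees (degrees h) n.
Local Notation D := (degrees h).

Lemma deg_above_dev k : (k <= K)%N ->
  deg_above R D k - surv f lam k = n%:R^-1 * dotp (tau_row k) (urn_dev h).
Proof.
move=> kK; have [sD D1 _] := hv.
rewrite /urn_dev /centred dotpBr dotpZr coord_sum_state tau_row_p// tau_row_state// sD.
by rewrite /deg_above sD; field; rewrite pnatr_eq0 -lt0n.
Qed.

Lemma deg_tw_dev k : deg_tw R K D n k - lim_tw K f lam k =
  n%:R^-1 * dotp (tw_row k) (urn_dev h) - (if (k < K)%N then 0 else n%:R^-1).
Proof.
rewrite /deg_tw /lim_tw /tail_wt /tw_row; case: ifP => kK.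
  by rewrite deg_above_dev ?subr0// ltnW.
have -> : dotp (- \sum_(1 <= j < K) tau_row j) (urn_dev h) = - \sum_(1 <= j < K) dotp (tau_row j) (urn_dev h).
  by rewrite /dotp mulNmx mxE mulmx_suml summxE.
have E : \sum_(1 <= j < K) deg_above R D j - \sum_(1 <= j < K) surv f lam j =
    n%:R^-1 * \sum_(1 <= j < K) dotp (tau_row j) (urn_dev h).
  rewrite mulr_sumr -sumrB !big_nat; apply: eq_bigr => j /andP[_ jK].
  by rewrite deg_above_dev// ltnW.
rewrite mulrN -E; ring.
Qed.

Lemma deg_mw_dev k : (k <= K)%N -> deg_mw R K D k - lim_mw K f lam k =
  n%:R^-1 * dotp (mw_row k) (urn_dev h).
Proof.
move=> kK; rewrite /deg_mw /lim_mw /mass_wt /mw_row.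
have kK1 : (k.-1 <= K)%N by lia.
case: ifP => _; last exact: deg_above_dev.
by rewrite dotpBl mulrBr -!deg_above_dev//; ring.
Qed.

Variables (d : nat) (df : nat -> 'cV[R]_d).
Hypothesis dfK : forall k, (K <= k)%N -> df k = df K.

Definition fluct_mx : 'M[R]_(d + d + 1, K.+1) :=
  col_mx (col_mx (\sum_(1 <= k < K.+1) ((f k)^-1 *: df k) *m tw_row k)
                 (\sum_(1 <= k < K.+1) df k *m mw_row k))
         (\sum_(1 <= k < K.+1) f k *: mw_row k).
Definition fluct_bias : 'cV[R]_(d + d + 1) := col_mx (col_mx ((f K)^-1 *: df K) 0) 0.

Lemma fluctuation_dev Ds : Ds n = D -> F_fluctuation f df lam Ds n =
  (Num.sqrt n%:R)^-1 *: (fluct_mx *m urn_dev h - fluct_bias).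
Proof.
move=> DE; have [sD D1 Dsum] := hv.
have Dsum' : sumn D = (2 * size D).-1 by rewrite sD.
have D0 : (0 < size D)%N by rewrite sD.
have sn : Num.sqrt (n%:R : R) != 0 by rewrite gt_eqF// sqrtr_gt0 ltr0n.
rewrite (F_fluctuationE K0 D0 D1 Dsum' DE sD f0 fK dfK malP).
have -> : (Num.sqrt (n%:R : R))^-1 = Num.sqrt n%:R * n%:R^-1.
  by apply: (mulfI sn); rewrite mulfV// mulrA -expr2 sqr_sqrtr// mulfV// pnatr_eq0 -lt0n.
rewrite -scalerA; congr (_ *: _).
have row1 N (v : 'cV[R]_N) (r : 'rV[R]_K.+1) x : v *m r *m x = dotp r x *: v.
  by rewrite -mulmxA [r *m x]mx11_scalar -/(dotp r x) mul_mx_scalar.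
rewrite /fluct_mx /fluct_bias !mul_col_mx !opp_col_mx !add_col_mx !scale_col_mx; congr (col_mx (col_mx _ _) _).
- rewrite mulmx_suml scalerBr scaler_sumr.
  rewrite (eq_bigr (fun k => n%:R^-1 *: ((f k)^-1 *: df k *m tw_row k *m urn_dev h) -
      (if (k < K)%N then 0 else n%:R^-1) *: ((f k)^-1 *: df k))); last first.
    by move=> k _; rewrite deg_tw_dev row1 scalerBl !scalerA.
  rewrite sumrB; congr (_ - _); rewrite big_nat_recr//= ltnn big_nat big1 ?add0r// => k /andP[_ kK].
  by rewrite kK scale0r.
- rewrite oppr0 addr0 mulmx_suml scaler_sumr !big_nat; apply: eq_bigr => k /andP[_ kK].
  by rewrite deg_mw_dev// row1 scalerA.
rewrite oppr0 addr0 mulmx_suml; apply/colP => i; rewrite (ord1 i) !mxE eqxx mulr1n summxE mulr_sumr !big_nat.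
apply: eq_bigr => k /andP[_ kK]; rewrite deg_mw_dev// -scalemxAl mxE -/(dotp _ _); ring.
Qed.

End UrnDeviation.

(** * Limit law of the degree fluctuations *)

Section UrnLimit.
Context (R : realType) (disp : measure_display) (T : measurableType disp) (P : probability T R).
Variables (c : nat -> {RV P >-> nat}) (f : nat -> R) (lam : R) (K : nat).
Hypothesis f0 : forall k, (0 < k)%N -> 0 < f k.
Hypothesis K0 : (0 < K)%N.
Hypothesis fK : forall k, (K <= k)%N -> f k = f K.
Hypothesis malP : is_malthusian f lam.
Hypothesis cP : is_PA_tree f c.
Variable ev : seq R[i].
Hypothesis evP : ordered_eigenvalues (urn_matrix f K) ev.
Hypothesis gap : complex.Re ev`_1 < complex.Re ev`_0 / 2.

Local Notation hist n := (history (fun m => c m : T -> nat) n).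
Local Notation p := (urn_p f lam K).
Local Notation urn_dev := (urn_dev f lam K).

Lemma urn_limit : exists (S : 'M[R]_K.+1) (hs : seq 'rV[R]_K.+1) (C0 : R),
  [/\ S^T = S, forall (x : 'cV[R]_K.+1) i, x i 0 ^+ 2 <= qb hs x x, 0 <= C0,
      forall n, (0 < n)%N -> hist_mean c n (fun h => qb hs (urn_dev h) (urn_dev h)) <= C0 * n%:R
    & forall (a : 'rV[R]_K.+1) th,
      (fun n => hist_mean c n (fun h => cos (th + dotp ((Num.sqrt n%:R)^-1 *: a) (urn_dev h)))) @ \oo -->
      cos th * expR (- (rform S a / 2))].
Proof.
have l0 := mal_lam0 malP; have mal := malthus_finite f0 K0 fK malP.
have fK1 : f K.+1 = f K by rewrite fK.
have [zs [evE zsP]] := urn_eigen f0 l0 K0 fK1 mal evP gap.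
have [cp _] := evP; rewrite evE in cp.
have meanE : chain_mean (urn_phi f K) (@urn_jump R K) = urn_matrix f K.
  by apply/matrixP => i j; rewrite mxE urn_matrixE.
have driftE : drift_mx (urn_phi f K) (@urn_jump R K) p = urn_matrix f K - p *m urn_phi f K.
  by rewrite /drift_mx meanE.
have an := urn_annih f0 l0 K0 fK1 mal cp.
have zsP' : forall z : R[i], z \in 0 :: zs -> complex.Re z < lam / 2.
  by move=> z; rewrite inE => /predU1P[->|/zsP//]; rewrite /= divr_gt0.
have [hs [g [gl hsC hsc]]] := lyapunov an zsP'.
rewrite -driftE in hsC.
have jump_sum j : coord_sum (urn_jump R j : 'cV[R]_K.+1) = 1 by exact: urn_jump_sum.
have phip : dotp (urn_phi f K) p = lam by exact: urn_phi_sum.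
have mp : chain_mean (urn_phi f K) (@urn_jump R K) *m p = lam *: p by rewrite meanE; exact: urn_Ap.
have phi0 : forall i, 0 < urn_phi f K 0 i by move=> i; exact: urn_phi_gt0.
have u0 : forall i, 0 < urn_u f lam K 0 i by move=> i; exact: urn_u_gt0.
have uj := urn_u_jump f0 l0 K0 fK1 mal.
have chain := urn_mean_chain f0 cP K0 fK.
have [C0 C00 C0P] := second_moment phi0 jump_sum l0 phip mp hsc u0 uj gl hsC chain.
have gl' : g / lam < 2^-1 by rewrite ltr_pdivrMr// mulrC.
have hsC' x : qb hs x (lam^-1 *: drift_mx (urn_phi f K) (@urn_jump R K) p *m x) <= g / lam * qb hs x x.
  rewrite -scalemxAl qbZr (_ : g / lam * _ = lam^-1 * (g * qb hs x x)); last ring.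
  by rewrite ler_pM2l ?invr_gt0.
have [S SE] := sylvester gl' hsC' hsc (chain_cov (urn_phi f K) (@urn_jump R K) lam p).
have cf := chain_cf_limit phi0 jump_sum l0 phip mp hsc u0 uj gl hsC chain SE.
(* A covariance has to be symmetric, and the form [rform] only sees the symmetric part of the
   Sylvester solution. *)
exists (2^-1 *: (S + S^T)), hs, C0; split => //.
  by rewrite linearZ /= linearD /= trmxK addrC.
move=> a th.
have -> : rform (2^-1 *: (S + S^T)) a = rform S a.
  have tr : dotp a (S^T *m a^T) = dotp a (S *m a^T).
    by rewrite /dotp -[in LHS](trmxK (a *m _)) mxE !trmx_mul !trmxK mulmxA.
  rewrite /rform -scalemxAl dotpZr mulmxDl dotpDr tr; by field.
exact: cf.
Qed.

Lemma hist_mean_le n (g g' : seq nat -> R) : (forall h, h \in histories n.-1 -> g h <= g' h) ->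
  hist_mean c n g <= hist_mean c n g'.
Proof.
move=> gg; rewrite /hist_mean !big_seq; apply: ler_sum => h hh.
by rewrite ler_wpM2l ?hist_prob_ge0// gg.
Qed.

Lemma bdm_history n (g : seq nat -> R) : (exists M, forall h, `|g h| <= M) ->
  bdm (fun w => g (hist n w)).
Proof. by move=> [M gM]; split; [exact: measurable_of_history|exists M]. Qed.

Lemma fine_P_subU (A B C : set T) : measurable A -> measurable B -> measurable C ->
  A `<=` B `|` C -> fine (P A) <= fine (P B) + fine (P C).
Proof.
move=> mA mB mC ABC; rewrite -fineD ?fin_num_measure//.
apply: fine_le; rewrite ?fin_numD ?fin_num_measure//.
apply: le_trans (measureU2 P mB mC).
by apply: le_measure; rewrite ?inE//; exact: measurableU.
Qed.

(** Markov's inequality for q: with B >= 1 and C0 <= e B, the ratio C0 / B^2 is at most e. *)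
Lemma dev_tight (hs : seq 'rV[R]_K.+1) (C0 : R) : 0 <= C0 ->
  (forall n, (0 < n)%N -> hist_mean c n (fun h => qb hs (urn_dev h) (urn_dev h)) <= C0 * n%:R) ->
  forall e, 0 < e -> exists2 B, 0 < B & forall n, (0 < n)%N ->
    fine (P [set w | B * Num.sqrt n%:R < Num.sqrt (qb hs (urn_dev (hist n w)) (urn_dev (hist n w)))]) <= e.
Proof.
move=> C00 C0P e e0; pose B := C0 / e + 1.
have Ce : 0 <= C0 / e by rewrite divr_ge0// ltW.
have B1 : 1 <= B by rewrite /B lerDr.
have B0 : 0 < B by lra.
exists B => // n n0; set A := [set w | _].
have np : 0 < n%:R :> R by rewrite ltr0n.
pose g h : R := (B * Num.sqrt n%:R < Num.sqrt (qb hs (urn_dev h) (urn_dev h)))%R%:R.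
have mA : measurable A by exact: (measurable_history c n (fun h => B * Num.sqrt n%:R < Num.sqrt (qb hs (urn_dev h) (urn_dev h)))).
have bg : bdm (fun w => g (hist n w)).
  by apply: bdm_history; exists 1 => h; rewrite /g; case: (_ < _); rewrite ?normr1 ?normr0.
have -> : fine (P A) = hist_mean c n g.
  rewrite -Ex_indic// -(Ex_history f0 cP n0 bg); apply: eq_Ex => w; rewrite indicE /g.
  by congr (nat_of_bool _)%:R; apply/idP/idP => [/set_mem|hw]; [|exact: mem_set].
apply: (@le_trans _ _ (hist_mean c n (fun h => (B ^+ 2 * n%:R)^-1 * qb hs (urn_dev h) (urn_dev h)))).
  apply: hist_mean_le => h _; rewrite /g; case: ltP => hB.
    rewrite mulrC ler_pdivlMr ?mulr_gt0 ?exprn_gt0// mul1r.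
    rewrite -[X in B ^+ 2 * X]sqr_sqrtr ?ler0n// -exprMn -[leRHS]sqr_sqrtr ?qb_ge0//.
    by rewrite ler_sqr ?nnegrE ?mulr_ge0 ?sqrtr_ge0// ltW.
  by rewrite mulr_ge0 ?qb_ge0// invr_ge0 mulr_ge0// exprn_ge0// ltW.
have -> : hist_mean c n (fun h => (B ^+ 2 * n%:R)^-1 * qb hs (urn_dev h) (urn_dev h)) =
    (B ^+ 2 * n%:R)^-1 * hist_mean c n (fun h => qb hs (urn_dev h) (urn_dev h)).
  by rewrite /hist_mean mulr_sumr; apply: eq_bigr => h _; rewrite mulrCA.
have i0 : 0 <= (B ^+ 2 * n%:R)^-1 by rewrite invr_ge0 mulr_ge0// exprn_ge0// ltW.
apply: le_trans (ler_wpM2l i0 (C0P n n0)) _.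
have -> : (B ^+ 2 * n%:R)^-1 * (C0 * n%:R) = C0 / B ^+ 2 by field; rewrite !gt_eqF.
rewrite ler_pdivrMr ?exprn_gt0//.
have : C0 <= e * B by rewrite /B mulrDr mulr1 mulrCA mulfV ?gt_eqF// mulr1 lerDl ltW.
move=> /le_trans; apply; rewrite ler_pM2l// expr2 ler_peMl//; exact: ltW.
Qed.

Variables (d : nat) (df : nat -> 'cV[R]_d).
Hypothesis dfK : forall k, (K <= k)%N -> df k = df K.
Local Notation fluct n w := (F_fluctuation f df lam (degree_path c w) n).

Definition fluct_of n (h : seq nat) := F_fluctuation f df lam (fun=> degrees h) n.

Lemma fluct_ofE n w : fluct n w = fluct_of n (hist n w). Proof. by []. Qed.

Lemma fluct_of_dev n h : (0 < n)%N -> h \in histories n.-1 ->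
  fluct_of n h = (Num.sqrt n%:R)^-1 *: (fluct_mx f K df *m urn_dev h - fluct_bias f K df).
Proof.
move=> n0 hh; have [_ hv] := histories_valid hh; rewrite prednK// in hv.
exact: fluctuation_dev.
Qed.

Lemma mulmx_dev_bound (hs : seq 'rV[R]_K.+1) N (L : 'M[R]_(N, K.+1)) :
  (forall (x : 'cV[R]_K.+1) i, x i 0 ^+ 2 <= qb hs x x) ->
  exists2 k, 0 <= k & forall x i, `|(L *m x) i 0| <= k * Num.sqrt (qb hs x x).
Proof.
move=> hsc.
have /choice[k kP] : forall i : 'I_N, exists k, 0 <= k /\ forall x, `|dotp (row i L) x| <= k * Num.sqrt (qb hs x x).
  by move=> i; have [k k0 kP] := dotp_nq hsc (row i L); exists k.
exists (\sum_i k i) => [|x i]; first by apply: sumr_ge0 => i _; case: (kP i).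
have -> : (L *m x) i 0 = dotp (row i L) x by rewrite /dotp -row_mul [RHS]mxE.
case: (kP i) => _ /(_ x) /le_trans; apply; rewrite ler_wpM2r ?sqrtr_ge0// (bigD1 i)//= lerDl.
by apply: sumr_ge0 => j _; case: (kP j).
Qed.

Lemma measurable_fluct n : measurable_fun [set: T] (fun w => fluct n w : borel_cV R (d + d + 1)).
Proof. exact: (measurable_of_history c n (fun h => fluct_of n h : borel_cV R (d + d + 1))). Qed.

Lemma fluct_tight (e : R) : 0 < e -> exists2 B, 0 < B & forall n, (0 < n)%N ->
  fine (P [set w | ~ box B (fluct n w)]) <= e.
Proof.
move=> e0; have [S [hs [C0 [_ hsc C00 C0P _]]]] := urn_limit.
have [B B0 BP] := dev_tight C00 C0P e0.
have [k k0 kP] := mulmx_dev_bound (fluct_mx f K df) hsc.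
pose bb : R := \sum_i `|fluct_bias f K df i 0|.
have bb0 : 0 <= bb by exact: sumr_ge0.
exists (k * B + bb + 1) => [|n n0].
  by have := mulr_ge0 k0 (ltW B0); lra.
apply: le_trans (BP n n0).
pose N := [set w | hist n w \notin histories n.-1].
have mN : measurable N by exact: (measurable_history c n (fun h => h \notin histories n.-1)).
have PN : fine (P N) = 0 by rewrite (history_null f0 cP n0).
rewrite -[leRHS]addr0 -PN; apply: fine_P_subU => //.
- exact: (measurable_history c n (fun h => ~ box (k * B + bb + 1) (fluct_of n h))).
- exact: (measurable_history c n (fun h => B * Num.sqrt n%:R < Num.sqrt (qb hs (urn_dev h) (urn_dev h)))).
move=> w /= nb; apply: contrapT => /not_orP[/negP]; rewrite -leNgt => hB /negP.
rewrite negbK => hw; apply: nb => i; rewrite fluct_ofE fluct_of_dev// mxE [X in _ * X]mxE [X in _ + X]mxE.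
have sn : 1 <= Num.sqrt (n%:R : R) by rewrite -[leLHS]sqrtr1 ler_wsqrtr// ler1n.
have sn0 : 0 < Num.sqrt (n%:R : R) by lra.
rewrite normrM gtr0_norm ?invr_gt0// mulrC ler_pdivrMr//.
apply: le_trans (ler_normB _ _) _.
have h1 : `|fluct_bias f K df i 0| <= bb by rewrite /bb (bigD1 i)//= lerDl sumr_ge0.
have h2 := kP (urn_dev (hist n w)) i; have h3 := ler_wpM2l k0 hB.
have h4 := ler_wpM2l bb0 sn; lra.
Qed.

Lemma fluct_normal : exists W0 : 'M[R]_(d + d + 1), asymptotically_normal P (fun n w => fluct n w) W0.
Proof.
have [S [hs [C0 [Ssym hsc C00 C0P cf]]]] := urn_limit.
pose L := fluct_mx f K df; pose W0 := L *m S *m L^T.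
have rf (u : 'cV[R]_(d + d + 1)) : rform S (u^T *m L) = qform W0 u.
  by rewrite /rform /dotp /qform /W0 trmx_mul trmxK !mulmxA.
have W0sym : W0^T = W0 by rewrite /W0 !trmx_mul trmxK Ssym mulmxA.
(* Positivity is read off from the limit: S comes from a linear equation, but exp (- [qform W0 u] /
   2) is a limit of expectations of cosines and so at most 1. *)
have W0psd u : 0 <= qform W0 u.
  rewrite -rf.
  have H := cf (u^T *m L) 0; rewrite cos0 mul1r in H.
  have : expR (- (rform S (u^T *m L) / 2)) <= 1.
    apply: (cvgr_to_le H); exists 1%N => // n /= n1.
    rewrite -(hist_mean1 f0 cP n1); apply: hist_mean_le => h _; exact: cos_le1.
  by move=> e1; have := ler_expR (- (rform S (u^T *m L) / 2)) 0; rewrite expR0 e1 => /esym; lra.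
have [mu muN] := psd_normal_law W0sym W0psd.
exists W0, mu => //.
apply: levy.
- by move=> n; exact: measurable_fluct.
- move=> e e0; have [B B0 BP] := fluct_tight e0; exists B => //.
  by exists 1%N => // n /= n1; exact: BP.
move=> th u.
rewrite (_ : Ex mu _ = cos th * expR (- (qform W0 u / 2))); last exact: (normal_law_cf th u muN).
have {}cf := cf (u^T *m L) th; rewrite rf in cf.
pose x n := hist_mean c n (fun h => cos (th + lform u (fluct_of n h))).
pose y n := hist_mean c n (fun h => cos (th + dotp ((Num.sqrt n%:R)^-1 *: (u^T *m L)) (urn_dev h))).
apply: (@near_cvg R R^o _ x).
  exists 1%N => // n /= n1; rewrite /x -(Ex_history f0 cP n1)//.
  apply: (@bdm_history n (fun h => cos (th + lform u (fluct_of n h)))).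
  by exists 1 => h; rewrite ler_norml cos_geN1 cos_le1.
rewrite (_ : x = fun n => y n + (x n - y n)); last by apply/funext => n; rewrite addrC subrK.
rewrite -[X in _ --> X]addr0; apply: cvgD; first exact: cf.
(* The deterministic bias enters the argument of the cosine divided by sqrt n and disappears in the
   limit. *)
pose b := `|lform u (fluct_bias f K df)|.
apply: (@cvg_le_dist0 _ _ (fun n => b * (Num.sqrt n%:R)^-1)).
  exists 1%N => // n /= n1; rewrite subr0.
  have -> : x n - y n = hist_mean c n (fun h => cos (th + lform u (fluct_of n h)) -
      cos (th + dotp ((Num.sqrt n%:R)^-1 *: (u^T *m L)) (urn_dev h))).
    by rewrite /x /y /hist_mean -sumrB; apply: eq_bigr => h _; rewrite mulrBr.
  apply: le_trans (ler_norm_sum _ _ _) _.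
  apply: (@le_trans _ _ (hist_mean c n (fun h => b * (Num.sqrt n%:R)^-1))); last first.
    rewrite (_ : hist_mean _ _ _ = b * (Num.sqrt n%:R)^-1 * hist_mean c n (fun=> 1)).
      by rewrite (hist_mean1 f0 cP)// mulr1.
    by rewrite /hist_mean mulr_sumr; apply: eq_bigr => h _; rewrite mulr1 mulrC.
  rewrite /hist_mean !big_seq; apply: ler_sum => h hh.
  rewrite normrM ger0_norm ?hist_prob_ge0// ler_wpM2l ?hist_prob_ge0//.
  apply: le_trans (cos_lip _ _) _; rewrite fluct_of_dev//.
  have -> : th + lform u ((Num.sqrt n%:R)^-1 *: (fluct_mx f K df *m urn_dev h - fluct_bias f K df)) -
     (th + dotp ((Num.sqrt n%:R)^-1 *: (u^T *m L)) (urn_dev h)) = - lform u (fluct_bias f K df) * (Num.sqrt n%:R)^-1.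
    have -> : lform u ((Num.sqrt n%:R)^-1 *: (fluct_mx f K df *m urn_dev h - fluct_bias f K df)) =
       (Num.sqrt n%:R)^-1 * (dotp (u^T *m L) (urn_dev h) - lform u (fluct_bias f K df)).
      by rewrite /lform -scalemxAr mxE mulmxBr mulmxA mxE [X in _ + X]mxE.
    by rewrite dotpZl; ring.
  by rewrite normrM normrN ler_wpM2l// ger0_norm// invr_ge0 sqrtr_ge0.
rewrite -(mulr0 b); apply: cvgM; first exact: cvg_cst.
exact: inv_sqrt_cvg0.
Qed.

End UrnLimit.

(** * The score equation *)

Section Fermat.
Variables (R : realType) (V : normedModType R).
Implicit Types (F g : V -> R) (t v : V).

Lemma derive_max0 F t v : derivable F t v -> (\forall s \near t, F s <= F t) -> 'D_v F t = 0.
Proof.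
move=> dF Fm; apply/eqP; apply/negPn/negP => D0.
have D0' : 0 < `|'D_v F t| by rewrite normr_gt0.
have /cvgrPdist_lt/(_ _ D0') H :
  (fun h => h^-1 *: ((F \o shift t) (h *: v) - F t)) @ 0^' --> 'D_v F t := dF.
have c : (fun h : R => h *: v + t) @ 0^' --> t.
  apply: cvg_within_filter; have : {for (0 : R), continuous (fun h : R => h *: v + t)}.
    by apply: cvgD; [apply: cvgZr_tmp; exact: cvg_id|exact: cvg_cst].
  by rewrite /prop_for /continuous_at scale0r add0r.
have [r /= r0 rP] : exists2 r, 0 < r & forall h : R, `|h| < r -> h != 0 ->
    `|'D_v F t - h^-1 * (F (h *: v + t) - F t)| < `|'D_v F t| /\ F (h *: v + t) <= F t.
  have [r /= r0 rP] := (nbhs_ballP (0 : R) _).1 (filterI H (c _ Fm)).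
  exists r => // h hr h0.
  by apply: rP => //; rewrite /ball /= sub0r normrN.
have r2 : 0 < r / 2 by rewrite divr_gt0.
have rr : r / 2 < r by lra.
have [Dp|Dn] := ltP 0 ('D_v F t).
  have [a b] := rP (r / 2) (eq_ind_r (fun x => x < r) rr (gtr0_norm r2)) (lt0r_neq0 r2).
  have b' : (r / 2)^-1 * (F (r / 2 *: v + t) - F t) <= 0.
    by apply: mulr_ge0_le0; [rewrite invr_ge0 ltW|rewrite subr_le0].
  by move: a; rewrite (gtr0_norm Dp) ltr_norml => /andP[_]; rewrite ltrBlDr ltrDl ltNge b'.
have {}Dn : 'D_v F t < 0 by rewrite lt_neqAle D0.
have r2n : - (r / 2) != 0 by rewrite oppr_eq0 lt0r_neq0.
have rrn : `|- (r / 2)| < r by rewrite normrN gtr0_norm.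
have [a b] := rP _ rrn r2n.
have b' : 0 <= (- (r / 2))^-1 * (F (- (r / 2) *: v + t) - F t).
  by apply: mulr_le0; [rewrite invr_le0 oppr_le0 ltW|rewrite subr_le0].
by move: a; rewrite (ltr0_norm Dn) ltr_norml => /andP[+ _]; rewrite opprK ltrBrDr gtrDl ltNge b'.
Qed.

Lemma is_derive_line g t v dg :
  is_derive t v g dg <-> is_derive (0 : R) 1 (fun h : R => g (h *: v + t)) dg.
Proof.
have E : 'D_v g t = 'D_1 (fun h : R => g (h *: v + t)) 0.
  rewrite /derive; set g1 := fun h => h^-1 *: _; set g2 := fun h => h^-1 *: _.
  suff -> : g1 = g2 by [].
  by apply/funext => h; rewrite /g1 /g2 /= addr0 scale0r add0r [_%:A]mulr1.
split=> -[d1 d2]; split.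
- by have [h _] := derivable1P g t v; exact: h.
- by rewrite -E.
- by have [_ h] := derivable1P g t v; exact: h.
- by rewrite E.
Qed.

Lemma is_derive_ord_sum n (h : 'I_n -> V -> R) (dh : 'I_n -> R) t v :
  (forall i, is_derive t v (h i) (dh i)) ->
  is_derive t v (fun s => \sum_i h i s) (\sum_i dh i).
Proof.
move=> H; have := is_derive_sum H.
by have -> : \sum_i h i = (fun s => \sum_i h i s) by apply/funext => s; rewrite fct_sumE.
Qed.

Lemma is_derive_ln_comp g t v dg : is_derive t v g dg -> 0 < g t ->
  is_derive t v (fun s => ln (g s)) ((g t)^-1 * dg).
Proof.
move=> /is_derive_line dgl g0; apply/is_derive_line.
have g0' : 0 < (fun h : R => g (h *: v + t)) 0 by rewrite /= scale0r add0r.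
have := @is_derive1_comp R _ _ _ _ _ (is_derive1_ln g0') dgl.
by rewrite /= scale0r add0r.
Qed.

End Fermat.

Section Truncation.
Variables (R : realType) (K d : nat) (Theta : set 'cV[R]_d).
Variables (f : 'cV[R]_d -> nat -> R) (df : 'cV[R]_d -> nat -> 'cV[R]_d).
Hypothesis K0 : (0 < K)%N.
Hypothesis f_C2 : forall k, (0 < k)%N ->
  is_C2_with_gradient Theta° (fun t => f t k) (fun t => df t k).
Hypothesis f_trunc : forall t k, Theta t -> (0 < k)%N -> f t k = f t (minn k K).

Lemma f_eventually t : Theta t -> forall k, (K <= k)%N -> f t k = f t K.
Proof. by move=> tT k Kk; rewrite f_trunc//; [congr (f t); lia|lia]. Qed.

(** Near an interior point f at k and f at K are the same function of the parameter, so their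
    directional derivatives along the unit vectors coincide. *)
Lemma df_eventually t : Theta° t -> forall k, (K <= k)%N -> df t k = df t K.
Proof.
move=> tT k Kk; apply/colP => i.
have k0 : (0 < k)%N by lia.
have E j : (0 < j)%N -> df t j i 0 = 'D_(delta_mx i 0) (fun s => f s j) t.
  by move=> /f_C2/(_ t tT)[_ -> _ _]; rewrite -colE !mxE.
rewrite !E//; apply: near_eq_derive; apply: filterS tT => s sT.
exact: f_eventually.
Qed.

End Truncation.

Section ScoreEquation.
Variables (R : realType) (K : nat) (D : seq nat) (Ds : nat -> seq nat) (m : nat).
Hypothesis K0 : (0 < K)%N.
Hypothesis D0 : (0 < size D)%N.
Hypothesis D1 : forall d, d \in D -> (0 < d)%N.
Hypothesis Dsum : sumn D = (2 * size D).-1.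
Hypothesis DE : Ds m = D.
Hypothesis Dm : size D = m.
Local Notation tw := (deg_tw R K D m).
Local Notation mw := (deg_mw R K D).

Lemma deg_mw_ge0 k : 0 <= mw k.
Proof.
rewrite /deg_mw /mass_wt; case: ifP => _; last by rewrite divr_ge0.
rewrite /deg_above -mulrBl divr_ge0// subr_ge0 ler_nat.
by apply: sub_count => x /=; lia.
Qed.

Lemma deg_mw_sum : \sum_(1 <= k < K.+1) mw k = 1.
Proof.
rewrite big_nat_recr//= /deg_mw {2}/mass_wt ltnn.
rewrite (eq_big_nat _ _ (F2 := fun k => deg_above R D k.-1 - deg_above R D k)); last first.
  by move=> k /andP[_ kK]; rewrite /mass_wt kK.
rewrite big_add1/=.
rewrite (eq_bigr (fun i => - (deg_above R D i.+1 - deg_above R D i))); last by move=> i _; rewrite opprB.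
by rewrite sumrN telescope_sumr// opprB subrK deg_above0.
Qed.

Lemma deg_mw_pos (f : nat -> R) : (forall k, (0 < k)%N -> 0 < f k) ->
  0 < \sum_(1 <= k < K.+1) mw k * f k.
Proof.
move=> f0; have := deg_mw_sum; rewrite !big_add1 /= !big_mkord => s1.
have t0 (i : 'I_K) : true -> 0 <= mw i.+1 * f i.+1.
  by move=> _; apply: mulr_ge0; [exact: deg_mw_ge0|exact/ltW/f0].
rewrite lt_neqAle sumr_ge0// andbT; apply/eqP => /esym /(psumr_eq0P t0) z.
move: s1; rewrite big1 => [/esym/eqP|i _]; first by rewrite oner_eq0.
have /eqP := z i isT; rewrite mulf_eq0 => /orP[/eqP//|].
by rewrite gt_eqF// f0.
Qed.

Variables (d : nat) (Theta : set 'cV[R]_d).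
Variables (f : 'cV[R]_d -> nat -> R) (df : 'cV[R]_d -> nat -> 'cV[R]_d).
Hypothesis f_gt0 : forall t k, Theta t -> (0 < k)%N -> 0 < f t k.
Hypothesis f_C2 : forall k, (0 < k)%N ->
  is_C2_with_gradient Theta° (fun t => f t k) (fun t => df t k).
Hypothesis f_trunc : forall t k, Theta t -> (0 < k)%N -> f t k = f t (minn k K).

Lemma PMLE_score t : Theta° t -> is_PMLE Theta f df Ds m t ->
  pseudo_score (f t) (df t) Ds m = 0.
Proof.
(* A zero of the score is the claim itself. For a maximiser, F is the log-likelihood without the
   constant ln m, and its directional derivatives, the entries of the score, vanish at an interior
   maximum. *)
move=> tT [_ [tmax|//]].
have Tt : Theta t by exact: interior_subset.
apply/colP => i; rewrite [RHS]mxE.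
pose F s := \sum_(j < K) tw j.+1 * ln (f s j.+1) - ln (\sum_(j < K) mw j.+1 * f s j.+1).
pose v : 'cV[R]_d := delta_mx i 0.
have df1 (j : 'I_K) : is_derive t v (fun s => f s j.+1) (df t j.+1 i 0).
  have [h1 h2 _ _] := f_C2 (ltn0Sn j) tT.
  by split; [exact: diff_derivable|rewrite h2 -colE !mxE].
have S0 s : Theta s -> 0 < \sum_(j < K) mw j.+1 * f s j.+1.
  by move=> sT; have := deg_mw_pos (fun k => @f_gt0 s k sT); rewrite big_add1 /= big_mkord.
have dF : is_derive t v F (pseudo_score (f t) (df t) Ds m i 0).
  rewrite (pseudo_scoreE K0 D0 D1 Dsum DE Dm (f_eventually K0 f_trunc Tt) (df_eventually K0 f_C2 f_trunc tT)).
  set S := \sum_(_ <= _ < _) _ * _.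
  have SE : S = \sum_(j < K) mw j.+1 * f t j.+1 by rewrite /S big_add1 /= big_mkord.
  rewrite !big_add1 /= !big_mkord mxE [X in _ + X]mxE [X in _ - X]mxE !summxE.
  rewrite (eq_bigr (fun j : 'I_K => tw j.+1 * ((f t j.+1)^-1 * df t j.+1 i 0))); last by move=> j _; rewrite !mxE.
  rewrite [X in S^-1 * X](eq_bigr (fun j : 'I_K => mw j.+1 * df t j.+1 i 0)); last by move=> j _; rewrite !mxE.
  have d1 : is_derive t v (fun s => \sum_(j < K) tw j.+1 * ln (f s j.+1))
      (\sum_(j < K) tw j.+1 * ((f t j.+1)^-1 * df t j.+1 i 0)).
    apply: is_derive_ord_sum => j.
    exact: (is_deriveZ (tw j.+1) (is_derive_ln_comp (df1 j) (f_gt0 Tt (ltn0Sn j)))).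
  have d2 : is_derive t v (fun s => \sum_(j < K) mw j.+1 * f s j.+1) (\sum_(j < K) mw j.+1 * df t j.+1 i 0).
    by apply: is_derive_ord_sum => j; exact: (is_deriveZ (mw j.+1) (df1 j)).
  rewrite SE; exact: (is_deriveB d1 (is_derive_ln_comp d2 (S0 t Tt))).
have [dd <-] := dF; apply: derive_max0 => //.
apply: filterS tT => s sT.
have := tmax s sT; rewrite !(pseudo_loglikE K0 D0 D1 Dsum DE Dm)//; last 4 first.
- by move=> k; exact: f_gt0.
- by move=> k; apply: (f_eventually K0 f_trunc).
- by move=> k; exact: f_gt0.
- by move=> k; apply: (f_eventually K0 f_trunc).
have mp : 0 < m%:R :> R by rewrite -Dm ltr0n.
by rewrite !big_add1 /= !big_mkord !lnM ?posrE ?S0// /F; lra.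
Qed.

Lemma PMLE_score_eq t : Theta° t -> is_PMLE Theta f df Ds m t ->
  \sum_(j < K) (mw j.+1 * f t j.+1) *:
    (\sum_(k < K) tw k.+1 *: ((f t k.+1)^-1 *: df t k.+1) - (f t j.+1)^-1 *: df t j.+1) = 0.
Proof.
move=> tT /(PMLE_score tT); have Tt : Theta t by exact: interior_subset.
rewrite (pseudo_scoreE K0 D0 D1 Dsum DE Dm (f_eventually K0 f_trunc Tt) (df_eventually K0 f_C2 f_trunc tT)).
have := deg_mw_pos (fun k => @f_gt0 t k Tt); rewrite !big_add1 /= !big_mkord => S0 sc.
rewrite (eq_bigr (fun j : 'I_K => (mw j.+1 * f t j.+1) *:
  \sum_(k < K) tw k.+1 *: ((f t k.+1)^-1 *: df t k.+1) - mw j.+1 *: df t j.+1)); last first.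
  by move=> j _; rewrite scalerBr [X in _ - X]scalerA mulfK// gt_eqF// f_gt0.
set S := \sum_(j < K) mw j.+1 * f t j.+1 in S0 sc *.
apply: (etrans _ (etrans (congr1 (fun x => S *: x) sc) (scaler0 _ _))).
rewrite sumrB -scaler_suml scalerBr scalerA mulfV?scale1r// gt_eqF// S0.
Qed.

End ScoreEquation.

Section NearLinearCombination.
Variables (R : realType) (V W : normedModType R) (I : finType).

Lemma cvg_fin_sum (X : V -> I -> W) (L : I -> W) (t0 : V) :
  (forall i, X^~ i @ t0 --> L i) -> (fun t => \sum_i X t i) @ t0 --> \sum_i L i.
Proof.
move=> XL; apply: (@cvg_big W I +%R 0 xpredT add_continuous V (nbhs t0) (index_enum I) (fun i t => X t i) L) => i _.
exact: XL.
Qed.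

(** The neighbourhood of t0 does not depend on the coefficients: these will be the random deviations
    of the weights. *)
Lemma near_lincomb (X : V -> I -> W) (L : I -> W) (t0 : V) e :
  (forall i, X^~ i @ t0 --> L i) -> 0 < e -> \forall t \near t0,
    forall (c : I -> R) rho, 0 <= rho -> (forall i, `|c i| <= rho) -> `|\sum_i c i *: X t i| <= rho * (\sum_i `|L i| + e).
Proof.
move=> XL e0.
have H : (fun t => \sum_i `|X t i|) @ t0 --> \sum_i `|L i|.
  apply: (@cvg_big R I +%R 0 xpredT add_continuous V (nbhs t0) (index_enum I) (fun i t => `|X t i|) (fun i => `|L i|)) => i _.
  exact: cvg_norm (XL i).
have /cvgrPdist_le/(_ _ e0) := H; apply: filterS => t Ht c rho rho0 crho.
apply: le_trans (ler_norm_sum _ _ _) _.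
apply: (@le_trans _ _ (rho * \sum_i `|X t i|)).
  by rewrite mulr_sumr; apply: ler_sum => k _; rewrite normrZ ler_wpM2r.
by rewrite ler_wpM2l// -lerBlDl; apply: le_trans Ht; rewrite distrC ler_norm.
Qed.

Lemma differentiable_near (g : V -> W) (t0 : V) e : differentiable g t0 -> 0 < e ->
  \forall t \near t0, `|g t - g t0 - 'D_(t - t0) g t0| <= e * `|t - t0|.
Proof.
move=> dg e0; have [_ /eqaddoP/(_ _ e0)] := (diff_locallyP t0 g).1 dg => H.
have c : (fun t : V => t - t0) @ t0 --> (0 : V).
  by rewrite -(subrr t0); apply: cvgB; [exact: cvg_id|exact: cvg_cst].
have := c _ H; rewrite /nbhs /=; apply: filterS => t /=; rewrite !fctE /= subrK => Ht.
by rewrite deriveE// -addrA -opprD.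
Qed.

End NearLinearCombination.

Section MatrixBounds.
Variable R : realType.

Lemma coord_norm m (x : 'cV[R]_m) i : `|x i 0| <= `|x|.
Proof. by rewrite [leRHS]/Num.Def.normr /= mx_normrE; apply/bigmax_geP; right; exists (i, 0). Qed.

Lemma norm_coord m (x : 'cV[R]_m) c : 0 <= c -> (forall i, `|x i 0| <= c) -> `|x| <= c.
Proof.
by move=> c0 xc; rewrite [leLHS]/Num.Def.normr /= mx_normrE; apply/bigmax_leP; split => // -[i j] _; rewrite (ord1 j).
Qed.

Lemma mulmx_bound m n (A : 'M[R]_(m, n)) : exists2 C, 0 < C & forall x : 'cV[R]_n, `|A *m x| <= C * `|x|.
Proof.
exists (\sum_i \sum_j `|A i j| + 1) => [|x].
  by rewrite ltr_wpDl// sumr_ge0// => i _; exact: sumr_ge0.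
have s0 : 0 <= \sum_i \sum_j `|A i j| by apply: sumr_ge0 => i _; exact: sumr_ge0.
apply: norm_coord => [|i]; first by rewrite mulr_ge0// addr_ge0.
rewrite mxE; apply: le_trans (ler_norm_sum _ _ _) _.
apply: (@le_trans _ _ (\sum_j `|A i j| * `|x|)).
  by apply: ler_sum => j _; rewrite normrM; apply: ler_wpM2l => //; exact: coord_norm.
rewrite -mulr_suml; apply: ler_wpM2r => //.
by rewrite (bigD1 i)//= -addrA lerDl addr_ge0// sumr_ge0// => k _; exact: sumr_ge0.
Qed.

Lemma lform_bound m (u x : 'cV[R]_m) : `|lform u x| <= (\sum_i `|u i 0|) * `|x|.
Proof.
rewrite /lform mxE; apply: le_trans (ler_norm_sum _ _ _) _; rewrite mulr_suml.
by apply: ler_sum => i _; rewrite mxE normrM; apply: ler_wpM2l => //; exact: coord_norm.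
Qed.

End MatrixBounds.

(** * Expansion of the score in parameter and weights *)

Section ScoreExpansion.
Variables (R : realType) (d : nat) (I : finType).
Variables (f : 'cV[R]_d -> I -> R) (df : 'cV[R]_d -> I -> 'cV[R]_d) (t0 : 'cV[R]_d).
Variables (al ph : I -> R) (lam : R).
Hypothesis f0 : forall i, 0 < f t0 i.
Hypothesis fd : forall i, differentiable (fun t => f t i) t0.
Hypothesis fgrad : forall i v, 'D_v (fun t => f t i) t0 = lform (df t0 i) v.
Hypothesis dfc : forall i, {for t0, continuous (fun t => df t i)}.
Hypothesis l0 : 0 < lam.
Hypothesis al1 : \sum_i al i = 1.
Hypothesis phal : forall i, ph i * f t0 i = lam * al i.

Let g t i : 'cV[R]_d := (f t i)^-1 *: df t i.
Let b : 'cV[R]_d := \sum_i al i *: g t0 i.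
Let V0 : 'M[R]_d := \sum_i al i *: (g t0 i *m (g t0 i)^T) - b *m b^T.
Let w t i : 'cV[R]_d := \sum_k al k *: g t k - g t i.

Let g_cvg i : (fun t => g t i) @ t0 --> g t0 i.
Proof.
have n0 : f t0 i != 0 by rewrite gt_eqF.
have h : (fun t => (f t i)^-1) @ t0 --> (f t0 i)^-1.
  exact: (cvgV n0 (differentiable_continuous (fd i))).
exact: (cvgZ h (@dfc i)).
Qed.

Let f_cvg i : (fun t => f t i) @ t0 --> f t0 i.
Proof. exact: differentiable_continuous (fd i). Qed.

Let w_cvg i : (fun t => w t i) @ t0 --> w t0 i.
Proof.
have h : (fun t => \sum_k al k *: g t k) @ t0 --> \sum_k al k *: g t0 k.
  apply: (@cvg_fin_sum R _ _ I (fun t k => al k *: g t k) (fun k => al k *: g t0 k)) => k.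
  exact: (cvgZl_tmp (@g_cvg k)).
exact: (cvgB h (@g_cvg i)).
Qed.

Let mf_sum : \sum_i ph i * f t0 i = lam.
Proof. by rewrite (eq_bigr _ (fun i _ => phal i)) -mulr_sumr al1 mulr1. Qed.

(** With the limiting weights the sum of ph_i f(t0)_i w(t)_i is zero for every t, because ph_i
    f(t0)_i = lam al_i. Hence the score there is the sum of ph_i (f(t)_i - f(t0)_i) w(t)_i: only f
    is differentiated, and of its gradient continuity suffices. *)
Lemma score_taylor e : 0 < e -> \forall t \near t0,
  `|\sum_i ph i *: ((f t i - f t0 i) *: w t i - lform (df t0 i) (t - t0) *: w t0 i)| <= e * `|t - t0|.
Proof.
move=> e0.
pose S := \sum_i `|ph i| + 1; have S0 : 0 < S by rewrite ltr_wpDl// sumr_ge0.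
have Si i : `|ph i| <= S by rewrite /S (bigD1 i)//= -addrA lerDl addr_ge0// sumr_ge0.
pose e1 := e / S; have e10 : 0 < e1 by rewrite divr_gt0.
suff H i : \forall t \near t0,
    `|(f t i - f t0 i) *: w t i - lform (df t0 i) (t - t0) *: w t0 i| <= e1 * `|t - t0|.
  near=> t.
  have Ht : forall i, `|(f t i - f t0 i) *: w t i - lform (df t0 i) (t - t0) *: w t0 i| <= e1 * `|t - t0|.
    by near: t; exact: filter_forall H.
  apply: le_trans (ler_norm_sum _ _ _) _.
  apply: (@le_trans _ _ (\sum_i `|ph i| * (e1 * `|t - t0|))).
    by apply: ler_sum => i _; rewrite normrZ; apply: ler_wpM2l.
  rewrite -mulr_suml mulrA; apply: ler_wpM2r => //.
  by rewrite /e1 mulrCA ger_pMr// ler_pdivrMr// mul1r /S lerDl.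
pose C := `|w t0 i| + 1; have C0 : 0 < C by rewrite ltr_wpDl.
pose D := \sum_j `|df t0 i j 0| + 1; have D0 : 0 < D by rewrite ltr_wpDl// sumr_ge0.
have h1 := differentiable_near (fd i) (divr_gt0 e10 (mulr_gt0 (ltr0Sn R 1) C0)).
have h2 := cvgr_dist_le _ _ (@w_cvg i) _ (divr_gt0 e10 (mulr_gt0 (ltr0Sn R 1) D0)).
have h3 := cvgr_dist_le _ _ (@w_cvg i) _ (ltr01 : 0 < 1 :> R).
near=> t.
have k1 : `|f t i - f t0 i - lform (df t0 i) (t - t0)| <= e1 / (2 * C) * `|t - t0|.
  by rewrite -fgrad; near: t.
have k2 : `|w t0 i - w t i| <= e1 / (2 * D) by near: t; exact: h2.
have k3 : `|w t i| <= C.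
  rewrite -[w t i](subrK (w t0 i)) (le_trans (ler_normD _ _))// /C addrC; apply: lerD => //.
  by rewrite distrC; near: t; exact: h3.
have k4 : `|lform (df t0 i) (t - t0)| <= D * `|t - t0|.
  by apply: le_trans (lform_bound _ _) _; apply: ler_wpM2r => //; rewrite /D lerDl.
set h := `|t - t0| in k1 k4 *; have h0 : 0 <= h by rewrite /h.
set l := lform _ _ in k1 k4 *.
have -> : (f t i - f t0 i) *: w t i - l *: w t0 i = (f t i - f t0 i - l) *: w t i - l *: (w t0 i - w t i).
  by move: (w t i) (w t0 i) => u v; apply/colP => j; rewrite !mxE; ring.
apply: le_trans (ler_normB _ _) _; rewrite !normrZ.
have a1 : `|f t i - f t0 i - l| * `|w t i| <= e1 / (2 * C) * h * C by apply: ler_pM.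
have a2 : `|l| * `|w t0 i - w t i| <= D * h * (e1 / (2 * D)) by apply: ler_pM.
apply: le_trans (lerD a1 a2) _; rewrite le_eqVlt; apply/orP; left; apply/eqP.
by field; rewrite !gt_eqF.
Unshelve. all: by end_near. Qed.

(** An exact identity ([key]) writes lam times the error as four remainders: T1 is the Taylor
    remainder at the limiting weights, T2 and T3 couple one deviation of weights with the continuity
    in t, and T4 T5 is the product of two deviations of weights. *)
Lemma score_expansion e : 0 < e -> exists2 dl, 0 < dl & forall t (a z : I -> R) rho,
  `|t - t0| < dl -> 0 <= rho -> rho < dl ->
  (forall i, `|a i - al i| <= rho) -> (forall i, `|z i - ph i| <= rho) ->
  \sum_j (z j * f t j) *: (\sum_k a k *: g t k - g t j) = 0 ->
  `|V0 *m (t - t0) - (\sum_i (a i - al i) *: g t0 i - lam^-1 *: (\sum_i (z i - ph i) *: df t0 i)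
      + (lam^-1 * \sum_i (z i - ph i) * f t0 i) *: b)| <= e * (`|t - t0| + rho).
Proof.
(* One quarter for each of the four remainders; the factor lam compensates the one in [key]. *)
move=> e0; pose e1 := lam * e / 4; have e10 : 0 < e1 by rewrite divr_gt0// mulr_gt0.
have t1 := score_taylor e10.
have cX2 i : (fun t => f t i *: w t i - f t0 i *: w t0 i) @ t0 --> (0 : 'cV[R]_d).
  rewrite -(subrr (f t0 i *: w t0 i)).
  exact: (cvgB (cvgZ (@f_cvg i) (@w_cvg i)) (@cst_continuous 'cV[R]_d 'cV[R]_d (f t0 i *: w t0 i) t0)).
have cS : (fun t => \sum_i ph i * f t i) @ t0 --> lam.
  rewrite -mf_sum.
  apply: (@cvg_fin_sum R _ R^o I (fun t k => ph k * f t k) (fun k => ph k * f t0 k)) => k.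
  exact: (cvgM (@cst_continuous 'cV[R]_d R (ph k) t0) (@f_cvg k)).
have cX3 i : (fun t => (\sum_k ph k * f t k) *: g t i - lam *: g t0 i) @ t0 --> (0 : 'cV[R]_d).
  rewrite -(subrr (lam *: g t0 i)).
  exact: (cvgB (cvgZ cS (@g_cvg i)) (@cst_continuous 'cV[R]_d 'cV[R]_d (lam *: g t0 i) t0)).
have t2 := near_lincomb cX2 e10.
have t3 := near_lincomb cX3 e10.
have t4 := @near_lincomb R _ R^o I f (f t0) t0 1 f_cvg ltr01.
have t5 := near_lincomb g_cvg (ltr01 : 0 < 1 :> R).
set Cf := \sum_i `|f t0 i| + 1 in t4; set Cg := \sum_i `|g t0 i| + 1 in t5.
have Cf0 : 0 < Cf by rewrite ltr_wpDl// sumr_ge0.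
have Cg0 : 0 < Cg by rewrite ltr_wpDl// sumr_ge0.
have [r /= r0 rP] := (nbhs_ballP t0 _).1 (filterI t1 (filterI t2 (filterI t3 (filterI t4 t5)))).
(* The second entry makes the product of two deviations, at most rho^2 Cf Cg, smaller than rho
   e1. *)
pose dl := Num.min r (e1 / (Cf * Cg)).
have dl0 : 0 < dl by rewrite lt_min r0 divr_gt0// mulr_gt0.
exists dl => // t a z rho; rewrite !lt_min => /andP[tr _] rho0 /andP[_ rhoe] ha hz psi.
have [|{}t1 [{}t2 [{}t3 [{}t4 {}t5]]]] := rP t.
  by rewrite mx_norm_ball /ball_ /= distrC.
set h := `|t - t0| in tr t1 *.
have {}t2 := t2 _ _ rho0 hz; have {}t3 := t3 _ _ rho0 ha.
have {}t4 := t4 _ _ rho0 hz; have {}t5 := t5 _ _ rho0 ha.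
rewrite [X in rho * (X + _)]big1 in t2; last by move=> i _; rewrite normr0.
rewrite [X in rho * (X + _)]big1 in t3; last by move=> i _; rewrite normr0.
rewrite add0r in t2 t3.
set x := V0 *m _ - _; set T1 := \sum_i ph i *: _ in t1.
set T2 := \sum_i (z i - ph i) *: _ in t2; set T3 := \sum_i (a i - al i) *: _ in t3.
set T4 := \sum_i (z i - ph i) *: _ in t4; set T5 := \sum_i (a i - al i) *: _ in t5.
have key : lam *: x = T1 + T2 + T3 + T4 *: T5.
  have E1 : lam *: \sum_i (a i - al i) *: g t0 i = \sum_i (a i - al i) *: (lam *: g t0 i).
    by rewrite scaler_sumr; apply: eq_bigr => i _; rewrite !scalerA [lam * _]mulrC.
  have E2 : lam *: (lam^-1 *: \sum_i (z i - ph i) *: df t0 i) = \sum_i (z i - ph i) *: (f t0 i *: g t0 i).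
    rewrite scalerA mulfV ?gt_eqF// scale1r; apply: eq_bigr => i _; congr (_ *: _).
    by rewrite /g scalerA mulfV ?scale1r// gt_eqF.
  have E3 : lam *: ((lam^-1 * \sum_i (z i - ph i) * f t0 i) *: b) = \sum_i (z i - ph i) *: (f t0 i *: b).
    rewrite scalerA mulrA mulfV ?gt_eqF// mul1r scaler_suml; apply: eq_bigr => i _.
    by rewrite scalerA.
  have E4 : lam *: (V0 *m (t - t0)) = - \sum_i ph i *: (lform (df t0 i) (t - t0) *: w t0 i).
    have E i : (g t0 i *m (g t0 i)^T) *m (t - t0) = lform (g t0 i) (t - t0) *: g t0 i.
      by rewrite -mulmxA [_^T *m _]mx11_scalar mul_mx_scalar.
    have Eb : b *m b^T *m (t - t0) = (\sum_i al i * lform (g t0 i) (t - t0)) *: b.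
      rewrite -mulmxA [_^T *m _]mx11_scalar mul_mx_scalar; congr (_ *: _).
      rewrite /b linear_sum /= mulmx_suml summxE; apply: eq_bigr => i _.
      by rewrite linearZ /= -scalemxAl mxE.
    rewrite /V0 mulmxBl Eb mulmx_suml scaler_suml -sumrB scaler_sumr -sumrN; apply: eq_bigr => i _.
    have -> : lform (df t0 i) (t - t0) = f t0 i * lform (g t0 i) (t - t0).
      rewrite /lform /g linearZ /= -scalemxAl [in RHS]mxE mulrA mulfV ?mul1r// gt_eqF//.
    rewrite -scalemxAl E [ph i *: _]scalerA mulrA phal /w -/b.
    by move: (lform (g t0 i) (t - t0)) (g t0 i) => l v; apply/colP => j; rewrite !mxE; ring.
  have Z : \sum_i (ph i * f t0 i) *: w t i = 0.
    rewrite (eq_bigr (fun i => lam *: (al i *: w t i))); last by move=> i _; rewrite phal scalerA.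
    rewrite -scaler_sumr /w (eq_bigr (fun i => al i *: \sum_k al k *: g t k - al i *: g t i)); last first.
      by move=> i _; rewrite scalerBr.
    by rewrite sumrB -scaler_suml al1 scale1r subrr scaler0.
  have P : \sum_j (z j * f t j) *: w t j + (\sum_j z j * f t j) *: T5 = 0.
    apply: etrans psi; rewrite scaler_suml -big_split /=; apply: eq_bigr => j _; rewrite -scalerDr; congr (_ *: _).
    rewrite /w /T5 addrAC -big_split /=; congr (_ - _); apply: eq_bigr => k _.
    by rewrite -scalerDl addrC subrK.
  have F1 : T1 = \sum_i (ph i * f t i) *: w t i - \sum_i ph i *: (lform (df t0 i) (t - t0) *: w t0 i).
    rewrite -[X in X - _]subr0 -[X in _ - X - _]Z -!sumrB; apply: eq_bigr => i _.
    by move: (w t i) (w t0 i) (lform _ _) => u v l; apply/colP => r'; rewrite !mxE; ring.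
  have F2 : T2 = \sum_i (z i * f t i) *: w t i - \sum_i (ph i * f t i) *: w t i
      - (\sum_i (z i - ph i) *: (f t0 i *: b) - \sum_i (z i - ph i) *: (f t0 i *: g t0 i)).
    rewrite -!sumrB; apply: eq_bigr => i _; rewrite (_ : w t0 i = b - g t0 i)//.
    by move: (w t i) (g t0 i) => u v; apply/colP => r'; rewrite !mxE; ring.
  have F3 : T3 = (\sum_i ph i * f t i) *: T5 - \sum_i (a i - al i) *: (lam *: g t0 i).
    rewrite /T5 scaler_sumr -sumrB; apply: eq_bigr => i _.
    by move: (g t i) (g t0 i) => u v; apply/colP => r'; rewrite !mxE; ring.
  have F4 : T4 = \sum_j z j * f t j - \sum_i ph i * f t i.
    by rewrite /T4 -sumrB; apply: eq_bigr => i _; rewrite -mulrBl.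
  rewrite /x scalerBr scalerDr scalerBr E1 E2 E3 E4 F1 F2 F3 F4.
  move/eqP: P; rewrite addr_eq0 => /eqP ->; rewrite scalerBl.
  move: (\sum_i _ *: (lam *: _)) (\sum_i _ *: (f t0 i *: g t0 i)) (\sum_i _ *: (f t0 i *: b)) => y1 y2 y3.
  move: (\sum_i _ *: (lform _ _ *: _)) (\sum_i _ *: w t i) (_ *: T5) (_ *: T5) => y4 y5 y6 y7.
  by apply/colP => i; rewrite !mxE; ring.
have : lam * `|x| <= e1 * h + rho * e1 + rho * e1 + rho * e1.
  rewrite -[X in X * _]gtr0_norm// -normrZ key.
  apply: le_trans (ler_normD _ _) _; apply: lerD.
    by apply: le_trans (ler_normD _ _) _; apply: lerD => //; apply: le_trans (ler_normD _ _) _; apply: lerD.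
  rewrite normrZ; apply: le_trans (ler_pM _ _ t4 t5) _ => //.
  rewrite mulrACA -mulrA; apply: ler_wpM2l => //.
  by rewrite -ler_pdivlMr ?mulr_gt0//; exact: ltW.
move=> H; rewrite -(ler_pM2l l0); apply: le_trans H _.
have -> : e1 * h + rho * e1 + rho * e1 + rho * e1 = lam * (e * ((h + 3 * rho) / 4)) by rewrite /e1; field.
have h0 : 0 <= h := normr_ge0 _; rewrite ler_pM2l// ler_pM2l//; lra.
Qed.

End ScoreExpansion.

(** * Asymptotic normality of the estimator *)

Lemma measurable_off_box (R : realType) disp (T : measurableType disp) N (Z : T -> borel_cV R N) B :
  measurable_fun [set: T] Z -> measurable [set w | ~ box B (Z w : 'cV[R]_N)].
Proof.
move=> mZ; have := mZ measurableT _ (measurableC (@measurable_box R N B)).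
by rewrite setTI.
Qed.

Section Slutsky.
Context (R : realType) (disp : measure_display) (T : measurableType disp) (P : probability T R).
Variables (m k : nat) (S : 'M[R]_m) (L : 'M[R]_(k, m)).
Variables (Y : nat -> T -> 'cV[R]_m) (X : nat -> T -> 'cV[R]_k).
Hypothesis mY : forall n, measurable_fun [set: T] (Y n : T -> borel_cV R m).
Hypothesis mX : forall n, measurable_fun [set: T] (X n : T -> borel_cV R k).
Hypothesis Yt : forall e : R, 0 < e -> exists2 B, 0 < B & forall n, (0 < n)%N ->
  fine (P [set w | ~ box B (Y n w)]) <= e.
Hypothesis XY : forall eta e : R, 0 < eta -> 0 < e -> \forall n \near \oo,
  exists A, [/\ measurable A, fine (P A) <= e & forall w, ~ A w -> `|X n w - L *m Y n w| <= eta].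
Hypothesis YS : asymptotically_normal P Y S.

Let bdm_X th (u : 'cV[R]_k) n : bdm (fun w => cos (th + lform u (X n w))).
Proof.
have [m1 _] := bdm_cos_form (m := k) th u.
split; last by exists 1 => w; rewrite ler_norml cos_geN1 cos_le1.
exact: (measurableT_comp m1 (mX n)).
Qed.

Let bdm_Y th (u : 'cV[R]_m) n : bdm (fun w => cos (th + lform u (Y n w))).
Proof.
have [m1 _] := bdm_cos_form (m := m) th u.
split; last by exists 1 => w; rewrite ler_norml cos_geN1 cos_le1.
exact: (measurableT_comp m1 (mY n)).
Qed.

(** Characteristic functions of X and L Y differ by a Lipschitz bound off A and by at most 2 on A.
    Tightness of X is inherited from Y, so [levy] applies with the normal law of covariance L S
    L^T. *)
Lemma slutsky_normal : asymptotically_normal P X (L *m S *m L^T).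
Proof.
have [mu muN YP] := YS; have [Ssym Spsd _] := muN.
have qL u : qform (L *m S *m L^T) u = qform S (L^T *m u).
  by rewrite /qform trmx_mul trmxK !mulmxA.
have Vsym : (L *m S *m L^T)^T = L *m S *m L^T by rewrite !trmx_mul trmxK Ssym mulmxA.
have [nu nuN] := psd_normal_law Vsym (fun u => eq_ind_r (fun x => 0 <= x) (Spsd _) (qL u)).
exists nu => //; apply: levy => //.
- move=> e e0; have e2 : 0 < e / 2 by rewrite divr_gt0.
  have [B B0 BP] := Yt e2; have [C C0 CP] := mulmx_bound L.
  exists (C * B + 1); first by rewrite ltr_wpDl// mulr_ge0// ltW.
  have := XY ltr01 e2; apply: filter_app; exists 1%N => // n /= n1 [A [mA PA AP]].
  rewrite (splitr e); apply: le_trans (lerD PA (BP n n1)).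
  apply: fine_P_subU => //; first exact: (measurable_off_box _ (mX n)).
    exact: (measurable_off_box _ (mY n)).
  move=> w /= nb; apply: contrapT => /not_orP[nA /contrapT hB]; apply: nb => i.
  have h1 : `|X n w i 0 - (L *m Y n w) i 0| <= 1.
    by apply: le_trans (AP w nA); have := coord_norm (X n w - L *m Y n w) i; rewrite !mxE.
  have h2 : `|(L *m Y n w) i 0| <= C * B.
    apply: le_trans (coord_norm _ _) _; apply: le_trans (CP _) _; apply: ler_wpM2l; first exact: ltW.
    by apply: norm_coord => //; exact: ltW.
  have := ler_normD (X n w i 0 - (L *m Y n w) i 0) ((L *m Y n w) i 0); rewrite subrK; lra.
move=> th u.
have -> : Ex nu (fun x : 'cV[R]_k => cos (th + lform u x)) =
    Ex mu (fun x : 'cV[R]_m => cos (th + lform (L^T *m u) x)).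
  transitivity (cos th * expR (- (qform S (L^T *m u) / 2))).
    by rewrite -qL; exact: (normal_law_cf th u nuN).
  by apply/esym; exact: (normal_law_cf th (L^T *m u) muN).
pose x n := Ex P (fun w => cos (th + lform u (X n w))).
pose y n := Ex P (fun w => cos (th + lform (L^T *m u) (Y n w))).
have cy : y @ \oo --> Ex mu (fun x : 'cV[R]_m => cos (th + lform (L^T *m u) x)).
  have cc : continuous (fun x : 'cV[R]_m => cos (th + lform (L^T *m u) x)).
    move=> v; apply: continuous_comp; last exact: continuous_cos.
    have h := @linear_form_continuous R m (L^T *m u) v.
    exact: (cvgD (@cst_continuous 'cV[R]_m R th v) h).
  have bc : exists M, forall x : 'cV[R]_m, `|cos (th + lform (L^T *m u) x)| <= M.
    by exists 1 => v; rewrite ler_norml cos_geN1 cos_le1.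
  have := YP _ cc bc; rewrite ExE; last exact: bdm_cont.
  by move=> /fine_cvg.
rewrite -/x (_ : x = fun n => y n + (x n - y n)); last by apply/funext => n; rewrite addrC subrK.
rewrite -[X in _ --> X]addr0; apply: cvgD => //.
apply/cvgrPdist_le => e e0; pose c := \sum_i `|u i 0| + 1.
have c0 : 0 < c by rewrite ltr_wpDl// sumr_ge0.
have e4 : 0 < e / 4 by rewrite divr_gt0.
have := XY (divr_gt0 e4 c0) e4; apply: filterS => n [A [mA PA AP]].
rewrite sub0r normrN /x /y -ExB//.
have bA : bdm (fun w : T => e / 4 + 2 * \1_A w).
  by apply: bdmD; [exact: bdm_cst|apply: bdmZ; exact: bdm_indic].
apply: (@le_trans _ _ (Ex P (fun w => e / 4 + 2 * \1_A w))).
  have H w : `|cos (th + lform u (X n w)) - cos (th + lform (L^T *m u) (Y n w))| <= e / 4 + 2 * \1_A w.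
    rewrite indicE; have [hA|hA] := pselect (A w).
      rewrite mem_set//= mulr1; apply: le_trans (ler_normB _ _) _.
      have l1 (z : R) : `|cos z| <= 1 by rewrite ler_norml cos_geN1 cos_le1.
      by have := l1 (th + lform u (X n w)); have := l1 (th + lform (L^T *m u) (Y n w)); lra.
    rewrite memNset// mulr0 addr0; apply: le_trans (cos_lip _ _) _.
    have -> : th + lform u (X n w) - (th + lform (L^T *m u) (Y n w)) = lform u (X n w - L *m Y n w).
      by rewrite /lform trmx_mul trmxK mulmxBr mulmxA [in RHS]mxE [X in _ = _ + X]mxE; ring.
    apply: le_trans (lform_bound _ _) _.
    apply: (@le_trans _ _ (c * (e / 4 / c))); last by rewrite mulrCA mulfV ?mulr1// gt_eqF.
    by apply: ler_pM => //; [exact: sumr_ge0|rewrite /c lerDl|exact: AP].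
  have bxy := bdmB (bdm_X th u n) (bdm_Y th (L^T *m u) n).
  rewrite ler_norml; apply/andP; split.
    rewrite lerNl -mulN1r -ExZ//; apply: Ex_le => //; first exact: bdmZ.
    by move=> w; rewrite mulN1r; apply: le_trans (H w); rewrite -normrN ler_norm.
  by apply: Ex_le => // w; apply: le_trans (H w); exact: ler_norm.
have bi : bdm (\1_A : T -> R) by exact: bdm_indic.
rewrite ExD; [|exact: bdm_cst|exact: bdmZ].
by rewrite Ex_cst ExZ// Ex_indic//; lra.
Qed.

End Slutsky.

Lemma row3_col3 (R : realType) d (a s : R) (b x y : 'cV[R]_d) :
  row_mx (row_mx 1%:M (- a *: 1%:M)) (a *: b) *m col_mx (col_mx x y) s%:M =
  x - a *: y + (a * s) *: b.
Proof.
by rewrite !mul_row_col mul1mx -scalemxAl mul1mx scaleNr mul_mx_scalar scalerA mulrC.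
Qed.

(** * From the score equation to the estimator *)

Section Linearization.
Variables (R : realType) (d : nat) (Theta : set 'cV[R]_d).
Variables (f : 'cV[R]_d -> nat -> R) (df : 'cV[R]_d -> nat -> 'cV[R]_d) (K : nat) (t0 : 'cV[R]_d) (lam : R).
Hypothesis f_gt0 : forall t k, Theta t -> (0 < k)%N -> 0 < f t k.
Hypothesis f_C2 : forall k, (0 < k)%N ->
  is_C2_with_gradient Theta° (fun t => f t k) (fun t => df t k).
Hypothesis K0 : (0 < K)%N.
Hypothesis f_trunc : forall t k, Theta t -> (0 < k)%N -> f t k = f t (minn k K).
Hypothesis t0_int : Theta° t0.
Hypothesis malP : is_malthusian (f t0) lam.

Local Notation V0 := (V0_matrix (f t0) (df t0) lam).
Local Notation M := (M_matrix (f t0) (df t0) lam).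
Local Notation urn_dev := (urn_dev (f t0) lam K).

Let Tt0 : Theta t0. Proof. exact: interior_subset. Qed.
Let f0 k : (0 < k)%N -> 0 < f t0 k. Proof. exact: f_gt0. Qed.
Let fK k : (K <= k)%N -> f t0 k = f t0 K. Proof. exact: (f_eventually K0 f_trunc Tt0). Qed.
Let dfK k : (K <= k)%N -> df t0 k = df t0 K.
Proof. exact: (df_eventually K0 f_C2 f_trunc t0_int). Qed.

(** Both kinds of weights deviate by O(|Y| / n); the added 1 absorbs the bias 1 / n of the last tail
    weight. *)
Lemma weight_dev_bound (hs : seq 'rV[R]_K.+1) :
  (forall (x : 'cV[R]_K.+1) i, x i 0 ^+ 2 <= qb hs x x) ->
  exists2 C, 0 <= C & forall n h (i : 'I_K), (0 < n)%N -> valid_degrees (degrees h) n ->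
    let rho := C * (Num.sqrt (qb hs (urn_dev h) (urn_dev h)) + 1) / n%:R in
    `|deg_tw R K (degrees h) n i.+1 - lim_tw K (f t0) lam i.+1| <= rho /\
    `|deg_mw R K (degrees h) i.+1 - lim_mw K (f t0) lam i.+1| <= rho.
Proof.
move=> hsc.
have /choice[k kP] : forall i : 'I_K, exists k, 0 <= k /\ forall x : 'cV[R]_K.+1,
    `|dotp (tw_row R K i.+1) x| <= k * Num.sqrt (qb hs x x) /\
    `|dotp (mw_row R K i.+1) x| <= k * Num.sqrt (qb hs x x).
  move=> i; have [k k0 kP] := dotp_nq hsc (tw_row R K i.+1).
  have [l l0 lP] := dotp_nq hsc (mw_row R K i.+1).
  exists (k + l); split; first exact: addr_ge0.
  move=> x; split; [apply: le_trans (kP x) _|apply: le_trans (lP x) _].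
    by apply: ler_wpM2r; [exact: sqrtr_ge0|rewrite lerDl].
  by apply: ler_wpM2r; [exact: sqrtr_ge0|rewrite lerDr].
have k0 i : 0 <= k i by case: (kP i).
have ks i : k i <= \sum_i k i by rewrite (bigD1 i)//= lerDl sumr_ge0.
exists (\sum_i k i + 1); first by apply: addr_ge0 => //; exact: sumr_ge0.
move=> n h i n0 hv rho; have [_ /(_ (urn_dev h))[h1 h2]] := kP i.
rewrite /rho {rho}; set q := Num.sqrt _ in h1 h2 *; have q0 : 0 <= q by exact: sqrtr_ge0.
have kq : k i * q + 1 <= (\sum_i k i + 1) * (q + 1).
  by have := ler_wpM2r q0 (ks i); have := k0 i; have := ks i; lra.
have np : 0 < n%:R^-1 :> R by rewrite invr_gt0 ltr0n.
split.
  rewrite (deg_tw_dev (f t0) lam K0 n0 hv); apply: le_trans (ler_normB _ _) _.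
  rewrite normrM (gtr0_norm np).
  apply: (@le_trans _ _ (n%:R^-1 * (k i * q + 1))); last first.
    by rewrite [leRHS]mulrC; apply: ler_wpM2l => //; exact: ltW.
  rewrite mulrDr mulr1; apply: lerD; first by apply: ler_wpM2l => //; exact: ltW.
  by case: ifP => _; rewrite ?normr0 ?(gtr0_norm np)//; exact: ltW.
rewrite (deg_mw_dev (f t0) lam K0 n0 hv) ?ltn_ord// normrM (gtr0_norm np).
rewrite [leRHS]mulrC; apply: ler_wpM2l; first exact: ltW.
by apply: le_trans h2 _; lra.
Qed.

(** A deterministic statement about a single history: probability enters later only through the
    smallness of the distance to t0 and of rho. *)
Lemma PMLE_linearization (hs : seq 'rV[R]_K.+1) :
  (forall (x : 'cV[R]_K.+1) i, x i 0 ^+ 2 <= qb hs x x) ->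
  exists2 C, 0 <= C & forall e, 0 < e -> exists2 dl, 0 < dl & forall n h Ds t,
    (0 < n)%N -> valid_degrees (degrees h) n -> Ds n = degrees h ->
    is_PMLE Theta f df Ds n t -> `|t - t0| < dl ->
    let rho := C * (Num.sqrt (qb hs (urn_dev h) (urn_dev h)) + 1) / n%:R in
    rho < dl ->
    `|V0 *m (t - t0) - M *m ((Num.sqrt n%:R)^-1 *: F_fluctuation (f t0) (df t0) lam Ds n)|
      <= e * (`|t - t0| + rho).
Proof.
move=> hsc; have [C C0 CP] := weight_dev_bound hsc; exists C => // e e0.
have l0 := mal_lam0 malP.
have tw1 : \sum_(i < K) lim_tw K (f t0) lam i.+1 = 1.
  by have := lim_tw_sum (f t0) lam K0; rewrite big_add1 /= big_mkord.
have [dl1 d1 dl1P] := @score_expansion R d 'I_K (fun t i => f t i.+1) (fun t i => df t i.+1) t0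
  (fun i => lim_tw K (f t0) lam i.+1) (fun i => lim_mw K (f t0) lam i.+1) lam
  (fun i => f0 (ltn0Sn i))
  (fun i => let: And4 h _ _ _ := f_C2 (ltn0Sn i) t0_int in h)
  (fun i v => let: And4 _ h _ _ := f_C2 (ltn0Sn i) t0_int in h v)
  (fun i => let: And4 _ _ h _ := f_C2 (ltn0Sn i) t0_int in differentiable_continuous h)
  l0
  tw1
  (fun i => lim_mw_tw K0 f0 fK malP (ltn0Sn i) (ltn_ord i)) e e0.
have [r /= r0 rP] := (nbhs_ballP t0 _).1 (open_nbhs_nbhs (conj (open_interior Theta) t0_int)).
exists (Num.min r dl1); first by rewrite lt_min r0.
move=> n h Ds t n0 hv DE pm; rewrite lt_min => /andP[tr td].
set rho := C * _ / _; rewrite lt_min => /andP[_ rd].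
have tT : Theta° t.
  by apply: rP; rewrite mx_norm_ball /ball_ /= distrC.
have [sD D1 Dsum] := hv.
have Dsum' : sumn (degrees h) = (2 * size (degrees h)).-1 by rewrite sD.
have D0 : (0 < size (degrees h))%N by rewrite sD.
have psi := PMLE_score_eq K0 D0 D1 Dsum' DE sD f_gt0 f_C2 f_trunc tT pm.
have rho0 : 0 <= rho by rewrite /rho divr_ge0// mulr_ge0// addr_ge0// sqrtr_ge0.
have := dl1P t (fun i => deg_tw R K (degrees h) n i.+1) (fun i => deg_mw R K (degrees h) i.+1) rho
  td rho0 rd (fun i => (CP n h i n0 hv).1) (fun i => (CP n h i n0 hv).2) psi.
rewrite (F_fluctuationE K0 D0 D1 Dsum' DE sD f0 fK dfK malP) scalerA mulVf ?scale1r; last first.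
  by rewrite gt_eqF// sqrtr_gt0 ltr0n.
rewrite (V0_matrixE K0 f0 fK dfK malP) (M_matrixE K0 f0 fK dfK malP) !big_add1 /= !big_mkord.
by rewrite row3_col3.
Qed.

End Linearization.

Section EstimatorFluctuation.
Context (R : realType) (disp : measure_display) (T : measurableType disp) (P : probability T R).
Variables (d : nat) (Theta : set 'cV[R]_d).
Variables (f : 'cV[R]_d -> nat -> R) (df : 'cV[R]_d -> nat -> 'cV[R]_d) (K : nat) (t0 : 'cV[R]_d) (lam : R).
Hypothesis f_gt0 : forall t k, Theta t -> (0 < k)%N -> 0 < f t k.
Hypothesis f_C2 : forall k, (0 < k)%N ->
  is_C2_with_gradient Theta° (fun t => f t k) (fun t => df t k).
Hypothesis K0 : (0 < K)%N.
Hypothesis f_trunc : forall t k, Theta t -> (0 < k)%N -> f t k = f t (minn k K).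
Hypothesis t0_int : Theta° t0.
Hypothesis malP : is_malthusian (f t0) lam.
Variable ev : seq R[i].
Hypothesis evP : ordered_eigenvalues (urn_matrix (f t0) K) ev.
Hypothesis gap : complex.Re ev`_1 < complex.Re ev`_0 / 2.
Variable c : nat -> {RV P >-> nat}.
Hypothesis cP : is_PA_tree (f t0) c.

Local Notation V0 := (V0_matrix (f t0) (df t0) lam).
Local Notation M := (M_matrix (f t0) (df t0) lam).
Local Notation hist n := (history (fun m => c m : T -> nat) n).
Local Notation fluct n w := (F_fluctuation (f t0) (df t0) lam (degree_path c w) n).

Hypothesis V0_unit : V0 \in unitmx.
Variable est : nat -> {RV P >-> borel_cV R d}.
Hypothesis estP : {ae P, forall w, forall n, (0 < n)%N -> is_PMLE Theta f df (degree_path c w) n (est n w)}.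
Hypothesis est_cvg : cvg_in_probability P est t0.

Lemma measurable_est_dist n e : measurable [set w | e <= `|(est n w : 'cV[R]_d) - t0|].
Proof.
have cn : continuous (fun x : 'cV[R]_d => `|x - t0|).
  move=> x; have h : (fun x : 'cV[R]_d => x - t0) @ x --> x - t0.
    have h1 : (fun y : 'cV[R]_d => y) @ x --> x by move=> A.
    exact: (cvgB h1 (@cst_continuous 'cV[R]_d 'cV[R]_d t0 x)).
  exact: (cvg_norm h).
have mn := measurableT_comp (continuous_borel_cV cn) (measurable_funPT (est n)).
have := mn measurableT _ (measurable_itv `[e, +oo[).
by rewrite setTI; congr measurable; apply/seteqP; split => w /=; rewrite in_itv /= andbT.
Qed.

Lemma measurable_scaled_est n :
  measurable_fun [set: T] (fun w => Num.sqrt n%:R *: ((est n w : 'cV[R]_d) - t0) : borel_cV R d).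
Proof.
apply: measurable_borel_cV => i.
have cn : continuous (fun x : 'cV[R]_d => Num.sqrt n%:R * (x i 0 - t0 i 0)).
  move=> x; have h1 := @coord_continuous R d 1 i 0 x.
  have h2 : (fun x : 'cV[R]_d => x i 0 - t0 i 0) @ x --> x i 0 - t0 i 0.
    exact: (cvgB h1 (@cst_continuous 'cV[R]_d R (t0 i 0) x)).
  exact: (cvgM (@cst_continuous 'cV[R]_d R (Num.sqrt n%:R) x) h2).
have := measurableT_comp (continuous_borel_cV cn) (measurable_funPT (est n)).
by apply: eq_measurable_fun => w _; rewrite /= !mxE.
Qed.

(** The statement is off an event A of small probability, the union of the events where the
    estimator is far from t0, Y or the fluctuation is large, the history is not in the list, or the
    estimator property fails. On the complement the linearisation is applied path by path. *)
Lemma PMLE_fluctuation_close (eta e : R) : 0 < eta -> 0 < e -> \forall n \near \oo,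
  exists A, [/\ measurable A, fine (P A) <= e & forall w, ~ A w ->
    `|Num.sqrt n%:R *: ((est n w : 'cV[R]_d) - t0) - invmx V0 *m M *m fluct n w| <= eta].
Proof.
move=> eta0 e0.
have Tt0 : Theta t0 by exact: interior_subset.
have f0 k : (0 < k)%N -> 0 < f t0 k by exact: f_gt0.
have fK := f_eventually K0 f_trunc Tt0.
have dfK := df_eventually K0 f_C2 f_trunc t0_int.
have [S [hs [C0 [_ hsc C00 C0P _]]]] := urn_limit f0 K0 fK malP cP evP gap.
have [C Cp HC] := PMLE_linearization f_gt0 f_C2 K0 f_trunc t0_int malP hsc.
have [CV CV0 CVP] := mulmx_bound (invmx V0).
have [CL CL0 CLP] := mulmx_bound (invmx V0 *m M).
have e4 : 0 < e / 4 by rewrite divr_gt0.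
have [B B0 BP] := dev_tight f0 cP C00 C0P e4.
have [B' B'0 B'P] := fluct_tight f0 K0 fK malP cP evP gap dfK e4.
pose rr := C * (B + 1); have rr0 : 0 <= rr by rewrite mulr_ge0// addr_ge0// ltW.
pose G := 2 * (CL * B') + 2 * rr + 1.
have G0 : 0 < G by have := mulr_gt0 CL0 B'0; rewrite /G; lra.
(* The first entry makes CV ep <= 1/2, so that sqrt n |h| can be absorbed; the second makes the
   final error at most eta, where G bounds sqrt n |h| + rr. *)
pose ep := Num.min (2^-1 / CV) (eta / G / CV).
have ep0 : 0 < ep by rewrite lt_min !divr_gt0.
have ep1 : CV * ep <= 2^-1 by rewrite mulrC -ler_pdivlMr// /ep ge_min lexx.
have ep2 : CV * ep * G <= eta by rewrite -ler_pdivlMr// mulrC -ler_pdivlMr// /ep ge_min lexx orbT.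
have [dl dl0 dlP] := HC ep ep0.
have rn : (fun n => rr * (Num.sqrt n%:R)^-1) @ \oo --> (0 : R).
  by rewrite -(mulr0 rr); apply: cvgM; [exact: cvg_cst|exact: inv_sqrt_cvg0].
have rnl := cvgr0_norm_lt _ rn _ dl0.
have pn : (fun n => fine (P [set w | dl <= `|(est n w : 'cV[R]_d) - t0|])) @ \oo --> (0 : R).
  exact: fine_cvg (est_cvg dl0).
have pnl := cvgr0_norm_lt _ pn _ e4.
have [N0 [mN0 PN0 N0P]] := estP.
near=> n; have n1 : (0 < n)%N by near: n; exists 1%N.
have PA1 : `|fine (P [set w | dl <= `|(est n w : 'cV[R]_d) - t0|])| < e / 4.
  by near: n; exact: pnl.
pose A1 := [set w | dl <= `|(est n w : 'cV[R]_d) - t0|].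
pose A2 := [set w | B * Num.sqrt n%:R < Num.sqrt (qb hs (urn_dev (f t0) lam K (hist n w)) (urn_dev (f t0) lam K (hist n w)))].
pose A3 := [set w | ~ box B' (fluct n w)].
pose A4 := [set w | hist n w \notin histories n.-1].
have mA1 : measurable A1 by exact: measurable_est_dist.
have mA2 : measurable A2 by exact: (measurable_history c n (fun h => B * Num.sqrt n%:R < Num.sqrt (qb hs (urn_dev (f t0) lam K h) (urn_dev (f t0) lam K h)))).
have mA3 : measurable A3.
  exact: (measurable_off_box _ (measurable_fluct c (f t0) lam (df t0) n)).
have mA4 : measurable A4 by exact: (measurable_history c n (fun h => h \notin histories n.-1)).
have PA4 : fine (P A4) = 0 by rewrite (history_null f0 cP n1).
have {}PA1 : fine (P A1) <= e / 4 by apply: le_trans (ler_norm _) _; exact: ltW.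
have PN : fine (P N0) = 0 by rewrite PN0.
pose U1 := A1 `|` A2; pose U2 := U1 `|` A3; pose U3 := U2 `|` A4.
have mU1 : measurable U1 by exact: measurableU.
have mU2 : measurable U2 by exact: measurableU.
have mU3 : measurable U3 by exact: measurableU.
have mU : measurable (U3 `|` N0) by exact: measurableU.
exists (U3 `|` N0); split => //.
  have q1 := fine_P_subU P mU1 mA1 mA2 (@subset_refl _ _).
  have q2 := fine_P_subU P mU2 mU1 mA3 (@subset_refl _ _).
  have q3 := fine_P_subU P mU3 mU2 mA4 (@subset_refl _ _).
  have q4 := fine_P_subU P mU mU3 mN0 (@subset_refl _ _).
  have := BP n n1; have := B'P n n1; rewrite -/A2 -/A3; lra.
move=> w /not_orP[/not_orP[/not_orP[/not_orP[nA1 nA2] nA3] nA4] nN].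
have {nN} pm : is_PMLE Theta f df (degree_path c w) n (est n w).
  by apply: contrapT => npm; apply: nN; apply: N0P => /= H; apply: npm; exact: H.
have {}nA1 : `|(est n w : 'cV[R]_d) - t0| < dl by rewrite ltNge; apply/negP.
have {}nA2 : Num.sqrt (qb hs (urn_dev (f t0) lam K (hist n w)) (urn_dev (f t0) lam K (hist n w))) <= B * Num.sqrt n%:R.
  by rewrite leNgt; apply/negP.
have {}nA3 : box B' (fluct n w) by exact: contrapT.
have {}nA4 : hist n w \in histories n.-1 by apply: contrapT => /negP.
have [_ hv] := histories_valid nA4; rewrite prednK// in hv.
have sq : 1 <= Num.sqrt (n%:R : R) by rewrite -[leLHS]sqrtr1 ler_wsqrtr// ler1n.
have sn2 : Num.sqrt (n%:R : R) ^+ 2 = n%:R by rewrite sqr_sqrtr.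
have rnn : rr * (Num.sqrt n%:R)^-1 < dl.
  by apply: le_lt_trans (ler_norm _) _; near: n; exact: rnl.
have {dlP}/= dlP := dlP n (hist n w) (degree_path c w) (est n w) n1 hv erefl pm nA1.
set s := Num.sqrt (n%:R : R) in sq sn2 nA2 rnn dlP *.
have s0 : 0 < s by lra.
set q := Num.sqrt (qb _ _ _) in nA2 dlP.
set rho := C * (q + 1) / n%:R in dlP.
have rs : s * rho <= rr.
  have -> : s * rho = C * (q + 1) / s by rewrite /rho -sn2; field; rewrite gt_eqF.
  rewrite ler_pdivrMr// /rr -mulrA; apply: ler_wpM2l => //; lra.
have rdl : rho < dl.
  by apply: le_lt_trans rnn; rewrite ler_pdivlMr// mulrC.
have {}dlP := dlP rdl.
set h := (est n w : 'cV[R]_d) - t0 in nA1 dlP *.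
set F := fluct n w in nA3 dlP *.
clearbody h F s.
have key : `|s *: h - invmx V0 *m M *m F| <= CV * ep * (s * `|h| + rr).
  have -> : s *: h - invmx V0 *m M *m F = s *: (invmx V0 *m (V0 *m h - M *m (s^-1 *: F))).
    rewrite mulmxBr mulKmx// scalerBr; congr (_ - _).
    by rewrite -!scalemxAr scalerA mulfV ?gt_eqF// scale1r mulmxA.
  rewrite normrZ (gtr0_norm s0).
  apply: (@le_trans _ _ (s * (CV * (ep * (`|h| + rho))))).
    rewrite ler_pM2l//; apply: le_trans (CVP _) _.
    by rewrite ler_pM2l.
  have -> : s * (CV * (ep * (`|h| + rho))) = CV * ep * (s * `|h| + s * rho) by ring.
  by apply: ler_wpM2l; [rewrite mulr_ge0// ltW|rewrite lerD2l].
(* Here the rate sqrt n appears: s |h| <= CL B' + (s |h| + rr) / 2, and the unknown on the right is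
   absorbed on the left. *)
have hb : s * `|h| <= 2 * (CL * B') + rr.
  have k1 : s * `|h| <= `|s *: h - invmx V0 *m M *m F| + CL * B'.
    rewrite -{1}(gtr0_norm s0) -normrZ -{1}[s *: h](subrK (invmx V0 *m M *m F)).
    apply: le_trans (ler_normD _ _) _; apply: lerD => //; apply: le_trans (CLP _) _.
    by rewrite ler_pM2l//; apply: norm_coord => //; exact: ltW.
  have k2 : CV * ep * (s * `|h| + rr) <= 2^-1 * (s * `|h| + rr).
    by apply: ler_wpM2r => //; rewrite addr_ge0// mulr_ge0// ltW.
  lra.
apply: le_trans key _; apply: le_trans ep2; apply: ler_wpM2l; first by rewrite mulr_ge0// ltW.
by rewrite /G; lra.
Unshelve. all: by end_near. Qed.

End EstimatorFluctuation.

Theorem corollary6p3 (R : realType) (d : nat) (Theta : set 'cV[R]_d)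
  (f : 'cV[R]_d -> nat -> R) (df : 'cV[R]_d -> nat -> 'cV[R]_d)
  (f_gt0 : forall t k, Theta t -> (0 < k)%N -> 0 < f t k)
  (f_nd : forall t k l, Theta t -> (0 < k)%N -> (k <= l)%N -> f t k <= f t l)
  (f_C2 : forall k, (0 < k)%N ->
     is_C2_with_gradient Theta° (fun t => f t k) (fun t => df t k))
  (K : nat) (K_gt0 : (0 < K)%N)
  (f_trunc : forall t k, Theta t -> (0 < k)%N -> f t k = f t (minn k K))
  (t0 : 'cV[R]_d) (t0_int : Theta° t0)
  (ev : seq R[i]) (evP : ordered_eigenvalues (urn_matrix (f t0) K) ev)
  (gap : complex.Re ev`_1 < complex.Re ev`_0 / 2)
  (lam : R) (lamP : is_malthusian (f t0) lam)
  (V0_unit : V0_matrix (f t0) (df t0) lam \in unitmx)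
  (disp : measure_display) (T : measurableType disp) (P : probability T R)
  (c : nat -> {RV P >-> nat}) (cP : is_PA_tree (f t0) c) :
  let fluct n w :=
    F_fluctuation (f t0) (df t0) lam (degree_path c w) n in
  (exists W0 : 'M[R]_(d + d + 1), asymptotically_normal P fluct W0) /\
  (forall W0 : 'M[R]_(d + d + 1), asymptotically_normal P fluct W0 ->
   forall est : nat -> {RV P >-> borel_cV R d},
     {ae P, forall w, forall n, (0 < n)%N ->
        is_PMLE Theta f df (degree_path c w) n (est n w)} ->
     cvg_in_probability P est t0 ->
     let V0 := V0_matrix (f t0) (df t0) lam in
     let M := M_matrix (f t0) (df t0) lam in
     let V := M *m W0 *m M^T in
     asymptotically_normal P
       (fun n w => Num.sqrt n%:R *: ((est n w : 'cV[R]_d) - t0))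
       (invmx V0 *m V *m invmx V0)).
Proof.
move=> fluct.
have Tt0 : Theta t0 by exact: interior_subset.
have f0 k : (0 < k)%N -> 0 < f t0 k by exact: f_gt0.
have fK := f_eventually K_gt0 f_trunc Tt0.
have dfK := df_eventually K_gt0 f_C2 f_trunc t0_int.
split; first exact: (fluct_normal f0 K_gt0 fK lamP cP evP gap dfK).
move=> W0 W0P est estP est_cvg V0 M V.
(* Symmetry makes the right factor of the sandwich the transpose of the left one, as
   [slutsky_normal] requires. *)
have V0sym : V0^T = V0.
  rewrite /V0 (V0_matrixE K_gt0 f0 fK dfK lamP) /= linearB /= linear_sum /= trmx_mul trmxK; congr (_ - _).
  by apply: eq_bigr => k _; rewrite linearZ /= trmx_mul trmxK.
have -> : invmx V0 *m V *m invmx V0 = (invmx V0 *m M) *m W0 *m (invmx V0 *m M)^T.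
  by rewrite trmx_mul trmx_inv V0sym /V !mulmxA.
apply: (@slutsky_normal _ _ _ _ _ _ _ _ fluct) => //.
- by move=> n; exact: measurable_fluct.
- by move=> n; exact: measurable_scaled_est.
- by move=> e e0; exact: (fluct_tight f0 K_gt0 fK lamP cP evP gap dfK e0).
move=> eta e eta0 e0.
exact: (PMLE_fluctuation_close f_gt0 f_C2 K_gt0 f_trunc t0_int lamP evP gap cP V0_unit estP est_cvg eta0 e0).
Qed.
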